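(* Let $d\in\{2,3\}$ and let $\lambda,\mu\in\mathbb R$ satisfy $\mu>0$ and $\lambda+2\mu>0$; put $c_p=(\lambda+2\mu)^{-1/2}$ and $c_s=\mu^{-1/2}$. Let $D\subset\mathbb R^d$ be a bounded domain, and let $\bm f$ be a $\mathbb C^d$-valued centered GMIG random field of order $-m$ in $D$, whose covariance operator and relation operator have principal symbols $A^c(x)|\xi|^{-m}$ and $A^r(x)|\xi|^{-m}$, respectively, with $A^c,A^r\in C_0^\infty(D;\mathbb C^{d\times d})$, and $m\in(d-4,d]$. For $\hat x\in\mathbb S^{d-1}$ and $\omega>0$ let $$\bm u_p^\infty(\hat x,\omega)=-C_dc_p^{\frac{d+1}2}\omega^{\frac{d-3}2}\hat x\hat x^\top\int_{\mathbb R^d}e^{-{\rm i}c_p\omega\hat x\cdot y}\bm f(y)\,dy,$$ $$\bm u_s^\infty(\hat x,\omega)=-C_dc_s^{\frac{d+1}2}\omega^{\frac{d-3}2}\left(\bm I-\hat x\hat x^\top\right)\int_{\mathbb R^d}e^{-{\rm i}c_s\omega\hat x\cdot y}\bm f(y)\,dy .$$ Then for all $\hat x\in\mathbb S^{d-1}$ and $\tau\ge0$, it holds almost surely that $$\begin{aligned}\lim_{Q\to\infty}\frac1Q\int_Q^{2Q}c_s^{m+3-d}\omega^{m+3-d}\Big[&c_p^{-4}\,\bm u_p^\infty\left(\hat x,c_sc_p^{-1}(\omega+\tau)\right)\overline{\bm u_p^\infty\left(\hat x,c_sc_p^{-1}\omega\right)}^\top\\&+c_s^{-2}c_p^{-2}\,\bm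 u_p^\infty\left(\hat x,c_sc_p^{-1}(\omega+\tau)\right)\overline{\bm u_s^\infty(\hat x,\omega)}^\top\\&+c_s^{-2}c_p^{-2}\,\bm u_s^\infty(\hat x,\omega+\tau)\overline{\bm u_p^\infty\left(\hat x,c_sc_p^{-1}\omega\right)}^\top\\&+c_s^{-4}\,\bm u_s^\infty(\hat x,\omega+\tau)\overline{\bm u_s^\infty(\hat x,\omega)}^\top\Big]d\omega=|C_d|^2\,\widehat{A^c}(c_s\tau\hat x)\end{aligned}$$ and $$\begin{aligned}\lim_{Q\to\infty}\frac1Q\int_Q^{2Q}c_s^{m+3-d}\omega^{m+3-d}\Big[&c_p^{-4}\,\bm u_p^\infty\left(\hat x,c_sc_p^{-1}(\omega+\tau)\right)\bm u_p^\infty\left(-\hat x,c_sc_p^{-1}\omega\right)^\top\\&+c_s^{-2}c_p^{-2}\,\bm u_p^\infty\left(\hat x,c_sc_p^{-1}(\omega+\tau)\right)\bm u_s^\infty(-\hat x,\omega)^\top\\&+c_s^{-2}c_p^{-2}\,\bm u_s^\infty(\hat x,\omega+\tau)\bm u_p^\infty\left(-\hat x,c_sc_p^{-1}\omega\right)^\top\\&+c_s^{-4}\,\bm u_s^\infty(\hat x,\omega+\tau)\bm u_s^\infty(-\hat x,\omega)^\top\Big]d\omega=C_d^2\,\widehat{A^r}(c_s\tau\hat x).\end{aligned}$$ Moreover, for any nonempty open set $\Theta\subset\mathbb R_+\times\mathbb S^{d-1}$, the matrices $A^c$ and $A^r$ are uniquely determined by the values of the first and, respectively, the second of these limits for $(\tau,\hat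 x)\in\Theta$.
   Context: Constants: $C_2=\frac{e^{{\rm i}\pi/4}}{\sqrt{8\pi}}$, $C_3=\frac1{4\pi}$. $\mathbb R_+=(0,\infty)$; $\bm I$ is the $d\times d$ identity matrix. Fourier transform: $\hat\varphi(\xi)=\int_{\mathbb R^d}e^{-{\rm i}x\cdot\xi}\varphi(x)\,dx$, applied entrywise to vectors and matrices. The functions $\bm u_p^\infty,\bm u_s^\infty$ are the compressional and shear far-field patterns of the radiating solution of the Navier equation $\mu\Delta\bm u+(\lambda+\mu)\nabla\nabla\cdot\bm u+\omega^2\bm u=\bm f$ in $\mathbb R^d$, i.e. $\bm u(x,\omega)=\frac{e^{{\rm i}c_p\omega|x|}}{|x|^{(d-1)/2}}\bm u_p^\infty(\hat x,\omega)+\frac{e^{{\rm i}c_s\omega|x|}}{|x|^{(d-1)/2}}\bm u_s^\infty(\hat x,\omega)+O(|x|^{-\frac{d+1}2})$ as $|x|\to\infty$, $\hat x=x/|x|$; $\bm f$ does not depend on $\omega$. The integrals defining them are componentwise pairings of the compactly supported distribution $\bm f$ with smooth functions. Random fields (here $n=d$). $(\Omega,\mathcal F,\mathbb P)$ is a complete probability space. A $\mathbb C^n$-valued generalized Gaussian random field is a map $\bm f=(f_1,\dots,f_n)^\top:\Omega\to\mathcal D'(\mathbb R^d;\mathbb C^n)$ such that $\langle\bm f,\bm\psi\rangle$ (bilinear pairing) is a $\mathbb C$-valued Gaussian random variable for every $\bm\psi\in C_0^\infty(\mathbb R^d;\mathbb C^n)$; it is centered if these have mean zero. For centered $\bm f$,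 the covariance and relation operators $\mathcal C_{\bm f},\mathcal R_{\bm f}$ are the operators with matrix-valued distributional kernels $K^c_{\bm f}(x,y)=\mathbb E[\bm f(x)\overline{\bm f(y)}^\top]$ and $K^r_{\bm f}(x,y)=\mathbb E[\bm f(x)\bm f(y)^\top]$, i.e. $\langle(K^c_{\bm f})_{jl},\psi\otimes\varphi\rangle=\mathbb E[\langle f_j,\psi\rangle\langle\overline{f_l},\varphi\rangle]$ and $\langle(K^r_{\bm f})_{jl},\psi\otimes\varphi\rangle=\mathbb E[\langle f_j,\psi\rangle\langle f_l,\varphi\rangle]$ for scalar test functions. Symbols: $\mathcal S^{-m}(\mathbb R^d\times\mathbb R^d;\mathbb C^{n\times n})$ is the set of smooth $\Sigma:\mathbb R^d\times\mathbb R^d\to\mathbb C^{n\times n}$ with $|\partial_\xi^{\gamma_1}\partial_x^{\gamma_2}\Sigma(x,\xi)|\le C_{\gamma_1,\gamma_2}(1+|\xi|)^{-m-|\gamma_1|}$ for all multi-indices. GMIG (generalized microlocally isotropic Gaussian) of order $-m$ in $D$: for $\eta\in\{c,r\}$ the operators are pseudo-differential, $\mathcal C_{\bm f}\bm\varphi(x)=(2\pi)^{-d}\int e^{{\rm i}x\cdot\xi}\Sigma^c(x,\xi)\widehat{\bm\varphi}(\xi)\,d\xi$, $\mathcal R_{\bm f}\bm\varphi(x)=(2\pi)^{-d}\int e^{{\rm i}x\cdot\xi}\Sigma^r(x,\xi)\widehat{\bm\varphi}(\xi)\,d\xi$, with $\Sigma^\eta\in\mathcal S^{-m}$, $\Sigma^\eta(\cdot,\xi)\in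 C_0^\infty(D;\mathbb C^{n\times n})$ for every $\xi$, and $\Sigma^\eta(x,\xi)=A^\eta(x)|\xi|^{-m}+B^\eta(x,\xi)$ for $|\xi|\ge1$, where $A^\eta\in C_0^\infty(D;\mathbb C^{n\times n})$, $B^\eta\in\mathcal S^{-m-1}$, $B^\eta(\cdot,\xi)\in C_0^\infty(D;\mathbb C^{n\times n})$. In particular $\bm f$ is almost surely a distribution supported in $\overline D$. *)

(* Defs.v *)
From HB Require Import structures.
From mathcomp Require Import all_boot all_order all_algebra.
From mathcomp Require Import complex.
From mathcomp Require Import all_classical all_reals all_analysis.
Set Implicit Arguments.
Unset Strict Implicit.
Unset Printing Implicit Defensive.
Import Order.TTheory GRing.Theory Num.Theory.
Import numFieldNormedType.Exports.
Local Open Scope classical_set_scope.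
Local Open Scope complex_scope.
Local Open Scope ring_scope.

Local Notation Re := complex.Re.
Local Notation Im := complex.Im.

(* Points of R^d are column vectors 'cV[R]_d.  The library norm on them is the
   sup norm; it only serves for topology and boundedness, and |x| in formulas
   is the Euclidean norm [enorm]. *)
Section Euclidean.
Context {R : realType} {d : nat}.

Definition dotp (x y : 'cV[R]_d) : R := \sum_i x i 0 * y i 0.

Definition enorm (x : 'cV[R]_d) : R := Num.sqrt (dotp x x).

Definition unit_sphere : set 'cV[R]_d := [set x | enorm x = 1].

Definition bounded_domain (D : set 'cV[R]_d) : Prop :=
  [/\ D !=set0, open D, connected D & bounded_set D].

End Euclidean.

Section ComplexScalars.
Context {R : realType}.

Definition cis (t : R) : R[i] := cos t +i* sin t.

Definition cmod (z : R[i]) : R := Num.sqrt (Re z ^+ 2 + Im z ^+ 2).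

Definition adjmx p q (A : 'M[R[i]]_(p, q)) : 'M[R[i]]_(q, p) :=
  map_mx conjc A^T.

(* Entrywise convergence of a matrix function as Q -> +oo. *)
Definition mx_cvg_pinfty p q (F : R -> 'M[R[i]]_(p, q)) (L : 'M[R[i]]_(p, q)) :=
  forall i j, (fun Q => Re (F Q i j)) @ +oo --> Re (L i j) /\
              (fun Q => Im (F Q i j)) @ +oo --> Im (L i j).

Definition Cintegral dT (T : measurableType dT) (mu : {measure set T -> \bar R})
    (A : set T) (f : T -> R[i]) : R[i] :=
  Rintegral mu A (fun t => Re (f t)) +i* Rintegral mu A (fun t => Im (f t)).

End ComplexScalars.

(* [lebesgueRn n] is Lebesgue measure on R^n: the n-fold product of the
   one-dimensional one, carried to n-tuples by (t, u) |-> t :: u. *)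
Section LebesgueRn.
Context {R : realType}.

Definition consRn n (p : R * n.-tuple R) : n.+1.-tuple R :=
  [the n.+1.-tuple R of p.1 :: p.2].

Definition splitRn n (u : n.+1.-tuple R) : R * n.-tuple R :=
  (thead u, [tuple of behead u]).

Lemma measurable_consRn n : measurable_fun setT (@consRn n).
Proof. exact: measurable_cons. Qed.

Lemma measurable_splitRn n : measurable_fun setT (@splitRn n).
Proof.
apply: measurable_fun_pair; last exact: measurable_behead.
exact: measurable_tnth.
Qed.

Lemma consRnK n : cancel (@consRn n) (@splitRn n).
Proof. by case=> x u; congr pair; apply: val_inj. Qed.

Section step.
Context n (mu : {sigma_finite_measure set (n.-tuple R) -> \bar R}).

Definition lebesgue_step : set (n.+1.-tuple R) -> \bar R :=
  pushforward ((@lebesgue_measure R) \x mu)%E (@consRn n).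

HB.instance Definition _ := Measure.copy lebesgue_step
  (measure_function_pushforward__canonical__measure_function_Measure
     ((@lebesgue_measure R) \x mu)%E (@measurable_consRn n)).

Let sigma_finite_step : sigma_finite setT lebesgue_step.
Proof.
suff [H HT mH] : sigma_finite setT ((@lebesgue_measure R) \x mu)%E.
  exists (fun i => @splitRn n @^-1` H i).
    by rewrite -preimage_bigcup -HT preimage_setT.
  move=> i; have [mHi Hoo] := mH i; split.
    by rewrite -[X in measurable X]setTI; exact: measurable_splitRn.
  rewrite /lebesgue_step /pushforward -comp_preimage.
  by rewrite (_ : @splitRn n \o @consRn n = id)// funeqE; exact: consRnK.
have /sigma_finiteP[A [TA ndA Aoo]] := sigma_finiteT (@lebesgue_measure R).
have /sigma_finiteP[B [TB ndB Boo]] := sigma_finiteT mu.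
exists (fun k => A k `*` B k).
  rewrite -setXTT TA TB predeqE => -[x y]; split.
    move=> [/= [i _ Ax] [k _ By]]; exists (maxn i k) => //; split.
      by move: x Ax; exact/subsetPset/ndA/leq_maxl.
    by move: y By; exact/subsetPset/ndB/leq_maxr.
  by move=> [i _ []/= ? ?]; split; exists i.
move=> k; have [? ?] := Aoo k; have [? ?] := Boo k.
split; first exact: measurableX.
by rewrite product_measure1E// lte_mul_pinfty// ge0_fin_numE.
Qed.

HB.instance Definition _ :=
  Measure_isSigmaFinite.Build _ _ _ lebesgue_step sigma_finite_step.

End step.

Fixpoint lebesgueRn n : {sigma_finite_measure set (n.-tuple R) -> \bar R} :=
  if n is n'.+1 return {sigma_finite_measure set (n.-tuple R) -> \bar R}
  then lebesgue_step (lebesgueRn n') else \d_[tuple].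

End LebesgueRn.

Section IntegralRd.
Context {R : realType} {d : nat}.

Definition integralRd (g : 'cV[R]_d -> R[i]) : R[i] :=
  Cintegral (lebesgueRn d) setT (fun u => g (\col_i tnth u i)).

Definition integralRd_mx p q (F : 'cV[R]_d -> 'M[R[i]]_(p, q)) :
    'M[R[i]]_(p, q) :=
  \matrix_(i, j) integralRd (fun x => F x i j).

Definition fourier p q (F : 'cV[R]_d -> 'M[R[i]]_(p, q)) (xi : 'cV[R]_d) :
    'M[R[i]]_(p, q) :=
  integralRd_mx (fun x => cis (- dotp x xi) *: F x).

End IntegralRd.

Section Smooth.
Context {R : realType} {n : nat}.
Implicit Types (g : 'cV[R]_n -> R[i]) (U : set 'cV[R]_n).

Definition basis_vec (i : 'I_n) : 'cV[R]_n := delta_mx i 0.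

Definition pderiv (i : 'I_n) g : 'cV[R]_n -> R[i] := fun x =>
  'D_(basis_vec i) (fun y => Re (g y)) x +i*
  'D_(basis_vec i) (fun y => Im (g y)) x.

(* A multi-index is represented by a list of coordinate directions, of length
   its order; on smooth functions the order of the list is irrelevant. *)
Definition pderivs (s : seq 'I_n) g := foldr pderiv g s.

Definition smooth g : Prop := forall s : seq 'I_n,
  [/\ continuous (fun x => Re (pderivs s g x)),
      continuous (fun x => Im (pderivs s g x)) &
      forall i x, derivable (fun y => Re (pderivs s g y)) x (basis_vec i) /\
                  derivable (fun y => Im (pderivs s g y)) x (basis_vec i)].

Definition fsupp g : set 'cV[R]_n := closure [set x | g x != 0].

Definition C0infty U g : Prop :=
  [/\ smooth g, compact (fsupp g) & fsupp g `<=` U].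

Definition C0infty_mx p q U (F : 'cV[R]_n -> 'M[R[i]]_(p, q)) : Prop :=
  forall i j, C0infty U (fun x => F x i j).

End Smooth.

(* A distribution is carried by a functional on all functions, of which only
   the values on test functions are meaningful.  Continuity is the usual
   seminorm estimate on each compact set: the hypothesis on M says that
   M bounds all derivatives of phi of order at most N. *)
Record distrib (R : realType) (d : nat) := Distrib {
  dpair :> ('cV[R]_d -> R[i]) -> R[i] ;
  dpair_linear : forall (a : R[i]) phi psi,
    C0infty setT phi -> C0infty setT psi ->
    dpair (fun x => a * phi x + psi x) = a * dpair phi + dpair psi ;
  dpair_continuous : forall K : set 'cV[R]_d, compact K ->
    exists (C : R) (N : nat), forall phi, C0infty setT phi -> fsupp phi `<=` K ->
      forall M : R,
      (forall s x, (size s <= N)%N -> cmod (pderivs s phi x) <= M) ->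
      cmod (dpair phi) <= C * M }.

Section Distributions.
Context {R : realType} {d : nat}.
Implicit Types (T : distrib R d) (g : 'cV[R]_d -> R[i]).

Definition dsupp T : set 'cV[R]_d :=
  [set x | forall U, open U -> U x -> exists2 phi, C0infty U phi & T phi != 0].

(* Pairing of a compactly supported distribution with a smooth function g:
   <T, chi g> for any cutoff chi equal to 1 near the support of T (it is 0 by
   convention when there is no such cutoff). *)
Definition dpair_smooth T g : R[i] :=
  xget 0 [set v | exists chi, [/\ C0infty setT chi,
    exists U, [/\ open U, dsupp T `<=` U & forall x, U x -> chi x = 1] &
    v = T (fun x => chi x * g x)]].

Definition dpair_vec n (f : 'I_n -> distrib R d)
    (psi : 'cV[R]_d -> 'cV[R[i]]_n) : R[i] :=
  \sum_j f j (fun x => psi x j 0).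

End Distributions.

Section RandomFields.
Context {R : realType} {dO : measure_display} {Omega : measurableType dO}.
Variable P : probability Omega R.

(* Degenerate Gaussian laws (Dirac masses) are allowed. *)
Definition gaussian_rv (Y : Omega -> R) : Prop :=
  measurable_fun setT Y /\
  exists mean sigma : R, forall A : set R, measurable A ->
    P (Y @^-1` A) = if sigma == 0 then \d_mean A else normal_prob mean sigma A.

(* Complex Gaussian: the real and imaginary parts are jointly Gaussian. *)
Definition complex_gaussian_rv (X : Omega -> R[i]) : Prop :=
  forall a b : R, gaussian_rv (fun w => a * Re (X w) + b * Im (X w)).

Definition Cexpectation (X : Omega -> R[i]) : R[i] := Cintegral P setT X.

Context {d n : nat}.
Variable f : Omega -> 'I_n -> distrib R d.

Definition centered_gaussian_field : Prop :=
  forall psi : 'cV[R]_d -> 'cV[R[i]]_n, C0infty_mx setT psi ->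
    complex_gaussian_rv (fun w => dpair_vec (f w) psi) /\
    Cexpectation (fun w => dpair_vec (f w) psi) = 0.

(* Matrix-valued kernels, given by their values on tensor products
   psi (x) phi of scalar test functions; the conjugate distribution is
   <conj T, phi> = conj <T, conj phi>. *)
Definition matrix_kernel :=
  'I_n -> 'I_n -> ('cV[R]_d -> R[i]) -> ('cV[R]_d -> R[i]) -> R[i].

Definition cov_kernel : matrix_kernel := fun j l psi phi =>
  Cexpectation (fun w =>
    f w j psi * conjc (f w l (fun x => conjc (phi x)))).

Definition rel_kernel : matrix_kernel := fun j l psi phi =>
  Cexpectation (fun w => f w j psi * f w l phi).

End RandomFields.

Section PseudoDifferential.
Context {R : realType} {d n : nat}.
Implicit Types (Sigma : 'cV[R]_d -> 'cV[R]_d -> 'M[R[i]]_n).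

(* The class S^s; the pair (x, xi) is the block column vector in R^(d + d). *)
Definition symbol_class (s : R) Sigma : Prop :=
  forall j l : 'I_n,
  let sigma := fun z : 'cV[R]_(d + d) => Sigma (usubmx z) (dsubmx z) j l in
  smooth sigma /\
  forall g1 g2 : seq 'I_d, exists C : R, forall x xi,
    cmod (pderivs (map (@rshift d d) g1 ++ map (@lshift d d) g2) sigma
            (col_mx x xi))
    <= C * (1 + enorm xi) `^ (s - (size g1)%:R).

Definition psido Sigma (phi : 'cV[R]_d -> 'cV[R[i]]_n) (x : 'cV[R]_d) :
    'cV[R[i]]_n :=
  ((2 * pi) ^- d)%:C *:
  integralRd_mx (fun xi => cis (dotp x xi) *: (Sigma x xi *m fourier phi xi)).

Definition has_kernel
    (Op : ('cV[R]_d -> 'cV[R[i]]_n) -> 'cV[R]_d -> 'cV[R[i]]_n)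
    (K : @matrix_kernel R d n) : Prop :=
  forall (phi : 'cV[R]_d -> 'cV[R[i]]_n) (psi : 'cV[R]_d -> R[i]),
  C0infty_mx setT phi -> C0infty setT psi -> forall j : 'I_n,
  integralRd (fun x => psi x * Op phi x j 0) =
  \sum_l K j l psi (fun x => phi x l 0).

(* The operator with kernel K is pseudo-differential, with a symbol of order
   -m compactly supported in D whose principal part is A(x) |xi|^(-m). *)
Definition principal_symbol (D : set 'cV[R]_d) (m : R)
    (A : 'cV[R]_d -> 'M[R[i]]_n) (K : @matrix_kernel R d n) : Prop :=
  exists Sigma B : 'cV[R]_d -> 'cV[R]_d -> 'M[R[i]]_n,
  [/\ has_kernel (psido Sigma) K,
      symbol_class (- m) Sigma /\
        (forall xi, C0infty_mx D (fun x => Sigma x xi)),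
      C0infty_mx D A,
      symbol_class (- m - 1) B /\
        (forall xi, C0infty_mx D (fun x => B x xi)) &
      forall x xi, 1 <= enorm xi ->
        Sigma x xi = (enorm xi `^ (- m))%:C *: A x + B x xi].

(* Centered GMIG random field of order -m in D with principal symbols
   Ac(x) |xi|^(-m) (covariance) and Ar(x) |xi|^(-m) (relation). *)
Definition GMIG (dO : measure_display) (Omega : measurableType dO)
    (P : probability Omega R) (D : set 'cV[R]_d) (m : R)
    (f : Omega -> 'I_n -> distrib R d) (Ac Ar : 'cV[R]_d -> 'M[R[i]]_n) : Prop :=
  [/\ centered_gaussian_field P f,
      principal_symbol D m Ac (cov_kernel P f) &
      principal_symbol D m Ar (rel_kernel P f)].

End PseudoDifferential.

Section FarField.
Context {R : realType} {d : nat}.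
Variables lambda mu : R.

Definition cp : R := (lambda + 2 * mu) `^ (- 2^-1).
Definition cs : R := mu `^ (- 2^-1).

(* C_2 and C_3; only d = 2 and d = 3 matter. *)
Definition Cdim : R[i] :=
  if d == 2%N then cis (pi / 4) / (Num.sqrt (8 * pi))%:C
  else ((4 * pi)^-1)%:C.

(* The componentwise pairing  int e^(- i c omega x.y) f(y) dy. *)
Definition plane_pairing (c : R) (f : 'I_d -> distrib R d) (x : 'cV[R]_d)
    (omega : R) : 'cV[R[i]]_d :=
  \col_j dpair_smooth (f j) (fun y => cis (- (c * omega * dotp x y))).

Definition xxT (x : 'cV[R]_d) : 'M[R[i]]_d := map_mx (real_complex R) (x *m x^T).

Variable f : 'I_d -> distrib R d.

Definition up_inf (x : 'cV[R]_d) (omega : R) : 'cV[R[i]]_d :=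
  - (Cdim * (cp `^ ((d%:R + 1) / 2) * omega `^ ((d%:R - 3) / 2))%:C) *:
    (xxT x *m plane_pairing cp f x omega).

Definition us_inf (x : 'cV[R]_d) (omega : R) : 'cV[R[i]]_d :=
  - (Cdim * (cs `^ ((d%:R + 1) / 2) * omega `^ ((d%:R - 3) / 2))%:C) *:
    ((1%:M - xxT x) *m plane_pairing cs f x omega).

Definition cov_bracket (x : 'cV[R]_d) (tau omega : R) : 'M[R[i]]_d :=
  let k := cs / cp in
    (cp ^- 4)%:C *:
      (up_inf x (k * (omega + tau)) *m adjmx (up_inf x (k * omega)))
  + (cs ^- 2 * cp ^- 2)%:C *:
      (up_inf x (k * (omega + tau)) *m adjmx (us_inf x omega))
  + (cs ^- 2 * cp ^- 2)%:C *:
      (us_inf x (omega + tau) *m adjmx (up_inf x (k * omega)))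
  + (cs ^- 4)%:C *:
      (us_inf x (omega + tau) *m adjmx (us_inf x omega)).

Definition rel_bracket (x : 'cV[R]_d) (tau omega : R) : 'M[R[i]]_d :=
  let k := cs / cp in
    (cp ^- 4)%:C *:
      (up_inf x (k * (omega + tau)) *m (up_inf (- x) (k * omega))^T)
  + (cs ^- 2 * cp ^- 2)%:C *:
      (up_inf x (k * (omega + tau)) *m (us_inf (- x) omega)^T)
  + (cs ^- 2 * cp ^- 2)%:C *:
      (us_inf x (omega + tau) *m (up_inf (- x) (k * omega))^T)
  + (cs ^- 4)%:C *:
      (us_inf x (omega + tau) *m (us_inf (- x) omega)^T).

Definition freq_average (m : R) (M : R -> 'M[R[i]]_d) (Q : R) : 'M[R[i]]_d :=
  \matrix_(j, l) ((Q^-1)%:C *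
    Cintegral (@lebesgue_measure R) `[Q, 2 * Q]%classic (fun omega =>
      (cs `^ (m + 3 - d%:R) * omega `^ (m + 3 - d%:R))%:C * M omega j l)).

Definition cov_average (m : R) (x : 'cV[R]_d) (tau : R) :=
  freq_average m (cov_bracket x tau).

Definition rel_average (m : R) (x : 'cV[R]_d) (tau : R) :=
  freq_average m (rel_bracket x tau).

End FarField.

Arguments Cdim R d : clear implicits.

(* Nonempty relatively open subsets of R_+ x S^(d-1). *)
Definition open_observation (R : realType) (d : nat) (Theta : set (R * 'cV[R]_d)) :
    Prop :=
  Theta !=set0 /\
  exists2 U : set (R * 'cV[R]_d), open U &
    Theta = U `&` [set p | 0 < p.1 /\ unit_sphere p.2].

(* Main.v *)
(* Along a ray the pairing V_j(w) = <f_j, e^(-i c_s w x.y)> is a centered Gaussian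
   process, and because u_p and u_s only see the longitudinal and transverse parts of
   V, the four terms of each bracket recombine into V(w + tau) V(w)^* (respectively
   V(w + tau) V_(-x)(w)^T) up to the factor |C_d|^2 (respectively C_d^2) and a power of
   the frequency.  The symbol calculus gives E[V(w + tau) V(w)^*] ~ |c_s w|^(-m) A^(c_s tau x)
   with an error of relative order 1/w, and decay of all second moments in the
   frequency difference; by Wick's formula the covariance of the rescaled products then
   decays like |w - w'|^(-2), which suffices for a law of large numbers along w -> oo.
   For uniqueness, the Fourier transform of a compactly supported function is analytic
   along lines, so it is determined by its values on the open cone of frequencies
   c_s tau x; Fourier inversion of tensor products of bumps gives injectivity. *)

(* Three points shape the details. The pairing with a plane wave makes sense only through a cutoff
   near the support of the distribution, so the support must almost surely lie in the closure of D.
   The covariance kernel yields this for one test function at a time; a countable family of test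
   functions that determines a distribution makes the exceptional null set uniform. Next, frequency
   integrals are treated path by path: V is continuous in the frequency, each integral is a limit of
   Riemann sums, and Fatou's lemma carries measurability and second-moment bounds over to it.
   Finally, one translation by half a period gains only one power of the frequency difference;
   Wick's formula squares this gain, and the integrability of the square gives a second moment O(Q)
   for the integral over [Q, 2Q]. Averages along Q = n^2 then have summable second moments, and the
   gaps between consecutive squares are short enough to be filled by a crude bound on the integral
   of the absolute value. *)
Require Import Defs.
From mathcomp Require Import all_boot all_order all_algebra.
From mathcomp Require Import complex.
From mathcomp Require Import all_classical all_reals all_analysis.
From mathcomp Require Import measurable_realfun ring lra.
Import Order.TTheory GRing.Theory Num.Theory.
Import numFieldNormedType.Exports.
Set Implicit Arguments.
Unset Strict Implicit.
Unset Printing Implicit Defensive.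
Local Open Scope classical_set_scope.
Local Open Scope complex_scope.
Local Open Scope ring_scope.
Local Notation Re := complex.Re.
Local Notation Im := complex.Im.

(** * Complex-valued integrals *)

Section ComplexScalars.
Context {R : realType}.
Implicit Types (x y z w : R[i]) (r s t : R).

Lemma ReD z w : Re (z + w) = Re z + Re w. Proof. by case: z; case: w. Qed.
Lemma ImD z w : Im (z + w) = Im z + Im w. Proof. by case: z; case: w. Qed.
Lemma ReN z : Re (- z) = - Re z. Proof. by case: z. Qed.
Lemma ImN z : Im (- z) = - Im z. Proof. by case: z. Qed.
Lemma ReB z w : Re (z - w) = Re z - Re w. Proof. by rewrite ReD ReN. Qed.
Lemma ImB z w : Im (z - w) = Im z - Im w. Proof. by rewrite ImD ImN. Qed.
Lemma ReM z w : Re (z * w) = Re z * Re w - Im z * Im w.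
Proof. by case: z; case: w. Qed.
Lemma ImM z w : Im (z * w) = Re z * Im w + Im z * Re w.
Proof. by case: z; case: w. Qed.
Lemma Re_conjc z : Re (conjc z) = Re z. Proof. by case: z. Qed.
Lemma Im_conjc z : Im (conjc z) = - Im z. Proof. by case: z. Qed.
Lemma Re_real r : Re r%:C = r. Proof. by []. Qed.
Lemma Im_real r : Im r%:C = 0. Proof. by []. Qed.
Lemma Re0 : Re (0 : R[i]) = 0. Proof. by []. Qed.
Lemma Im0 : Im (0 : R[i]) = 0. Proof. by []. Qed.
Lemma Re_cis t : Re (cis t) = cos t. Proof. by []. Qed.
Lemma Im_cis t : Im (cis t) = sin t. Proof. by []. Qed.

Lemma complex_ext z w : Re z = Re w -> Im z = Im w -> z = w.
Proof. by case: z w => [a b] [c e] /= -> ->. Qed.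

Lemma Re_sum I (r : seq I) (P : pred I) (F : I -> R[i]) :
  Re (\sum_(i <- r | P i) F i) = \sum_(i <- r | P i) Re (F i).
Proof. by elim/big_rec2 : _ => // i y1 y2 _ <-; rewrite ReD. Qed.

Lemma Im_sum I (r : seq I) (P : pred I) (F : I -> R[i]) :
  Im (\sum_(i <- r | P i) F i) = \sum_(i <- r | P i) Im (F i).
Proof. by elim/big_rec2 : _ => // i y1 y2 _ <-; rewrite ImD. Qed.

Definition ReImE :=
  (ReM, ImM, ReB, ImB, ReD, ImD, ReN, ImN, Re_conjc, Im_conjc, Re_real, Im_real,
   Re0, Im0, Re_cis, Im_cis).

Lemma realCM r s : (r * s)%:C = r%:C * s%:C.
Proof. by apply: complex_ext; rewrite !ReImE; ring. Qed.
Lemma cmodE z : cmod z = Normc.normc z. Proof. by case: z. Qed.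
Lemma cmodM z w : cmod (z * w) = cmod z * cmod w.
Proof. by rewrite !cmodE Normc.normcM. Qed.
Lemma cmod_ge0 z : 0 <= cmod z. Proof. exact: sqrtr_ge0. Qed.
Lemma cmodD z w : cmod (z + w) <= cmod z + cmod w.
Proof. by rewrite !cmodE le_normcD. Qed.
Lemma cmodN z : cmod (- z) = cmod z.
Proof. by rewrite !cmodE normcN. Qed.
Lemma cmodB z w : cmod (z - w) <= cmod z + cmod w.
Proof. by rewrite (le_trans (cmodD _ _))// cmodN. Qed.
Lemma cmod_real r : cmod r%:C = `|r|.
Proof. by rewrite /cmod Re_real Im_real expr0n addr0 sqrtr_sqr. Qed.
Lemma cmod0 : cmod (0 : R[i]) = 0.
Proof. by rewrite cmod_real normr0. Qed.
Lemma cmod1 : cmod (1 : R[i]) = 1.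
Proof. by rewrite cmod_real normr1. Qed.
Lemma cmod_eq0 z : (cmod z == 0) = (z == 0).
Proof.
apply/eqP/eqP => [|->]; last exact: cmod0.
by rewrite cmodE => /Normc.eq0_normc.
Qed.
Lemma cmod_sqr z : cmod z ^+ 2 = Re z ^+ 2 + Im z ^+ 2.
Proof. by rewrite sqr_sqrtr// addr_ge0 ?sqr_ge0. Qed.
Lemma ler_Re_cmod z : `|Re z| <= cmod z.
Proof. by rewrite -sqrtr_sqr ler_wsqrtr// lerDl sqr_ge0. Qed.
Lemma ler_Im_cmod z : `|Im z| <= cmod z.
Proof. by rewrite -sqrtr_sqr ler_wsqrtr// lerDr sqr_ge0. Qed.
Lemma cmod_le z : cmod z <= `|Re z| + `|Im z|.
Proof.
rewrite -(@ler_pXn2r _ 2)// ?nnegrE ?cmod_ge0 ?addr_ge0//.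
rewrite cmod_sqr sqrrD !real_normK ?num_real//.
by rewrite lerD2r lerDl mulrn_wge0// mulr_ge0.
Qed.
Lemma cisD s t : cis (s + t) = cis s * cis t.
Proof. by apply: complex_ext; rewrite !ReImE ?cosD ?sinD//; ring. Qed.
Lemma cis0 : cis (0 : R) = 1.
Proof. by rewrite /cis cos0 sin0. Qed.
Lemma cisN t : cis (- t) = conjc (cis t).
Proof. by apply: complex_ext; rewrite !ReImE ?cosN ?sinN. Qed.
Lemma cmod_cis t : cmod (cis t) = 1.
Proof. by rewrite /cmod Re_cis Im_cis cos2Dsin2 sqrtr1. Qed.
Lemma lipschitz_of_derive (h h' : R -> R) (M : R) :
  (forall t, is_derive t 1 h (h' t)) -> (forall t, `|h' t| <= M) ->
  forall s t, `|h s - h t| <= M * `|s - t|.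
Proof.
move=> dh bh.
suff H s t : s <= t -> `|h t - h s| <= M * `|t - s|.
  move=> s t; case: (leP s t) => [/H|/ltW /H//].
  by rewrite (distrC (h t)) (distrC t).
move=> st.
have ch : {within `[s, t], continuous h}.
  apply: continuous_subspaceT => x.
  by apply: differentiable_continuous; apply/derivable1_diffP; case: (dh x).
have [c _ ->] := MVT_segment st (fun (c : R) _ => dh c) ch.
by rewrite normrM ler_wpM2r.
Qed.

Lemma cos_lipschitz s t : `|cos s - cos t| <= `|s - t|.
Proof.
rewrite -[leRHS]mul1r.
apply: (@lipschitz_of_derive cos (fun t => - sin t)) => c.
by rewrite normrN sin_max.
Qed.

Lemma sin_lipschitz s t : `|sin s - sin t| <= `|s - t|.
Proof.
rewrite -[leRHS]mul1r.
apply: (@lipschitz_of_derive sin cos) => c.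
exact: cos_max.
Qed.

Lemma cis_lipschitz s t : cmod (cis s - cis t) <= 2 * `|s - t|.
Proof.
rewrite (le_trans (cmod_le _))// !ReImE mulr_natl mulr2n.
by rewrite lerD ?cos_lipschitz ?sin_lipschitz.
Qed.

End ComplexScalars.

Section RealIntegral.
Context {R : realType} {dT : measure_display} {T : measurableType dT}.
Variable mu : {measure set T -> \bar R}.
Implicit Types (f g : T -> R).

Definition itg f : Prop := mu.-integrable setT (EFin \o f).

Definition itgR f : R := Rintegral mu setT f.

Lemma itg_meas f : itg f -> measurable_fun setT f.
Proof. by move=> /measurable_int /measurable_EFinP. Qed.

Lemma itgD f g : itg f -> itg g -> itg (fun x => f x + g x).
Proof. by move=> If Ig; have := integrableD measurableT If Ig. Qed.

Lemma itgN f : itg f -> itg (fun x => - f x).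
Proof. by move=> If; have := integrableN If. Qed.

Lemma itgB f g : itg f -> itg g -> itg (fun x => f x - g x).
Proof. by move=> If Ig; have := itgD If (itgN Ig). Qed.

Lemma itgZ c f : itg f -> itg (fun x => c * f x).
Proof. by move=> If; have := integrableZl measurableT c If. Qed.

Lemma itg0 : itg (fun=> 0).
Proof. exact: integrable0. Qed.

Lemma itg_sum I (r : seq I) (P : pred I) (F : I -> T -> R) :
  (forall i, itg (F i)) -> itg (fun x => \sum_(i <- r | P i) F i x).
Proof.
move=> h; elim: r => [|a r IH].
  by under eq_fun do rewrite big_nil; exact: itg0.
under eq_fun do rewrite big_cons.
by case: (P a) => //; apply: itgD.
Qed.

Lemma itg_le f g : measurable_fun setT f -> (forall x, `|f x| <= g x) ->
  itg g -> itg f.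
Proof.
move=> mf fg Ig; apply: (le_integrable _ _ _ Ig) => //.
  exact/measurable_EFinP.
by move=> x _ /=; rewrite lee_fin (le_trans (fg x))// ler_norm.
Qed.

Lemma itg_abs f : itg f -> itg (fun x => `|f x|).
Proof.
move=> If; apply: (itg_le (g := fun x => `|f x|)).
- exact: measurableT_comp (itg_meas If).
- by move=> x; rewrite normr_id.
- by have := integrable_norm If.
Qed.

Lemma itgRD f g : itg f -> itg g -> itgR (fun x => f x + g x) = itgR f + itgR g.
Proof. exact: RintegralD. Qed.

Lemma itgRB f g : itg f -> itg g -> itgR (fun x => f x - g x) = itgR f - itgR g.
Proof. exact: RintegralB. Qed.

Lemma itgRZ c f : itg f -> itgR (fun x => c * f x) = c * itgR f.
Proof. exact: RintegralZl. Qed.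

Lemma itgR0 : itgR (fun=> 0) = 0.
Proof. by rewrite /itgR /Rintegral integral0. Qed.

Lemma itgRN f : itg f -> itgR (fun x => - f x) = - itgR f.
Proof.
move=> If; have := itgRZ (-1) If.
by rewrite mulN1r => <-; congr itgR; apply/funext => x; rewrite mulN1r.
Qed.

Lemma itgR_sum I (r : seq I) (P : pred I) (F : I -> T -> R) :
  (forall i, itg (F i)) ->
  itgR (fun x => \sum_(i <- r | P i) F i x) = \sum_(i <- r | P i) itgR (F i).
Proof.
move=> h; elim: r => [|a r IH].
  rewrite big_nil (_ : (fun x => _) = fun=> 0) ?itgR0//.
  by apply/funext => x; rewrite big_nil.
rewrite big_cons; case: ifPn => Pa; last first.
  by rewrite -IH; congr itgR; apply/funext => x; rewrite big_cons (negbTE Pa).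
rewrite -IH -itgRD//; last exact: itg_sum.
by congr itgR; apply/funext => x; rewrite big_cons Pa.
Qed.

Lemma itgR_ge0 f : (forall x, 0 <= f x) -> 0 <= itgR f.
Proof. by move=> f0; apply: Rintegral_ge0. Qed.

Lemma le_itgR f g : itg f -> itg g -> (forall x, f x <= g x) -> itgR f <= itgR g.
Proof. by move=> If Ig fg; apply: le_Rintegral. Qed.

Lemma itgR_abs f g : measurable_fun setT f -> (forall x, `|f x| <= g x) ->
  itg g -> `|itgR f| <= itgR g.
Proof.
move=> mf fg Ig; have If := itg_le mf fg Ig.
rewrite (le_trans (le_normr_Rintegral measurableT If))//.
by apply: le_itgR => //; apply: itg_abs.
Qed.

Lemma itgR_fin f : itg f -> (\int[mu]_x (f x)%:E)%E = (itgR f)%:E.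
Proof. by move=> If; rewrite /itgR /Rintegral fineK//; exact: integrable_fin_num. Qed.

Lemma itgR_dct (F : nat -> T -> R) f g :
  (forall n, measurable_fun setT (F n)) ->
  (forall x, F n x @[n --> \oo] --> f x) ->
  (forall n x, `|F n x| <= g x) -> itg g ->
  itg f /\ itgR (F n) @[n --> \oo] --> itgR f.
Proof.
move=> mF Ff Fg Ig.
have mf : measurable_fun setT f.
  by apply: (measurable_fun_cvg (h := F)) => // x _; exact: Ff.
have [If _ Fcvg] : [/\ mu.-integrable setT (EFin \o f),
  [sequence \int[mu]_(x in setT) `|(EFin \o F n) x - (EFin \o f) x|]_n @ \oo --> 0%E &
  [sequence \int[mu]_(x in setT) ((EFin \o F n) x)]_n @ \oo --> (\int[mu]_(x in setT) ((EFin \o f) x))%E]%E.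
  apply: (@dominated_convergence _ _ _ _ _ _ (fun n => EFin \o F n) _ (EFin \o g)) => //.
  - by move=> n; apply/measurable_EFinP.
  - exact/measurable_EFinP.
  - by apply: aeW => x _; apply: cvg_EFin; [exact: nearW|exact: Ff].
  - by apply: aeW => x n _; rewrite lee_fin; exact: Fg.
split => //.
have IF n : itg (F n) by exact: itg_le (mF n) (Fg n) Ig.
have := Fcvg; rewrite (_ : (\int[mu]_(x in setT) ((EFin \o f) x))%E = (itgR f)%:E); last first.
  exact: itgR_fin.
move=> /fine_cvgP[_]; apply: cvg_trans.
by apply: near_eq_cvg; near=> n.
Unshelve. all: by end_near. Qed.

End RealIntegral.

Section ComplexIntegral.
Context {R : realType} {dT : measure_display} {T : measurableType dT}.
Variable mu : {measure set T -> \bar R}.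
Implicit Types (f g : T -> R[i]).

Definition cmeas f : Prop :=
  measurable_fun setT (fun x => Re (f x)) /\
  measurable_fun setT (fun x => Im (f x)).

Definition citg f : Prop :=
  itg mu (fun x => Re (f x)) /\ itg mu (fun x => Im (f x)).

Definition citgC f : R[i] := Cintegral mu setT f.

Lemma cmeasM f g : cmeas f -> cmeas g -> cmeas (fun x => f x * g x).
Proof.
move=> [f1 f2] [g1 g2]; split.
  by under eq_fun do rewrite ReM; apply: measurable_funB; exact: measurable_funM.
by under eq_fun do rewrite ImM; apply: measurable_funD; exact: measurable_funM.
Qed.

Lemma cmeas_cst z : cmeas (fun=> z).
Proof. by split; exact: measurable_cst. Qed.

Lemma cmeasB f g : cmeas f -> cmeas g -> cmeas (fun x => f x - g x).
Proof.
move=> [f1 f2] [g1 g2]; split.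
  by under eq_fun do rewrite ReB; exact: measurable_funB.
by under eq_fun do rewrite ImB; exact: measurable_funB.
Qed.

Lemma cmeas_real (h : T -> R) : measurable_fun setT h -> cmeas (fun x => (h x)%:C).
Proof. by move=> mh; split => //; exact: measurable_cst. Qed.

Lemma cmeas_cis (h : T -> R) : measurable_fun setT h -> cmeas (fun x => cis (h x)).
Proof.
move=> mh; split.
- apply: (measurableT_comp (f := cos)) => //.
  by apply: continuous_measurable_fun; exact: continuous_cos.
- apply: (measurableT_comp (f := sin)) => //.
  by apply: continuous_measurable_fun; exact: continuous_sin.
Qed.

Lemma citg_meas f : citg f -> cmeas f.
Proof. by move=> [/itg_meas f1 /itg_meas f2]; split. Qed.

Lemma citg_le f (h : T -> R) : cmeas f -> (forall x, cmod (f x) <= h x) ->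
  itg mu h -> citg f.
Proof.
move=> [f1 f2] fh Ih; split; apply: (itg_le _ _ Ih) => // x.
  by rewrite (le_trans (ler_Re_cmod _)).
by rewrite (le_trans (ler_Im_cmod _)).
Qed.

Lemma cmeas_cmod f : cmeas f -> measurable_fun setT (fun x => cmod (f x)).
Proof.
move=> [f1 f2]; rewrite /cmod; apply: (measurableT_comp (f := @Num.sqrt R)).
  by apply: continuous_measurable_fun; exact: sqrt_continuous.
by apply: measurable_funD; apply: measurable_funX.
Qed.

Lemma citg_cmod f : citg f -> itg mu (fun x => cmod (f x)).
Proof.
move=> If; have [f1 f2] := If.
apply: (itg_le (cmeas_cmod (citg_meas If)) _ (itgD (itg_abs f1) (itg_abs f2))) => x.
by rewrite ger0_norm ?cmod_ge0// cmod_le.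
Qed.

Lemma citgZ c f : citg f -> citg (fun x => c * f x).
Proof.
move=> [f1 f2]; split.
  by under eq_fun do rewrite ReM; apply: itgB; exact: itgZ.
by under eq_fun do rewrite ImM; apply: itgD; exact: itgZ.
Qed.

Lemma citgC_Re f : Re (citgC f) = itgR mu (fun x => Re (f x)). Proof. by []. Qed.
Lemma citgC_Im f : Im (citgC f) = itgR mu (fun x => Im (f x)). Proof. by []. Qed.

Lemma citgCD f g : citg f -> citg g ->
  citgC (fun x => f x + g x) = citgC f + citgC g.
Proof.
move=> [f1 f2] [g1 g2]; apply: complex_ext.
  by rewrite ReD !citgC_Re -itgRD//; under eq_fun do rewrite ReD.
by rewrite ImD !citgC_Im -itgRD//; under eq_fun do rewrite ImD.
Qed.

Lemma citgCB f g : citg f -> citg g ->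
  citgC (fun x => f x - g x) = citgC f - citgC g.
Proof.
move=> [f1 f2] [g1 g2]; apply: complex_ext.
  by rewrite ReB !citgC_Re -itgRB//; under eq_fun do rewrite ReB.
by rewrite ImB !citgC_Im -itgRB//; under eq_fun do rewrite ImB.
Qed.

Lemma citgCZ c f : citg f -> citgC (fun x => c * f x) = c * citgC f.
Proof.
move=> [f1 f2]; apply: complex_ext.
  rewrite ReM citgC_Re (_ : (fun x => _) = fun x => Re c * Re (f x) - Im c * Im (f x)).
    by rewrite itgRB ?itgRZ//; exact: itgZ.
  by apply/funext => x; rewrite ReM.
rewrite ImM citgC_Im (_ : (fun x => _) = fun x => Re c * Im (f x) + Im c * Re (f x)).
  by rewrite itgRD ?itgRZ//; exact: itgZ.
by apply/funext => x; rewrite ImM.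
Qed.

Lemma citgC0 : citgC (fun=> 0) = 0.
Proof. by apply: complex_ext; rewrite ?citgC_Re ?citgC_Im itgR0. Qed.

Lemma citg_sum I (r : seq I) (P : pred I) (F : I -> T -> R[i]) :
  (forall i, citg (F i)) -> citg (fun x => \sum_(i <- r | P i) F i x).
Proof.
move=> h; split.
  under eq_fun do rewrite Re_sum.
  by apply: itg_sum => i; have [] := h i.
under eq_fun do rewrite Im_sum.
by apply: itg_sum => i; have [] := h i.
Qed.

Lemma citgC_sum I (r : seq I) (P : pred I) (F : I -> T -> R[i]) :
  (forall i, citg (F i)) ->
  citgC (fun x => \sum_(i <- r | P i) F i x) = \sum_(i <- r | P i) citgC (F i).
Proof.
move=> h; apply: complex_ext.
  rewrite Re_sum citgC_Re -itgR_sum; last by move=> i; have [] := h i.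
  by congr itgR; apply/funext => x; rewrite Re_sum.
rewrite Im_sum citgC_Im -itgR_sum; last by move=> i; have [] := h i.
by congr itgR; apply/funext => x; rewrite Im_sum.
Qed.

Lemma cmod_citgC f (h : T -> R) : cmeas f -> (forall x, cmod (f x) <= h x) ->
  itg mu h -> cmod (citgC f) <= 2 * itgR mu h.
Proof.
move=> [f1 f2] fh Ih; rewrite (le_trans (cmod_le _))// mulr_natl mulr2n.
rewrite lerD//.
  by apply: itgR_abs => // x; rewrite (le_trans (ler_Re_cmod _)).
apply: itgR_abs => // x.
by rewrite (le_trans (ler_Im_cmod _)).
Qed.

Lemma citgC_dct (F : nat -> T -> R[i]) f (g : T -> R) :
  (forall n, cmeas (F n)) ->
  (forall x, Re (F n x) @[n --> \oo] --> Re (f x)) ->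
  (forall x, Im (F n x) @[n --> \oo] --> Im (f x)) ->
  (forall n x, cmod (F n x) <= g x) -> itg mu g ->
  [/\ citg f, Re (citgC (F n)) @[n --> \oo] --> Re (citgC f) &
      Im (citgC (F n)) @[n --> \oo] --> Im (citgC f)].
Proof.
move=> mF F1 F2 Fg Ig.
have [] := @itgR_dct _ _ _ mu (fun n x => Re (F n x)) (fun x => Re (f x)) g.
- by move=> n; have [] := mF n.
- exact: F1.
- by move=> n x; rewrite (le_trans (ler_Re_cmod _)).
- exact: Ig.
move=> I1 C1.
have [] := @itgR_dct _ _ _ mu (fun n x => Im (F n x)) (fun x => Im (f x)) g.
- by move=> n; have [] := mF n.
- exact: F2.
- by move=> n x; rewrite (le_trans (ler_Im_cmod _)).
- exact: Ig.
by move=> I2 C2; split.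
Qed.

End ComplexIntegral.

(** * Lebesgue measure on R^n *)

Section ProductDominated.
Context {R : realType} {d1 d2 : measure_display}
  {T1 : measurableType d1} {T2 : measurableType d2}.
Variables (m1 : {sigma_finite_measure set T1 -> \bar R})
          (m2 : {sigma_finite_measure set T2 -> \bar R}).

Section real.
Variables (f : T1 * T2 -> R) (g : T1 -> R) (h : T2 -> R).
Hypothesis mf : measurable_fun setT f.
Hypothesis fgh : forall x y, `|f (x, y)| <= g x * h y.
Hypothesis Ig : itg m1 g.
Hypothesis Ih : itg m2 h.

Lemma measurable_section1 x : measurable_fun setT (fun y => f (x, y)).
Proof. exact: (measurableT_comp mf (pair1_measurable x)). Qed.

Lemma measurable_section2 y : measurable_fun setT (fun x => f (x, y)).
Proof. exact: (measurableT_comp mf (pair2_measurable y)). Qed.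

Lemma itg_section1 x : itg m2 (fun y => f (x, y)).
Proof. exact: itg_le (measurable_section1 x) (fgh x) (itgZ (g x) Ih). Qed.

Lemma itg_section2 y : itg m1 (fun x => f (x, y)).
Proof.
apply: itg_le (measurable_section2 y) _ (itgZ (h y) Ig) => x.
by rewrite mulrC.
Qed.

(** By Tonelli the double integral of |f| is at most the product of the integrals of |g| and |h|. A
    product majorant is available in every exchange of integrals below, so this single form of
    Fubini suffices. *)
Lemma itg_prod_dominated : itg (m1 \x m2)%E f.
Proof.
have mF : measurable_fun setT (EFin \o f) by exact/measurable_EFinP.
apply/(integrable12ltyP m1 m2 mF).
have H x : (\int[m2]_y `|(EFin \o f) (x, y)| <= (`|g x| * itgR m2 (fun y => `|h y|))%:E)%E.
  have If := itg_abs (itg_section1 x).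
  rewrite (itgR_fin If) lee_fin -(itgRZ _ (itg_abs Ih)).
  apply: le_itgR => //; first exact/itgZ/itg_abs.
  by move=> y; rewrite (le_trans (fgh x y))// -normrM ler_norm.
apply: (@le_lt_trans _ _ (\int[m1]_x (`|g x| * itgR m2 (fun y => `|h y|))%:E)%E).
  apply: ge0_le_integral => //.
  - by move=> x _; exact: integral_ge0.
  - apply: (@measurable_fun_fubini_tonelli_F _ _ _ _ _ m2 (fun z => `|(f z)%:E|%E)) => //.
    exact: measurableT_comp.
  - apply/measurable_EFinP; apply: measurable_funM => //.
    exact: measurableT_comp (itg_meas Ig).
have Igg := itgZ (itgR m2 (fun y => `|h y|)) (itg_abs Ig).
under eq_integral do rewrite mulrC.
by rewrite (itgR_fin Igg) ltry.
Qed.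

Let F1 x := (\int[m2]_y (EFin \o f) (x, y))%E.
Let F1E : F1 = fun x => (itgR m2 (fun y => f (x, y)))%:E.
Proof. by apply/funext => x; rewrite /F1 (itgR_fin (itg_section1 x)). Qed.

Lemma itg_inner1 : itg m1 (fun x => itgR m2 (fun y => f (x, y))).
Proof.
apply: (itg_le _ _ (itgZ (itgR m2 (fun y => `|h y|)) (itg_abs Ig))).
  apply/measurable_EFinP; have : measurable_fun setT F1.
    apply: (@measurable_fubini_F _ _ _ _ _ m1 m2 (EFin \o f)).
    exact: itg_prod_dominated.
  by rewrite F1E.
move=> x; rewrite mulrC -(itgRZ _ (itg_abs Ih)).
apply: itgR_abs (measurable_section1 x) _ (itgZ _ (itg_abs Ih)) => y.
by rewrite (le_trans (fgh x y))// -normrM ler_norm.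
Qed.

Lemma itgR_fubini1 :
  itgR (m1 \x m2)%E f = itgR m1 (fun x => itgR m2 (fun y => f (x, y))).
Proof.
have := @integral12_prod_meas1 _ _ _ _ _ m1 m2 (EFin \o f) itg_prod_dominated.
rewrite /fubini_F -/F1 F1E (itgR_fin itg_prod_dominated) (itgR_fin itg_inner1).
by case.
Qed.

Let F2 y := (\int[m1]_x (EFin \o f) (x, y))%E.
Let F2E : F2 = fun y => (itgR m1 (fun x => f (x, y)))%:E.
Proof. by apply/funext => y; rewrite /F2 (itgR_fin (itg_section2 y)). Qed.

Lemma itg_inner2 : itg m2 (fun y => itgR m1 (fun x => f (x, y))).
Proof.
apply: (itg_le _ _ (itgZ (itgR m1 (fun y => `|g y|)) (itg_abs Ih))).
  apply/measurable_EFinP; have : measurable_fun setT F2.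
    apply: (@measurable_fubini_G _ _ _ _ _ m1 m2 (EFin \o f)).
    exact: itg_prod_dominated.
  by rewrite F2E.
move=> y; rewrite mulrC -(itgRZ _ (itg_abs Ig)).
apply: itgR_abs (measurable_section2 y) _ (itgZ _ (itg_abs Ig)) => x.
by rewrite (le_trans (fgh x y))// mulrC -normrM ler_norm.
Qed.

Lemma itgR_fubini2 :
  itgR (m1 \x m2)%E f = itgR m2 (fun y => itgR m1 (fun x => f (x, y))).
Proof.
have := @integral21_prod_meas1 _ _ _ _ _ m1 m2 (EFin \o f) itg_prod_dominated.
rewrite /fubini_G -/F2 F2E (itgR_fin itg_prod_dominated) (itgR_fin itg_inner2).
by case.
Qed.

End real.

Section cplx.
Variables (f : T1 * T2 -> R[i]) (g : T1 -> R) (h : T2 -> R).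
Hypothesis mf : cmeas f.
Hypothesis fgh : forall x y, cmod (f (x, y)) <= g x * h y.
Hypothesis Ig : itg m1 g.
Hypothesis Ih : itg m2 h.

Let Rf x y : `|Re (f (x, y))| <= g x * h y.
Proof. exact: le_trans (ler_Re_cmod _) (fgh x y). Qed.
Let If x y : `|Im (f (x, y))| <= g x * h y.
Proof. exact: le_trans (ler_Im_cmod _) (fgh x y). Qed.

Lemma citg_prod_dominated : citg (m1 \x m2)%E f.
Proof. by case: mf => r i; split; [exact: itg_prod_dominated Rf _ _|exact: itg_prod_dominated If _ _]. Qed.

Lemma citgC_fubini1 :
  citgC (m1 \x m2)%E f = citgC m1 (fun x => citgC m2 (fun y => f (x, y))).
Proof.
by case: mf => r i; apply: complex_ext; [exact: (itgR_fubini1 r Rf)|exact: (itgR_fubini1 i If)].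
Qed.

Lemma citgC_fubini2 :
  citgC (m1 \x m2)%E f = citgC m2 (fun y => citgC m1 (fun x => f (x, y))).
Proof.
by case: mf => r i; apply: complex_ext; [exact: (itgR_fubini2 r Rf)|exact: (itgR_fubini2 i If)].
Qed.

Lemma citgC_swap : citgC m1 (fun x => citgC m2 (fun y => f (x, y))) =
  citgC m2 (fun y => citgC m1 (fun x => f (x, y))).
Proof. by rewrite -citgC_fubini1 citgC_fubini2. Qed.

End cplx.
End ProductDominated.

(** * Translation invariance of Lebesgue measure *)

Section Shift1.
Context {R : realType}.
Local Notation leb := (@lebesgue_measure R).
Local Open Scope ereal_scope.

Let shift1 (a : R) (x : measurableTypeR R) : measurableTypeR R := (x + a)%R.

Let measurable_shift1 a : measurable_fun setT (shift1 a).
Proof. by apply: measurable_funD. Qed.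

(** The image of Lebesgue measure under a translation has the right value on half-open intervals,
    hence is Lebesgue measure; the rest is a change of variables. *)
Lemma ge0_integral_shift1 (a : R) (f : R -> \bar R) : measurable_fun setT f ->
  (forall x, 0 <= f x) -> \int[leb]_x f (x + a)%R = \int[leb]_x f x.
Proof.
move=> mf f0.
have H A : measurable A -> leb A = pushforward leb (shift1 a) A.
  apply: (@lebesgue_measure_unique R (pushforward leb (shift1 a))).
  move=> X [[u v] _ <-]; rewrite /pushforward /=.
  rewrite /pushforward (_ : shift1 a @^-1` _ = `](u - a)%R, (v - a)%R]%classic); last first.
    apply/seteqP; split => z /=; rewrite /shift1 !in_itv/=.
      by rewrite ltrBlDr lerBrDr.
    by rewrite ltrBlDr lerBrDr.
  rewrite !lebesgue_measure_itv/= !lte_fin ltrD2r.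
  by case: ifP => // _; rewrite -!EFinB; congr EFin; ring.
have -> : \int[leb]_x f x = \int[pushforward leb (shift1 a)]_x f x.
  by apply: eq_measure_integral => A mA _; exact: H.
rewrite ge0_integral_pushforward//.
Qed.

End Shift1.

Section RealFromGe0.
Context {R : realType} {dT : measure_display} {T : measurableType dT}.
Variables (mu : {measure set T -> \bar R}) (phi : T -> T).
Hypothesis mphi : measurable_fun setT phi.
Hypothesis ge0_phi : forall f : T -> \bar R, measurable_fun setT f ->
  (forall x, (0 <= f x)%E) -> (\int[mu]_x f (phi x) = \int[mu]_x f x)%E.

(** Invariance for nonnegative functions is applied to the positive and negative parts. *)
Lemma itg_invariant (f : T -> R) : itg mu f ->
  itg mu (fun x => f (phi x)) /\ itgR mu (fun x => f (phi x)) = itgR mu f.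
Proof.
move=> If; have mf := itg_meas If; split.
  apply/integrableP; split.
    by apply/measurable_EFinP; exact: (measurableT_comp mf mphi).
  rewrite (ge0_phi (f := fun x => `|(f x)%:E|%E))//.
    by case/integrableP: If.
  by apply: measurableT_comp => //; apply/measurable_EFinP.
rewrite /itgR /Rintegral; congr fine.
have mF : measurable_fun setT (EFin \o f) by exact/measurable_EFinP.
rewrite integralE [RHS]integralE; congr (_ - _)%E.
  rewrite -[RHS](ge0_phi (f := ((EFin \o f)^\+)%E))//; last exact: (measurable_funepos mF).
  by apply: eq_integral => x _; rewrite !funeposE.
rewrite -[RHS](ge0_phi (f := ((EFin \o f)^\-)%E))//; last exact: (measurable_funeneg mF).
by apply: eq_integral => x _; rewrite !funenegE.
Qed.

End RealFromGe0.

Section LebesgueRn.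
Context {R : realType}.
Local Notation leb := (@lebesgue_measure R).

Lemma mconsRn n :
  measurable_fun (setT : set (measurableTypeR R * n.-tuple R)) (@consRn R n).
Proof. exact: measurable_consRn. Qed.

Definition pushRn n : {measure set (n.+1.-tuple R) -> \bar R} :=
  measure_function_pushforward__canonical__measure_function_Measure
    (leb \x lebesgueRn n)%E (@mconsRn n).

Lemma ge0_integral_lebesgueRnS n (f : n.+1.-tuple R -> \bar R) :
  measurable_fun setT f -> (forall x, (0 <= f x)%E) ->
  (\int[lebesgueRn n.+1]_u f u =
   \int[leb]_x \int[lebesgueRn n]_v f (consRn (x, v)))%E.
Proof.
move=> mf f0.
rewrite (eq_measure_integral (pushRn n))//.
rewrite (ge0_integral_pushforward (@mconsRn n))// preimage_setT.
rewrite (fubini_tonelli1 (m1 := leb) (m2 := lebesgueRn n) (f \o @consRn R n))//.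
  exact: measurableT_comp mf (@mconsRn n).
by move=> z; exact: f0.
Qed.

Definition shiftT n (a u : n.-tuple R) : n.-tuple R :=
  [tuple tnth u i + tnth a i | i < n].

Lemma measurable_tnthR n (i : 'I_n) :
  measurable_fun setT (fun u : n.-tuple R => tnth u i).
Proof. exact: measurable_tnth. Qed.

Lemma measurable_shiftT n (a : n.-tuple R) : measurable_fun setT (shiftT a).
Proof.
apply/measurable_fun_tnthP => i.
rewrite (_ : _ \o _ = fun u => tnth u i + tnth a i); last first.
  by apply/funext => u /=; rewrite tnth_mktuple.
by apply: measurable_funD => //; exact: measurable_tnthR.
Qed.

Lemma tnth_consRn0 n (x : R) (v : n.-tuple R) : tnth (consRn (x, v)) ord0 = x.
Proof. by rewrite (tnth_nth 0). Qed.

Lemma tnth_consRnS n (x : R) (v : n.-tuple R) j :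
  tnth (consRn (x, v)) (lift ord0 j) = tnth v j.
Proof. by rewrite !(tnth_nth 0). Qed.

Lemma tnth_splitRn2 n (u : n.+1.-tuple R) j :
  tnth (splitRn u).2 j = tnth u (lift ord0 j).
Proof. by rewrite !(tnth_nth 0)/= nth_behead. Qed.

Lemma shiftT_consRn n (a : n.+1.-tuple R) x v :
  shiftT a (consRn (x, v)) =
  consRn (x + thead a, shiftT (splitRn a).2 v).
Proof.
apply: eq_from_tnth => i; rewrite tnth_mktuple.
case: (unliftP ord0 i) => [j ->|->]; last by rewrite !tnth_consRn0.
by rewrite !tnth_consRnS tnth_mktuple tnth_splitRn2.
Qed.

(** Induction on the dimension: Tonelli peels off the first coordinate, which is shifted on the
    line, while the tail is shifted by the induction hypothesis. *)
Lemma ge0_integral_shiftT n (a : n.-tuple R) (f : n.-tuple R -> \bar R) :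
  measurable_fun setT f -> (forall x, (0 <= f x)%E) ->
  (\int[lebesgueRn n]_u f (shiftT a u) = \int[lebesgueRn n]_u f u)%E.
Proof.
elim: n a f => [|n IH] a f mf f0.
  by apply: eq_integral => u _; congr f; apply: eq_from_tnth; case.
rewrite (ge0_integral_lebesgueRnS mf f0) (ge0_integral_lebesgueRnS
  (measurableT_comp mf (measurable_shiftT a)) (fun u => f0 (shiftT a u))).
under eq_integral => x _.
  under eq_integral do rewrite /= shiftT_consRn.
  rewrite (IH _ (fun v => f (consRn (x + thead a, v))))//; last first.
    apply: measurableT_comp mf _.
    exact: (measurableT_comp (@mconsRn n) (pair1_measurable _)).
  over.
rewrite (ge0_integral_shift1 (thead a)
  (f := fun x => \int[lebesgueRn n]_v f (consRn (x, v)))%E)//.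
- apply: (@measurable_fun_fubini_tonelli_F _ _ _ _ _ (lebesgueRn n)
    (fun z => f (consRn z))) => //.
  exact: measurableT_comp mf (@mconsRn n).
- by move=> x; exact: integral_ge0.
Qed.

Lemma itg_lebesgueRnS n (f : n.+1.-tuple R -> R) :
  itg (leb \x lebesgueRn n)%E (fun z => f (consRn z)) -> measurable_fun setT f ->
  itg (lebesgueRn n.+1) f /\
  itgR (lebesgueRn n.+1) f = itgR (leb \x lebesgueRn n)%E (fun z => f (consRn z)).
Proof.
move=> If mf; have mF : measurable_fun setT (EFin \o f) by exact/measurable_EFinP.
have If' : (leb \x lebesgueRn n)%E.-integrable (@consRn R n @^-1` setT) ((EFin \o f) \o @consRn R n).
  by rewrite preimage_setT; have := If.
split.
  apply/integrableP; split => //; rewrite (eq_measure_integral (pushRn n))//.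
  by have /integrableP[] := integrable_pushforward (@mconsRn n) mF If' measurableT.
rewrite /itgR /Rintegral; congr fine; rewrite (eq_measure_integral (pushRn n))//.
have := integral_pushforward (@mconsRn n) mF If' measurableT.
by rewrite preimage_setT.
Qed.

Definition vec n (u : n.-tuple R) : 'cV[R]_n := \col_i tnth u i.

(** The preimage of a set under the composite is a countable union of fibres of [k]. It is applied
    with [k] the rounding of a point to a grid. *)
Lemma measurable_int_valued n (K : countType) (k : n.-tuple R -> K) (g : K -> R) :
  (forall c, measurable (k @^-1` [set c])) -> measurable_fun setT (g \o k).
Proof.
move=> mk _ A mA; rewrite setTI.
rewrite (_ : _ @^-1` _ = \bigcup_(c in [set c | A (g c)]) k @^-1` [set c]); last first.
  apply/seteqP; split => [u Au|u [c /= Ac kuc]]; first by exists (k u).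
  by rewrite /= kuc.
rewrite bigcup_mkcond; apply: countable_bigcupT_measurable => [|c].
  exact: countableP.
by case: ifP.
Qed.

Lemma ler_cV_norm n (x : 'cV[R]_n) (e : R) : 0 <= e ->
  (forall i, `|x i 0| <= e) -> `|x| <= e.
Proof.
move=> e0 h; rewrite /Num.norm/= mx_normrE; apply: bigmax_le => // -[i j] _.
by rewrite ord1 h.
Qed.

Lemma coord_le_norm n (x : 'cV[R]_n) i : `|x i 0| <= `|x|.
Proof.
rewrite [leRHS]/Num.norm/= mx_normrE.
exact: (le_bigmax _ (fun ij : 'I_n * 'I_1 => `|x ij.1 ij.2|) (i, 0)).
Qed.

(** The sigma-algebra on tuples is generated by the coordinates, whereas continuity of [g] refers to
    the norm of column vectors. Rounding each coordinate down to a multiple of 1/(p+1) leaves a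
    function of countably many measurable cells, and continuity recovers [g] as p grows. *)
Lemma measurable_continuous_vec n (g : 'cV[R]_n -> R) : continuous g ->
  measurable_fun setT (fun u => g (vec u)).
Proof.
move=> cg.
pose k p (u : n.-tuple R) : {ffun 'I_n -> int} :=
  [ffun i => Num.floor (p.+1%:R * tnth u i)].
pose v p (c : {ffun 'I_n -> int}) : 'cV[R]_n := \col_i ((c i)%:~R / p.+1%:R).
apply: (measurable_fun_cvg (h := fun p u => g (v p (k p u)))).
  move=> p; apply: (@measurable_int_valued n _ (k p) (fun c => g (v p c))) => c.
  rewrite (_ : _ @^-1` _ = \bigcap_(i in [set: 'I_n])
      ((fun u : n.-tuple R => p.+1%:R * tnth u i) @^-1` `[(c i)%:~R, (c i + 1)%:~R[)); last first.
    apply/seteqP; split => [u <- i _ /=|u h].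
      by rewrite ffunE in_itv/= floor_itv.
    apply/ffunP => i; rewrite ffunE; apply/eqP; rewrite floor_eq.
    by have := h i I; rewrite /= in_itv.
  apply: fin_bigcap_measurable => // i _; rewrite -[X in measurable X]setTI.
  have : measurable_fun setT (fun u : n.-tuple R => p.+1%:R * tnth u i).
    by apply: measurable_funM => //; exact: measurable_tnthR.
  by apply.
move=> u _; suff C : v p (k p u) @[p --> \oo] --> vec u by exact: (cvg_comp _ _ C (cg (vec u))).
apply/cvgrPdist_le => e e0; near=> p.
apply: ler_cV_norm => [|i]; first exact: ltW.
have p0 : (0 : R) < p.+1%:R by [].
have pe : p.+1%:R^-1 <= e.
  rewrite -[leRHS]invrK lef_pV2 ?posrE ?invr_gt0//.
  rewrite -natr1 ler_wpDr//; near: p; exact: nbhs_infty_ger.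
rewrite !mxE ffunE.
have /andP[h1 h2] := floor_itv (p.+1%:R * tnth u i).
set q : R := (Num.floor _)%:~R in h1 h2 *.
have -> : tnth u i - q / p.+1%:R = (p.+1%:R * tnth u i - q) / p.+1%:R by field.
apply: le_trans pe; rewrite normrM [X in _ * X]gtr0_norm ?invr_gt0// ler_piMl ?invr_ge0//.
rewrite ger0_norm ?subr_ge0// lerBlDl ltW//.
by rewrite (lt_le_trans h2)// intrD.
Unshelve. all: by end_near. Qed.

Lemma itgR_shiftT n (a : n.-tuple R) (f : n.-tuple R -> R) : itg (lebesgueRn n) f ->
  itg (lebesgueRn n) (fun u => f (shiftT a u)) /\
  itgR (lebesgueRn n) (fun u => f (shiftT a u)) = itgR (lebesgueRn n) f.
Proof.
apply: itg_invariant => [|g mg g0]; first exact: measurable_shiftT.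
exact: ge0_integral_shiftT.
Qed.

Lemma itgR_shift1 (a : R) (f : R -> R) : itg leb f ->
  itg leb (fun x => f (x + a)) /\
  itgR leb (fun x => f (x + a)) = itgR leb f.
Proof.
apply: (itg_invariant (T := measurableTypeR R) (phi := fun x => x + a)) => [|g mg g0].
  exact: measurable_funD.
exact: ge0_integral_shift1.
Qed.

Lemma measurable_prodT n (h : 'I_n -> R -> R) : (forall i, measurable_fun setT (h i)) ->
  measurable_fun setT (fun u : n.-tuple R => \prod_i h i (tnth u i)).
Proof.
move=> mh; apply: measurable_prod => i _.
exact: measurableT_comp (mh i) (measurable_tnthR i).
Qed.

Lemma itgR_lebesgueRn0 (c : R) : itgR (lebesgueRn 0) (fun=> c) = c.
Proof. have mu0 : (lebesgueRn 0 [set: 0.-tuple R] = 1)%E by rewrite /= diracT.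
have mu1 : fine (lebesgueRn 0 [set: 0.-tuple R]) = 1 by rewrite mu0.
by rewrite /itgR Rintegral_cst// -[RHS]mulr1 -mu1. Qed.

Lemma itg_prodT n (h : 'I_n -> R -> R) : (forall i, itg leb (h i)) ->
  itg (lebesgueRn n) (fun u => \prod_i h i (tnth u i)) /\
  itgR (lebesgueRn n) (fun u => \prod_i h i (tnth u i)) = \prod_i itgR leb (h i).
Proof.
elim: n h => [|n IH] h Ih.
  rewrite !big_ord0; have -> : (fun u : 0.-tuple R => \prod_i h i (tnth u i)) = fun=> 1.
    by apply/funext => u; rewrite big_ord0.
  split; first by apply: finite_measure_integrable_cst.
  exact: itgR_lebesgueRn0.
have mh i := itg_meas (Ih i).
have [I1 E1] := IH (fun j => h (lift ord0 j)) (fun j => Ih _).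
pose G (v : n.-tuple R) := \prod_j h (lift ord0 j) (tnth v j).
pose F (z : measurableTypeR R * n.-tuple R) := h ord0 z.1 * G z.2.
have FE : (fun z : measurableTypeR R * n.-tuple R => \prod_i h i (tnth (consRn z) i)) = F.
  apply/funext => -[x v]; rewrite big_ord_recl tnth_consRn0; congr (_ * _).
  by apply: eq_bigr => j _; rewrite tnth_consRnS.
have mF : measurable_fun setT F.
  by rewrite -FE; exact: (measurableT_comp (measurable_prodT mh) (@mconsRn n)).
have dF x v : `|F (x, v)| <= `|h ord0 x| * `|G v| by rewrite normrM.
have Ia := itg_abs (Ih ord0); have Ib := itg_abs I1.
have [] := itg_lebesgueRnS (f := fun u => \prod_i h i (tnth u i)).
- by rewrite FE; exact: itg_prod_dominated mF dF Ia Ib.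
- exact: measurable_prodT.
move=> I2 ->; split => //; rewrite FE (itgR_fubini1 mF dF Ia Ib) big_ord_recl -E1.
rewrite mulrC -(itgRZ _ (Ih ord0)); congr itgR; apply/funext => x.
by rewrite [RHS]mulrC -(itgRZ _ I1).
Qed.

Lemma cmeas_prodT n (h : 'I_n -> R -> R[i]) : (forall i, cmeas (h i)) ->
  cmeas (fun u : n.-tuple R => \prod_i h i (tnth u i)).
Proof.
move=> mh.
suff H (s : seq 'I_n) : cmeas (fun u : n.-tuple R => \prod_(i <- s) h i (tnth u i)) by apply: H.
elim: s => [|i s IH].
  by under eq_fun do rewrite big_nil; exact: cmeas_cst.
under eq_fun do rewrite big_cons.
apply: cmeasM => //; have [m1 m2] := mh i.
by split; [exact: measurableT_comp m1 (measurable_tnthR i)|exact: measurableT_comp m2 (measurable_tnthR i)].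
Qed.

Lemma cmod_prod I (s : seq I) (F : I -> R[i]) :
  cmod (\prod_(i <- s) F i) = \prod_(i <- s) cmod (F i).
Proof. by elim/big_rec2: _ => [|i x y _ <-]; rewrite ?cmod1 ?cmodM. Qed.

Lemma citg_prodT n (h : 'I_n -> R -> R[i]) : (forall i, citg leb (h i)) ->
  citg (lebesgueRn n) (fun u => \prod_i h i (tnth u i)) /\
  citgC (lebesgueRn n) (fun u => \prod_i h i (tnth u i)) = \prod_i citgC leb (h i).
Proof.
move=> Ih; have I0 m (k : 'I_m -> R -> R[i]) : (forall i, citg leb (k i)) ->
    citg (lebesgueRn m) (fun u => \prod_i k i (tnth u i)).
  move=> Ik; have [Ia _] := itg_prodT (fun i => citg_cmod (Ik i)).
  apply: citg_le (cmeas_prodT (fun i => citg_meas (Ik i))) _ Ia => u.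
  by rewrite cmod_prod.
split; first exact: I0.
elim: n h Ih => [|n IH] h Ih.
  have -> : (fun u : 0.-tuple R => \prod_i h i (tnth u i)) = fun=> 1.
    by apply/funext => u; rewrite big_ord0.
  rewrite big_ord0; apply: complex_ext; rewrite ?citgC_Re ?citgC_Im itgR_lebesgueRn0//.
have mh i := citg_meas (Ih i).
have E1 := IH (fun j => h (lift ord0 j)) (fun j => Ih _).
have I1 := I0 _ (fun j => h (lift ord0 j)) (fun j => Ih _).
pose G (v : n.-tuple R) := \prod_j h (lift ord0 j) (tnth v j).
pose F (z : measurableTypeR R * n.-tuple R) := h ord0 z.1 * G z.2.
have FE : (fun z : measurableTypeR R * n.-tuple R => \prod_i h i (tnth (consRn z) i)) = F.
  apply/funext => -[x v]; rewrite big_ord_recl tnth_consRn0; congr (_ * _).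
  by apply: eq_bigr => j _; rewrite tnth_consRnS.
have mP := cmeas_prodT mh.
have mF : cmeas F.
  rewrite -FE; case: mP => p1 p2.
  by split; [exact: measurableT_comp p1 (@mconsRn n)|exact: measurableT_comp p2 (@mconsRn n)].
have dF x v : cmod (F (x, v)) <= cmod (h ord0 x) * cmod (G v) by rewrite cmodM.
have Ia := citg_cmod (Ih ord0); have Ib := citg_cmod I1.
have [IF1 IF2] := citg_prod_dominated (m1 := leb) (m2 := lebesgueRn n) mF dF Ia Ib.
have -> : citgC (lebesgueRn n.+1) (fun u => \prod_i h i (tnth u i)) =
    citgC (leb \x lebesgueRn n)%E F.
  apply: complex_ext; rewrite ?citgC_Re ?citgC_Im -FE.
    have [//||_ //] := itg_lebesgueRnS (f := fun u => Re (\prod_i h i (tnth u i))).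
      by rewrite (_ : (fun z => _) = (fun z => Re (F z)))// -FE.
    by case: mP.
  have [//||_ //] := itg_lebesgueRnS (f := fun u => Im (\prod_i h i (tnth u i))).
    by rewrite (_ : (fun z => _) = (fun z => Im (F z)))// -FE.
  by case: mP.
rewrite (citgC_fubini1 mF dF Ia Ib) big_ord_recl -E1.
rewrite mulrC -(citgCZ _ (Ih ord0)); congr citgC; apply/funext => x.
by rewrite [RHS]mulrC -(citgCZ _ I1).
Qed.

Lemma itg_indic_itv (r : R) : itg leb (\1_(`[- r, r]%classic) : R -> R).
Proof. exact: integrable_indic_itv. Qed.

Lemma itg_bounded_support n (f : n.-tuple R -> R) (M r : R) :
  measurable_fun setT f -> (forall u, `|f u| <= M) ->
  (forall u, f u != 0 -> `|vec u| <= r) -> itg (lebesgueRn n) f.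
Proof.
move=> mf fM fr.
have [I1 _] := itg_prodT (fun i : 'I_n => itg_indic_itv r).
apply: (itg_le mf _ (itgZ M I1)) => u.
have [->|f0] := eqVneq (f u) 0.
  rewrite normr0 mulr_ge0//; first exact: le_trans (fM u).
  by apply: prodr_ge0 => i _; rewrite indicE.
rewrite big1 ?mulr1// => i _; rewrite indicE mem_set//= in_itv/= -ler_norml.
by rewrite (le_trans _ (fr _ f0))//; have := coord_le_norm (vec u) i; rewrite mxE.
Qed.

End LebesgueRn.

(** * Fourier inversion on the line *)

Section LineIntegral.
Context {R : realType}.
Local Notation leb := (@lebesgue_measure R).
Implicit Types (f F : R -> R).

Lemma is_derive_continuous f (f' : R -> R) :
  (forall x : R, is_derive x 1 f (f' x)) -> continuous f.
Proof.
move=> df x; apply: differentiable_continuous; apply/derivable1_diffP.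
by case: (df x).
Qed.

Lemma FTC_segment f F (a b : R) : a < b -> continuous f -> continuous F ->
  (forall x : R, a < x < b -> is_derive x 1 F (f x)) ->
  leb.-integrable `[a, b]%classic (EFin \o f) /\
  Rintegral leb `[a, b]%classic f = F b - F a.
Proof.
move=> ab cf cF dF; split.
  apply: continuous_compact_integrable; first exact: segment_compact.
  exact: continuous_subspaceT.
rewrite /Rintegral (@continuous_FTC2 _ f F)//.
- exact: continuous_subspaceT.
- split.
  + by move=> x; rewrite in_itv/= => /dF[].
  + exact: cvg_at_right_filter (cF a).
  + exact: cvg_at_left_filter (cF b).
- by move=> x; rewrite in_itv/= derive1E => /dF h; rewrite derive_val.
Qed.

(** The segment is cut at 0, where the formula for the integrand changes; intended for integrands
    containing e^(-e|t|). *)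
Lemma FTC_kink f f1 F1 f2 F2 (n : R) : 0 < n -> continuous f ->
  (forall x : R, is_derive x 1 F1 (f1 x)) -> (forall x, 0 <= x -> f x = f1 x) ->
  (forall x : R, is_derive x 1 F2 (f2 x)) -> (forall x, x <= 0 -> f x = f2 x) ->
  Rintegral leb `[- n, n]%classic f = (F1 n - F1 0) + (F2 0 - F2 (- n)).
Proof.
move=> n0 cf dF1 E1 dF2 E2; have nn0 : - n < 0 by rewrite oppr_lt0.
have [] := @FTC_segment f F2 (- n) 0 nn0 cf (is_derive_continuous dF2).
  by move=> x /andP[_ x0]; rewrite E2// ltW.
have [] := @FTC_segment f F1 0 n n0 cf (is_derive_continuous dF1).
  by move=> x /andP[x0 _]; rewrite E1// ltW.
move=> I1 J1 I2 J2.
have I : leb.-integrable `[- n, n]%classic (EFin \o f).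
  apply: continuous_compact_integrable; first exact: segment_compact.
  exact: continuous_subspaceT.
have := @Rintegral_itvB _ f (BLeft (- n)) (BRight n) 0 I.
rewrite !bnd_simp => /(_ (ltW nn0) (ltW n0)).
rewrite Rintegral_itv_obnd_cbnd; last first.
  by apply: integrableS I1 => //; exact: subset_itv_oc_cc.
by rewrite J1 J2 => /eqP; rewrite subr_eq => /eqP.
Qed.

Lemma cvg_realn F (l : R) : F x @[x --> +oo] --> l -> F n.+1%:R @[n --> \oo] --> l.
Proof.
move=> h; apply: (cvg_comp (fun n => n.+1%:R) F _ h).
apply/cvgryPge => A; near=> n; rewrite -natr1 ler_wpDr//.
near: n; exact: nbhs_infty_ger.
Unshelve. all: by end_near. Qed.

Lemma restrict_segment_cvg f (x : R) :
  (f \_ `[- n.+1%:R, n.+1%:R]%classic) x @[n --> \oo] --> f x.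
Proof.
apply: cvg_near_cst; near=> n; rewrite patchE mem_set//= in_itv/= -ler_norml.
by rewrite -natr1 ler_wpDr//; near: n; exact: nbhs_infty_ger.
Unshelve. all: by end_near. Qed.

(** Restrictions to [-n, n] are dominated by |f|, so their integrals converge to that of f, while
    the primitives supply the limit. *)
Lemma line_FTC_kink f f1 F1 f2 F2 (l L : R) : continuous f -> itg leb f ->
  (forall x : R, is_derive x 1 F1 (f1 x)) -> (forall x, 0 <= x -> f x = f1 x) ->
  (forall x : R, is_derive x 1 F2 (f2 x)) -> (forall x, x <= 0 -> f x = f2 x) ->
  F1 x @[x --> +oo] --> L -> F2 (- x) @[x --> +oo] --> l ->
  itgR leb f = (L - F1 0) + (F2 0 - l).
Proof.
move=> cf If dF1 E1 dF2 E2 FL Fl.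
have mf := itg_meas If.
have m1 n : measurable_fun (setT : set (measurableTypeR R)) (f \_ `[- n.+1%:R, n.+1%:R]%classic).
  by apply/measurable_restrict => //; exact: measurable_funS mf.
have m2 n x : `|(f \_ `[- n.+1%:R, n.+1%:R]%classic) x| <= `|f x|.
  by rewrite patchE; case: ifP => // _; rewrite normr0.
have [_] := itgR_dct (mu := leb) m1 (fun x => @restrict_segment_cvg f x) m2 (itg_abs If).
have E n : itgR leb (f \_ `[- n.+1%:R, n.+1%:R]%classic) =
    (F1 n.+1%:R - F1 0) + (F2 0 - F2 (- n.+1%:R)).
  by rewrite /itgR -Rintegral_mkcond (FTC_kink _ cf dF1 E1 dF2 E2).
under eq_fun do rewrite E.
move=> h; apply: (cvg_unique _ h) => //.
apply: cvgD; apply: cvgB; try exact: cvg_cst.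
  exact: cvg_realn FL.
exact: (cvg_realn (F := fun x => F2 (- x)) Fl).
Qed.

Lemma line_FTC f F (l L : R) : continuous f -> itg leb f ->
  (forall x : R, is_derive x 1 F (f x)) ->
  F x @[x --> +oo] --> L -> F (- x) @[x --> +oo] --> l -> itgR leb f = L - l.
Proof.
move=> cf If dF FL Fl.
by rewrite (line_FTC_kink cf If dF _ dF _ FL Fl)// addrA subrK.
Qed.

Lemma cvg0_inv F (K : R) : (forall x, 0 < x -> `|F x| <= K / x) ->
  F x @[x --> +oo] --> 0.
Proof.
move=> h; apply/cvgr0Pnorm_le => e e0; near=> x.
have x0 : 0 < x by near: x; exact: nbhs_pinfty_gt.
rewrite (le_trans (h x x0))// ler_pdivrMr// mulrC -ler_pdivrMr//.
Unshelve. all: by end_near. Qed.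

(** Integrals over [-n, n] are increments of F, hence at most 2B; monotone convergence extends the
    bound to the line. *)
Lemma itg_bounded_primitive f F (B : R) : continuous f -> (forall x, 0 <= f x) ->
  (forall x : R, is_derive x 1 F (f x)) -> (forall x, `|F x| <= B) -> itg leb f.
Proof.
move=> cf f0 dF FB; have cF := is_derive_continuous dF.
have mf : measurable_fun setT (EFin \o f).
  by apply/measurable_EFinP; exact: continuous_measurable_fun.
apply/integrableP; split => //.
have -> : (\int[leb]_x `|(EFin \o f) x| = \int[leb]_x (f x)%:E)%E.
  by apply: eq_integral => x _ /=; rewrite ger0_norm.
pose A n : set R := `[- n.+1%:R, n.+1%:R]%classic.
have ndA : {homo A : n m / (n <= m)%N >-> (n <= m)%O}.
  move=> n m nm; apply/subsetPset => x; rewrite /A /= !in_itv/= -!ler_norml => /le_trans; apply.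
  by rewrite ler_nat.
have UA : \bigcup_n A n = setT.
  apply/seteqP; split => // x _; exists (Num.truncn `|x|) => //.
  by rewrite /A /= in_itv/= -ler_norml ltW// truncnS_gt.
have := @ge0_nondecreasing_set_cvg_integral _ (measurableTypeR R) _ A (EFin \o f) leb.
rewrite UA; move=> /(_ ndA) H.
have {}H : (\int[leb]_(x in A n) (f x)%:E)%E @[n --> \oo] --> (\int[leb]_x (f x)%:E)%E.
  apply: H => //.
  - by move=> n; exact: measurable_itv.
  - by move=> n; exact: measurable_funS mf.
  - by move=> n x _; rewrite lee_fin.
have En n : (\int[leb]_(x in A n) (f x)%:E <= (B + B)%:E)%E.
  have [I E] := @FTC_segment f F (- n.+1%:R) n.+1%:R ltac:(by rewrite gtrN) cf cF (fun x _ => dF x).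
  have Ei : (\int[leb]_(x in A n) (f x)%:E)%E = (Rintegral leb (A n) f)%:E.
    rewrite /Rintegral fineK//; apply: (integrable_fin_num _ I); exact: measurable_itv.
  rewrite Ei /A E lee_fin; move: (FB n.+1%:R) (FB (- n.+1%:R)).
  move: (F n.+1%:R) (F (- n.+1%:R)) => u v.
  by rewrite !ler_norml => /andP[u1 u2] /andP[v1 v2]; lra.
have : (\int[leb]_x (f x)%:E <= (B + B)%:E)%E.
  rewrite -(cvg_lim _ H)//; apply: lime_le; last exact: nearW.
  by apply/cvg_ex; eexists; exact: H.
by move=> /le_lt_trans; apply; rewrite ltry.
Qed.

(** The standard integrable majorant on the line, with bounded primitive [atan]. *)
Definition cauchyd (x : R) : R := (1 + x ^+ 2)^-1.

Lemma cauchyd_ge0 x : 0 <= cauchyd x.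
Proof. by rewrite invr_ge0 addr_ge0 ?sqr_ge0. Qed.

Lemma oneDsqr_gt0 (x : R) : 0 < 1 + x ^+ 2.
Proof. by rewrite ltr_pwDl ?sqr_ge0. Qed.

Lemma continuous_cauchyd : continuous cauchyd.
Proof.
move=> x; apply: cvgV; first by rewrite gt_eqF ?oneDsqr_gt0.
by apply: cvgD; [exact: cvg_cst|exact: exprn_continuous].
Qed.

Lemma atan_le x : `|atan x| <= pi / 2 :> R.
Proof. by rewrite ler_norml ltW ?atan_gtNpi2// ltW ?atan_ltpi2. Qed.

Lemma itg_cauchyd : itg leb cauchyd.
Proof.
apply: (itg_bounded_primitive (F := atan)) => //.
- exact: continuous_cauchyd.
- exact: cauchyd_ge0.
- exact: atan_le.
Qed.

Lemma itg_quadratic_decay f (M : R) : measurable_fun setT f ->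
  (forall x, `|f x| * (1 + x ^+ 2) <= M) -> itg leb f.
Proof.
move=> mf h; apply: (@itg_le R _ (measurableTypeR R) leb f _ mf _ (itgZ M itg_cauchyd)) => x.
by rewrite /cauchyd ler_pdivlMr ?oneDsqr_gt0.
Qed.

(** Write e^y as the (k+1)-st power of e^(y/(k+1)) and use e^z >= 1 + z. *)
Lemma expR_ge_pow (y : R) k : 0 <= y -> (y / k.+1%:R) ^+ k.+1 <= expR y.
Proof.
move=> y0.
have -> : expR y = expR (y / k.+1%:R) ^+ k.+1.
  by rewrite -expRM_natl; congr expR; field.
apply: lerXn2r; rewrite ?nnegrE ?expR_ge0 ?divr_ge0//.
by rewrite (le_trans _ (expR_ge1Dx _))// lerDr.
Qed.

End LineIntegral.

(** * Smooth plateau functions on the line *)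

Section Smooth1.
Context {R : realType}.

(** The powers x^-n are included because the family of flat functions x^-n e^(-1/x) is then closed
    under differentiation up to linear combinations. *)
Definition fexp (n : nat) (x : R) : R :=
  if 0 < x then x ^- n * expR (- x^-1) else 0.

(** [expR_ge_pow] at 1/x with exponent n + 2 beats x^-n and leaves x^2. A quadratic bound is what
    makes the derivative at the origin vanish. *)
Lemma fexp_bound n (x : R) : `|fexp n x| <= n.+2%:R ^+ n.+2 * x ^+ 2.
Proof.
rewrite /fexp; case: ifPn => x0; last first.
  by rewrite normr0 mulr_ge0 ?sqr_ge0 ?exprn_ge0.
rewrite ger0_norm ?mulr_ge0 ?expR_ge0 ?invr_ge0 ?exprn_ge0 ?(ltW x0)//.
rewrite expRN ler_pdivrMr ?expR_gt0//.
have := @expR_ge_pow R x^-1 n.+1; rewrite invr_ge0 => /(_ (ltW x0)) h.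
apply: (@le_trans _ _ (n.+2%:R ^+ n.+2 * x ^+ 2 * (x^-1 / n.+2%:R) ^+ n.+2)); last first.
  have c0 : 0 <= n.+2%:R ^+ n.+2 * x ^+ 2 by rewrite mulr_ge0 ?sqr_ge0// exprn_ge0.
  by rewrite ler_wpM2l.
rewrite le_eqVlt; apply/orP; left; apply/eqP.
have x1 : x != 0 by rewrite gt_eqF.
rewrite expr_div_n exprVn; set A : R := _ ^+ n.+2.
have A0 : A != 0 by rewrite expf_neq0.
have -> : x ^+ n.+2 = x ^+ n * x ^+ 2 by rewrite -exprD addn2.
move: (x ^+ n) (expf_neq0 n x1) => X X0.
by field; rewrite A0 x1 X0.
Qed.

Lemma is_derive_fexp n (x : R) :
  is_derive x 1 (fexp n) (- n%:R * fexp n.+1 x + fexp n.+2 x).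
Proof.
have [x0|x0|->] := ltgtP x 0.
- rewrite /fexp ltNge (ltW x0)/= mulr0 addr0.
  apply: (@near_eq_is_derive _ _ _ (fun=> 0)).
  near=> y; rewrite ltNge ltW//=.
  by near: y; exact: lt_nbhsl.
- rewrite /fexp x0.
  apply: (@near_eq_is_derive _ _ _ (fun y : R => y ^- n * expR (- y^-1))).
    near=> y; suff -> : 0 < y by [].
    by near: y; exact: lt_nbhsr.
  have xn0 : x ^+ n != 0 by rewrite expf_neq0 ?gt_eqF.
  have x1 : x != 0 by rewrite gt_eqF.
  have d0 : is_derive x 1 (fun y : R => y ^+ n) (n%:R * x ^+ n.-1).
    have -> : (fun y : R => y ^+ n) = (id : R -> R) ^+ n.
      by apply/funext => y; rewrite exprfctE.
    apply: (is_derive_eq (is_deriveX n (is_derive_id x 1))).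
    by rewrite /GRing.scale/= mulr1.
  have d1 := @is_deriveV R (fun y : R => y ^+ n) x _ 1 xn0 d0.
  have d2 := @is_deriveV R id x _ 1 x1 (is_derive_id x 1).
  have d3 := is_derive1_comp (is_derive_expR _) (is_deriveN d2).
  apply: (is_derive_eq (is_deriveM d1 d3)).
  rewrite /GRing.scale/= /comp.
  case: n xn0 {d0 d1} => [|n] xn0.
    by rewrite /= !expr0 mul0r; field.
  by rewrite /= !exprS; field; rewrite x1 expf_neq0.
- have -> : - n%:R * fexp n.+1 0 + fexp n.+2 0 = 0 by rewrite /fexp ltxx mulr0 addr0.
  have f0 : fexp n 0 = 0 by rewrite /fexp ltxx.
  (* At the origin the quadratic bound makes the difference quotient O(h). *)
  have C : h^-1 *: (fexp n (h *: 1 + 0) - fexp n 0) @[h --> 0^'] --> (0 : R).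
    apply/cvgr0Pnorm_le => e e0; near=> h.
    rewrite f0 subr0 addr0 /GRing.scale/= mulr1 normrM.
    have h0 : h != 0 by near: h; exact: nbhs_dnbhs_neq.
    have hb : `|h| <= e / n.+2%:R ^+ n.+2.
      near: h; apply: dnbhs0_le; rewrite divr_gt0// exprn_gt0//.
    rewrite normfV ler_pdivrMl ?normr_gt0//.
    rewrite (le_trans (fexp_bound _ _))//.
    rewrite -real_normK ?num_real// expr2 mulrA mulrAC mulrC ler_wpM2l//.
    by rewrite mulrC -ler_pdivlMr// exprn_gt0.
  split; first by apply/cvg_ex; exists 0; exact: C.
  exact: cvg_lim C.
Unshelve. all: by end_near. Qed.

(** A syntactic class closed under differentiation: one derivative that stays in the class gives
    derivatives of all orders by iteration. *)
Inductive smooth1 : (R -> R) -> Prop :=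
| smooth1_cst c : smooth1 (fun=> c)
| smooth1_fexp n : smooth1 (fexp n)
| smooth1_affine f a b : smooth1 f -> smooth1 (fun x => f (a * x + b))
| smooth1D f g : smooth1 f -> smooth1 g -> smooth1 (fun x => f x + g x)
| smooth1M f g : smooth1 f -> smooth1 g -> smooth1 (fun x => f x * g x)
| smooth1V f : smooth1 f -> (forall x, f x != 0) -> smooth1 (fun x => (f x)^-1).

Lemma smooth1_derive f : smooth1 f ->
  exists2 f', smooth1 f' & forall x : R, is_derive x 1 f (f' x).
Proof.
elim=> {f} [c|n|f a b sf [f' sf' df]|f g sf [f' sf' df] sg [g' sg' dg]|
    f g sf [f' sf' df] sg [g' sg' dg]|f sf [f' sf' df] f0].
- by exists (fun=> 0) => [|x]; [exact: smooth1_cst|exact: is_derive_cst].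
- exists (fun x => - n%:R * fexp n.+1 x + fexp n.+2 x); last exact: is_derive_fexp.
  apply: smooth1D; last exact: smooth1_fexp.
  by apply: smooth1M; [exact: smooth1_cst|exact: smooth1_fexp].
- exists (fun x => a * f' (a * x + b)).
    by apply: smooth1M; [exact: smooth1_cst|exact: smooth1_affine].
  move=> x.
  have d1 : is_derive x 1 (fun x => a * x + b) a.
    by apply: is_derive_eq; rewrite /GRing.scale/= mulr1 addr0.
  by rewrite mulrC; exact: (@is_derive1_comp _ f (fun x => a * x + b) _ _ _ (df (a * x + b)) d1).
- exists (fun x => f' x + g' x); first exact: smooth1D.
  by move=> x; exact: is_deriveD.
- exists (fun x => f x * g' x + g x * f' x).
    by apply: smooth1D; exact: smooth1M.
  by move=> x; exact: is_deriveM.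
- exists (fun x => - ((f x)^-1 * (f x)^-1) * f' x).
    apply: smooth1M => //.
    have -> : (fun x => - ((f x)^-1 * (f x)^-1)) = (fun x => -1 * ((f x)^-1 * (f x)^-1)).
      by apply/funext => x; rewrite mulN1r.
    apply: smooth1M; first exact: smooth1_cst.
    by apply: smooth1M; exact: smooth1V.
  move=> x; apply: (is_derive_eq (is_deriveV (f0 x) (df x))).
  by rewrite /GRing.scale/= expr2 invfM.
Qed.

Lemma smooth1_continuous f : smooth1 f -> continuous f.
Proof. by move=> /smooth1_derive[f' _ df]; exact: is_derive_continuous df. Qed.

(** A smooth transition from 0 on x <= 0 to 1 on x >= 1. The argument is written [-1 * x + 1] so
    that [smooth1_affine] applies as it stands; the same holds in [plateau]. *)
Definition step (x : R) : R := fexp 0 x * (fexp 0 x + fexp 0 (-1 * x + 1))^-1.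

Lemma fexp0_gt0 (x : R) : 0 < x -> 0 < fexp 0 x.
Proof. by move=> x0; rewrite /fexp x0 expr0 invr1 mul1r expR_gt0. Qed.

Lemma fexp0_le0 n (x : R) : x <= 0 -> fexp n x = 0.
Proof. by move=> x0; rewrite /fexp ltNge x0. Qed.

Lemma fexp0_ge0 (x : R) : 0 <= fexp 0 x.
Proof. by case: (leP x 0) => [/fexp0_le0 ->//|/fexp0_gt0/ltW]. Qed.

Lemma step_den_gt0 (x : R) : 0 < fexp 0 x + fexp 0 (-1 * x + 1).
Proof.
case: (leP x 0) => x0.
  by rewrite ltr_wpDl ?fexp0_ge0// fexp0_gt0// mulN1r addrC subr_gt0 (le_lt_trans x0).
by rewrite ltr_pwDl ?fexp0_ge0// fexp0_gt0.
Qed.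

Lemma smooth1_step : smooth1 step.
Proof.
apply: smooth1M; first exact: smooth1_fexp.
apply: smooth1V => [|x]; last by rewrite gt_eqF ?step_den_gt0.
apply: smooth1D; first exact: smooth1_fexp.
exact: (smooth1_affine (-1) 1 (smooth1_fexp 0)).
Qed.

Lemma step_le0 (x : R) : x <= 0 -> step x = 0.
Proof. by move=> x0; rewrite /step fexp0_le0// mul0r. Qed.

Lemma step_ge1 (x : R) : 1 <= x -> step x = 1.
Proof.
move=> x1; rewrite /step [fexp 0 (_ + _)]fexp0_le0 ?addr0; last first.
  by rewrite mulN1r addrC subr_le0.
by rewrite divff// gt_eqF// fexp0_gt0// (lt_le_trans _ x1).
Qed.

Definition plateau (r x : R) : R := step (1 * x + (r + 1)) * step (-1 * x + (r + 1)).

Lemma smooth1_plateau r : smooth1 (plateau r).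
Proof. by apply: smooth1M; apply: smooth1_affine; exact: smooth1_step. Qed.

Lemma plateau_eq1 (r x : R) : `|x| <= r -> plateau r x = 1.
Proof. by rewrite ler_norml => /andP[h1 h2]; rewrite /plateau !step_ge1 ?mulr1//; lra. Qed.

Lemma plateau_eq0 (r x : R) : r + 1 <= `|x| -> plateau r x = 0.
Proof.
rewrite ler_normr => /orP[h|h]; rewrite /plateau.
  by rewrite [X in _ * X]step_le0 ?mulr0//; lra.
by rewrite step_le0 ?mul0r//; lra.
Qed.

End Smooth1.

(** * The one-dimensional Fourier transform and its inversion *)

Section Fourier1.
Context {R : realType}.
Local Notation leb := (@lebesgue_measure R).
Implicit Types (f : R -> R).

Definition supp1 (r : R) f := forall x, r < `|x| -> f x = 0.

Lemma supp1_bounded r f : continuous f -> supp1 r f -> exists M, forall x, `|f x| <= M.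
Proof.
move=> cf sf; have [r0|r0] := ltP r 0.
  by exists 0 => x; rewrite sf ?normr0// (lt_le_trans r0).
have [c _ hc] : exists2 c, c \in `[- r, r] & forall t, t \in `[- r, r] -> `|f t| <= `|f c|.
  apply: (@EVT_max R (fun x => `|f x|)); first by rewrite ge0_cp.
  by apply: continuous_subspaceT => x; apply: cvg_norm; exact: cf.
exists `|f c| => x; have [xr|xr] := leP `|x| r.
  by apply: hc; rewrite in_itv/= -ler_norml.
by rewrite sf// normr0.
Qed.

Lemma supp1_itg r f : continuous f -> supp1 r f -> itg leb f.
Proof.
move=> cf sf; have [M fM] := supp1_bounded cf sf.
apply: (@itg_le R _ (measurableTypeR R) leb f _ _ _ (itgZ M (itg_indic_itv r))).
  exact: continuous_measurable_fun.
move=> x; rewrite indicE; have [xr|xr] := leP `|x| r.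
  by rewrite mem_set ?mulr1//= in_itv/= -ler_norml.
by rewrite sf// normr0 mulr_ge0// (le_trans _ (fM x)).
Qed.

Lemma supp1_derive r f f' : (forall x : R, is_derive x 1 f (f' x)) -> supp1 r f -> supp1 r f'.
Proof.
move=> df sf x xr.
have h : is_derive x 1 f 0.
  apply: (@near_eq_is_derive _ _ _ (fun=> 0)).
  near=> y; rewrite sf//.
  near: y; apply: (cvgr_gt `|x|) => //.
  by apply: cvg_norm; exact: cvg_id.
by have := df x => /@derive_val <-; have := h => /@derive_val ->.
Unshelve. all: by end_near. Qed.

Definition ft1 f (eta : R) : R[i] :=
  citgC leb (fun t => cis (- (eta * t)) * (f t)%:C).

Lemma cmeas_ft1 f eta : continuous f ->
  cmeas (fun t : measurableTypeR R => cis (- (eta * t)) * (f t)%:C).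
Proof.
move=> cf; apply: cmeasM; last by apply: cmeas_real; exact: continuous_measurable_fun.
apply: cmeas_cis; apply: continuous_measurable_fun => x.
by apply: cvgN; apply: cvgM; [exact: cvg_cst|exact: cvg_id].
Qed.

Lemma citg_ft1 r f eta : continuous f -> supp1 r f ->
  citg leb (fun t => cis (- (eta * t)) * (f t)%:C).
Proof.
move=> cf sf; apply: (citg_le (cmeas_ft1 eta cf) _ (itg_abs (supp1_itg cf sf))) => x.
by rewrite cmodM cmod_cis mul1r cmod_real.
Qed.

Lemma ft1_bound r f eta : continuous f -> supp1 r f ->
  cmod (ft1 f eta) <= 2 * itgR leb (fun x => `|f x|).
Proof.
move=> cf sf; apply: cmod_citgC (cmeas_ft1 eta cf) _ (itg_abs (supp1_itg cf sf)) => x.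
by rewrite cmodM cmod_cis mul1r cmod_real.
Qed.

Lemma cvg0_supp1 r f : supp1 r f -> f x @[x --> +oo] --> 0 /\ f (- x) @[x --> +oo] --> 0.
Proof.
move=> sf; split; apply: cvg_near_cst; near=> x; rewrite sf ?normrN//.
  by rewrite (lt_le_trans _ (ler_norm _))//; near: x; apply: nbhs_pinfty_gt; exact: num_real.
by rewrite (lt_le_trans _ (ler_norm _))//; near: x; apply: nbhs_pinfty_gt; exact: num_real.
Unshelve. all: by end_near. Qed.

Lemma itgR_derive_supp1 r f f' : (forall x : R, is_derive x 1 f (f' x)) ->
  continuous f' -> supp1 r f -> itgR leb f' = 0.
Proof.
move=> df cf' sf; have [h1 h2] := cvg0_supp1 sf.
rewrite (line_FTC cf' _ df h1 h2) ?subr0//.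
exact: supp1_itg cf' (supp1_derive df sf).
Qed.

(** Integration by parts, carried out on the cosine and sine integrals separately. *)
Lemma ft1_derive r f f' eta : (forall x : R, is_derive x 1 f (f' x)) ->
  continuous f' -> supp1 r f -> ft1 f' eta = 'i * eta%:C * ft1 f eta.
Proof.
move=> df cf' sf; have cf := is_derive_continuous df.
have sf' := supp1_derive df sf.
have cu (g : R -> R) : continuous g -> continuous (fun t : R => g (eta * t)).
  move=> cg x; apply: continuous_comp; last exact: cg.
  by apply: cvgM; [exact: cvg_cst|exact: cvg_id].
have cc := cu _ (@continuous_cos R); have cs := cu _ (@continuous_sin R).
have de (x : R) : is_derive x 1 (fun t : R => eta * t) eta.
  by apply: is_derive_eq; rewrite /GRing.scale/= mulr1.
have dc (x : R) : is_derive x 1 (fun t => cos (eta * t)) (- sin (eta * x) * eta).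
  exact: (@is_derive1_comp _ cos (fun t => eta * t) _ _ _ (is_derive_cos _) (de x)).
have ds (x : R) : is_derive x 1 (fun t => sin (eta * t)) (cos (eta * x) * eta).
  exact: (@is_derive1_comp _ sin (fun t => eta * t) _ _ _ (is_derive_sin _) (de x)).
(* The common integration by parts: [g * f] has bounded support, so the integral of its derivative
   is 0. It is used with g = cos, h = -sin and with g = sin, h = cos. *)
have Z (g h : R -> R) : continuous g -> continuous h ->
    (forall x : R, is_derive x 1 g (h x * eta)) ->
    itgR leb (fun t => g t * f' t) = - eta * itgR leb (fun t => h t * f t).
  move=> cg ch dg.
  have sM k p : supp1 r p -> supp1 r (fun t => k t * p t) by move=> sp x /sp ->; rewrite mulr0.
  have cM (k p : R -> R) : continuous k -> continuous p -> continuous (fun t => k t * p t).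
    by move=> ck cp x; apply: cvgM; [exact: ck|exact: cp].
  have I1 := supp1_itg (cM _ _ cg cf') (sM g _ sf').
  have I2 := supp1_itg (cM _ _ ch cf) (sM h _ sf).
  have dgf (x : R) : is_derive x 1 (fun t => g t * f t) (g x * f' x + eta * (h x * f x)).
    apply: (is_derive_eq (is_deriveM (dg x) (df x))).
    by rewrite /GRing.scale/=; ring.
  have := itgR_derive_supp1 dgf _ (sM g _ sf).
  rewrite (itgRD I1 (itgZ eta I2)) (itgRZ eta I2) => H.
  rewrite mulNr; apply/eqP; rewrite -addr_eq0; apply/eqP; apply: H.
  move=> x; apply: cvgD; first by apply: cvgM; [exact: cg|exact: cf'].
  by apply: cvgM; [exact: cvg_cst|apply: cvgM; [exact: ch|exact: cf]].
have N (g : R -> R) : continuous g -> continuous (fun x => - g x) by move=> cg x; apply: cvgN; exact: cg.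
have J (g : R -> R) : continuous g -> supp1 r g -> itg leb (fun t => sin (eta * t) * g t).
  move=> cg sg; apply: (@supp1_itg r) => [|x xr]; last by rewrite sg// mulr0.
  by move=> x; apply: cvgM; [exact: cs|exact: cg].
have E1 : itgR leb (fun t => cos (eta * t) * f' t) = eta * itgR leb (fun t => sin (eta * t) * f t).
  rewrite (Z _ (fun t => - sin (eta * t)))//; last exact: N.
  have -> : itgR leb (fun t => - sin (eta * t) * f t) = - itgR leb (fun t => sin (eta * t) * f t).
    by rewrite -(itgRN (J f cf sf)); congr itgR; apply/funext => x; rewrite mulNr.
  by rewrite mulrNN.
have E2 : itgR leb (fun t => sin (eta * t) * f' t) = - eta * itgR leb (fun t => cos (eta * t) * f t).
  exact: Z.
have R1 (g : R -> R) t : Re (cis (- (eta * t)) * (g t)%:C) = cos (eta * t) * g t.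
  by rewrite !ReImE cosN mulr0 subr0.
have R2 (g : R -> R) t : Im (cis (- (eta * t)) * (g t)%:C) = - (sin (eta * t) * g t).
  by rewrite !ReImE sinN mulr0 add0r mulNr.
have T1 g : Re (ft1 g eta) = itgR leb (fun t => cos (eta * t) * g t).
  by rewrite /ft1 citgC_Re; congr itgR; apply/funext => t; rewrite R1.
have T2 g : Im (ft1 g eta) = itgR leb (fun t => - (sin (eta * t) * g t)).
  by rewrite /ft1 citgC_Im; congr itgR; apply/funext => t; rewrite R2.
have i1 : Re ('i * eta%:C) = 0 by rewrite ReM /=; ring.
have i2 : Im ('i * eta%:C) = eta by rewrite ImM /=; ring.
apply: complex_ext.
  by rewrite [RHS]ReM i1 i2 !T1 !T2 E1 (itgRN (J f cf sf)) mul0r sub0r mulrN opprK.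
by rewrite [RHS]ImM i1 i2 !T1 !T2 (itgRN (J f' cf' sf')) E2 mul0r add0r mulNr opprK.
Qed.

Lemma ft1_decay_pow k r f : smooth1 f -> supp1 r f ->
  exists C, forall eta, `|eta| ^+ k * cmod (ft1 f eta) <= C.
Proof.
elim: k f => [|k IH] f sm sf.
  exists (2 * itgR leb (fun x => `|f x|)) => eta.
  by rewrite mul1r; apply: ft1_bound sf; exact: smooth1_continuous.
have [f' sm' df] := smooth1_derive sm.
have [C hC] := IH f' sm' (supp1_derive df sf).
exists C => eta; apply: le_trans (hC eta).
rewrite (ft1_derive _ df (smooth1_continuous sm') sf) !cmodM cmod_real.
have -> : cmod ('i : R[i]) = 1 by rewrite /cmod /= expr0n expr1n add0r sqrtr1.
by rewrite mul1r exprSr mulrA.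
Qed.

(** Splitting at |eta| = 1 gives (1 + |eta|)^k <= 2^k (1 + |eta|^k), so the decay of orders 0 and k
    suffices. *)
Lemma ft1_decay k r f : smooth1 f -> supp1 r f ->
  exists2 C, 0 <= C & forall eta, (1 + `|eta|) ^+ k * cmod (ft1 f eta) <= C.
Proof.
move=> sm sf; have [C0 h0] := ft1_decay_pow 0 sm sf.
have [Ck hk] := ft1_decay_pow k sm sf.
have C0g : 0 <= C0 by apply: le_trans (h0 0); rewrite mul1r cmod_ge0.
have Ckg : 0 <= Ck by apply: le_trans (hk 0); rewrite mulr_ge0 ?cmod_ge0 ?exprn_ge0.
exists (2 ^+ k * (C0 + Ck)); first by rewrite mulr_ge0 ?exprn_ge0 ?addr_ge0.
move=> eta; apply: (@le_trans _ _ (2 ^+ k * ((1 + `|eta| ^+ k) * cmod (ft1 f eta)))).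
  rewrite mulrA ler_wpM2r ?cmod_ge0//; have [h|/ltW h] := leP `|eta| 1.
    apply: (@le_trans _ _ (2 ^+ k)).
      by rewrite lerXn2r ?nnegrE ?addr_ge0// -[leRHS]/(1 + 1) lerD2l.
    by rewrite ler_peMr ?exprn_ge0// lerDl exprn_ge0.
  apply: (@le_trans _ _ (2 ^+ k * `|eta| ^+ k)).
    rewrite -exprMn lerXn2r ?nnegrE ?addr_ge0 ?mulr_ge0// mulr_natl mulr2n.
    by rewrite lerD2r.
  by rewrite ler_wpM2l ?exprn_ge0// lerDr.
rewrite ler_wpM2l ?exprn_ge0// mulrDl lerD//.
by have := h0 eta; rewrite expr0.
Qed.

Lemma lipschitz_continuous (h : R -> R) (M : R) :
  (forall s t, `|h s - h t| <= M * `|s - t|) -> continuous h.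
Proof.
move=> hM x; apply/cvgrPdist_le => e e0; near=> y.
rewrite (le_trans (hM _ _))//.
have M0 : 0 < `|M| + 1 by rewrite ltr_wpDl.
apply: (@le_trans _ _ ((`|M| + 1) * `|x - y|)).
  by rewrite ler_wpM2r// (le_trans (ler_norm M))// lerDl.
rewrite mulrC -ler_pdivlMr//; near: y.
by apply: (@cvgr_dist_le _ _ _ (nbhs x) _ id) => //; rewrite divr_gt0.
Unshelve. all: by end_near. Qed.

(** The Lipschitz constant is a multiple of the first absolute moment of f. Continuity is wanted
    here for the measurability of the transform. *)
Lemma ft1_lipschitz r f : continuous f -> supp1 r f ->
  exists M, forall s t, cmod (ft1 f s - ft1 f t) <= M * `|s - t|.
Proof.
move=> cf sf; pose h (x : R) := `|x| * `|f x|.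
have Ih : itg leb h.
  apply: (@supp1_itg r) => [x|x xr]; last by rewrite /h sf// normr0 mulr0.
  by apply: cvgM; apply: cvg_norm; [exact: cvg_id|exact: cf].
exists (2 * (2 * itgR leb h)) => s t.
rewrite /ft1 -(citgCB (citg_ft1 s cf sf) (citg_ft1 t cf sf)).
have := @cmod_citgC R _ _ leb _ (fun x => (2 * `|s - t|) * h x)
  (cmeasB (cmeas_ft1 s cf) (cmeas_ft1 t cf)) _ (itgZ _ Ih).
rewrite (itgRZ _ Ih) => H; apply: (le_trans (H _)); last by rewrite le_eqVlt; apply/orP; left; apply/eqP; ring.
move=> x; rewrite -mulrBl cmodM cmod_real /h mulrA ler_wpM2r//.
rewrite (le_trans (cis_lipschitz _ _))// -mulrA ler_wpM2l//.
by rewrite -opprD normrN -mulrBl normrM.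
Qed.

Lemma cmeas_ft1_fun r f : continuous f -> supp1 r f ->
  cmeas (ft1 f : measurableTypeR R -> R[i]).
Proof.
move=> cf sf; have [M hM] := ft1_lipschitz cf sf.
split; apply: continuous_measurable_fun; apply: (@lipschitz_continuous _ M) => s t.
  by rewrite -ReB (le_trans (ler_Re_cmod _)).
by rewrite -ImB (le_trans (ler_Im_cmod _)).
Qed.

Lemma citg_ft1_fun r f : smooth1 f -> supp1 r f -> citg leb (ft1 f).
Proof.
move=> sm sf; have cf := smooth1_continuous sm.
have [C C0 hC] := ft1_decay 2 sm sf.
apply: (citg_le (cmeas_ft1_fun cf sf) _ (itgZ C itg_cauchyd)) => x.
rewrite /cauchyd ler_pdivlMr ?oneDsqr_gt0// mulrC (le_trans _ (hC x))//.
rewrite ler_wpM2r ?cmod_ge0// sqrrD expr1n mul1r real_normK ?num_real//.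
by rewrite lerD2r lerDl mulrn_wge0.
Qed.

Section poisson.
Variables (e : R) (e0 : 0 < e).

(** The Poisson kernel of height e, normalized as the Fourier transform of e^(-e|t|); its total mass
    is 2 pi. *)
Definition poisson (z : R) : R := 2 * e / (e ^+ 2 + z ^+ 2).

Let D z := e ^+ 2 + z ^+ 2.
Let D0 z : 0 < D z. Proof. by rewrite /D ltr_pwDl ?exprn_gt0 ?sqr_ge0. Qed.

Lemma continuous_scale (z : R) : continuous (fun t : R => z * t).
Proof. by move=> x; apply: cvgM; [exact: cvg_cst|exact: cvg_id]. Qed.

Let expe (t : R) := expR (- (e * `|t|)).

Let continuous_expe : continuous expe.
Proof.
move=> x; apply: continuous_comp; last exact: continuous_expR.
by apply: cvgN; apply: cvgM; [exact: cvg_cst|apply: cvg_norm; exact: cvg_id].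
Qed.

Let expe_le t : expe t <= (1 + 4 / e ^+ 2) * cauchyd t.
Proof.
rewrite /expe expRN /cauchyd ler_pdivlMr ?oneDsqr_gt0// mulrC ler_pdivrMr ?expR_gt0//.
have := @expR_ge_pow R (e * `|t|) 1 _; rewrite mulr_ge0 ?(ltW e0)// => /(_ isT).
rewrite expr_div_n exprMn real_normK ?num_real// => h.
have h1 : 1 <= expR (e * `|t|) by rewrite -[leLHS]expR0 ler_expR mulr_ge0 ?(ltW e0).
rewrite mulrDl mul1r lerD//.
rewrite mulrAC ler_pdivlMr ?exprn_gt0// mulrC.
by move: h; rewrite ler_pdivrMr ?exprn_gt0// mulrC => h; apply: (le_trans h); lra.
Qed.

Let itg_expe (g : R -> R) : continuous g -> (forall x, `|g x| <= 1) ->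
  itg leb (fun t => expe t * g t).
Proof.
move=> cg g1.
apply: (@itg_le R _ (measurableTypeR R) leb _ _ _ _ (itgZ (1 + 4 / e ^+ 2) itg_cauchyd)).
  apply: continuous_measurable_fun => x.
  by apply: cvgM; [exact: continuous_expe|exact: cg].
move=> x; rewrite (le_trans _ (expe_le x))// normrM ger0_norm ?expR_ge0//.
by rewrite ler_piMr ?expR_ge0.
Qed.

Let expe_decay (g : R -> R) (K : R) : (forall x, `|g x| <= K) ->
  expR (- (e * x)) * g x @[x --> +oo] --> (0 : R).
Proof.
move=> gK; apply: (@cvg0_inv _ _ (K / e)) => x x0.
rewrite normrM ger0_norm ?expR_ge0// -mulrA -invfM mulrC ler_pM ?expR_ge0//.
rewrite expRN lef_pV2 ?posrE ?mulr_gt0 ?expR_gt0//.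
by rewrite (le_trans _ (expR_ge1Dx _))// lerDr.
Qed.

Let dE (t : R) : is_derive t 1 (fun t => expR (- (e * t))) (- e * expR (- (e * t))).
Proof. by apply: is_derive_eq; rewrite /GRing.scale/= mulr1 mulrC. Qed.

Let dE' (t : R) : is_derive t 1 (fun t => expR (e * t)) (e * expR (e * t)).
Proof. by apply: is_derive_eq; rewrite /GRing.scale/= mulr1 mulrC. Qed.

Let bound_trig z a b x : `|(a * sin (z * x) + b * cos (z * x)) / D z| <= (`|a| + `|b|) / D z.
Proof.
rewrite normrM [X in _ * X <= _]gtr0_norm ?invr_gt0 ?D0//.
rewrite ler_wpM2r ?invr_ge0 ?(ltW (D0 z))//.
rewrite (le_trans (ler_normD _ _))// lerD// normrM ler_piMr//.
  exact: sin_max.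
exact: cos_max.
Qed.

Lemma itgR_exp_cos z : itgR leb (fun t => expe t * cos (z * t)) = poisson z.
Proof.
have cf : continuous (fun t : R => cos (z * t)).
  by move=> x; apply: continuous_comp; [exact: continuous_scale|exact: continuous_cos].
have cef : continuous (fun t : R => expe t * cos (z * t)).
  by move=> x; apply: cvgM; [exact: continuous_expe|exact: cf].
pose f1 (t : R) := expR (- (e * t)) * cos (z * t).
pose f2 (t : R) := expR (e * t) * cos (z * t).
(* Explicit primitives of e^(-et) cos(zt) and e^(et) cos(zt), to be used on the right and left
   half-lines. *)
pose G1 (t : R) := expR (- (e * t)) * ((z * sin (z * t) + - e * cos (z * t)) / D z).
pose G2 (t : R) := expR (e * t) * ((z * sin (z * t) + e * cos (z * t)) / D z).
have Dn : D z != 0 by rewrite gt_eqF.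
have dL a b (t : R) : is_derive t 1 (fun t => (a * sin (z * t) + b * cos (z * t)) / D z)
    ((a * (z * cos (z * t)) + b * (- z * sin (z * t))) / D z).
  by apply: is_derive_eq; rewrite /GRing.scale/=; ring.
have d1 (t : R) : is_derive t 1 G1 (f1 t).
  apply: (is_derive_eq (is_deriveM (dE t) (dL z (- e) t))).
  by rewrite /GRing.scale/= /f1; move: Dn; rewrite /D => Dn; field.
have d2 (t : R) : is_derive t 1 G2 (f2 t).
  apply: (is_derive_eq (is_deriveM (dE' t) (dL z e t))).
  by rewrite /GRing.scale/= /f2; move: Dn; rewrite /D => Dn; field.
rewrite (@line_FTC_kink _ _ f1 G1 f2 G2 0 0)//.
- rewrite /G1 /G2 !mulr0 oppr0 expR0 sin0 cos0 /poisson; move: Dn; rewrite /D => Dn.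
  by field.
- by apply: itg_expe => // x; exact: cos_max.
- by move=> x x0; rewrite /expe ger0_norm.
- by move=> x x0; rewrite /expe ler0_norm// mulrN opprK.
- exact: expe_decay (bound_trig z z (- e)).
- rewrite /G2; under eq_fun do rewrite mulrN.
  apply: (expe_decay (g := fun x => (z * sin (z * - x) + e * cos (z * - x)) / D z)
    (K := (`|z| + `|e|) / D z)) => x.
  by have := bound_trig z z e (- x).
Qed.

Lemma itgR_exp_sin z : itgR leb (fun t => expe t * sin (z * t)) = 0.
Proof.
have cf : continuous (fun t : R => sin (z * t)).
  by move=> x; apply: continuous_comp; [exact: continuous_scale|exact: continuous_sin].
have cef : continuous (fun t : R => expe t * sin (z * t)).
  by move=> x; apply: cvgM; [exact: continuous_expe|exact: cf].
pose f1 (t : R) := expR (- (e * t)) * sin (z * t).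
pose f2 (t : R) := expR (e * t) * sin (z * t).
pose G1 (t : R) := expR (- (e * t)) * ((- e * sin (z * t) + - z * cos (z * t)) / D z).
pose G2 (t : R) := expR (e * t) * ((e * sin (z * t) + - z * cos (z * t)) / D z).
have Dn : D z != 0 by rewrite gt_eqF.
have dL a b (t : R) : is_derive t 1 (fun t => (a * sin (z * t) + b * cos (z * t)) / D z)
    ((a * (z * cos (z * t)) + b * (- z * sin (z * t))) / D z).
  by apply: is_derive_eq; rewrite /GRing.scale/=; ring.
have d1 (t : R) : is_derive t 1 G1 (f1 t).
  apply: (is_derive_eq (is_deriveM (dE t) (dL (- e) (- z) t))).
  by rewrite /GRing.scale/= /f1; move: Dn; rewrite /D => Dn; field.
have d2 (t : R) : is_derive t 1 G2 (f2 t).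
  apply: (is_derive_eq (is_deriveM (dE' t) (dL e (- z) t))).
  by rewrite /GRing.scale/= /f2; move: Dn; rewrite /D => Dn; field.
rewrite (@line_FTC_kink _ _ f1 G1 f2 G2 0 0)//.
- by rewrite /G1 /G2 !mulr0 oppr0 expR0 sin0 cos0; ring.
- by apply: itg_expe => // x; exact: sin_max.
- by move=> x x0; rewrite /expe ger0_norm.
- by move=> x x0; rewrite /expe ler0_norm// mulrN opprK.
- exact: expe_decay (bound_trig z (- e) (- z)).
- rewrite /G2; under eq_fun do rewrite mulrN.
  apply: (expe_decay (g := fun x => (e * sin (z * - x) + - z * cos (z * - x)) / D z)
    (K := (`|e| + `|- z|) / D z)) => x.
  by have := bound_trig z e (- z) (- x).
Qed.

Lemma poisson_ft z :
  citg leb (fun t => cis (z * t) * (expR (- (e * `|t|)))%:C) /\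
  citgC leb (fun t => cis (z * t) * (expR (- (e * `|t|)))%:C) = (poisson z)%:C.
Proof.
have r1 t : Re (cis (z * t) * (expe t)%:C) = expe t * cos (z * t).
  by rewrite !ReImE mulr0 subr0 mulrC.
have r2 t : Im (cis (z * t) * (expe t)%:C) = expe t * sin (z * t).
  by rewrite !ReImE mulr0 add0r mulrC.
split.
  split; [under eq_fun do rewrite r1|under eq_fun do rewrite r2]; apply: itg_expe.
  - by move=> x; apply: continuous_comp; [exact: continuous_scale|exact: continuous_cos].
  - by move=> x; exact: cos_max.
  - by move=> x; apply: continuous_comp; [exact: continuous_scale|exact: continuous_sin].
  - by move=> x; exact: sin_max.
apply: complex_ext; rewrite ?citgC_Re ?citgC_Im ?ReImE.
  by under eq_fun do rewrite r1; exact: itgR_exp_cos.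
by under eq_fun do rewrite r2; exact: itgR_exp_sin.
Qed.

Lemma itg_exp_abs : itg leb (fun t => expR (- (e * `|t|))).
Proof.
have c1 : continuous (fun _ : R => 1 : R) by move=> x; exact: cvg_cst.
have := itg_expe c1.
under eq_fun do rewrite mulr1; apply => x.
by rewrite normr1.
Qed.

Lemma poisson_ge0 z : 0 <= poisson z.
Proof. by rewrite /poisson divr_ge0 ?mulr_ge0 ?(ltW e0)// ltW// D0. Qed.

Lemma continuous_poisson (x : R) : continuous (fun t => poisson (t - x)).
Proof.
move=> t; apply: cvgM; first exact: cvg_cst.
apply: cvgV; first by rewrite gt_eqF// D0.
apply: cvgD; first exact: cvg_cst.
apply: (continuous_comp (f := fun t => t - x) (g := fun t => t ^+ 2)).
  by apply: cvgB; [exact: cvg_id|exact: cvg_cst].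
exact: exprn_continuous.
Qed.

Let dP (x t : R) : is_derive t 1 (fun t => 2 * atan ((t - x) / e)) (poisson (t - x)).
Proof.
have d1 : is_derive t 1 (fun t : R => (t - x) / e) e^-1.
  by apply: is_derive_eq; rewrite /GRing.scale/=; ring.
have d2 := @is_derive1_comp _ atan (fun t => (t - x) / e) _ _ _ (is_derive1_atan _) d1.
apply: (is_derive_eq (is_deriveZ 2 d2)).
rewrite /GRing.scale/= /poisson; have := D0 (t - x); rewrite /D => h.
have e1 : e != 0 by rewrite gt_eqF.
have -> : 1 + ((t - x) / e) ^+ 2 = (e ^+ 2 + (t - x) ^+ 2) / e ^+ 2 by field.
by field; rewrite e1 gt_eqF.
Qed.

Lemma itgR_poisson x : itg leb (fun t => poisson (t - x)) /\
  itgR leb (fun t => poisson (t - x)) = 2 * pi.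
Proof.
have I : itg leb (fun t => poisson (t - x)).
  apply: (itg_bounded_primitive (F := fun t => 2 * atan ((t - x) / e)) (B := pi)).
  - exact: continuous_poisson.
  - by move=> t; exact: poisson_ge0.
  - exact: dP.
  - by move=> t; rewrite normrM ger0_norm//; have := atan_le ((t - x) / e); lra.
split => //.
have cy y : (t + y) / e @[t --> +oo] --> +oo.
  by apply: gt0_cvgMly; [rewrite invr_gt0|exact: cvg_addrr].
have l1 : 2 * atan ((t - x) / e) @[t --> +oo] --> 2 * (pi / 2).
  by apply: cvgM; [exact: cvg_cst|exact: (cvg_comp _ _ (cy (- x)) (@cvgy_atan R))].
have l2 : 2 * atan ((- t - x) / e) @[t --> +oo] --> 2 * - (pi / 2).
  have -> : (fun t : R => 2 * atan ((- t - x) / e)) = (fun t => 2 * - atan ((t + x) / e)).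
    by apply/funext => t; rewrite -atanN -mulNr opprD.
  apply: cvgM; first exact: cvg_cst.
  by apply: cvgN; exact: (cvg_comp _ _ (cy x) (@cvgy_atan R)).
by rewrite (line_FTC (fun t => @continuous_poisson x t) I (dP x) l1 l2); field.
Qed.

End poisson.

Lemma cvg_invn : (n.+1%:R : R)^-1 @[n --> \oo] --> 0.
Proof. exact: cvg_harmonic. Qed.

Lemma harmonic_gt0 n : 0 < (n.+1%:R : R)^-1. Proof. by rewrite invr_gt0. Qed.

(** A majorant independent of e in (0, 1]. For |z| <= 1 the Lipschitz bound on h and 2e|z| <= e^2 +
    z^2 cancel the singularity of the kernel; for |z| >= 1 the sup bound on h is enough. *)
Lemma poisson_bound (e z L M h : R) : 0 < e <= 1 -> 0 <= L -> `|h| <= L * `|z| -> `|h| <= M ->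
  `|h * poisson e z| <= (2 * L + 4 * M) * cauchyd z.
Proof.
move=> /andP[e0 e1] L0 hL hM; have M0 : 0 <= M by apply: le_trans hM.
rewrite normrM (ger0_norm (poisson_ge0 e0 z)) /poisson /cauchyd.
have d0 : 0 < e ^+ 2 + z ^+ 2 by rewrite ltr_pwDl ?exprn_gt0 ?sqr_ge0.
rewrite ler_pdivlMr ?oneDsqr_gt0// [_ * (2 * e / _)]mulrA -mulrAC ler_pdivrMr//.
have z2 : z ^+ 2 = `|z| ^+ 2 by rewrite real_normK ?num_real.
rewrite z2; move: (`|z|) (normr_ge0 z) hL => a a0 hL.
move: (`|h|) (normr_ge0 h) hL hM => k k0 hL hM {z z2 d0 h}.
have [a1|/ltW a1] := leP a 1.
  have La : 0 <= L * a by rewrite mulr_ge0.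
  have h1 : 2 * (e * a) <= e ^+ 2 + a ^+ 2.
    by rewrite -subr_ge0 (_ : _ - _ = (e - a) ^+ 2) ?sqr_ge0//; ring.
  have h2 : k * (2 * e) <= L * (e ^+ 2 + a ^+ 2).
    apply: (@le_trans _ _ (L * a * (2 * e))); first by rewrite ler_wpM2r ?mulr_ge0 ?(ltW e0).
    rewrite -mulrA ler_wpM2l// (le_trans _ h1)//; lra.
  have s0 : 0 <= e ^+ 2 + a ^+ 2 by rewrite addr_ge0 ?sqr_ge0.
  apply: (@le_trans _ _ (L * (e ^+ 2 + a ^+ 2) * 2)).
    rewrite ler_pM// ?mulr_ge0 ?addr_ge0 ?sqr_ge0 ?(ltW e0)//.
    by rewrite -[leRHS]/(1 + 1) lerD2l expr_le1.
  by rewrite [leLHS]mulrAC ler_wpM2r// [leLHS]mulrC lerDl mulr_ge0.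
apply: (@le_trans _ _ (4 * M * a ^+ 2)).
  have a2 : 1 + a ^+ 2 <= 2 * a ^+ 2.
    by have : 1 <= a ^+ 2 by [rewrite expr_ge1]; lra.
  apply: (@le_trans _ _ (M * 2 * (2 * a ^+ 2))); last by rewrite le_eqVlt; apply/orP; left; apply/eqP; ring.
  apply: ler_pM => //; rewrite ?mulr_ge0 ?addr_ge0 ?sqr_ge0 ?(ltW e0)//.
  by apply: ler_pM => //; rewrite ?mulr_ge0 ?(ltW e0)//; lra.
apply: (@le_trans _ _ (4 * M * (e ^+ 2 + a ^+ 2))).
  by rewrite ler_wpM2l ?mulr_ge0// lerDr sqr_ge0.
by rewrite ler_wpM2r ?addr_ge0 ?sqr_ge0// lerDr mulr_ge0.
Qed.

Lemma cvg_add0 (u : nat -> R) (c : R) :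
  u n @[n --> \oo] --> (0 : R) -> u n + c @[n --> \oo] --> c.
Proof. by move=> h; rewrite -[X in _ --> X]add0r; apply: cvgD => //; exact: cvg_cst. Qed.

Lemma cvg_mul1 (u : nat -> R) (c : R) :
  u n @[n --> \oo] --> (1 : R) -> u n * c @[n --> \oo] --> c.
Proof. by move=> h; rewrite -[X in _ --> X]mul1r; apply: cvgM => //; exact: cvg_cst. Qed.

(** The transform is damped by e^(-e|eta|). Fubini turns the damped integral into the Poisson
    integral of f at x, and e -> 0 is taken by dominated convergence on both sides. *)
Theorem fourier_inversion1 r f x : smooth1 f -> supp1 r f ->
  citgC leb (fun eta => cis (x * eta) * ft1 f eta) = (2 * pi * f x)%:C.
Proof.
move=> sm sf; have cf := smooth1_continuous sm.
have Ic := citg_ft1_fun sm sf; have mc := cmeas_ft1_fun cf sf.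
have [M fM] := supp1_bounded cf sf.
have [f' sm' df] := smooth1_derive sm.
have [L fL] := supp1_bounded (smooth1_continuous sm') (supp1_derive df sf).
have Lf := lipschitz_of_derive df fL.
pose e n : R := n.+1%:R^-1.
have e0 n : 0 < e n by exact: harmonic_gt0.
have cur := @continuous_measurable_fun R.
have mcis (a : R) : cmeas (fun t : measurableTypeR R => cis (a * t)).
  by apply: cmeas_cis; apply: cur; exact: continuous_scale.
have mexp n : cmeas (fun t : measurableTypeR R => (expR (- (e n * `|t|)))%:C).
  exact/cmeas_real/itg_meas/itg_exp_abs.
pose u n := citgC leb (fun eta => (expR (- (e n * `|eta|)))%:C * (cis (x * eta) * ft1 f eta)).
(* The damping makes the integrand absolutely integrable in both variables, so the exchange is
   licit. *)
have S n : u n =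
    (itgR leb (fun t => f t * poisson (e n) (t - x)))%:C.
  pose G (z : measurableTypeR R * measurableTypeR R) : R[i] :=
    cis ((x - z.2) * z.1) * (expR (- (e n * `|z.1|)))%:C * (f z.2)%:C.
  have mG : cmeas G.
    have m1 := @measurable_fst _ _ (measurableTypeR R) (measurableTypeR R).
    have m2 := @measurable_snd _ _ (measurableTypeR R) (measurableTypeR R).
    apply: cmeasM; first apply: cmeasM.
    - apply: cmeas_cis; apply: measurable_funM => //.
      by apply: measurable_funB => //; exact: measurable_cst.
    - apply: cmeas_real.
      apply: (measurableT_comp (f := fun t : measurableTypeR R => expR (- (e n * `|t|)))) => //.
      exact: itg_meas (itg_exp_abs (e0 n)).
    - apply: cmeas_real; apply: (measurableT_comp (f := f)) => //.
      exact: cur.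
  have dG s t : cmod (G (s, t)) <= expR (- (e n * `|s|)) * `|f t|.
    by rewrite /G !cmodM cmod_cis mul1r !cmod_real ger0_norm ?expR_ge0.
  have := citgC_swap (m1 := leb) (m2 := leb) mG dG (itg_exp_abs (e0 n)) (itg_abs (supp1_itg cf sf)).
  have -> : (fun s => citgC leb (fun t => G (s, t))) =
     (fun eta => (expR (- (e n * `|eta|)))%:C * (cis (x * eta) * ft1 f eta)).
    apply/funext => s; rewrite mulrA /ft1 -(citgCZ _ (citg_ft1 s cf sf)).
    congr citgC; apply/funext => t; rewrite /G mulrBl cisD (mulrC s); ring.
  rewrite /u => ->.
  have -> : (fun t => citgC leb (fun s => G (s, t))) =
     (fun t => (f t * poisson (e n) (t - x))%:C).
    apply/funext => t; have [I1 E1] := poisson_ft (e0 n) (x - t).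
    have -> : poisson (e n) (t - x) = poisson (e n) (x - t).
      by rewrite /poisson -[in LHS]opprB sqrrN.
    rewrite realCM -E1 -(citgCZ _ I1); congr citgC; apply/funext => s.
    by rewrite /G; ring.
  by apply: complex_ext; rewrite ?citgC_Re ?citgC_Im ?ReImE// itgR0.
have cvgL : Re (u n) @[n --> \oo] --> Re (citgC leb (fun eta => cis (x * eta) * ft1 f eta)) /\
  Im (u n) @[n --> \oo] --> Im (citgC leb (fun eta => cis (x * eta) * ft1 f eta)).
  have ce (eta : R) : expR (- (e n * `|eta|)) @[n --> \oo] --> (1 : R).
    rewrite -expR0; apply: (cvg_comp (fun n => - (e n * `|eta|)) expR); last exact: continuous_expR.
    rewrite -oppr0 -(mul0r `|eta|); apply: cvgN; apply: cvgM; last exact: cvg_cst.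
    exact: cvg_invn.
  have [] := @citgC_dct _ _ _ leb
    (fun n eta => (expR (- (e n * `|eta|)))%:C * (cis (x * eta) * ft1 f eta))
    (fun eta => cis (x * eta) * ft1 f eta) (fun eta => cmod (ft1 f eta)).
  - by move=> n; apply: cmeasM (mexp n) (cmeasM (mcis x) mc).
  - move=> eta; under eq_fun do rewrite ReM Re_real Im_real mul0r subr0.
    exact/cvg_mul1/ce.
  - move=> eta; under eq_fun do rewrite ImM Re_real Im_real mul0r addr0.
    exact/cvg_mul1/ce.
  - move=> n eta; rewrite !cmodM cmod_cis mul1r cmod_real ger0_norm ?expR_ge0//.
    rewrite ler_piMl ?cmod_ge0// -expR0 ler_expR oppr_le0 mulr_ge0//.
    exact: ltW.
  - exact: citg_cmod.
  by move=> _ c1 c2; split.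
have cvgR : itgR leb (fun t => f t * poisson (e n) (t - x)) @[n --> \oo] --> 2 * pi * f x.
  have I0 n : itg leb (fun t => poisson (e n) (t - x)) by have [] := itgR_poisson (e0 n) x.
  have bnd n t : `|(f t - f x) * poisson (e n) (t - x)| <= (2 * L + 4 * (M + M)) * cauchyd (t - x).
    apply: poisson_bound.
    - by rewrite e0 /e invf_le1// ler1n.
    - exact: le_trans (fL x).
    - exact: Lf.
    - by rewrite (le_trans (ler_normB _ _))// lerD.
  have mb n : measurable_fun (setT : set (measurableTypeR R)) (fun t => (f t - f x) * poisson (e n) (t - x)).
    apply: cur => t; apply: cvgM; last exact: continuous_poisson.
    by apply: cvgB; [exact: cf|exact: cvg_cst].
  have [Ij _] := itgR_shift1 (- x) (@itg_cauchyd R).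
  have Ib n : itg leb (fun t => (f t - f x) * poisson (e n) (t - x)).
    exact: itg_le (mb n) (bnd n) (itgZ _ Ij).
  (* Subtracting f(x) against the total mass 2 pi leaves an integrand to which the uniform majorant
     [bnd] applies. *)
  have E n : itgR leb (fun t => f t * poisson (e n) (t - x)) =
      itgR leb (fun t => (f t - f x) * poisson (e n) (t - x)) + f x * (2 * pi).
    have [_ <-] := itgR_poisson (e0 n) x.
    rewrite -(itgRZ _ (I0 n)) -(itgRD (Ib n) (itgZ _ (I0 n))); congr itgR.
    by apply/funext => t; ring.
  under eq_fun do rewrite E.
  rewrite [2 * pi * _]mulrC; apply: cvg_add0.
  suff pt t : (f t - f x) * poisson (e n) (t - x) @[n --> \oo] --> 0.
    by have [_] := itgR_dct mb pt bnd (itgZ _ Ij); rewrite itgR0; apply.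
  (* The kernel blows up at t = x, but there the factor f(t) - f(x) is 0. *)
  have [->|tx] := eqVneq t x.
    by under eq_fun do rewrite subrr mul0r; exact: cvg_cst.
  have tx0 : (t - x) ^+ 2 != 0 by rewrite expf_neq0// subr_eq0.
  have := cvg_invn; rewrite -/e => ce.
  rewrite [X in _ --> X](_ : _ = (f t - f x) * (2 * 0 / (0 ^+ 2 + (t - x) ^+ 2))); last by rewrite mulr0 mul0r mulr0.
  apply: cvgM; first exact: cvg_cst.
  apply: cvgM; first by apply: cvgM; [exact: cvg_cst|exact: ce].
  apply: cvgV; first by rewrite expr0n add0r.
  apply: cvgD; last exact: cvg_cst.
  by rewrite expr2; under eq_fun do rewrite expr2; apply: cvgM; exact: ce.
case: cvgL => c1 c2; apply: complex_ext.
  rewrite Re_real; apply: (cvg_unique _ c1) => //.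
  have E : (fun n => Re (u n)) = (fun n => itgR leb (fun t => f t * poisson (e n) (t - x))).
    by apply/funext => n; rewrite S.
  by rewrite /= E.
rewrite Im_real; apply: (cvg_unique _ c2) => //.
have E : (fun n => Im (u n)) = fun=> 0 by apply/funext => n; rewrite S.
by rewrite /= E; exact: cvg_cst.
Qed.

End Fourier1.

(** * Smooth functions and symbols *)

Section Continuity.
Context {R : realType} {T : topologicalType}.
Implicit Types (f g : T -> R).

Lemma contD f g : continuous f -> continuous g -> continuous (fun x => f x + g x).
Proof. by move=> cf cg x; apply: cvgD; [exact: cf|exact: cg]. Qed.

Lemma contB f g : continuous f -> continuous g -> continuous (fun x => f x - g x).
Proof. by move=> cf cg x; apply: cvgB; [exact: cf|exact: cg]. Qed.

Lemma contM f g : continuous f -> continuous g -> continuous (fun x => f x * g x).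
Proof. by move=> cf cg x; apply: cvgM; [exact: cf|exact: cg]. Qed.

Lemma contN f : continuous f -> continuous (fun x => - f x).
Proof. by move=> cf x; apply: cvgN; exact: cf. Qed.

Lemma cont_cst (c : R) : continuous (fun _ : T => c).
Proof. by move=> x; exact: cvg_cst. Qed.

Lemma cont_comp f (h : R -> R) : continuous f -> continuous h -> continuous (fun x => h (f x)).
Proof. by move=> cf ch x; apply: (continuous_comp (f := f)); [exact: cf|exact: ch]. Qed.

End Continuity.

Lemma lipschitz_normed_continuous (R : realType) (V W : normedModType R) (f : V -> W) (M : R) :
  (forall x y, `|f x - f y| <= M * `|x - y|) -> continuous f.
Proof.
move=> fM x; apply/cvgrPdist_le => e e0; near=> y.
have M0 : 0 < `|M| + 1 by rewrite ltr_wpDl.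
rewrite (le_trans (fM _ _))// (@le_trans _ _ ((`|M| + 1) * `|x - y|))//.
  by rewrite ler_wpM2r// (le_trans (ler_norm M))// lerDl.
rewrite mulrC -ler_pdivlMr//; near: y.
by apply: (@cvgr_dist_le _ _ _ (nbhs x) _ id) => //; rewrite divr_gt0.
Unshelve. all: by end_near. Qed.

Section Lines.
Context {R : realType} {n : nat}.
Implicit Types (f : 'cV[R]_n -> R) (x v : 'cV[R]_n).

(** Both sides are limits of the same difference quotients; this reduces directional derivatives to
    the calculus on the line. *)
Lemma is_derive_line f x v (t df : R) :
  is_derive (t *: v + x) v f df <-> is_derive t 1 (fun s : R => f (s *: v + x)) df.
Proof.
have E : (fun h : R => h^-1 *: (f (h *: v + (t *: v + x)) - f (t *: v + x))) =
         (fun h : R => h^-1 *: (f ((h *: 1 + t) *: v + x) - f (t *: v + x))).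
  by apply/funext => h; rewrite scalerDl addrA -[h%:A]/(h * 1) mulr1.
split=> -[d1 d2]; split.
- by move: d1; rewrite /derivable /= E.
- by move: d2; rewrite /derive /= E.
- by rewrite /derivable /= E.
- by rewrite /derive /= E.
Qed.

Lemma is_derive_line0 f x v (df : R) :
  is_derive (0 : R) 1 (fun s : R => f (s *: v + x)) df -> is_derive x v f df.
Proof. by move=> /is_derive_line; rewrite scale0r add0r. Qed.

Lemma is_derive_coord (h h' : R -> R) (i j : 'I_n) x : (forall t : R, is_derive t 1 h (h' t)) ->
  is_derive x (basis_vec j) (fun y => h (y i 0)) (h' (x i 0) * (i == j)%:R).
Proof.
move=> dh; apply: is_derive_line0.
have E s : (s *: basis_vec j + x) i 0 = s * (i == j)%:R + x i 0.
  by rewrite !mxE eqxx andbT.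
under eq_fun do rewrite E.
have d1 : is_derive (0 : R) 1 (fun s : R => s * (i == j)%:R + x i 0) (i == j)%:R.
  by apply: is_derive_eq; rewrite /GRing.scale/=; ring.
apply: (is_derive_eq (@is_derive1_comp _ h (fun s : R => s * (i == j)%:R + x i 0) _ _ _ (dh _) d1)).
by rewrite mul0r add0r.
Qed.

Lemma dotpDl (x y z : 'cV[R]_n) : dotp (x + y) z = dotp x z + dotp y z.
Proof. by rewrite /dotp -big_split; apply: eq_bigr => i _; rewrite mxE mulrDl. Qed.

Lemma dotpC (x y : 'cV[R]_n) : dotp x y = dotp y x.
Proof. by apply: eq_bigr => i _; rewrite mulrC. Qed.

Lemma dotpDr (x y z : 'cV[R]_n) : dotp z (x + y) = dotp z x + dotp z y.
Proof. by rewrite dotpC dotpDl !(dotpC z). Qed.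

Lemma dotpZl a (x y : 'cV[R]_n) : dotp (a *: x) y = a * dotp x y.
Proof. by rewrite /dotp big_distrr; apply: eq_bigr => i _; rewrite mxE /= mulrA. Qed.

Lemma dotpZr a (x y : 'cV[R]_n) : dotp y (a *: x) = a * dotp y x.
Proof. by rewrite dotpC dotpZl dotpC. Qed.

Lemma dotpNl (x y : 'cV[R]_n) : dotp (- x) y = - dotp x y.
Proof. by rewrite -scaleN1r dotpZl mulN1r. Qed.

Lemma dotpNr (x y : 'cV[R]_n) : dotp y (- x) = - dotp y x.
Proof. by rewrite dotpC dotpNl dotpC. Qed.

Lemma dotpBl (x y z : 'cV[R]_n) : dotp (x - y) z = dotp x z - dotp y z.
Proof. by rewrite dotpDl dotpNl. Qed.

Lemma dotpBr (x y z : 'cV[R]_n) : dotp z (x - y) = dotp z x - dotp z y.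
Proof. by rewrite dotpDr dotpNr. Qed.

Lemma dotp_basis j (xi : 'cV[R]_n) : dotp (basis_vec j) xi = xi j 0.
Proof.
rewrite /dotp (bigD1 j)//= mxE !eqxx mul1r big1 ?addr0// => i ij.
by rewrite mxE (negbTE ij) mul0r.
Qed.

Lemma is_derive_dotp (h h' : R -> R) (xi : 'cV[R]_n) (j : 'I_n) x :
  (forall t : R, is_derive t 1 h (h' t)) ->
  is_derive x (basis_vec j) (fun y => h (dotp y xi)) (h' (dotp x xi) * xi j 0).
Proof.
move=> dh; apply: is_derive_line0.
have E s : dotp (s *: basis_vec j + x) xi = s * xi j 0 + dotp x xi.
  by rewrite dotpDl dotpZl dotp_basis.
under eq_fun do rewrite E.
have d1 : is_derive (0 : R) 1 (fun s : R => s * xi j 0 + dotp x xi) (xi j 0).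
  by apply: is_derive_eq; rewrite /GRing.scale/=; ring.
apply: (is_derive_eq (@is_derive1_comp _ h (fun s : R => s * xi j 0 + dotp x xi) _ _ _ (dh _) d1)).
by rewrite mul0r add0r.
Qed.

Lemma continuous_coord i : continuous (fun x : 'cV[R]_n => x i 0).
Proof. exact: coord_continuous. Qed.

Lemma continuous_dotp (xi : 'cV[R]_n) : continuous (fun x => dotp x xi).
Proof.
rewrite /dotp; elim: (index_enum _) => [|i s IH].
  by under eq_fun do rewrite big_nil; exact: cont_cst.
under eq_fun do rewrite big_cons; apply: contD => //.
by apply: contM; [exact: continuous_coord|exact: cont_cst].
Qed.

Lemma MVT_abs (g g' : R -> R) (M : R) : (forall t : R, is_derive t 1 g (g' t)) ->
  (forall t, 0 <= t <= 1 -> `|g' t| <= M) -> `|g 1 - g 0| <= M.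
Proof.
move=> dg bg; have cg : {within `[0, 1], continuous g}.
  by apply: continuous_subspaceT; exact: is_derive_continuous dg.
have [c] := MVT_segment ler01 (fun (t : R) _ => dg t) cg.
by rewrite in_itv/= => c01 ->; rewrite subr0 mulr1; exact: bg.
Qed.

(* Move from y to x one coordinate at a time. *)
Lemma lipschitz_box f (f' : 'I_n -> 'cV[R]_n -> R) (M : R) (x y : 'cV[R]_n) :
  (forall i (z : 'cV[R]_n), is_derive z (basis_vec i) f (f' i z)) ->
  (forall i (z : 'cV[R]_n), (forall j, `|z j 0 - y j 0| <= `|x j 0 - y j 0|) -> `|f' i z| <= M) ->
  `|f x - f y| <= M * \sum_i `|x i 0 - y i 0|.
Proof.
move=> df bf.
pose z (k : nat) : 'cV[R]_n := \col_i (if (i < k)%N then x i 0 else y i 0).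
have z0 : z 0%N = y by apply/matrixP => i j; rewrite mxE ord1.
have zn : z n = x by apply/matrixP => i j; rewrite mxE ord1 ltn_ord.
suff H k : (k <= n)%N ->
    `|f (z k) - f y| <= M * \sum_(i < n | (i < k)%N) `|x i 0 - y i 0|.
  by have := H n (leqnn n); rewrite zn (eq_bigl predT)// => i; rewrite ltn_ord.
elim: k => [|k IH] kn; first by rewrite z0 subrr normr0 big_pred0 ?mulr0.
pose i0 := Ordinal kn.
rewrite (bigD1 i0)//= (eq_bigl (fun i : 'I_n => (i < k)%N)); last first.
  by move=> i; rewrite ltnS -val_eqE /= ltn_neqAle andbC.
rewrite mulrDr -(subrK (f (z k)) (f (z k.+1))) -addrA (le_trans (ler_normD _ _))//.
apply: lerD; last by apply: IH; exact: ltnW.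
pose a := x i0 0 - y i0 0.
pose g (t : R) := f (t *: (a *: basis_vec i0) + z k).
have E t : t *: (a *: basis_vec i0) + z k = (t * a) *: basis_vec i0 + z k by rewrite scalerA.
have g0 : g 0 = f (z k) by rewrite /g scale0r add0r.
have g1 : g 1 = f (z k.+1).
  rewrite /g; congr f; apply/matrixP => i j; rewrite !mxE ord1 eqxx andbT mul1r ltnS.
  have [->|ii] := eqVneq i i0; first by rewrite /= ltnn leqnn mulr1 subrK.
  have -> : (i <= k)%N = (i < k)%N.
    rewrite leq_eqVlt; case: eqP => // ik.
    by move: ii; rewrite -val_eqE /= ik eqxx.
  by rewrite mulr0 add0r.
rewrite -g1 -g0.
have dg (t : R) : is_derive t 1 g (f' i0 ((t * a) *: basis_vec i0 + z k) * a).
  have -> : g = (fun u => f (u *: basis_vec i0 + z k)) \o (fun t => t * a).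
    by apply/funext => s; rewrite /g E.
  apply: is_derive1_comp; last by apply: is_derive_eq; rewrite /GRing.scale/=; ring.
  by apply/is_derive_line; exact: df.
apply: (MVT_abs dg) => t /andP[t0 t1]; rewrite normrM ler_wpM2r//; apply: bf => j.
rewrite !mxE eqxx andbT; have [->|ji] := eqVneq j i0.
  rewrite mulr1 ltnn addrK normrM ger0_norm// ler_piMl//.
rewrite mulr0 add0r; case: ifP => // _; by rewrite subrr normr0.
Qed.

End Lines.

(** * Closure properties of smooth functions *)

Section SmoothAlgebra.
Context {R : realType} {n : nat}.
Implicit Types (g : 'cV[R]_n -> R[i]).

Definition cderive (i : 'I_n) g (x : 'cV[R]_n) (z : R[i]) : Prop :=
  is_derive x (basis_vec i) (fun y => Re (g y)) (Re z) /\
  is_derive x (basis_vec i) (fun y => Im (g y)) (Im z).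

Lemma cderive_pderiv i g g' : (forall x, cderive i g x (g' x)) -> pderiv i g = g'.
Proof.
move=> h; apply/funext => x; have [h1 h2] := h x.
by apply: complex_ext; [have := @derive_val _ _ _ _ _ _ _ h1|have := @derive_val _ _ _ _ _ _ _ h2].
Qed.

Lemma smooth_cderive i g x : smooth g -> cderive i g x (pderiv i g x).
Proof.
move=> sg; have [_ _ /(_ i x)[d1 d2]] := sg [::].
by split; [exact: (DeriveDef d1)|exact: (DeriveDef d2)].
Qed.

Lemma smooth_pderivs s g : smooth g -> smooth (pderivs s g).
Proof.
move=> sg t; have -> : pderivs t (pderivs s g) = pderivs (t ++ s) g.
  by rewrite /pderivs foldr_cat.
exact: sg.
Qed.

Lemma smooth_pderiv i g : smooth g -> smooth (pderiv i g).
Proof. exact: (@smooth_pderivs [:: i]). Qed.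

Definition ccont g := continuous (fun x => Re (g x)) /\ continuous (fun x => Im (g x)).

Lemma smooth_ccont g : smooth g -> ccont g.
Proof. by move=> /(_ [::])[]. Qed.

Lemma ccont_cmeas g : ccont g -> cmeas (fun u => g (vec u)).
Proof. by case=> c1 c2; split; [exact: (measurable_continuous_vec c1)|exact: (measurable_continuous_vec c2)]. Qed.

(** The device of [smooth1] in several variables: the smooth functions are among the generators, and
    the class is closed under partial derivatives. Its members are continuous, so they are smooth
    ([salgP]), which yields all closure properties at once without a Leibniz formula of higher
    order. *)
Inductive salg : ('cV[R]_n -> R[i]) -> Prop :=
| salg_smooth g : smooth g -> salg g
| salg_cst c : salg (fun=> c)
| salg_coord i h : smooth1 h -> salg (fun x => (h (x i 0))%:C)
| salg_wave xi : salg (fun x => cis (dotp x xi))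
| salg_add f g : salg f -> salg g -> salg (fun x => f x + g x)
| salg_mul f g : salg f -> salg g -> salg (fun x => f x * g x)
| salg_conj g : salg g -> salg (fun x => conjc (g x)).

Lemma cderiveD i f g x z w : cderive i f x z -> cderive i g x w ->
  cderive i (fun y => f y + g y) x (z + w).
Proof.
move=> [f1 f2] [g1 g2]; split.
  by under eq_fun do rewrite ReD; rewrite ReD; exact: is_deriveD.
by under eq_fun do rewrite ImD; rewrite ImD; exact: is_deriveD.
Qed.

Lemma cderiveM i f g x z w : cderive i f x z -> cderive i g x w ->
  cderive i (fun y => f y * g y) x (f x * w + z * g x).
Proof.
move=> [f1 f2] [g1 g2]; split.
  under eq_fun do rewrite ReM.
  apply: (is_derive_eq (is_deriveB (is_deriveM f1 g1) (is_deriveM f2 g2))).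
  by rewrite /GRing.scale/= ReD !ReM; ring.
under eq_fun do rewrite ImM.
apply: (is_derive_eq (is_deriveD (is_deriveM f1 g2) (is_deriveM f2 g1))).
by rewrite /GRing.scale/= ImD !ImM; ring.
Qed.

Lemma cderive_cst i c x : cderive i (fun=> c) x 0.
Proof. by split; exact: is_derive_cst. Qed.

Lemma cderive_wave i (xi : 'cV[R]_n) x :
  cderive i (fun x => cis (dotp x xi)) x ('i * (xi i 0)%:C * cis (dotp x xi)).
Proof.
split.
  rewrite (_ : Re _ = - sin (dotp x xi) * xi i 0); last by rewrite !ReM !ImM /=; ring.
  by apply: (is_derive_dotp (h := cos) (h' := fun t => - sin t)).
rewrite (_ : Im _ = cos (dotp x xi) * xi i 0); last by rewrite !ImM !ReM /=; ring.
by apply: (is_derive_dotp (h := sin) (h' := cos)).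
Qed.

Lemma salg_cderive g i : salg g -> exists2 g', salg g' & forall x, cderive i g x (g' x).
Proof.
elim=> {g} [g sg|c|j h sh|xi|f g sf [f' sf' df] sg [g' sg' dg]|f g sf [f' sf' df] sg [g' sg' dg]|g sg [g' sg' dg]].
- exists (pderiv i g); last by move=> x; exact: smooth_cderive.
  by apply: salg_smooth; exact: smooth_pderiv.
- by exists (fun=> 0); [exact: salg_cst|move=> x; exact: cderive_cst].
- have [h' sh' dh] := smooth1_derive sh.
  exists (fun x => (h' (x j 0))%:C * ((j == i)%:R)%:C).
    by apply: salg_mul; [exact: salg_coord|exact: salg_cst].
  move=> x; split; rewrite -realCM; last exact: is_derive_cst.
  exact: is_derive_coord.
- exists (fun x => 'i * (xi i 0)%:C * cis (dotp x xi)).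
    by apply: salg_mul; [exact: salg_cst|exact: salg_wave].
  by move=> x; exact: cderive_wave.
- exists (fun x => f' x + g' x); first exact: salg_add.
  by move=> x; exact: cderiveD.
- exists (fun x => f x * g' x + f' x * g x).
    by apply: salg_add; exact: salg_mul.
  by move=> x; exact: cderiveM.
- exists (fun x => conjc (g' x)); first exact: salg_conj.
  move=> x; have [g1 g2] := dg x; split.
    by under eq_fun do rewrite Re_conjc; rewrite Re_conjc.
  by under eq_fun do rewrite Im_conjc; rewrite Im_conjc; exact: is_deriveN.
Qed.

Lemma salg_ccont g : salg g -> ccont g.
Proof.
elim=> {g} [g sg|c|j h sh|xi|f g sf [f1 f2] sg [g1 g2]|f g sf [f1 f2] sg [g1 g2]|g sg [g1 g2]].
- exact: smooth_ccont.
- by split; exact: cont_cst.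
- split; last exact: cont_cst.
  by apply: cont_comp; [exact: continuous_coord|exact: smooth1_continuous].
- by split; apply: cont_comp; [exact: continuous_dotp|exact: continuous_cos|exact: continuous_dotp|exact: continuous_sin].
- split.
    by under eq_fun do rewrite ReD; exact: contD.
  by under eq_fun do rewrite ImD; exact: contD.
- split.
    by under eq_fun do rewrite ReM; apply: contB; exact: contM.
  by under eq_fun do rewrite ImM; apply: contD; exact: contM.
- split.
    by under eq_fun do rewrite Re_conjc.
  by under eq_fun do rewrite Im_conjc; exact: contN.
Qed.

Lemma salgP g : salg g <-> smooth g.
Proof.
split; last exact: salg_smooth.
move=> sg; have H s : salg (pderivs s g).
  elim: s => //= i s IH; have [g' sg' dg] := salg_cderive i IH.
  by rewrite (cderive_pderiv dg).
move=> s; have [c1 c2] := salg_ccont (H s); split => // i x.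
have [g' _ /(_ x)[d1 d2]] := salg_cderive i (H s).
by split; [case: d1|case: d2].
Qed.

Lemma smoothM f g : smooth f -> smooth g -> smooth (fun x => f x * g x).
Proof. by move=> /salgP sf /salgP sg; apply/salgP; exact: salg_mul. Qed.

Lemma smoothD f g : smooth f -> smooth g -> smooth (fun x => f x + g x).
Proof. by move=> /salgP sf /salgP sg; apply/salgP; exact: salg_add. Qed.

Lemma smooth_cst c : smooth (fun _ : 'cV[R]_n => c).
Proof. by apply/salgP; exact: salg_cst. Qed.

Lemma smoothZ c g : smooth g -> smooth (fun x => c * g x).
Proof. by move=> sg; exact: (smoothM (smooth_cst c) sg). Qed.

Lemma smoothB f g : smooth f -> smooth g -> smooth (fun x => f x - g x).
Proof.
move=> sf sg; have -> : (fun x => f x - g x) = (fun x => f x + -1 * g x).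
  by apply/funext => x; rewrite mulN1r.
exact: (smoothD sf (smoothZ (-1) sg)).
Qed.

Lemma smooth_conj g : smooth g -> smooth (fun x => conjc (g x)).
Proof. by move=> /salgP sg; apply/salgP; exact: salg_conj. Qed.

Lemma smooth_wave (xi : 'cV[R]_n) : smooth (fun x => cis (dotp x xi)).
Proof. by apply/salgP; exact: salg_wave. Qed.

Lemma pderivD i f g : smooth f -> smooth g ->
  pderiv i (fun x => f x + g x) = (fun x => pderiv i f x + pderiv i g x).
Proof.
move=> sf sg; apply: cderive_pderiv => x.
exact: (cderiveD (smooth_cderive i x sf) (smooth_cderive i x sg)).
Qed.

Lemma pderivM i f g : smooth f -> smooth g ->
  pderiv i (fun x => f x * g x) = (fun x => f x * pderiv i g x + pderiv i f x * g x).
Proof.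
move=> sf sg; apply: cderive_pderiv => x.
exact: (cderiveM (smooth_cderive i x sf) (smooth_cderive i x sg)).
Qed.

Lemma pderivZ i c g : smooth g -> pderiv i (fun x => c * g x) = (fun x => c * pderiv i g x).
Proof.
move=> sg; apply: cderive_pderiv => x.
have := cderiveM (cderive_cst i c x) (smooth_cderive i x sg).
by rewrite mul0r addr0.
Qed.

Lemma pderiv_wave i (xi : 'cV[R]_n) : pderiv i (fun x => cis (dotp x xi)) =
  (fun x => 'i * (xi i 0)%:C * cis (dotp x xi)).
Proof. by apply: cderive_pderiv => x; exact: cderive_wave. Qed.

Lemma pderivsB s f g : smooth f -> smooth g ->
  pderivs s (fun x => f x - g x) = (fun x => pderivs s f x - pderivs s g x).
Proof.
move=> sf sg; have E (a b : 'cV[R]_n -> R[i]) : (fun x => a x - b x) = (fun x => a x + -1 * b x).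
  by apply/funext => x; rewrite mulN1r.
elim: s => //= i s ->; have sf' := smooth_pderivs s sf; have sg' := smooth_pderivs s sg.
by rewrite !E (pderivD i sf' (smoothZ (-1) sg')) (pderivZ i (-1) sg').
Qed.

Definition tens (c : 'I_n -> R -> R) (x : 'cV[R]_n) : R[i] := \prod_i (c i (x i 0))%:C.

Lemma smooth_tens c : (forall i, smooth1 (c i)) -> smooth (tens c).
Proof.
move=> sc; apply/salgP; rewrite /tens; elim: (index_enum _) => [|i s IH].
  by under eq_fun do rewrite big_nil; exact: salg_cst.
under eq_fun do rewrite big_cons; apply: salg_mul => //.
exact: salg_coord.
Qed.

End SmoothAlgebra.

(** * Supports and test functions *)

Section Supports.
Context {R : realType} {n : nat}.
Implicit Types (f g : 'cV[R]_n -> R[i]) (U : set 'cV[R]_n).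

Lemma fsupp_nz g x : g x != 0 -> fsupp g x.
Proof. by move=> gx; apply: subset_closure. Qed.

Lemma fsupp_out g x : ~ fsupp g x -> \forall y \near x, g y = 0.
Proof.
move=> gx; have oC : open (~` fsupp g) by apply: closed_openC; exact: closed_closure.
have := open_nbhs_nbhs (conj oC gx); apply: filterS => y ny.
by apply/eqP; apply: contrapT => gy; apply: ny; apply: fsupp_nz; apply/negP.
Qed.

Lemma fsuppS f g : (forall x, g x = 0 -> f x = 0) -> fsupp f `<=` fsupp g.
Proof.
move=> h; apply: closureS => x /= /eqP fx; apply/eqP => gx; apply: fx.
exact: h.
Qed.

Lemma fsupp_sub_closed g (K : set 'cV[R]_n) : closed K -> (forall x, ~ K x -> g x = 0) ->
  fsupp g `<=` K.
Proof.
move=> cK h; rewrite [X in _ `<=` X](iffLR (closure_id _) cK).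
apply: closureS => x /= gx; apply: contrapT => /h /eqP.
by rewrite (negbTE gx).
Qed.

Lemma fsupp_pderiv i g : fsupp (pderiv i g) `<=` fsupp g.
Proof.
apply: fsupp_sub_closed; first exact: closed_closure.
move=> x /fsupp_out gx; apply: complex_ext.
  transitivity ('D_(basis_vec i) (fun _ : 'cV[R]_n => 0 : R) x); last exact: derive_cst.
  by apply: near_eq_derive; apply: filterS gx => y ->.
transitivity ('D_(basis_vec i) (fun _ : 'cV[R]_n => 0 : R) x); last exact: derive_cst.
by apply: near_eq_derive; apply: filterS gx => y ->.
Qed.

Lemma C0inftyS U V g : U `<=` V -> C0infty U g -> C0infty V g.
Proof. by move=> UV [h1 h2 h3]; split => // x /h3 /UV. Qed.

Lemma C0infty_sub U g h : C0infty U g -> smooth h -> fsupp h `<=` fsupp g -> C0infty U h.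
Proof.
move=> [h1 h2 h3] sh hg; split => //; last by move=> x /hg /h3.
by apply: subclosed_compact h2 hg; exact: closed_closure.
Qed.

Lemma C0infty_pderivs U s g : C0infty U g -> C0infty U (pderivs s g).
Proof.
elim: s => //= i s IH Cg; have {}IH := IH Cg; apply: (C0infty_sub IH).
  by case: IH => h _ _; exact: smooth_pderiv.
exact: fsupp_pderiv.
Qed.

Lemma C0inftyMr U f g : C0infty U f -> smooth g -> C0infty U (fun x => f x * g x).
Proof.
move=> Cf sg; apply: (C0infty_sub Cf); first by case: Cf => sf _ _; exact: (smoothM sf sg).
by apply: fsuppS => x ->; rewrite mul0r.
Qed.

Lemma C0inftyZ U c f : C0infty U f -> C0infty U (fun x => c * f x).
Proof.
move=> Cf; apply: (C0infty_sub Cf); first by case: Cf => sf _ _; exact: (smoothZ c sf).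
by apply: fsuppS => x ->; rewrite mulr0.
Qed.

Lemma C0infty_conj U f : C0infty U f -> C0infty U (fun x => conjc (f x)).
Proof.
move=> Cf; apply: (C0infty_sub Cf); first by case: Cf => sf _ _; exact: (smooth_conj sf).
by apply: fsuppS => x ->; rewrite conjc0.
Qed.

Lemma C0inftyD U f g : C0infty U f -> C0infty U g -> C0infty U (fun x => f x + g x).
Proof.
move=> [f1 f2 f3] [g1 g2 g3].
have sub : fsupp (fun x => f x + g x) `<=` fsupp f `|` fsupp g.
  apply: fsupp_sub_closed; first by apply: closedU; exact: closed_closure.
  move=> x /not_orP[nf ng]; have -> : f x = 0.
    by apply/eqP; apply: contrapT => /negP/fsupp_nz.
  by rewrite add0r; apply/eqP; apply: contrapT => /negP/fsupp_nz.
split; first exact: (smoothD f1 g1).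
- by apply: subclosed_compact sub; [exact: closed_closure|exact: compactU].
- by move=> x /sub[/f3|/g3].
Qed.

Lemma C0inftyB U f g : C0infty U f -> C0infty U g -> C0infty U (fun x => f x - g x).
Proof.
move=> Cf Cg; have -> : (fun x => f x - g x) = (fun x => f x + -1 * g x).
  by apply/funext => x; rewrite mulN1r.
exact: (C0inftyD Cf (C0inftyZ (-1) Cg)).
Qed.

Lemma C0infty0 U : C0infty U (fun=> 0).
Proof.
have e : fsupp (fun=> 0 : R[i]) `<=` (set0 : set 'cV[R]_n).
  by apply: fsupp_sub_closed; first exact: closed0.
split; first exact: smooth_cst.
- by apply: subclosed_compact e; [exact: closed_closure|exact: compact0].
- by move=> x /e.
Qed.

Lemma C0infty_bounded U g : C0infty U g -> exists r M, [/\ 0 <= r, 0 <= M,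
  forall x, cmod (g x) <= M & forall x, g x != 0 -> `|x| <= r].
Proof.
move=> [sg cg _]; have [c1 c2] := smooth_ccont sg.
have bd (h : 'cV[R]_n -> R) : continuous h -> exists M, forall x, fsupp g x -> `|h x| <= M.
  move=> ch; have := continuous_compact (continuous_subspaceT ch) cg.
  move=> /compact_bounded[M [_ hM]]; exists (M + 1) => x gx.
  by apply: (hM (M + 1)); [rewrite ltrDl|exists x].
have [M1 h1] := bd _ c1; have [M2 h2] := bd _ c2.
have [r [_ hr]] := compact_bounded cg.
exists (`|r| + 1), (`|M1| + `|M2|); split => [||x|x gx]; rewrite ?addr_ge0//.
  have [->|gx] := eqVneq (g x) 0; first by rewrite cmod0 addr_ge0.
  rewrite (le_trans (cmod_le _))// lerD//.
    by rewrite (le_trans (h1 _ (fsupp_nz gx)))// ler_norm.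
  by rewrite (le_trans (h2 _ (fsupp_nz gx)))// ler_norm.
apply: (hr (`|r| + 1)); first by rewrite (le_lt_trans (ler_norm r))// ltrDl.
exact: fsupp_nz.
Qed.

Lemma citg_bounded_support g (r M : R) : ccont g -> (forall x, cmod (g x) <= M) ->
  (forall x, g x != 0 -> `|x| <= r) -> citg (lebesgueRn n) (fun u => g (vec u)).
Proof.
move=> /ccont_cmeas mg gM gr; have [m1 m2] := mg.
split; apply: (itg_bounded_support (M := M) (r := r)) => //.
- by move=> u; rewrite (le_trans (ler_Re_cmod _)).
- by move=> u h; apply: gr; apply: contra h => /eqP ->.
- by move=> u; rewrite (le_trans (ler_Im_cmod _)).
- by move=> u h; apply: gr; apply: contra h => /eqP ->.
Qed.

Lemma C0infty_citg U g : C0infty U g -> citg (lebesgueRn n) (fun u => g (vec u)).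
Proof.
move=> Cg; have [r [M [_ _ gM gr]]] := C0infty_bounded Cg.
by apply: citg_bounded_support gM gr; apply: smooth_ccont; case: Cg.
Qed.

(** The box is the image under transposition of a product of segments of row vectors. *)
Lemma compact_box (a : 'cV[R]_n) (r : R) : compact [set x : 'cV[R]_n | forall i, `|x i 0 - a i 0| <= r].
Proof.
pose B := [set v : 'rV[R]_n | forall i, `[a i 0 - r, a i 0 + r]%classic (v ord0 i)].
have cB : compact B by apply: (@rV_compact R n (fun i => `[a i 0 - r, a i 0 + r]%classic)) => i; exact: segment_compact.
have ct : continuous (fun v : 'rV[R]_n => v^T).
  apply: (@lipschitz_normed_continuous _ _ _ _ 1) => v w; rewrite mul1r.
  apply: ler_cV_norm => // i; rewrite !mxE [leRHS]/Num.norm/= mx_normrE.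
  have := le_bigmax (0 : R) (fun ij : 'I_1 * 'I_n => `|(v - w) ij.1 ij.2|) (0, i).
  by rewrite /= !mxE.
have -> : [set x : 'cV[R]_n | forall i, `|x i 0 - a i 0| <= r] = [set v^T | v in B].
  apply/seteqP; split => x /=.
    move=> h; exists x^T; last by rewrite trmxK.
    by move=> i; rewrite /= in_itv/= mxE; have := h i; rewrite ler_distl.
  by move=> [v vB <-] i; rewrite mxE ler_distl; have := vB i; rewrite /= in_itv.
by apply: continuous_compact => //; exact: continuous_subspaceT.
Qed.

Lemma closed_box (a : 'cV[R]_n) (r : R) : closed [set x : 'cV[R]_n | forall i, `|x i 0 - a i 0| <= r].
Proof. by apply: compact_closed; [exact: norm_hausdorff|exact: compact_box]. Qed.

Lemma C0infty_tens U (c : 'I_n -> R -> R) (a : 'cV[R]_n) (r : R) :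
  (forall i, smooth1 (c i)) ->
  (forall i t, r < `|t - a i 0| -> c i t = 0) ->
  [set x : 'cV[R]_n | forall i, `|x i 0 - a i 0| <= r] `<=` U -> C0infty U (tens c).
Proof.
move=> sc hc BU.
have sub : fsupp (tens c) `<=` [set x : 'cV[R]_n | forall i, `|x i 0 - a i 0| <= r].
  apply: fsupp_sub_closed; first exact: closed_box.
  move=> x /existsNP[i /negP]; rewrite -ltNge => h.
  by rewrite /tens (bigD1 i)//= hc// mul0r.
split; first exact: smooth_tens.
- by apply: subclosed_compact sub; [exact: closed_closure|exact: compact_box].
- by move=> x /sub /BU.
Qed.

End Supports.

(** * The Euclidean norm and Peetre's inequality *)

Section Euclid.
Context {R : realType} {d : nat}.
Implicit Types (x y z k : 'cV[R]_d).

Lemma dotp_ge0 x : 0 <= dotp x x.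
Proof. by apply: sumr_ge0 => i _; rewrite -expr2 sqr_ge0. Qed.

Lemma enorm_ge0 x : 0 <= enorm x. Proof. exact: sqrtr_ge0. Qed.

Lemma enorm_sqr x : enorm x ^+ 2 = dotp x x.
Proof. by rewrite sqr_sqrtr// dotp_ge0. Qed.

Lemma enormZ a x : enorm (a *: x) = `|a| * enorm x.
Proof.
by rewrite /enorm dotpZl dotpZr mulrA -expr2 sqrtrM ?sqr_ge0// sqrtr_sqr.
Qed.

Lemma enormN x : enorm (- x) = enorm x.
Proof. by rewrite -scaleN1r enormZ normrN1 mul1r. Qed.

Lemma coord_le_enorm x i : `|x i 0| <= enorm x.
Proof.
rewrite -sqrtr_sqr ler_wsqrtr// /dotp (bigD1 i)//= -expr2 lerDl.
by apply: sumr_ge0 => j _; rewrite -expr2 sqr_ge0.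
Qed.

Lemma norm_le_enorm x : `|x| <= enorm x.
Proof. by apply: ler_cV_norm => [|i]; [exact: enorm_ge0|exact: coord_le_enorm]. Qed.

Lemma cauchy_schwarz x y : dotp x y <= enorm x * enorm y.
Proof.
have [y0|y0] := eqVneq (dotp y y) 0.
  have y00 i : y i 0 = 0.
    apply/eqP; rewrite -normr_eq0 eq_le normr_ge0 andbT (le_trans (coord_le_enorm y i))//.
    by rewrite /enorm y0 sqrtr0.
  rewrite (_ : dotp x y = 0) ?mulr_ge0 ?enorm_ge0//.
  by rewrite /dotp big1// => i _; rewrite y00 mulr0.
have yy : 0 < dotp y y by rewrite lt_neqAle eq_sym y0 dotp_ge0.
have h : dotp x y ^+ 2 <= dotp x x * dotp y y.
  (* Expanding this square gives the inequality after division by |y|^2. *)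
  have := dotp_ge0 (dotp y y *: x - dotp x y *: y).
  rewrite !(dotpBl, dotpBr, dotpZl, dotpZr) (dotpC y x) => h.
  rewrite -(ler_pM2l yy) -subr_ge0; apply: le_trans h _.
  by rewrite le_eqVlt; apply/orP; left; apply/eqP; ring.
rewrite -sqrtrM ?dotp_ge0// (le_trans (ler_norm _))// -sqrtr_sqr.
by rewrite ler_wsqrtr.
Qed.

Lemma enormD x y : enorm (x + y) <= enorm x + enorm y.
Proof.
rewrite -(@ler_pXn2r _ 2)// ?nnegrE ?enorm_ge0 ?addr_ge0 ?enorm_ge0//.
rewrite sqrrD !enorm_sqr dotpDl !dotpDr (dotpC y x).
have := cauchy_schwarz x y; set a := dotp x y; set b := enorm x * enorm y => ab.
by rewrite mulr2n; lra.
Qed.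

Lemma enorm_le_mono x y : (forall i, `|x i 0| <= `|y i 0|) -> enorm x <= enorm y.
Proof.
move=> h; rewrite ler_wsqrtr// ler_sum// => i _.
by rewrite -!expr2 -(real_normK (num_real (x i 0))) -(real_normK (num_real (y i 0))) lerXn2r ?nnegrE.
Qed.

Lemma sum_le_enorm x : \sum_i `|x i 0| <= d%:R * enorm x.
Proof.
rewrite (le_trans (ler_sum _ (fun i _ => coord_le_enorm x i)))//.
by rewrite sumr_const card_ord mulr_natl.
Qed.

Definition wt x := 1 + enorm x.

Lemma wt_ge1 x : 1 <= wt x. Proof. by rewrite lerDl enorm_ge0. Qed.
Lemma wt_gt0 x : 0 < wt x. Proof. exact: lt_le_trans (wt_ge1 x). Qed.
Lemma wt_ge0 x : 0 <= wt x. Proof. exact: ltW (wt_gt0 x). Qed.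

Lemma wtD x y : wt (x + y) <= wt x * wt y.
Proof.
rewrite /wt mulrDl mul1r mulrDr mulr1 addrA; have := enormD x y.
have := mulr_ge0 (enorm_ge0 x) (enorm_ge0 y).
by move: (enorm x) (enorm y) (enorm (x + y)) => a b c; lra.
Qed.

Lemma wtN x : wt (- x) = wt x. Proof. by rewrite /wt enormN. Qed.

Lemma powR_wt_le (s : R) (N : nat) x : `|s| <= N%:R -> wt x `^ s <= wt x ^+ N.
Proof.
move=> sN; rewrite -powR_mulrn ?wt_ge0//.
by apply: ler_powR; [exact: wt_ge1|exact: le_trans (ler_norm s) sN].
Qed.

(** Peetre's inequality. The exponent |s| on [wt x] is rounded up to a natural number, since only
    natural powers are integrated later. For s < 0 the submultiplicativity is applied to k = (x + k)
    - x. *)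
Lemma peetre (s : R) (N : nat) x k : `|s| <= N%:R ->
  wt (x + k) `^ s <= wt k `^ s * wt x ^+ N.
Proof.
move=> sN; have [s0|s0] := leP 0 s.
  apply: (@le_trans _ _ ((wt x * wt k) `^ s)).
    by apply: ge0_ler_powR => //; rewrite ?nnegrE ?mulr_ge0 ?wt_ge0// wtD.
  rewrite powRM ?wt_ge0// mulrC ler_wpM2l ?powR_ge0//.
  exact: powR_wt_le.
have h : wt k <= wt (x + k) * wt x.
  by have := wtD (x + k) (- x); rewrite addrAC subrr add0r wtN.
have h2 : wt k `^ (- s) <= wt (x + k) `^ (- s) * wt x `^ (- s).
  rewrite -powRM ?wt_ge0//; apply: ge0_ler_powR => //; rewrite ?nnegrE ?mulr_ge0 ?wt_ge0//.
  by rewrite oppr_ge0 ltW.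
rewrite -(opprK s) !(powRN _ (- s)).
have p0 y : 0 < wt y `^ (- s) by rewrite powR_gt0// wt_gt0.
rewrite (ler_pdivlMl _ _ (p0 _)) (ler_pdivrMr _ _ (p0 _)); apply: (le_trans h2).
by rewrite mulrC ler_wpM2r ?powR_ge0//; apply: powR_wt_le; rewrite normrN.
Qed.

(** Reduces weighted integrals over R^d of tensor products to one-dimensional ones. *)
Lemma wt_le_prod x : wt x <= \prod_i (1 + `|x i 0|).
Proof.
have h1 : enorm x <= \sum_i `|x i 0|.
  rewrite -(@ler_pXn2r _ 2)// ?nnegrE ?enorm_ge0 ?sumr_ge0// enorm_sqr.
  rewrite expr2 big_distrl/= ler_sum// => i _.
  rewrite -expr2 -(real_normK (num_real (x i 0))) expr2 ler_wpM2l//.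
  by rewrite (bigD1 i)//= lerDl sumr_ge0.
apply: (@le_trans _ _ (1 + \sum_i `|x i 0|)); first by rewrite lerD2l.
rewrite /wt; elim: (index_enum _) => [|i s IH]; first by rewrite !big_nil addr0.
rewrite !big_cons mulrDl mul1r.
have h2 : 1 <= \prod_(j <- s) (1 + `|x j 0|).
  by elim/big_ind : _ => [//|a b a1 b1|j _]; [rewrite -[leLHS]mulr1 ler_pM|rewrite lerDl].
have h3 : `|x i 0| <= `|x i 0| * \prod_(j <- s) (1 + `|x j 0|) by rewrite ler_peMr.
by move: IH h3; lra.
Qed.

End Euclid.

Lemma cont_compT (R : realType) (T U : topologicalType) (f : T -> U) (h : U -> R) :
  continuous f -> continuous h -> continuous (fun x => h (f x)).
Proof. by move=> cf ch x; apply: (continuous_comp (f := f)); [exact: cf|exact: ch]. Qed.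

Lemma is_derive_to_line (R : realType) n (f : 'cV[R]_n -> R) x v (df : R) :
  is_derive x v f df -> is_derive (0 : R) 1 (fun s : R => f (s *: v + x)) df.
Proof. by move=> h; apply/is_derive_line; rewrite scale0r add0r. Qed.

(** * Pointwise estimates for symbols *)

Section SymbolSections.
Context {R : realType} {d n : nat}.
Implicit Types (x y k eta : 'cV[R]_d).

Lemma col_mx_line2 x xi (i : 'I_d) (t : R) :
  t *: basis_vec (rshift d i) + col_mx x xi = col_mx x (t *: basis_vec i + xi).
Proof.
apply/matrixP => a b; rewrite !mxE; case: split_ordP => c ac; rewrite ?mxE ac.
  by rewrite eq_lrshift mulr0 add0r.
by rewrite eq_rshift.
Qed.

Lemma col_mx_line1 x xi (i : 'I_d) (t : R) :
  t *: basis_vec (lshift d i) + col_mx x xi = col_mx (t *: basis_vec i + x) xi.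
Proof.
apply/matrixP => a b; rewrite !mxE; case: split_ordP => c ac; rewrite ?mxE ac.
  by rewrite eq_lshift.
by rewrite eq_rlshift mulr0 add0r.
Qed.

Lemma continuous_col_mx x : continuous (fun xi : 'cV[R]_d => col_mx x xi).
Proof.
apply: (@lipschitz_normed_continuous _ _ _ _ 1) => v w; rewrite mul1r.
apply: ler_cV_norm => // i; rewrite !mxE; case: split_ordP => c _.
  by rewrite subrr normr0.
by have := coord_le_norm (v - w) c; rewrite !mxE.
Qed.

Section scalar.
Variables (sigma : 'cV[R]_(d + d) -> R[i]).
Hypothesis ss : smooth sigma.

Lemma smooth_section_ccont x : ccont (fun xi => sigma (col_mx x xi)).
Proof.
have [c1 c2] := smooth_ccont ss; split.
  exact: (cont_compT (@continuous_col_mx x) c1).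
exact: (cont_compT (@continuous_col_mx x) c2).
Qed.

Lemma section_cderive2 x xi i :
  cderive i (fun xi => sigma (col_mx x xi)) xi (pderiv (rshift d i) sigma (col_mx x xi)).
Proof.
have [h1 h2] := smooth_cderive (rshift d i) (col_mx x xi) ss.
split; apply: is_derive_line0.
  rewrite (_ : (fun s : R => _) = (fun s : R => Re (sigma (s *: basis_vec (rshift d i) + col_mx x xi)))).
    exact: (is_derive_to_line h1).
  by apply/funext => s; rewrite col_mx_line2.
rewrite (_ : (fun s : R => _) = (fun s : R => Im (sigma (s *: basis_vec (rshift d i) + col_mx x xi)))).
  exact: (is_derive_to_line h2).
by apply/funext => s; rewrite col_mx_line2.
Qed.

Lemma section_cderive1 x xi i :
  cderive i (fun x => sigma (col_mx x xi)) x (pderiv (lshift d i) sigma (col_mx x xi)).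
Proof.
have [h1 h2] := smooth_cderive (lshift d i) (col_mx x xi) ss.
split; apply: is_derive_line0.
  rewrite (_ : (fun s : R => _) = (fun s : R => Re (sigma (s *: basis_vec (lshift d i) + col_mx x xi)))).
    exact: (is_derive_to_line h1).
  by apply/funext => s; rewrite col_mx_line1.
rewrite (_ : (fun s : R => _) = (fun s : R => Im (sigma (s *: basis_vec (lshift d i) + col_mx x xi)))).
  exact: (is_derive_to_line h2).
by apply/funext => s; rewrite col_mx_line1.
Qed.

End scalar.

Lemma cmod_lipschitz_box (g : 'cV[R]_d -> R[i]) (g' : 'I_d -> 'cV[R]_d -> R[i]) (M : R) x y :
  (forall i (z : 'cV[R]_d), cderive i g z (g' i z)) ->
  (forall i (z : 'cV[R]_d), (forall j, `|z j 0 - y j 0| <= `|x j 0 - y j 0|) -> cmod (g' i z) <= M) ->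
  cmod (g x - g y) <= 2 * M * \sum_i `|x i 0 - y i 0|.
Proof.
move=> dg bg; rewrite (le_trans (cmod_le _))// -mulrA mulr_natl mulr2n ReB ImB.
apply: lerD.
  apply: (@lipschitz_box _ _ (fun z => Re (g z)) (fun i z => Re (g' i z))) => i z.
    by have [] := dg i z.
  by move=> /(bg i); exact: le_trans (ler_Re_cmod _).
apply: (@lipschitz_box _ _ (fun z => Im (g z)) (fun i z => Im (g' i z))) => i z.
  by have [] := dg i z.
by move=> /(bg i); exact: le_trans (ler_Im_cmod _).
Qed.

Section symbol.
Variables (s : R) (Sigma : 'cV[R]_d -> 'cV[R]_d -> 'M[R[i]]_n).
Hypothesis sS : symbol_class s Sigma.
Variables (j l : 'I_n).

Let sigma (z : 'cV[R]_(d + d)) := Sigma (usubmx z) (dsubmx z) j l.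
Let sigmaE x xi : sigma (col_mx x xi) = Sigma x xi j l.
Proof. by rewrite /sigma col_mxKu col_mxKd. Qed.
Let ss : smooth sigma. Proof. by have [] := sS j l. Qed.

Lemma symbol_ccont x : ccont (fun xi => Sigma x xi j l).
Proof.
rewrite (_ : (fun xi => _) = (fun xi => sigma (col_mx x xi))); last by apply/funext => xi; rewrite sigmaE.
exact: (smooth_section_ccont ss).
Qed.

Lemma symbol_bound : exists2 C, 0 <= C & forall x xi, cmod (Sigma x xi j l) <= C * wt xi `^ s.
Proof.
have [_ /(_ [::] [::])[C hC]] := sS j l.
exists `|C| => // x xi; rewrite -sigmaE; apply: (le_trans (hC x xi)).
by rewrite subr0 ler_wpM2r ?powR_ge0// ler_norm.
Qed.

(** A derivative in x does not change the order, so the increment carries the same weight as the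
    symbol. *)
Lemma symbol_lipschitz1 : exists2 C, 0 <= C & forall x y xi,
  cmod (Sigma x xi j l - Sigma y xi j l) <= C * wt xi `^ s * \sum_i `|x i 0 - y i 0|.
Proof.
have [_ hS] := sS j l.
have /choice[C hC] : forall i, exists C, forall x xi,
    cmod (pderiv (lshift d i) sigma (col_mx x xi)) <= C * wt xi `^ s.
  by move=> i; have [C hC] := hS [::] [:: i]; exists C => x xi; have := hC x xi; rewrite subr0.
exists (2 * \sum_i `|C i|) => [|x y xi]; first by rewrite mulr_ge0// sumr_ge0.
rewrite -!sigmaE -[2 * _ * _]mulrA.
apply: (cmod_lipschitz_box (g := fun x => sigma (col_mx x xi)) (fun i z => section_cderive1 ss z xi i)) => i z _.
apply: (le_trans (hC i z xi)); rewrite ler_wpM2r ?powR_ge0// (le_trans (ler_norm _))//.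
by rewrite (bigD1 i)//= lerDl sumr_ge0.
Qed.

(** A derivative in xi lowers the order by one. On the box spanned by k and eta + k Peetre's
    inequality moves its weight to k at the price of N powers of [wt eta]; one further power pays
    for the length of eta. *)
Lemma symbol_lipschitz2 (N : nat) : `|s - 1| <= N%:R -> exists2 C, 0 <= C & forall x eta k,
  cmod (Sigma x (eta + k) j l - Sigma x k j l) <= C * wt k `^ (s - 1) * wt eta ^+ N.+1.
Proof.
move=> sN; have [_ hS] := sS j l.
have /choice[C hC] : forall i, exists C, forall x xi,
    cmod (pderiv (rshift d i) sigma (col_mx x xi)) <= C * wt xi `^ (s - 1).
  by move=> i; have [C hC] := hS [:: i] [::]; exists C => x xi; have := hC x xi.
pose C0 := \sum_i `|C i|; have C00 : 0 <= C0 by rewrite sumr_ge0.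
exists (2 * C0 * d%:R) => [|x eta k]; first by rewrite !mulr_ge0.
rewrite -!sigmaE.
have := @cmod_lipschitz_box (fun xi => sigma (col_mx x xi))
  (fun i xi => pderiv (rshift d i) sigma (col_mx x xi)) (C0 * (wt k `^ (s - 1) * wt eta ^+ N)) (eta + k) k
  (fun i z => section_cderive2 ss x z i).
have e i : (eta + k) i 0 - k i 0 = eta i 0 by rewrite mxE addrK.
under eq_bigr do rewrite e.
move=> H; apply: (le_trans (H _)).
  move=> i z hz; apply: (le_trans (hC i x z)).
  have zk : wt z `^ (s - 1) <= wt k `^ (s - 1) * wt eta ^+ N.
    rewrite -{1}(subrK k z); apply: (le_trans (peetre _ _ sN)).
    rewrite ler_wpM2l ?powR_ge0// lerXn2r ?nnegrE ?wt_ge0// lerD2l.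
    apply: enorm_le_mono => a; have := hz a; rewrite e.
    by rewrite !mxE.
  have Ci : C i <= C0 by rewrite (le_trans (ler_norm _))// /C0 (bigD1 i)//= lerDl sumr_ge0.
  apply: (@le_trans _ _ (C0 * wt z `^ (s - 1))); first by rewrite ler_wpM2r ?powR_ge0.
  by rewrite ler_wpM2l.
have := sum_le_enorm eta; set S := \sum_i _ => hS1.
have hS2 : S <= d%:R * wt eta.
  by rewrite (le_trans hS1)// ler_wpM2l// /wt lerDr.
apply: (@le_trans _ _ (2 * (C0 * (wt k `^ (s - 1) * wt eta ^+ N)) * (d%:R * wt eta))).
  by rewrite ler_wpM2l// !mulr_ge0 ?powR_ge0 ?exprn_ge0 ?wt_ge0.
by rewrite le_eqVlt; apply/orP; left; apply/eqP; rewrite exprS; ring.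
Qed.

End symbol.
End SymbolSections.

(** * Correlations of wave packets *)

Section Translation.
Context {R : realType} {n : nat}.

Definition untuple (k : 'cV[R]_n) : n.-tuple R := [tuple k i 0 | i < n].

Lemma vec_shiftT (k : 'cV[R]_n) (u : n.-tuple R) : vec (shiftT (untuple k) u) = vec u + k.
Proof. by apply/matrixP => i j; rewrite !mxE !tnth_mktuple ord1. Qed.

(** Translation invariance in the vector notation of the integrands, for complex values. *)
Lemma citgC_translate (g : 'cV[R]_n -> R[i]) (k : 'cV[R]_n) :
  citg (lebesgueRn n) (fun u => g (vec u)) ->
  citg (lebesgueRn n) (fun u => g (vec u + k)) /\
  citgC (lebesgueRn n) (fun u => g (vec u + k)) = citgC (lebesgueRn n) (fun u => g (vec u)).
Proof.
move=> [g1 g2].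
have [a1 a2] := itgR_shiftT (untuple k) g1; have [b1 b2] := itgR_shiftT (untuple k) g2.
have E : (fun u : n.-tuple R => g (vec u + k)) = (fun u => g (vec (shiftT (untuple k) u))).
  by apply/funext => u; rewrite vec_shiftT.
rewrite E; split; first by split.
by apply: complex_ext; rewrite ?citgC_Re ?citgC_Im.
Qed.

End Translation.

Section Oscillatory.
Context {R : realType} {d : nat}.
Implicit Types (x y z k : 'cV[R]_d).

Lemma norm_lipschitz_ccont (g : 'cV[R]_d -> R[i]) (M : R) : 0 <= M ->
  (forall x y, cmod (g x - g y) <= M * \sum_i `|x i 0 - y i 0|) -> ccont g.
Proof.
move=> M0 h.
have h2 x y : cmod (g x - g y) <= (M * d%:R) * `|x - y|.
  rewrite (le_trans (h x y))// -mulrA ler_wpM2l//.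
  rewrite (@le_trans _ _ (\sum_(i < d) `|x - y|))//; last by rewrite sumr_const card_ord mulr_natl.
  rewrite ler_sum// => i _.
  by have := coord_le_norm (x - y) i; rewrite !mxE.
split; apply: (@lipschitz_normed_continuous _ _ _ _ (M * d%:R)) => x y.
  by rewrite -ReB (le_trans (ler_Re_cmod _)).
by rewrite -ImB (le_trans (ler_Im_cmod _)).
Qed.

Lemma ccontM (f g : 'cV[R]_d -> R[i]) : ccont f -> ccont g -> ccont (fun x => f x * g x).
Proof.
move=> [f1 f2] [g1 g2]; split.
  by under eq_fun do rewrite ReM; apply: contB; exact: contM.
by under eq_fun do rewrite ImM; apply: contD; exact: contM.
Qed.

Lemma ccont_wave (kappa : 'cV[R]_d) : ccont (fun y => cis (- dotp y kappa)).
Proof.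
rewrite (_ : (fun y => _) = (fun y => cis (dotp y (- kappa)))).
  by apply: smooth_ccont; exact: smooth_wave.
by apply/funext => y; rewrite dotpNr.
Qed.

Definition box_volume (r : R) : R :=
  itgR (lebesgueRn d) (fun u : d.-tuple R => \prod_i (\1_(`[- r, r]%classic) (tnth u i) : R)).

Lemma box_volume_ge0 r : 0 <= box_volume r.
Proof. by apply: itgR_ge0 => u; apply: prodr_ge0 => i _; rewrite indicE. Qed.

Lemma citgC_box_bound (g : 'cV[R]_d -> R[i]) (M r : R) : cmeas (fun u => g (vec u)) -> 0 <= M ->
  (forall x, cmod (g x) <= M) -> (forall x, g x != 0 -> `|x| <= r) ->
  cmod (citgC (lebesgueRn d) (fun u => g (vec u))) <= 2 * (M * box_volume r).
Proof.
move=> mg M0 gM gr; have [Ib _] := itg_prodT (fun i : 'I_d => itg_indic_itv r).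
rewrite /box_volume -(itgRZ _ Ib); apply: cmod_citgC mg _ (itgZ M Ib) => u.
have [->|g0] := eqVneq (g (vec u)) 0.
  by rewrite cmod0 mulr_ge0// prodr_ge0// => i _; rewrite indicE.
rewrite big1 ?mulr1// => i _; rewrite indicE mem_set//= in_itv/= -ler_norml.
by rewrite (le_trans _ (gr _ g0))//; have := coord_le_norm (vec u) i; rewrite mxE.
Qed.

(* Translating by half a period pi kappa / |kappa|^2 changes the sign of the wave, so the
   integral is controlled by the increments of g over that distance. *)
Lemma oscillatory_bound (r : R) : exists2 C, 0 <= C &
  forall (g : 'cV[R]_d -> R[i]) (M : R) (kappa : 'cV[R]_d), 0 <= M ->
  (forall x, cmod (g x) <= M) ->
  (forall x y, cmod (g x - g y) <= M * \sum_i `|x i 0 - y i 0|) ->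
  (forall x, g x != 0 -> `|x| <= r) ->
  cmod (citgC (lebesgueRn d) (fun u => cis (- dotp (vec u) kappa) * g (vec u)))
    <= C * M / (1 + enorm kappa).
Proof.
have pi0 := @pi_ge0 R.
pose V1 := 2 * box_volume r; pose V2 := 2 * (d%:R * pi * box_volume (r + pi)).
have V10 : 0 <= V1 by rewrite mulr_ge0 ?box_volume_ge0.
have V20 : 0 <= V2 by rewrite !mulr_ge0 ?box_volume_ge0.
exists (2 * (V1 + V2)) => [|g M kappa M0 gM gL gr]; first by rewrite mulr_ge0// addr_ge0.
have cg : ccont g by exact: norm_lipschitz_ccont gL.
have cF := ccontM (ccont_wave kappa) cg.
pose F y := cis (- dotp y kappa) * g y.
have Fr x : F x != 0 -> `|x| <= r.
  by move=> h; apply: gr; apply: contra h => /eqP g0; rewrite /F g0 mulr0.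
have FM x : cmod (F x) <= M by rewrite cmodM cmod_cis mul1r.
have IF : citg (lebesgueRn d) (fun u => F (vec u)) by exact: citg_bounded_support cF FM Fr.
have k0 := enorm_ge0 kappa.
rewrite ler_pdivlMr ?ltr_pwDl//.
have B1 : cmod (citgC (lebesgueRn d) (fun u => F (vec u))) <= V1 * M.
  by have := citgC_box_bound (ccont_cmeas cF) M0 FM Fr; rewrite /V1 mulrA mulrAC.
have [k1|/ltW k1] := leP (enorm kappa) 1.
  apply: (@le_trans _ _ (V1 * M * 2)); first by rewrite ler_pM ?cmod_ge0 ?addr_ge0//; lra.
  have := mulr_ge0 V20 M0; lra.
have kk : 0 < enorm kappa by exact: lt_le_trans k1.
pose v : 'cV[R]_d := (pi / enorm kappa ^+ 2) *: kappa.
have vk : dotp v kappa = pi by rewrite dotpZl -enorm_sqr divfK// gt_eqF// exprn_gt0.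
have ve : enorm v = pi / enorm kappa.
  rewrite enormZ ger0_norm ?divr_ge0 ?exprn_ge0// expr2; field; by rewrite gt_eqF.
have vpi : enorm v <= pi by rewrite ve ler_pdivrMr// ler_peMr.
have [IFv EFv] := citgC_translate v IF.
pose G y := g y - g (y + v).
have FE y : F (y + v) = - (cis (- dotp y kappa) * g (y + v)).
  have cpi : cis (- pi) = -1 :> R[i].
    by apply: complex_ext; rewrite !ReImE ?cosN ?sinN ?cospi ?sinpi /= ?oppr0.
  by rewrite /F dotpDl vk opprD cisD cpi mulrN1 mulNr.
have Gr x : G x != 0 -> `|x| <= r + pi.
  move=> G0; have [gx|/gr gx] := eqVneq (g x) 0; last by rewrite (le_trans gx)// lerDl.
  have /gr h : g (x + v) != 0.
    by apply: contra G0 => /eqP gv; rewrite /G gx gv subrr.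
  rewrite -(addrK v x) (le_trans (ler_normB _ _))// lerD//.
  exact: le_trans (norm_le_enorm v) vpi.
have GM x : cmod (G x) <= M * (d%:R * (pi / enorm kappa)).
  rewrite (le_trans (gL _ _))// ler_wpM2l// -ve.
  rewrite (le_trans _ (sum_le_enorm v))// ler_sum// => i _.
  by rewrite !mxE opprD addrA subrr add0r normrN.
have cgv : ccont (fun y => g (y + v)).
  apply: (norm_lipschitz_ccont M0) => x y; rewrite (le_trans (gL _ _))// ler_wpM2l// ler_sum// => i _.
  by rewrite !mxE opprD addrACA subrr addr0.
have cG : ccont G.
  by case: cg cgv => [a1 a2] [b1 b2]; split; [under eq_fun do rewrite ReB|under eq_fun do rewrite ImB]; exact: contB.
have cWG := ccontM (ccont_wave kappa) cG.
have K0 : 0 <= M * (d%:R * (pi / enorm kappa)) by rewrite !mulr_ge0 ?invr_ge0.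
have B2 := citgC_box_bound (g := fun y => cis (- dotp y kappa) * G y) (r := r + pi) (ccont_cmeas cWG) K0.
have {B2} : cmod (citgC (lebesgueRn d) (fun u => cis (- dotp (vec u) kappa) * G (vec u))) <=
    2 * (M * (d%:R * (pi / enorm kappa)) * box_volume (r + pi)).
  apply: B2 => x; first by rewrite cmodM cmod_cis mul1r.
  by move=> h; apply: Gr; apply: contra h => /eqP ->; rewrite mulr0.
have -> : citgC (lebesgueRn d) (fun u => cis (- dotp (vec u) kappa) * G (vec u)) =
    2%:C * citgC (lebesgueRn d) (fun u => F (vec u)).
  transitivity (citgC (lebesgueRn d) (fun u => F (vec u) + F (vec u + v))).
    by congr citgC; apply/funext => u; rewrite FE /F /G mulrBr.
  by rewrite citgCD// EFv (_ : 2%:C = 1 + 1 :> R[i]) ?mulrDl ?mul1r//; apply: complex_ext; rewrite !ReImE /=; ring.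
rewrite cmodM cmod_real ger0_norm// ler_pM2l// => B2.
apply: (@le_trans _ _ (M * (d%:R * (pi / enorm kappa)) * box_volume (r + pi) * (2 * enorm kappa))).
  by rewrite ler_pM ?cmod_ge0 ?addr_ge0//; lra.
have -> : M * (d%:R * (pi / enorm kappa)) * box_volume (r + pi) * (2 * enorm kappa) = V2 * M.
  by rewrite /V2; field; rewrite gt_eqF.
by have := mulr_ge0 V10 M0; have := mulr_ge0 V20 M0; lra.
Qed.

End Oscillatory.

(** * Wave packets and their amplitudes *)

Section Amplitude.
Context {R : realType} {d : nat}.
Implicit Types (x y z k : 'cV[R]_d) (tau : 'cV[R]_d -> R[i]).
Variable r0 : R.

Let c := @plateau R r0.
Let sc : smooth1 c. Proof. exact: smooth1_plateau. Qed.
Let supc : supp1 (r0 + 1) c. Proof. by move=> t /ltW; exact: plateau_eq0. Qed.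

Definition cutoff : 'cV[R]_d -> R[i] := tens (fun _ => plateau r0).

(** A plane wave made into a test function. Once r0 exceeds the radius of the support of the field
    strictly, the field does not distinguish it from the plane wave ([dpair_smooth_eq]). *)
Definition probe k x := cutoff x * cis (dotp x k).

Lemma cutoff_eq1 x : `|x| <= r0 -> cutoff x = 1.
Proof.
move=> xr; rewrite /cutoff /tens big1// => i _; rewrite plateau_eq1//.
exact: le_trans (coord_le_norm x i) xr.
Qed.

Lemma C0infty_cutoff : C0infty setT cutoff.
Proof.
apply: (@C0infty_tens _ _ _ _ 0 (r0 + 1)) => // i t; rewrite mxE subr0 => /ltW.
exact: plateau_eq0.
Qed.

Lemma C0infty_probe k : C0infty setT (probe k).
Proof. exact: (C0inftyMr C0infty_cutoff (smooth_wave k)). Qed.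

(** The Fourier transform of [cutoff], by [probe_ft] at k = 0; the product form reflects that
    [cutoff] is a tensor product. *)
Definition cutoff_ft (eta : 'cV[R]_d) : R[i] := \prod_i ft1 (plateau r0) (eta i 0).

Lemma cis_sum I (s : seq I) (a : I -> R) : cis (\sum_(i <- s) a i) = \prod_(i <- s) cis (a i).
Proof. by elim/big_rec2 : _ => [|i y1 y2 _ <-]; rewrite ?cis0 ?cisD. Qed.

Lemma realC_prod I (s : seq I) (a : I -> R) : (\prod_(i <- s) a i)%:C = \prod_(i <- s) (a i)%:C.
Proof. by elim/big_rec2 : _ => [//|i y1 y2 _ <-]; rewrite realCM. Qed.

Lemma probe_ft k xi :
  integralRd (fun x => cis (- dotp x xi) * probe k x) = cutoff_ft (xi - k).
Proof.
have [_ E] := citg_prodT (fun i : 'I_d => citg_ft1 ((xi - k) i 0) (smooth1_continuous sc) supc).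
transitivity (citgC (lebesgueRn d)
  (fun u => \prod_i (cis (- ((xi - k) i 0 * tnth u i)) * (c (tnth u i))%:C))); last exact: E.
rewrite /integralRd -/(citgC _ _); congr citgC; apply/funext => u; rewrite -/(vec u).
rewrite /probe /cutoff /tens mulrCA -cisD.
rewrite (_ : - dotp _ _ + _ = \sum_i (- ((xi - k) i 0 * tnth u i))).
  by rewrite cis_sum -big_split/=; apply: eq_bigr => i _; rewrite [vec u i 0]mxE mulrC.
rewrite /dotp addrC -sumrB; apply: eq_bigr => i _; rewrite !mxE; ring.
Qed.

Lemma cmeas_cutoff_ft : cmeas (fun u : d.-tuple R => cutoff_ft (vec u)).
Proof.
have := cmeas_prodT (fun i : 'I_d => cmeas_ft1_fun (smooth1_continuous sc) supc).
rewrite (_ : (fun u : d.-tuple R => cutoff_ft _) = (fun u => \prod_(i < d) ft1 c (tnth u i)))//.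
by apply/funext => u; apply: eq_bigr => i _; rewrite mxE.
Qed.

Definition ft_moment (N : nat) : R :=
  itgR (lebesgueRn d) (fun u => wt (vec u) ^+ N * cmod (cutoff_ft (vec u))).

Lemma continuous_wt : continuous (@wt R d).
Proof.
apply: contD; first exact: cont_cst.
have : continuous (fun x : 'cV[R]_d => Num.sqrt (dotp x x)); last by [].
apply: cont_comp; last exact: sqrt_continuous.
rewrite /dotp; elim: (index_enum _) => [|i s IH].
  by under eq_fun do rewrite big_nil; exact: cont_cst.
under eq_fun do rewrite big_cons; apply: contD => //.
by apply: contM; exact: continuous_coord.
Qed.

(** The weight is bounded by a product over the coordinates, and each one-dimensional transform
    decays two orders faster than the weight grows. *)
Lemma itg_ft_moment N :
  itg (lebesgueRn d) (fun u => wt (vec u) ^+ N * cmod (cutoff_ft (vec u))).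
Proof.
have [C C0 hC] := ft1_decay N.+2 sc supc.
have I1 : itg lebesgue_measure (fun t : measurableTypeR R => (1 + `|t|) ^+ N * cmod (ft1 c t)).
  apply: (@itg_quadratic_decay _ _ C) => [|t].
    apply: measurable_funM; last exact: cmeas_cmod (cmeas_ft1_fun (smooth1_continuous sc) supc).
    apply: measurable_funX; apply: measurable_funD; first exact: measurable_cst.
    by apply: continuous_measurable_fun; exact: norm_continuous.
  rewrite ger0_norm ?mulr_ge0 ?cmod_ge0 ?exprn_ge0 ?addr_ge0//.
  rewrite mulrAC (le_trans _ (hC t))// ler_wpM2r ?cmod_ge0//.
  rewrite -[N.+2]addn2 exprD ler_wpM2l ?exprn_ge0 ?addr_ge0//.
  rewrite sqrrD expr1n mul1r real_normK ?num_real// lerD2r lerDl.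
  by rewrite mulrn_wge0.
have [I2 _] := itg_prodT (fun i : 'I_d => I1).
apply: (itg_le _ _ I2).
  apply: measurable_funM; last exact: cmeas_cmod cmeas_cutoff_ft.
  by apply: measurable_funX; apply: measurable_continuous_vec; exact: continuous_wt.
move=> u; rewrite ger0_norm ?mulr_ge0 ?cmod_ge0 ?exprn_ge0 ?wt_ge0//.
rewrite big_split/= ler_pM ?cmod_ge0 ?exprn_ge0 ?wt_ge0//; last first.
  by rewrite /cutoff_ft cmod_prod le_eqVlt; apply/orP; left; apply/eqP; apply: eq_bigr => i _; rewrite mxE.
rewrite prodrXl lerXn2r ?nnegrE ?wt_ge0// ?prodr_ge0// ?(le_trans (wt_le_prod _))//.
  rewrite le_eqVlt; apply/orP; left; apply/eqP; apply: eq_bigr => i _; by rewrite mxE.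
Qed.

Lemma ft_moment_ge0 N : 0 <= ft_moment N.
Proof. by apply: itgR_ge0 => u; rewrite mulr_ge0 ?exprn_ge0 ?wt_ge0 ?cmod_ge0. Qed.

(** Up to (2 pi)^-d, the pseudo-differential operator of symbol tau applied to [cutoff], evaluated
    at y. With tau a symbol shifted by k, this is what remains of the operator applied to [probe k]
    after the wave of frequency k is factored out. *)
Definition amp y tau : R[i] :=
  citgC (lebesgueRn d) (fun u => cis (dotp y (vec u)) * (tau (vec u) * cutoff_ft (vec u))).

Lemma ccont_dual_wave y : ccont (fun eta : 'cV[R]_d => cis (dotp y eta)).
Proof.
rewrite (_ : (fun _ => _) = (fun eta => cis (dotp eta y))); last by apply/funext => eta; rewrite dotpC.
exact: smooth_ccont (smooth_wave y).
Qed.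

Lemma cmeas_amp y tau : ccont tau ->
  cmeas (fun u => cis (dotp y (vec u)) * (tau (vec u) * cutoff_ft (vec u))).
Proof.
move=> ct; apply: cmeasM; first exact: ccont_cmeas (ccont_dual_wave y).
by apply: cmeasM; [exact: ccont_cmeas|exact: cmeas_cutoff_ft].
Qed.

Lemma citg_amp y tau (M : R) N : ccont tau -> (forall eta, cmod (tau eta) <= M * wt eta ^+ N) ->
  citg (lebesgueRn d) (fun u => cis (dotp y (vec u)) * (tau (vec u) * cutoff_ft (vec u))).
Proof.
move=> ct hM; apply: (citg_le (cmeas_amp y ct) _ (itgZ M (itg_ft_moment N))) => u.
by rewrite cmodM cmod_cis mul1r cmodM mulrA ler_wpM2r ?cmod_ge0.
Qed.

Lemma amp_diff_bound y1 y2 tau1 tau2 (M M1 M2 : R) N N1 N2 : ccont tau1 -> ccont tau2 ->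
  (forall eta, cmod (tau1 eta) <= M1 * wt eta ^+ N1) ->
  (forall eta, cmod (tau2 eta) <= M2 * wt eta ^+ N2) ->
  (forall eta, cmod (cis (dotp y1 eta) * tau1 eta - cis (dotp y2 eta) * tau2 eta) <= M * wt eta ^+ N) ->
  cmod (amp y1 tau1 - amp y2 tau2) <= 2 * (M * ft_moment N).
Proof.
move=> c1 c2 h1 h2 h; have I1 := citg_amp y1 c1 h1; have I2 := citg_amp y2 c2 h2.
rewrite /amp -(citgCB I1 I2) /ft_moment -(itgRZ _ (itg_ft_moment N)).
apply: cmod_citgC (itgZ _ (itg_ft_moment N)); first exact: cmeasB (cmeas_amp _ c1) (cmeas_amp _ c2).
by move=> u; rewrite !mulrA -mulrBl cmodM ler_wpM2r ?cmod_ge0.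
Qed.

Lemma amp_bound y tau (M : R) N : ccont tau -> (forall eta, cmod (tau eta) <= M * wt eta ^+ N) ->
  cmod (amp y tau) <= 2 * (M * ft_moment N).
Proof.
move=> ct hM; rewrite /ft_moment -(itgRZ _ (itg_ft_moment N)).
apply: cmod_citgC (cmeas_amp y ct) _ (itgZ _ (itg_ft_moment N)) => u.
by rewrite cmodM cmod_cis mul1r cmodM mulrA ler_wpM2r ?cmod_ge0.
Qed.

(** For a constant symbol this is Fourier inversion of the cutoff at a point where the cutoff is
    1. *)
Lemma amp_cst y a : `|y| <= r0 -> amp y (fun=> a) = a * ((2 * pi) ^+ d)%:C.
Proof.
move=> yr; rewrite /amp.
have I i : citg lebesgue_measure (fun t : measurableTypeR R => cis (y i 0 * t) * ft1 c t).
  have If := citg_ft1_fun sc supc.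
  apply: (citg_le _ _ (citg_cmod If)) => [|t]; last by rewrite cmodM cmod_cis mul1r.
  apply: cmeasM (citg_meas If); apply: cmeas_cis; apply: continuous_measurable_fun.
  exact: continuous_scale.
have [I1 E1] := citg_prodT I.
have -> : (fun u : d.-tuple R => cis (dotp y (vec u)) * (a * cutoff_ft (vec u))) =
    (fun u => a * \prod_i (cis (y i 0 * tnth u i) * ft1 c (tnth u i))).
  apply/funext => u; rewrite mulrCA; congr (_ * _).
  rewrite big_split/= -cis_sum /dotp; congr (cis _ * _); apply: eq_bigr => i _; by rewrite mxE.
rewrite (citgCZ _ I1) E1; congr (_ * _).
under eq_bigr => i _ do rewrite (fourier_inversion1 _ sc supc) /c plateau_eq1 ?mulr1 ?(le_trans (coord_le_norm y i))//.
by rewrite -realC_prod prodr_const card_ord.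
Qed.

End Amplitude.

(** * Kernels of pseudo-differential operators on wave packets *)

Section Correlation.
Context {R : realType} {d n : nat}.
Variables (r0 : R) (D : set 'cV[R]_d).
Hypothesis Dr : forall x, D x -> `|x| <= r0.

Lemma C0infty_out (g : 'cV[R]_d -> R[i]) x : C0infty D g -> ~ `|x| <= r0 -> g x = 0.
Proof.
move=> [_ _ gD] xr; apply: contrapT => /eqP gx; apply: xr; apply: Dr; apply: gD.
exact: fsupp_nz.
Qed.

Section symbol.
Variables (s : R) (Sigma : 'cV[R]_d -> 'cV[R]_d -> 'M[R[i]]_n) (j l : 'I_n).
Hypothesis sS : symbol_class s Sigma.
Hypothesis sD : forall xi, C0infty_mx D (fun x => Sigma x xi).

Definition symbol_amp (k y : 'cV[R]_d) : R[i] :=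
  amp r0 y (fun eta => Sigma y (eta + k) j l).

Lemma symbol_out y xi : ~ `|y| <= r0 -> Sigma y xi j l = 0.
Proof. exact: (C0infty_out (sD xi j l)). Qed.

Lemma symbol_shift_ccont y k : ccont (fun eta => Sigma y (eta + k) j l).
Proof.
have ct : continuous (fun eta : 'cV[R]_d => eta + k).
  by apply: (@lipschitz_normed_continuous _ _ _ _ 1) => a b; rewrite mul1r opprD addrACA subrr addr0.
have [c1 c2] := symbol_ccont sS j l y.
by split; [exact: (cont_compT ct c1)|exact: (cont_compT ct c2)].
Qed.

Variable N : nat.
Hypothesis sN : `|s| + 1 <= N%:R.

(** The margin 1 in [sN] lets the same N serve Peetre's inequality for the exponents s and s - 1. *)
Let sN0 : `|s| <= N%:R. Proof. by rewrite (le_trans _ sN)// lerDl. Qed.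
Let sN1 : `|s - 1| <= N%:R.
Proof. by rewrite (le_trans (ler_normB _ _))// normr1. Qed.

Lemma symbol_shift_bound : exists2 C, 0 <= C & forall y eta k,
  cmod (Sigma y (eta + k) j l) <= C * wt k `^ s * wt eta ^+ N.
Proof.
have [C C0 hC] := symbol_bound sS j l; exists C => // y eta k.
rewrite (le_trans (hC _ _))// -mulrA ler_wpM2l//; exact: peetre.
Qed.

Lemma symbol_amp_out k y : ~ `|y| <= r0 -> symbol_amp k y = 0.
Proof.
move=> yr; rewrite /symbol_amp /amp -(citgC0 (lebesgueRn d)); congr citgC; apply/funext => u.
by rewrite symbol_out// mul0r mulr0.
Qed.

(** Size and Lipschitz constant of the amplitude share one bound, the format required by
    [oscillatory_bound]. The variable y enters through the wave and through the symbol;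
    differentiating the wave costs one power of eta, hence the moment of order N + 1. *)
Lemma symbol_amp_bounds : exists2 C, 0 <= C & forall k,
  (forall y, cmod (symbol_amp k y) <= C * wt k `^ s) /\
  (forall x y, cmod (symbol_amp k x - symbol_amp k y) <= C * wt k `^ s * \sum_i `|x i 0 - y i 0|).
Proof.
have [C1 C10 h1] := symbol_shift_bound.
have [C2 C20 h2] := symbol_lipschitz1 sS j l.
have m0 := ft_moment_ge0 (d := d) r0.
exists (2 * (C1 * ft_moment (d := d) r0 N + (2 * C1 + C2) * ft_moment (d := d) r0 N.+1)) => [|k].
  by rewrite !(mulr_ge0, addr_ge0).
have p0 : 0 <= wt k `^ s by exact: powR_ge0.
split=> [y|x y].
  have := amp_bound r0 y (symbol_shift_ccont y k) (fun eta => h1 y eta k); rewrite -/(symbol_amp k y) => H.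
  apply: (le_trans H); rewrite -[leRHS]mulrA ler_wpM2l// mulrDl.
  apply: (@le_trans _ _ (C1 * ft_moment (d := d) r0 N * wt k `^ s)).
    by rewrite le_eqVlt; apply/orP; left; apply/eqP; ring.
  by rewrite lerDl !mulr_ge0// addr_ge0// mulr_ge0.
have := amp_diff_bound r0 (y1 := x) (y2 := y) (M := (2 * C1 + C2) * wt k `^ s * \sum_i `|x i 0 - y i 0|) (N := N.+1)
  (symbol_shift_ccont x k) (symbol_shift_ccont y k) (fun eta => h1 x eta k) (fun eta => h1 y eta k).
rewrite -!/(symbol_amp k _) => H; apply: (le_trans (H _)).
  move=> eta; set S := \sum_i _; have S0 : 0 <= S by rewrite sumr_ge0.
  have -> : cis (dotp x eta) * Sigma x (eta + k) j l - cis (dotp y eta) * Sigma y (eta + k) j l =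
     (cis (dotp x eta) - cis (dotp y eta)) * Sigma x (eta + k) j l +
     cis (dotp y eta) * (Sigma x (eta + k) j l - Sigma y (eta + k) j l) by ring.
  have w1 := wt_ge1 eta; have w0 := wt_ge0 eta; have wN : 0 <= wt eta ^+ N by rewrite exprn_ge0.
  have b1 : cmod (cis (dotp x eta) - cis (dotp y eta)) <= 2 * (S * wt eta).
    rewrite (le_trans (cis_lipschitz _ _))// ler_wpM2l// -dotpBl.
    rewrite (le_trans (ler_norm_sum _ _ _))// mulr_suml ler_sum// => i _.
    rewrite !mxE normrM ler_wpM2l// (le_trans (coord_le_enorm eta i))//.
    by rewrite /wt lerDr.
  have b2 : cmod (Sigma x (eta + k) j l - Sigma y (eta + k) j l) <= C2 * (wt k `^ s * wt eta ^+ N) * S.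
    by rewrite (le_trans (h2 _ _ _))// ler_wpM2r// ler_wpM2l//; exact: peetre.
  rewrite (le_trans (cmodD _ _))// !cmodM cmod_cis mul1r.
  apply: (@le_trans _ _ (2 * (S * wt eta) * (C1 * wt k `^ s * wt eta ^+ N) + C2 * (wt k `^ s * wt eta ^+ N) * S)).
    by rewrite lerD// ler_pM ?cmod_ge0.
  rewrite exprS; have -> : (2 * C1 + C2) * wt k `^ s * S * (wt eta * wt eta ^+ N) =
    2 * (S * wt eta) * (C1 * wt k `^ s * wt eta ^+ N) + (C2 * (wt k `^ s * wt eta ^+ N) * S) * wt eta by ring.
  by rewrite lerD2l ler_peMr// !mulr_ge0.
set S := \sum_i _; have S0 : 0 <= S by rewrite sumr_ge0.
rewrite -2![leRHS]mulrA ler_wpM2l// mulrDl.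
rewrite (_ : _ * ft_moment (d := d) r0 N.+1 = (2 * C1 + C2) * ft_moment (d := d) r0 N.+1 * (wt k `^ s * S)); last by ring.
by rewrite ler_wpM2r ?mulr_ge0// lerDr mulr_ge0.
Qed.

Lemma symbol_amp_ccont k : ccont (symbol_amp k).
Proof.
have [C C0 /(_ k)[_ h]] := symbol_amp_bounds.
by apply: norm_lipschitz_ccont h; rewrite mulr_ge0// powR_ge0.
Qed.

Section principal.
Variables (A : 'cV[R]_d -> 'M[R[i]]_n) (B : 'cV[R]_d -> 'cV[R]_d -> 'M[R[i]]_n).
Hypothesis CA : C0infty_mx D A.
Hypothesis sB : symbol_class (s - 1) B.
Hypothesis SAB : forall x xi, 1 <= enorm xi ->
  Sigma x xi = (enorm xi `^ s)%:C *: A x + B x xi.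

Lemma symbol_amp_principal : exists2 C, 0 <= C & forall k y, 1 <= enorm k ->
  cmod (symbol_amp k y - (enorm k `^ s)%:C * A y j l * ((2 * pi) ^+ d)%:C) <= C * wt k `^ (s - 1).
Proof.
have [C1 C10 h1] := symbol_shift_bound.
have [C2 C20 h2] := symbol_lipschitz2 sS j l sN1.
have [C3 C30 h3] := symbol_bound sB j l.
have m0 := ft_moment_ge0 (d := d) r0.
exists (2 * ((C2 + C3) * ft_moment (d := d) r0 N.+1)) => [|k y k1].
  by rewrite !(mulr_ge0, addr_ge0).
have p0 : 0 <= wt k `^ (s - 1) by exact: powR_ge0.
have [yr|yr] := pselect (`|y| <= r0); last first.
  rewrite symbol_amp_out// (C0infty_out (CA j l) yr) mulr0 mul0r subrr cmod0.
  by rewrite !mulr_ge0 ?addr_ge0.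
pose a := (enorm k `^ s)%:C * A y j l.
rewrite -(amp_cst a yr) /symbol_amp.
have hcst (eta : 'cV[R]_d) : cmod a <= cmod a * wt eta ^+ 0 by rewrite expr0 mulr1.
have ca : ccont (fun _ : 'cV[R]_d => a) by split; exact: cont_cst.
have := amp_diff_bound r0 (y1 := y) (y2 := y) (M := (C2 + C3) * wt k `^ (s - 1)) (N := N.+1)
  (symbol_shift_ccont y k) ca (fun eta => h1 y eta k) hcst.
move=> H; apply: (le_trans (H _)); last by rewrite le_eqVlt; apply/orP; left; apply/eqP; ring.
move=> eta; rewrite -mulrBr cmodM cmod_cis mul1r.
have -> : Sigma y (eta + k) j l - a = (Sigma y (eta + k) j l - Sigma y k j l) + B y k j l.
  by rewrite [Sigma y k](SAB _ k1) !mxE /a; ring.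
rewrite (le_trans (cmodD _ _))// mulrDl mulrDl lerD//.
rewrite (le_trans (h3 _ _))// ler_peMr ?mulr_ge0//.
by rewrite exprn_ege1// wt_ge1.
Qed.

End principal.
End symbol.

(** On wave packets the kernel becomes an oscillatory integral at frequency k1 - k2 whose amplitude
    is [symbol_amp]. The outer cutoff disappears because the amplitude vanishes wherever the cutoff
    may differ from 1. *)
Lemma has_kernel_probe (Sigma : 'cV[R]_d -> 'cV[R]_d -> 'M[R[i]]_n) (s : R) (K : matrix_kernel) j l k1 k2 :
  symbol_class s Sigma -> (forall xi, C0infty_mx D (fun x => Sigma x xi)) ->
  has_kernel (psido Sigma) K -> (forall j l psi, K j l psi (fun=> 0) = 0) ->
  K j l (probe r0 (- k1)) (probe r0 k2) =
  ((2 * pi) ^- d)%:C *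
  citgC (lebesgueRn d) (fun u => cis (- dotp (vec u) (k1 - k2)) * symbol_amp Sigma j l k2 (vec u)).
Proof.
move=> sS sD hK K0.
pose N := (Num.truncn (`|s| + 1)).+1.
have sN : `|s| + 1 <= N%:R by rewrite ltW// truncnS_gt.
(* The packet is placed in component l only; the condition that K vanish on the zero function
   removes the other terms of the sum. *)
pose phi (x : 'cV[R]_d) : 'cV[R[i]]_n := \col_a (if a == l then probe r0 k2 x else 0).
have phiE a (b : 'I_1) : (fun x => phi x a b) = if a == l then probe r0 k2 else fun=> 0.
  by apply/funext => x; rewrite mxE; case: ifP.
have Cphi : C0infty_mx setT phi.
  move=> a b; rewrite phiE; case: ifP => _; first exact: C0infty_probe.
  exact: C0infty0.
have := hK phi (probe r0 (- k1)) Cphi (C0infty_probe r0 (- k1)) j.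
rewrite (bigD1 l)//= big1 => [|a al]; last by rewrite phiE (negbTE al) K0.
rewrite phiE eqxx addr0 => <-.
have F xi a : fourier phi xi a 0 = if a == l then cutoff_ft r0 (xi - k2) else 0.
  rewrite mxE; case: ifPn => al.
    rewrite -(probe_ft r0) /integralRd; congr (Cintegral _ _ _); apply/funext => u.
    by rewrite !mxE al.
  transitivity (citgC (lebesgueRn d) (fun=> 0 : R[i])); last exact: citgC0.
  by congr (citgC _); apply/funext => u; rewrite !mxE (negbTE al) mulr0.
have Op x : psido Sigma phi x j 0 = ((2 * pi) ^- d)%:C * (cis (dotp x k2) * symbol_amp Sigma j l k2 x).
  rewrite !mxE; congr (_ * _).
  have [C1 C10 h1] := symbol_shift_bound j l sS sN.
  have I := citg_amp r0 x (symbol_shift_ccont j l sS x k2) (fun eta => h1 x eta k2).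
  rewrite /symbol_amp /amp -(citgCZ _ I).
  pose g (xi : 'cV[R]_d) := cis (dotp x xi) * (Sigma x xi j l * cutoff_ft r0 (xi - k2)).
  have E1 : (fun u : d.-tuple R => cis (dotp x k2) *
      (cis (dotp x (vec u)) * (Sigma x (vec u + k2) j l * cutoff_ft r0 (vec u)))) = (fun u => g (vec u + k2)).
    by apply/funext => u; rewrite mulrA -cisD -dotpDr addrC /g addrK.
  have Ig : citg (lebesgueRn d) (fun u : d.-tuple R => g (vec u)).
    have := citgZ (cis (dotp x k2)) I; rewrite E1 => Ig.
    have -> : (fun u : d.-tuple R => g (vec u)) = (fun u => g (vec u - k2 + k2)).
      by apply/funext => u; rewrite subrK.
    exact: (citgC_translate (g := fun y => g (y + k2)) (- k2) Ig).1.
  rewrite E1; have [_ ->] := citgC_translate k2 Ig.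
  rewrite /integralRd; congr (Cintegral _ _ _); apply/funext => u.
  rewrite -/(vec u) !mxE /g; congr (_ * _); rewrite (bigD1 l)//= big1 => [|a al].
    by rewrite addr0 F eqxx.
  by rewrite F (negbTE al) mulr0.
have Iw : citg (lebesgueRn d) (fun u => cis (- dotp (vec u) (k1 - k2)) * symbol_amp Sigma j l k2 (vec u)).
  have [C C0 /(_ k2)[hb _]] := symbol_amp_bounds j l sS sN.
  apply: (citg_bounded_support (g := fun y => cis (- dotp y (k1 - k2)) * symbol_amp Sigma j l k2 y)
    (M := C * wt k2 `^ s) (r := r0)).
  - by apply: ccontM; [exact: ccont_wave|exact: (symbol_amp_ccont j l sS sN)].
  - by move=> y; rewrite cmodM cmod_cis mul1r.
  - move=> y h; apply: contrapT => yr; move: h.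
    by rewrite (symbol_amp_out j l sD k2 yr) mulr0 eqxx.
rewrite -(citgCZ _ Iw) /integralRd; congr (Cintegral _ _ _); apply/funext => u; rewrite -/(vec u) Op.
rewrite mulrCA; congr (_ * _).
have [yr|yr] := pselect (`|vec u| <= r0); last first.
  by rewrite (symbol_amp_out j l sD k2 yr) !mulr0.
rewrite /probe cutoff_eq1// mul1r mulrA -cisD dotpNr dotpBr; congr (cis _ * _); ring.
Qed.

Lemma powR_wt_enorm (s : R) (k : 'cV[R]_d) : 1 <= enorm k ->
  wt k `^ s <= 2 `^ `|s| * enorm k `^ s.
Proof.
move=> k1; have k0 : 0 < enorm k by exact: lt_le_trans k1.
have w2 : wt k <= 2 * enorm k by rewrite /wt; lra.
have [s0|s0] := leP 0 s.
  rewrite ger0_norm// -powRM//; last exact: ltW.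
  by apply: ge0_ler_powR => //; rewrite ?nnegrE ?wt_ge0 ?mulr_ge0 ?(ltW k0).
rewrite -[leLHS]mul1r ler_pM ?powR_ge0//.
  by rewrite -[leLHS](powRr0 2); apply: ler_powR => //; rewrite ler1n.
rewrite -(opprK s) !(powRN _ (- s)) lef_pV2 ?posrE ?powR_gt0 ?wt_gt0//.
apply: ge0_ler_powR; rewrite ?nnegrE ?wt_ge0 ?enorm_ge0 ?oppr_ge0 ?(ltW s0)//.
by rewrite /wt lerDr.
Qed.

(** The decay in k1 - k2 is [oscillatory_bound] applied to the amplitude. The leading term comes
    from replacing the amplitude by its principal part and integrating the error of
    [symbol_amp_principal] over the box of radius r0. *)
Theorem symbol_correlation (m : R) (A : 'cV[R]_d -> 'M[R[i]]_n) (K : matrix_kernel) :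
  principal_symbol D m A K -> (forall j l psi, K j l psi (fun=> 0) = 0) ->
  forall j l, exists2 C, 0 <= C & forall k1 k2, 1 <= enorm k2 ->
    cmod (K j l (probe r0 (- k1)) (probe r0 k2)) <= C * enorm k2 `^ (- m) / (1 + enorm (k1 - k2)) /\
    cmod (K j l (probe r0 (- k1)) (probe r0 k2) - (enorm k2 `^ (- m))%:C * fourier A (k1 - k2) j l) <=
      C * enorm k2 `^ (- m - 1).
Proof.
move=> [Sigma [B [hK [sS sD] CA [sB _] SAB]]] K0 j l.
pose s := - m; pose N := (Num.truncn (`|s| + 1)).+1.
have sN : `|s| + 1 <= N%:R by rewrite ltW// truncnS_gt.
have [C1 C10 h1] := symbol_amp_bounds j l sS sN.
have [C2 C20 h2] := symbol_amp_principal j l sS sD sN CA sB SAB.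
have [C3 C30 h3] := oscillatory_bound (d := d) r0.
pose c : R := (2 * pi) ^- d.
have c0 : 0 <= c by rewrite invr_ge0 exprn_ge0// mulr_ge0// pi_ge0.
have cn : (2 * pi) ^+ d != 0 :> R by rewrite expf_neq0// mulf_neq0// ?pnatr_eq0// gt_eqF// pi_gt0.
pose V := box_volume (d := d) r0; have V0 : 0 <= V by exact: box_volume_ge0.
(* The powers of 2 come from trading the weight 1 + |k2| for |k2|, which is legitimate for |k2| >=
   1. *)
pose E1 := c * (C3 * C1) * 2 `^ `|s|; pose E2 := c * (2 * (C2 * V)) * 2 `^ `|s - 1|.
have E10 : 0 <= E1 by rewrite !mulr_ge0 ?powR_ge0.
have E20 : 0 <= E2 by rewrite !mulr_ge0 ?powR_ge0.
exists (E1 + E2) => [|k1 k2 k2g]; first exact: addr_ge0.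
have [hb hL] := h1 k2.
have out y : symbol_amp Sigma j l k2 y != 0 -> `|y| <= r0.
  by move=> h; apply: contrapT => yr; move: h; rewrite (symbol_amp_out j l sD k2 yr) eqxx.
have M0 : 0 <= C1 * wt k2 `^ s by rewrite mulr_ge0 ?powR_ge0.
have cb := symbol_amp_ccont j l sS sN k2.
rewrite (has_kernel_probe j l k1 k2 sS sD hK K0); set I := citgC _ _; split.
  have := h3 _ _ (k1 - k2) M0 hb hL out; rewrite -/I => hI.
  rewrite cmodM cmod_real ger0_norm//; apply: (le_trans (ler_wpM2l c0 hI)).
  rewrite [leLHS]mulrA; apply: ler_wpM2r; first by rewrite invr_ge0 addr_ge0 ?enorm_ge0.
  apply: (@le_trans _ _ (E1 * enorm k2 `^ (- m))); last by rewrite ler_wpM2r ?powR_ge0// lerDl.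
  have := powR_wt_enorm s k2g; rewrite -/s => hw.
  rewrite (_ : c * (C3 * (C1 * wt k2 `^ s)) = c * (C3 * C1) * wt k2 `^ s); last by ring.
  by rewrite /E1 -[leRHS]mulrA ler_wpM2l// !mulr_ge0.
have CAjl := CA j l.
pose g y := symbol_amp Sigma j l k2 y - (enorm k2 `^ s)%:C * A y j l * ((2 * pi) ^+ d)%:C.
have cA : ccont (fun y => A y j l) by apply: smooth_ccont; case: CAjl.
have cstc z : ccont (fun _ : 'cV[R]_d => z : R[i]) by split; exact: cont_cst.
have cA2 : ccont (fun y => (enorm k2 `^ s)%:C * A y j l * ((2 * pi) ^+ d)%:C).
  by apply: ccontM => //; apply: ccontM.
have cg : ccont g.
  by case: cb cA2 => a1 a2 [b1 b2]; split; [under eq_fun do rewrite ReB|under eq_fun do rewrite ImB]; exact: contB.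
have Aout y : ~ `|y| <= r0 -> A y j l = 0 by exact: (C0infty_out CAjl).
have gout y : g y != 0 -> `|y| <= r0.
  move=> h; apply: contrapT => yr; move: h.
  by rewrite /g (symbol_amp_out j l sD k2 yr) (Aout _ yr) mulr0 mul0r subrr eqxx.
have wg y : cmod (cis (- dotp y (k1 - k2)) * g y) <= C2 * wt k2 `^ (s - 1).
  by rewrite cmodM cmod_cis mul1r; exact: h2.
have M20 : 0 <= C2 * wt k2 `^ (s - 1) by rewrite mulr_ge0 ?powR_ge0.
have wout y : cis (- dotp y (k1 - k2)) * g y != 0 -> `|y| <= r0.
  by move=> h; apply: gout; apply: contra h => /eqP ->; rewrite mulr0.
have hI := citgC_box_bound (ccont_cmeas (ccontM (ccont_wave (k1 - k2)) cg)) M20 wg wout.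
have IA : citg (lebesgueRn d) (fun u => cis (- dotp (vec u) (k1 - k2)) * A (vec u) j l).
  have := C0infty_citg (C0inftyMr CAjl (smooth_wave (- (k1 - k2)))).
  by under eq_fun do rewrite mulrC dotpNr.
have Ib : citg (lebesgueRn d) (fun u => cis (- dotp (vec u) (k1 - k2)) * symbol_amp Sigma j l k2 (vec u)).
  apply: (citg_bounded_support (g := fun y => cis (- dotp y (k1 - k2)) * symbol_amp Sigma j l k2 y)
    (M := C1 * wt k2 `^ s) (r := r0)).
  - by apply: ccontM => //; exact: ccont_wave.
  - by move=> y; rewrite cmodM cmod_cis mul1r.
  - by move=> y h; apply: out; apply: contra h => /eqP ->; rewrite mulr0.
have FA : fourier A (k1 - k2) j l = citgC (lebesgueRn d) (fun u => cis (- dotp (vec u) (k1 - k2)) * A (vec u) j l).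
  by rewrite mxE /integralRd; congr (Cintegral _ _ _); apply/funext => u; rewrite !mxE.
pose q := (enorm k2 `^ s)%:C * ((2 * pi) ^+ d)%:C : R[i].
have EI : citgC (lebesgueRn d) (fun u => cis (- dotp (vec u) (k1 - k2)) * g (vec u)) = I - q * fourier A (k1 - k2) j l.
  rewrite FA -(citgCZ _ IA) -(citgCB Ib (citgZ _ IA)); congr citgC; apply/funext => u.
  by rewrite /g /q; ring.
have -> : c%:C * I - (enorm k2 `^ - m)%:C * fourier A (k1 - k2) j l = c%:C * (I - q * fourier A (k1 - k2) j l).
  rewrite mulrBr; congr (_ - _); rewrite mulrA /q (mulrC _ ((2 * pi) ^+ d)%:C) mulrA -realCM /c mulVf//.
  by rewrite mul1r.
rewrite -EI cmodM cmod_real ger0_norm// (le_trans (ler_wpM2l c0 hI))//.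
apply: (@le_trans _ _ (E2 * enorm k2 `^ (- m - 1))); last by rewrite ler_wpM2r ?powR_ge0// lerDr.
have hw := powR_wt_enorm (s - 1) k2g.
rewrite (_ : c * (2 * (C2 * wt k2 `^ (s - 1) * box_volume r0)) = c * (2 * (C2 * V)) * wt k2 `^ (s - 1)); last by rewrite /V; ring.
by rewrite /E2 -[leRHS]mulrA ler_wpM2l// !mulr_ge0.
Qed.

End Correlation.

(** * Gaussian moments *)

Section Density.
Context {R : realType} {dT : measure_display} {T : measurableType dT}.
Variables (mu nu : {measure set T -> \bar R}) (p : T -> R).
Hypotheses (mp : measurable_fun setT p) (p0 : forall x, 0 <= p x).
Hypothesis nuE : forall A, measurable A -> nu A = (\int[mu]_(x in A) (p x)%:E)%E.

Import HBNNSimple.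

Let integral_density_indic E : measurable E ->
  (\int[nu]_x (\1_E x)%:E = \int[mu]_x ((\1_E x * p x)%:E))%E.
Proof.
move=> mE; rewrite integral_indic//= setIT nuE// [LHS]integral_mkcond/=.
apply: eq_integral => x _; rewrite patchE indicE.
by case: ifPn => h; rewrite ?mul1r ?mul0r.
Qed.

Let integral_density_nnsfun (f : {nnsfun T >-> R}) :
  (\int[nu]_x (f x)%:E = \int[mu]_x ((f x * p x)%:E))%E.
Proof.
under [LHS]eq_integral do rewrite fimfunE -fsumEFin//.
rewrite [LHS]ge0_integral_fsum//; last 2 first.
  - by move=> r; exact/measurable_EFinP/measurableT_comp.
  - by move=> n x _; rewrite EFinM nnfun_muleindic_ge0.
under [RHS]eq_integral.
  move=> x xD; rewrite EFinM fimfunE -fsumEFin// ge0_mule_fsuml; last first.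
    by move=> r; rewrite EFinM nnfun_muleindic_ge0.
  over.
rewrite [RHS]ge0_integral_fsum//; last 2 first.
  - move=> r; apply/measurable_EFinP/measurable_funM => //.
    exact: measurableT_comp.
  - move=> n x _; rewrite EFinM mule_ge0 ?lee_fin//.
    by have := nnfun_muleindic_ge0 f n x; rewrite -EFinM lee_fin.
apply: eq_fsbigr => r _.
rewrite integralZl_indic_nnsfun//= integral_density_indic//.
case: (ltP r 0) => r0.
  rewrite (_ : f @^-1` [set r] = set0).
    rewrite !integral0_eq ?mule0// => x _; rewrite /= indicE in_set0/= ?mulr0 ?mul0r ?mul0e//.
  by rewrite preimage_nnfun0.
rewrite -ge0_integralZl//.
- by apply: eq_integral => x _; rewrite -!EFinM mulrA.
- by apply/measurable_EFinP/measurable_funM.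
- by move=> x _; rewrite lee_fin mulr_ge0.
Qed.

(** The usual ascent from indicators to simple functions to monotone limits. *)
Lemma ge0_integral_density (f : T -> R) : measurable_fun setT f ->
  (forall x, 0 <= f x) -> (\int[nu]_x (f x)%:E = \int[mu]_x (f x * p x)%:E)%E.
Proof.
move=> mf f0; have mef : measurable_fun setT (EFin \o f) by exact/measurable_EFinP.
pose f_ := nnsfun_approx measurableT mef.
transitivity (lim (\int[nu]_x (f_ n x)%:E @[n --> \oo])%E).
  rewrite -monotone_convergence//=.
  - apply: eq_integral => x /[!inE] xD; apply/esym/cvg_lim => //=.
    by apply: cvg_nnsfun_approx => // y _; rewrite /= lee_fin.
  - by move=> n; exact/measurable_EFinP/measurable_funTS.
  - by move=> n ? _; rewrite lee_fin.
  - by move=> ? _ ? ? mn; rewrite lee_fin; exact/lefP/nd_nnsfun_approx.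
rewrite [RHS](_ : _ = lim (\int[mu]_x (f_ n x * p x)%:E @[n --> \oo])%E).
  by apply: congr_lim; apply/funext => n; exact: integral_density_nnsfun.
rewrite -monotone_convergence//=.
- apply: eq_integral => x /[!inE] xD; apply/esym/cvg_lim => //=.
  rewrite EFinM; under eq_fun do rewrite EFinM.
  apply: cvgeZr => //.
  by apply: cvg_nnsfun_approx => // y _; rewrite /= lee_fin.
- by move=> n; apply/measurable_EFinP/measurable_funM.
- by move=> n ? _; rewrite lee_fin mulr_ge0.
- move=> x _ ? ? mn; rewrite lee_fin ler_wpM2r//; exact/lefP/nd_nnsfun_approx.
Qed.

End Density.

(** * Moments of a Gaussian variable *)

Section GaussianLaw.
Context {R : realType} {dO : measure_display} {Omega : measurableType dO}.
Variable P : probability Omega R.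
Local Notation leb := (@lebesgue_measure R).

Lemma ge0_itg_itgR dT (T : measurableType dT) (nu : {measure set T -> \bar R})
    (f : T -> R) (a : R) : measurable_fun setT f -> (forall x, 0 <= f x) ->
  (\int[nu]_x (f x)%:E)%E = a%:E -> itg nu f /\ itgR nu f = a.
Proof.
move=> mf f0 h; split; last by rewrite /itgR /Rintegral h.
apply/integrableP; split; first exact/measurable_EFinP.
rewrite (eq_integral (fun x => (f x)%:E)) ?h ?ltry// => x _ /=.
by rewrite ger0_norm.
Qed.

(* A signed integrand is the difference of |h| + h and |h|. *)
Lemma itg_signed dT (T : measurableType dT) (nu : {measure set T -> \bar R})
    (Y : T -> R) (L : (R -> R) -> R) (h : R -> R) : measurable_fun setT Y ->
  measurable_fun setT h ->
  (forall k : R -> R, measurable_fun setT k -> (forall x, 0 <= k x) ->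
     (forall x, k x <= 2 * `|h x|) -> (\int[nu]_w (k (Y w))%:E)%E = (L k)%:E) ->
  itg nu (h \o Y) /\
  itgR nu (h \o Y) = L (fun x => `|h x| + h x) - L (fun x => `|h x|).
Proof.
move=> mY mh H.
have mk1 : measurable_fun setT (fun x => `|h x|) by exact: measurableT_comp.
have mk2 : measurable_fun setT (fun x => `|h x| + h x) by exact: measurable_funD.
have k2 x : 0 <= `|h x| + h x by have := ler_norm (- h x); rewrite normrN; lra.
have b1 x : `|h x| <= 2 * `|h x| by rewrite ler_peMl// ler1n.
have b2 x : `|h x| + h x <= 2 * `|h x| by rewrite mulrDl mul1r lerD2l ler_norm.
have [I1 E1] := ge0_itg_itgR (measurableT_comp mk1 mY) (fun w => normr_ge0 _)
  (H _ mk1 (fun w => normr_ge0 _) b1).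
have [I2 E2] := ge0_itg_itgR (measurableT_comp mk2 mY) (fun w => k2 _) (H _ mk2 k2 b2).
have -> : h \o Y = (fun w => ((fun x => `|h x| + h x) \o Y) w - ((fun x => `|h x|) \o Y) w).
  by apply/funext => w /=; rewrite addrC addKr.
by split; [exact: itgB|rewrite itgRB// E1 E2].
Qed.

Let ge0_law (Y : Omega -> measurableTypeR R) (k : measurableTypeR R -> R) : measurable_fun setT Y ->
  measurable_fun setT k -> (forall x, 0 <= k x) ->
  (\int[P]_w (k (Y w))%:E)%E = (\int[pushforward P Y]_x (k x)%:E)%E.
Proof.
move=> mY mk k0.
by rewrite ge0_integral_pushforward//; [exact/measurable_EFinP|move=> x _; rewrite lee_fin].
Qed.

Lemma dirac_law (Y : Omega -> R) (m : R) (h : R -> R) : measurable_fun setT Y ->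
  (forall A : set R, measurable A -> P (Y @^-1` A) = \d_m A) ->
  measurable_fun setT h -> itg P (h \o Y) /\ itgR P (h \o Y) = h m.
Proof.
move=> mY law mh.
have H (k : R -> R) : measurable_fun setT k -> (forall x, 0 <= k x) ->
    (forall x, k x <= 2 * `|h x|) -> (\int[P]_w (k (Y w))%:E)%E = (k m)%:E.
  move=> mk k0 _; rewrite ge0_law//.
  pose nu : {measure set (measurableTypeR R) -> \bar R} := @dirac _ (measurableTypeR R) m R.
  transitivity (\int[nu]_x (k x)%:E)%E.
    by apply: eq_measure_integral => A mA _; exact: law.
  by rewrite integral_dirac//= ?diracT ?mul1e//; exact/measurable_EFinP.
have [I E] := itg_signed (L := fun k => k m) mY mh H.
by split=> //; rewrite E addrC addKr.
Qed.

Lemma normal_law (Y : Omega -> R) (m s : R) (h : R -> R) : s != 0 ->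
  measurable_fun setT Y ->
  (forall A : set R, measurable A -> P (Y @^-1` A) = normal_prob m s A) ->
  measurable_fun setT h -> itg leb (fun x => h x * normal_pdf m s x) ->
  itg P (h \o Y) /\ itgR P (h \o Y) = itgR leb (fun x => h x * normal_pdf m s x).
Proof.
move=> s0 mY law mh Ih.
have p0 x : 0 <= normal_pdf m s x by exact: normal_pdf_ge0.
have mp : measurable_fun setT (normal_pdf m s) by exact: measurable_normal_pdf.
have Ik (k : R -> R) : measurable_fun setT k -> (forall x, 0 <= k x) ->
    (forall x, k x <= 2 * `|h x|) -> itg leb (fun x => k x * normal_pdf m s x).
  move=> mk k0 kh.
  have I2 := itgZ 2 (itg_abs Ih).
  apply: (itg_le _ _ I2); first exact: measurable_funM.
  move=> x; rewrite !normrM (ger0_norm (k0 x)) (ger0_norm (p0 x)) mulrA.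
  exact: ler_wpM2r.
have H (k : R -> R) : measurable_fun setT k -> (forall x, 0 <= k x) ->
    (forall x, k x <= 2 * `|h x|) -> (\int[P]_w (k (Y w))%:E)%E =
      (itgR leb (fun x => k x * normal_pdf m s x))%:E.
  move=> mk k0 kh; rewrite ge0_law//.
  rewrite -(itgR_fin (Ik k mk k0 kh)).
  pose nu : {measure set (measurableTypeR R) -> \bar R} := normal_prob m s.
  transitivity (\int[nu]_x (k x)%:E)%E.
    by apply: eq_measure_integral => A mA _; exact: law.
  apply: (@ge0_integral_density R _ (measurableTypeR R) leb nu (normal_pdf m s) mp p0) => //.
have [I E] := itg_signed (L := fun k => itgR leb (fun x => k x * normal_pdf m s x)) mY mh H.
split=> //; rewrite E -itgRB; first last.
- by apply: Ik; [exact: measurableT_comp|move=> x|move=> x; rewrite ler_peMl// ler1n].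
- apply: Ik.
  + by apply: measurable_funD => //; exact: measurableT_comp.
  + by move=> x; have := ler_norm (- h x); rewrite normrN; lra.
  + by move=> x; rewrite mulrDl mul1r lerD2l ler_norm.
by congr itgR; apply/funext => x; ring.
Qed.

Lemma normal_pdf_derive (m s : R) (q : R -> R) (q' x : R) : s != 0 ->
  is_derive x 1 q q' ->
  is_derive x 1 (fun x => q x * normal_pdf m s x)
    ((q' - q x * ((x - m) / s ^+ 2)) * normal_pdf m s x).
Proof.
move=> s0 dq; rewrite (normal_pdfE m s0) /normal_fun.
have dE : is_derive x 1 (fun y : R => - (y - m) ^+ 2 / (s ^+ 2 *+ 2)) (- ((x - m) / s ^+ 2)).
  have -> : (fun y : R => - (y - m) ^+ 2 / (s ^+ 2 *+ 2)) =
      (fun y => - (s ^+ 2 *+ 2)^-1 * ((y - m) * (y - m))).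
    by apply/funext => y; rewrite expr2 mulrC mulNr mulrN.
  apply: is_derive_eq; rewrite /GRing.scale/=.
  by rewrite -(mulr_natr (s ^+ 2)); field; exact: s0.
have dX := @is_derive1_comp R expR (fun y : R => - (y - m) ^+ 2 / (s ^+ 2 *+ 2)) x _ _
  (is_derive_expR (- (x - m) ^+ 2 / (s ^+ 2 *+ 2))) dE.
rewrite /comp in dX.
by apply: is_derive_eq; rewrite /GRing.scale/=; ring.
Qed.

(** From e^(-y) <= (1 + y/4)^-4. Of the four powers gained, three absorb polynomials of degree up to
    6 and one absorbs 1 + x^2, which provides integrability and decay at infinity. *)
Lemma normal_pdf_decay (m s : R) : s != 0 -> exists2 M, 0 <= M &
  forall x, (1 + (x - m) ^+ 2) ^+ 3 * (1 + x ^+ 2) * normal_pdf m s x <= M.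
Proof.
move=> s0; have s2 : 0 < s ^+ 2 by rewrite exprn_even_gt0.
(* Chosen so that c (1 + z^2) <= 1 + z^2 / (8 s^2), the quantity 1 + y/4 for y = z^2 / (2 s^2). *)
pose c := Num.min 1 (8 * s ^+ 2)^-1.
have c0 : 0 < c by rewrite /c lt_min ltr01 invr_gt0 mulr_gt0.
exists (normal_peak s * (2 + 2 * m ^+ 2) * c ^- 4).
  rewrite !mulr_ge0 ?normal_peak_ge0 ?invr_ge0 ?exprn_ge0 ?(ltW c0)//.
  by rewrite addr_ge0// mulr_ge0// sqr_ge0.
move=> x; rewrite (normal_pdfE m s0) /normal_fun.
set z := x - m; have zE : 0 <= z ^+ 2 by exact: sqr_ge0.
have u0 : 0 < 1 + z ^+ 2 by lra.
have yE : z ^+ 2 / (s ^+ 2 *+ 2) / 4 + 1 >= c * (1 + z ^+ 2).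
  rewrite mulrDr mulr1 addrC lerD//; last by rewrite /c ge_min lexx.
  rewrite (_ : _ / 4 = (8 * s ^+ 2)^-1 * z ^+ 2); last by rewrite -(mulr_natr (s ^+ 2)); field; exact: s0.
  by rewrite ler_wpM2r// /c ge_min lexx orbT.
have eb : expR (- (z ^+ 2 / (s ^+ 2 *+ 2))) <= (c * (1 + z ^+ 2)) ^- 4.
  rewrite expRN lef_pV2 ?posrE ?expR_gt0 ?exprn_gt0 ?mulr_gt0//.
  have y0 : 0 <= z ^+ 2 / (s ^+ 2 *+ 2) by rewrite divr_ge0// mulrn_wge0// ltW.
  have cu : 0 <= c * (1 + z ^+ 2) by rewrite mulr_ge0 ?(ltW c0) ?(ltW u0).
  rewrite (_ : expR _ = expR (z ^+ 2 / (s ^+ 2 *+ 2) / 4) ^+ 4).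
    rewrite lerXn2r ?nnegrE ?expR_ge0// (le_trans yE)// addrC; exact: expR_ge1Dx.
  by rewrite -(mulr_natr (s ^+ 2)) -expRM_natl; congr expR; field; exact: s0.
have xz : 1 + x ^+ 2 <= (2 + 2 * m ^+ 2) * (1 + z ^+ 2).
  have := sqr_ge0 (m * z); have := sqr_ge0 (x - 2 * m); rewrite /z; nra.
rewrite mulNr.
have x0 : 0 <= 1 + x ^+ 2 by have := sqr_ge0 x; lra.
apply: le_trans (_ : (1 + z ^+ 2) ^+ 3 * ((2 + 2 * m ^+ 2) * (1 + z ^+ 2)) *
   (normal_peak s * (c * (1 + z ^+ 2)) ^- 4) <= _).
  apply: ler_pM; rewrite ?mulr_ge0 ?exprn_ge0 ?(ltW u0) ?expR_ge0 ?normal_peak_ge0//.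
    by rewrite ler_wpM2l ?exprn_ge0 ?(ltW u0).
  by rewrite ler_wpM2l ?normal_peak_ge0.
rewrite le_eqVlt; apply/orP; left; apply/eqP; field.
by rewrite !gt_eqF.
Qed.

Lemma itg_normal_poly (m s : R) (q : R -> R) (B : R) : s != 0 -> continuous q ->
  (forall x, `|q x| <= B * (1 + (x - m) ^+ 2) ^+ 3) ->
  itg leb (fun x => q x * normal_pdf m s x).
Proof.
move=> s0 cq qB; have [M M0 hM] := normal_pdf_decay m s0.
have B0 : 0 <= B.
  have := le_trans (normr_ge0 _) (qB m); rewrite subrr expr0n/= addr0 expr1n mulr1//.
apply: (@itg_quadratic_decay R _ (B * M)).
  apply: measurable_funM; first exact: continuous_measurable_fun.
  exact: measurable_normal_pdf.
move=> x; have p0 := normal_pdf_ge0 m s x.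
have x0 : 0 <= 1 + x ^+ 2 by have := sqr_ge0 x; lra.
rewrite normrM (ger0_norm p0).
apply: le_trans (_ : B * (1 + (x - m) ^+ 2) ^+ 3 * (1 + x ^+ 2) * normal_pdf m s x <= _).
  by rewrite mulrAC; do 2 apply: ler_wpM2r => //.
have := hM x; move: (normal_pdf m s x) => p hp.
rewrite (_ : B * _ * _ * p = B * ((1 + (x - m) ^+ 2) ^+ 3 * (1 + x ^+ 2) * p)); last by ring.
exact: ler_wpM2l.
Qed.

Lemma normal_pdf_cvg0 (m s : R) (q : R -> R) (B : R) : s != 0 ->
  (forall x, `|q x| <= B * (1 + (x - m) ^+ 2) ^+ 3) ->
  (q x * normal_pdf m s x @[x --> +oo] --> (0 : R)) /\
  (q (- x) * normal_pdf m s (- x) @[x --> +oo] --> (0 : R)).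
Proof.
move=> s0 qB; have [M M0 hM] := normal_pdf_decay m s0.
have B0 : 0 <= B.
  have := le_trans (normr_ge0 _) (qB m); rewrite subrr expr0n/= addr0 expr1n mulr1//.
have key x : `|q x * normal_pdf m s x| * (1 + x ^+ 2) <= B * M.
  have p0 := normal_pdf_ge0 m s x.
  have x0 : 0 <= 1 + x ^+ 2 by have := sqr_ge0 x; lra.
  rewrite normrM (ger0_norm p0).
  apply: le_trans (_ : B * (1 + (x - m) ^+ 2) ^+ 3 * (1 + x ^+ 2) * normal_pdf m s x <= _).
    by rewrite mulrAC; do 2 apply: ler_wpM2r => //.
  have := hM x; move: (normal_pdf m s x) => p hp.
  rewrite (_ : B * _ * _ * p = B * ((1 + (x - m) ^+ 2) ^+ 3 * (1 + x ^+ 2) * p)); last by ring.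
  exact: ler_wpM2l.
have inv x y : 0 < x -> x ^+ 2 = y ^+ 2 -> `|q y * normal_pdf m s y| <= B * M / x.
  move=> x0 xy; rewrite ler_pdivlMr// (le_trans _ (key y))// ler_wpM2l// -xy.
  by have := sqr_ge0 (x - 1); nra.
split; apply: (@cvg0_inv R _ (B * M)) => x x0; apply: inv => //.
by rewrite sqrrN.
Qed.

(** Stein's identity: the integrand is the derivative of q times the density, which tends to 0 at
    both ends. *)
Lemma itgR_normal_primitive (m s : R) (q q' : R -> R) (B B' : R) : s != 0 ->
  (forall x : R, is_derive x 1 q (q' x)) -> continuous q' ->
  (forall x, `|q x| <= B * (1 + (x - m) ^+ 2) ^+ 3) ->
  (forall x, `|q' x - q x * ((x - m) / s ^+ 2)| <= B' * (1 + (x - m) ^+ 2) ^+ 3) ->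
  itgR leb (fun x => (q' x - q x * ((x - m) / s ^+ 2)) * normal_pdf m s x) = 0.
Proof.
move=> s0 dq cq' qB qB'.
have cq := is_derive_continuous dq.
have c2 : continuous (fun x : R => q' x - q x * ((x - m) / s ^+ 2)).
  apply: contB => //; apply: contM => //; apply: contM; last exact: cont_cst.
  by apply: (@contB _ _ id (fun=> m)); [move=> ?; exact: cvg_id|exact: cont_cst].
have [h1 h2] := normal_pdf_cvg0 s0 qB.
have -> : 0 = 0 - 0 :> R by rewrite subr0.
apply: (line_FTC _ _ _ h1 h2).
- by apply: contM => //; exact: continuous_normal_pdf.
- exact: itg_normal_poly s0 c2 qB'.
- by move=> x; exact: normal_pdf_derive.
Qed.

Let q_cont (m : R) k : continuous (fun x : R => (x - m) ^+ k).
Proof.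
elim: k => [|k IH]; first by under eq_fun do rewrite expr0; exact: cont_cst.
under eq_fun do rewrite exprS; apply: contM => //.
by apply: (@contB _ _ id (fun=> m)); [move=> ?; exact: cvg_id|exact: cont_cst].
Qed.

Let q_bound (m : R) k x : (k <= 6)%N -> `|(x - m) ^+ k| <= (1 + (x - m) ^+ 2) ^+ 3.
Proof.
move=> k6; rewrite normrX; set z := x - m.
have z0 := normr_ge0 z; rewrite -(real_normK (num_real z)); move: `|z| z0 => {}z z0.
apply: le_trans (_ : 1 + z ^+ 6 <= _).
  case: (lerP z 1) => z1.
    by rewrite (le_trans (exprn_ile1 _ z0 z1))// lerDl exprn_ge0.
  by rewrite (le_trans (ler_weXn2l (ltW z1) k6))// lerDr.
have key (u : R) : 0 <= u -> 1 + u ^+ 3 <= (1 + u) ^+ 3.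
  move=> u0; rewrite (_ : (1 + u) ^+ 3 = 1 + u ^+ 3 + (3 * u + 3 * u ^+ 2)); last by ring.
  by rewrite lerDl addr_ge0 ?mulr_ge0 ?sqr_ge0.
by have := key _ (sqr_ge0 z); rewrite -exprM.
Qed.

Lemma itg_normal_moment (m s : R) k : s != 0 -> (k <= 6)%N ->
  itg leb (fun x => (x - m) ^+ k * normal_pdf m s x).
Proof.
move=> s0 k6; apply: (itg_normal_poly (B := 1) s0); first exact: q_cont.
by move=> x; rewrite mul1r; exact: q_bound.
Qed.

(** Stein's identity with q = (x - m)^(k+1). The restriction on k keeps every degree within the 6
    covered by the decay bound. *)
Lemma normal_moment_rec (m s : R) k : s != 0 -> (k <= 4)%N ->
  itgR leb (fun x => (x - m) ^+ k.+2 * normal_pdf m s x) =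
  s ^+ 2 * k.+1%:R * itgR leb (fun x => (x - m) ^+ k * normal_pdf m s x).
Proof.
move=> s0 k4.
pose q x := (x - m) ^+ k.+1; pose q' x := k.+1%:R * (x - m) ^+ k.
have dq (x : R) : is_derive x 1 q (q' x).
  have d1 : is_derive x 1 (fun y : R => y - m) 1 by apply: is_derive_eq; rewrite subr0.
  have := is_deriveX k.+1 d1; rewrite /GRing.scale/= mulr1.
  by congr (is_derive x 1 _ _); apply/funext => y; rewrite exprfctE.
have s2 : s ^+ 2 != 0 by rewrite expf_neq0.
have := @itgR_normal_primitive m s q q' 1 (k.+1%:R + (s ^+ 2)^-1) s0 dq.
have qE x : q' x - q x * ((x - m) / s ^+ 2) =
    k.+1%:R * (x - m) ^+ k - (s ^+ 2)^-1 * (x - m) ^+ k.+2.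
  rewrite /q /q' (exprSr _ k.+1); move: (s ^+ 2)^-1 ((x - m) ^+ k.+1) ((x - m) ^+ k) => a b c.
  by ring.
move=> H.
have : itgR leb (fun x => (k.+1%:R * ((x - m) ^+ k * normal_pdf m s x) -
   (s ^+ 2)^-1 * ((x - m) ^+ k.+2 * normal_pdf m s x))) = 0.
  rewrite -[RHS]H.
  - by congr itgR; apply/funext => x; rewrite qE; ring.
  - by apply: contM; [exact: cont_cst|exact: q_cont].
  - by move=> x; rewrite mul1r; apply: q_bound; rewrite ltnS (leq_trans k4).
  move=> x; rewrite qE (le_trans (ler_normB _ _))// (normrM k.+1%:R) (normrM (s ^+ 2)^-1) mulrDl.
  rewrite (ger0_norm (ler0n _ _)) (ger0_norm (x := (s ^+ 2)^-1)) ?invr_ge0 ?sqr_ge0//.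
  by rewrite lerD// ler_wpM2l ?invr_ge0 ?sqr_ge0 ?ler0n// q_bound// ?ltnS ?(leq_trans k4).
have I1 := itg_normal_moment m s0 (leq_trans k4 (isT : (4 <= 6)%N)).
have I2 := itg_normal_moment m s0 (k4 : (k.+2 <= 6)%N).
rewrite itgRB; [|exact: itgZ I1|exact: itgZ I2].
rewrite !itgRZ// => /eqP; rewrite subr_eq0 => /eqP h.
by rewrite -mulrA h mulrA divff// mul1r.
Qed.

Lemma itgR_normal_pdf (m s : R) : s != 0 -> itgR leb (normal_pdf m s) = 1.
Proof. by move=> s0; rewrite /itgR /Rintegral integral_normal_pdf. Qed.

Lemma normal_moment1 (m s : R) : s != 0 ->
  itgR leb (fun x => (x - m) ^+ 1 * normal_pdf m s x) = 0.
Proof.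
move=> s0.
have s2 : s ^+ 2 != 0 by rewrite expf_neq0.
have c0 : continuous (fun _ : R => 0 : R) by exact: cont_cst.
have := @itgR_normal_primitive m s (fun=> 1) (fun=> 0) 1 (s ^+ 2)^-1 s0
  (fun x => is_derive_cst _ _ _) c0.
have bb (x : R) : 1 <= (1 + (x - m) ^+ 2) ^+ 3.
  by rewrite exprn_ege1// lerDl sqr_ge0.
move=> H; have {H} := H _ _.
have I1 := itg_normal_moment m s0 (isT : (1 <= 6)%N).
rewrite (_ : (fun x => _) = fun x => - (s ^+ 2)^-1 * ((x - m) ^+ 1 * normal_pdf m s x)).
  rewrite itgRZ// => H; apply/eqP.
  suff /eqP : - (s ^+ 2)^-1 * itgR leb (fun x => (x - m) ^+ 1 * normal_pdf m s x) = 0.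
    by rewrite mulf_eq0 oppr_eq0 invr_eq0 (negbTE s2).
  apply: H => x; first by rewrite normr1 mul1r.
  rewrite sub0r normrN mul1r normrM mulrC (ger0_norm (x := (s ^+ 2)^-1)) ?invr_ge0 ?sqr_ge0//.
  by rewrite ler_wpM2l ?invr_ge0 ?sqr_ge0// -[X in `|X|]expr1; apply: q_bound.
by apply/funext => x; rewrite expr1; ring.
Qed.

(** A degenerate law is a point mass and is treated apart. Otherwise centering forces m = 0, and two
    applications of the recursion give second moment s^2 and fourth moment 3 s^4. *)
Lemma gaussian_moments (Y : Omega -> R) : gaussian_rv P Y ->
  itg P (fun w => Y w ^+ 4) /\
  (itgR P Y = 0 -> itgR P (fun w => Y w ^+ 4) = 3 * itgR P (fun w => Y w ^+ 2) ^+ 2).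
Proof.
move=> [mY [m [s law]]].
have mk k (a : R) : measurable_fun [set: R] (fun x : R => (x - a) ^+ k).
  by apply: continuous_measurable_fun; exact: q_cont.
have [s0|s0] := eqVneq s 0.
  have {}law A : measurable A -> P (Y @^-1` A) = \d_m A.
    by move=> mA; rewrite law// s0 eqxx.
  have [I4 E4] := dirac_law mY law (mk 4%N 0).
  have [I2 E2] := dirac_law mY law (mk 2%N 0).
  have [I1 E1] := dirac_law mY law (mk 1%N 0).
  have e k : (fun x : R => (x - 0) ^+ k) \o Y = fun w => Y w ^+ k.
    by apply/funext => w /=; rewrite subr0.
  rewrite !e in I4 E4 E2 E1; split=> // E.
  have : itgR P (fun w => Y w ^+ 1) = 0 by [].
  by rewrite E1 E4 E2 subr0 expr1 => ->; rewrite !expr0n/= !mulr0.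
have {}law A : measurable A -> P (Y @^-1` A) = normal_prob m s A.
  by move=> mA; rewrite law// (negbTE s0).
have I k : (k <= 6)%N -> itg P (fun w => (Y w - m) ^+ k) /\
    itgR P (fun w => (Y w - m) ^+ k) = itgR leb (fun x => (x - m) ^+ k * normal_pdf m s x).
  by move=> k6; exact: (normal_law s0 mY law (mk k m) (itg_normal_moment m s0 k6)).
split.
  have [I4 _] := I 4%N isT; have [I0 _] := I 0%N isT.
  (* From (a + m)^4 <= 8 a^4 + 8 m^4; the factor with exponent 0 makes the constant term another
     moment. *)
  apply: (itg_le (g := fun w => 8 * (Y w - m) ^+ 4 + 8 * m ^+ 4 * (Y w - m) ^+ 0)).
  - have := measurableT_comp (mk 4%N 0) mY.
    by under [X in measurable_fun _ X -> _]eq_fun do rewrite /= subr0.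
  - move=> w; rewrite expr0 mulr1 ger0_norm ?exprn_even_ge0//.
    move: (Y w) => y; pose a := y - m; rewrite (_ : y = a + m) ?addrK; last by rewrite /a subrK.
    have h1 : (a + m) ^+ 2 <= 2 * (a ^+ 2 + m ^+ 2) by have := sqr_ge0 (a - m); lra.
    have key (u v t : R) : 0 <= u -> 0 <= v -> 0 <= t -> t <= 2 * (u + v) ->
        t ^+ 2 <= 8 * u ^+ 2 + 8 * v ^+ 2.
      by move=> u0 v0 t0 tuv; have := sqr_ge0 (u - v); nra.
    have h2 := key _ _ _ (sqr_ge0 a) (sqr_ge0 m) (sqr_ge0 (a + m)) h1.
    by rewrite -!exprM in h2.
  - by apply: itgD; exact: itgZ.
move=> E0.
have [I1 E1] := I 1%N isT; rewrite normal_moment1// in E1.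
have [I0 _] := I 0%N isT.
have m0 : m = 0.
  have : itgR P (fun w => (Y w - m) ^+ 1 + m * (Y w - m) ^+ 0) = 0.
    by rewrite -[RHS]E0; congr itgR; apply/funext => w; rewrite expr1 expr0 mulr1 subrK.
  rewrite itgRD//; last exact: itgZ.
  rewrite E1 add0r itgRZ// (_ : itgR P (fun w => (Y w - m) ^+ 0) = 1) ?mulr1//.
  have [_ ->] := I 0%N isT.
  by rewrite -[RHS](itgR_normal_pdf m s0); congr itgR; apply/funext => x; rewrite expr0 mul1r.
have [_ E4] := I 4%N isT; have [_ E2] := I 2%N isT.
have e k : (fun w => (Y w - m) ^+ k) = (fun w => Y w ^+ k) by apply/funext => w; rewrite m0 subr0.
rewrite !e in E4 E2; rewrite E4 E2 (normal_moment_rec m s0 (isT : (2 <= 4)%N)).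
rewrite (normal_moment_rec m s0 (isT : (0 <= 4)%N)).
rewrite (_ : itgR leb (fun x => (x - m) ^+ 0 * _) = 1); first by ring.
by rewrite -[RHS](itgR_normal_pdf m s0); congr itgR; apply/funext => x; rewrite expr0 mul1r.
Qed.

End GaussianLaw.

(* A centered Gaussian space; Wick's formula follows from the fourth moments by
   polarization. *)
Section Wick.
Context {R : realType} {dO : measure_display} {Omega : measurableType dO}.
Variable P : probability Omega R.
Variable G : (Omega -> R) -> Prop.
Hypothesis GD : forall Y Z, G Y -> G Z -> G (fun w => Y w + Z w).
Hypothesis GZ : forall (a : R) Y, G Y -> G (fun w => a * Y w).
Hypothesis Gg : forall Y, G Y -> gaussian_rv P Y.
Hypothesis G0 : forall Y, G Y -> itgR P Y = 0.

Let moment (Y : Omega -> R) k : G Y -> (k <= 4)%N -> itg P (fun w => Y w ^+ k).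
Proof.
move=> GY k4; have [I4 _] := gaussian_moments (Gg GY).
have mY : measurable_fun setT Y by have [] := Gg GY.
apply: (itg_le (g := fun w => 1 + Y w ^+ 4)).
- exact: measurable_funX.
- move=> w; rewrite normrX (_ : Y w ^+ 4 = `|Y w| ^+ 4).
    case: (lerP `|Y w| 1) => h; first by rewrite (le_trans (exprn_ile1 _ _ h))// lerDl exprn_ge0.
    by rewrite (le_trans (ler_weXn2l (ltW h) k4))// lerDr.
  by rewrite -normrX ger0_norm// exprn_even_ge0.
- by apply: itgD => //; exact: finite_measure_integrable_cst.
Qed.

Lemma wick_itg (A B C E : Omega -> R) : G A -> G B -> G C -> G E ->
  itg P (fun w => A w * B w * C w * E w).
Proof.
move=> GA GB GC GE.
have mm Y : G Y -> measurable_fun setT Y by move=> /Gg[].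
apply: (itg_le (g := fun w => A w ^+ 4 + B w ^+ 4 + C w ^+ 4 + E w ^+ 4)).
- by do !apply: measurable_funM; exact: mm.
- move=> w; move: (A w) (B w) (C w) (E w) => a b c e.
  have p (x y : R) : `|x * y| * 2 <= x ^+ 2 + y ^+ 2.
    rewrite normrM -(real_normK (num_real x)) -(real_normK (num_real y)).
    by have := sqr_ge0 (`|x| - `|y|); lra.
  have := p (a * b) (c * e); rewrite mulrA.
  have := p (a ^+ 2) (b ^+ 2); have := p (c ^+ 2) (e ^+ 2).
  rewrite -!exprMn -!exprM (ger0_norm (x := (a * b) ^+ 2)) ?sqr_ge0//.
  rewrite (ger0_norm (x := (c * e) ^+ 2)) ?sqr_ge0//.
  have e0 (x : R) : 0 <= x ^+ 4 by rewrite exprn_even_ge0.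
  by have := e0 a; have := e0 b; have := e0 c; have := e0 e; lra.
- by do !apply: itgD; exact: moment.
Qed.

Lemma wick_itg2 (A B : Omega -> R) : G A -> G B -> itg P (fun w => A w * B w).
Proof.
move=> GA GB.
have mm Y : G Y -> measurable_fun setT Y by move=> /Gg[].
apply: (itg_le (g := fun w => A w ^+ 2 + B w ^+ 2)).
- by apply: measurable_funM; exact: mm.
- move=> w; rewrite normrM -(real_normK (num_real (A w))) -(real_normK (num_real (B w))).
  by have := sqr_ge0 (`|A w| - `|B w|); have := normr_ge0 (A w); have := normr_ge0 (B w); nra.
- by apply: itgD; exact: moment.
Qed.

Let E2 A B := itgR P (fun w => A w * B w).
Let E4 A B C E := itgR P (fun w => A w * B w * C w * E w).

Let E2C A B : E2 A B = E2 B A.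
Proof. by congr itgR; apply/funext => w; rewrite mulrC. Qed.

Let fourth A : G A -> E4 A A A A = 3 * E2 A A ^+ 2.
Proof.
move=> GA; have [_ /(_ (G0 GA)) h] := gaussian_moments (Gg GA).
rewrite /E4 /E2 (_ : (fun w => A w * A w) = (fun w => A w ^+ 2)).
  by rewrite -h; congr itgR; apply/funext => w; ring.
by apply/funext => w; ring.
Qed.

(* 24 abcd is an alternating sum of fourth powers of a ± b ± c ± d. *)
Lemma wick A B C E : G A -> G B -> G C -> G E ->
  E4 A B C E = E2 A B * E2 C E + E2 A C * E2 B E + E2 A E * E2 B C.
Proof.
move=> GA GB GC GE.
pose S (x y z : R) w := A w + (x * B w + (y * C w + z * E w)).
have GS x y z : G (S x y z) by apply: GD => //; apply: GD; [|apply: GD]; exact: GZ.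
have I x y z : itg P (fun w => S x y z w ^+ 4) by exact: moment.
have ES x y z : itgR P (fun w => S x y z w ^+ 4) = 3 * E2 (S x y z) (S x y z) ^+ 2.
  rewrite -fourth//; congr itgR; apply/funext => w; ring.
have E2S x y z : E2 (S x y z) (S x y z) = E2 A A + x ^+ 2 * E2 B B + y ^+ 2 * E2 C C +
    z ^+ 2 * E2 E E + 2 * (x * E2 A B + y * E2 A C + z * E2 A E + x * y * E2 B C +
    x * z * E2 B E + y * z * E2 C E).
  have lin U : G U -> E2 (S x y z) U = E2 A U + (x * E2 B U + (y * E2 C U + z * E2 E U)).
    move=> GU; rewrite /E2 -!itgRZ; [|exact: wick_itg2..].
    have h V c : G V -> itg P (fun w => c * (V w * U w)).
      by move=> GV; apply: itgZ; exact: wick_itg2.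
    rewrite -itgRD; [|exact: h..]; rewrite -itgRD; [|exact: h|by apply: itgD; exact: h].
    rewrite -itgRD; [|exact: wick_itg2|by do 2 (apply: itgD; first exact: h); exact: h].
    by congr itgR; apply/funext => w; rewrite /S; ring.
  rewrite lin// !(E2C _ (S x y z)) !lin// !(E2C B A) !(E2C C A) !(E2C E A).
  by rewrite !(E2C C B) !(E2C E B) !(E2C E C); ring.
(* Each of the eight sign patterns contributes 24 ABCE with the sign xyz, and all other monomials
   cancel; 192 = 8 * 24. *)
have -> : E4 A B C E = 192^-1 * (
   itgR P (fun w => S 1 1 1 w ^+ 4) - itgR P (fun w => S 1 1 (-1) w ^+ 4)
 - itgR P (fun w => S 1 (-1) 1 w ^+ 4) + itgR P (fun w => S 1 (-1) (-1) w ^+ 4)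
 - itgR P (fun w => S (-1) 1 1 w ^+ 4) + itgR P (fun w => S (-1) 1 (-1) w ^+ 4)
 + itgR P (fun w => S (-1) (-1) 1 w ^+ 4) - itgR P (fun w => S (-1) (-1) (-1) w ^+ 4)).
  rewrite -itgRB// -itgRB; [|exact: itgB|by[]].
  rewrite -itgRD; [|do 2 apply: itgB => //|by[]].
  rewrite -itgRB; [|apply: itgD => //; do 2 apply: itgB => //|by[]].
  rewrite -itgRD; [|apply: itgB => //; apply: itgD => //; do 2 apply: itgB => //|by[]].
  rewrite -itgRD; [|apply: itgD => //; apply: itgB => //; apply: itgD => //; do 2 apply: itgB => //|by[]].
  rewrite -itgRB; [|do 2 apply: itgD => //; apply: itgB => //; apply: itgD => //; do 2 apply: itgB => //|by[]].
  rewrite -itgRZ; last first.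
    by apply: itgB => //; do 2 apply: itgD => //; apply: itgB => //; apply: itgD => //; do 2 apply: itgB => //.
  by congr itgR; apply/funext => w; rewrite /S; field.
by rewrite !ES !E2S; field.
Qed.

End Wick.

(** * A law of large numbers *)

Section Riemann.
Context {R : realType}.
Local Notation leb := (@lebesgue_measure R).
Implicit Types (y F : R -> R).

(** Heine's theorem from the near-covering form of compactness. Only s is confined to the segment; t
    may lie outside. *)
Lemma segment_unif_continuous y (a b e : R) : continuous y -> 0 < e ->
  exists2 d, 0 < d & forall s t, a <= s <= b -> `|t - s| < d -> `|y t - y s| < e.
Proof.
move=> cy e0.
have /compact_near_coveringP cov := @segment_compact R a b.
pose P (d s : R) := forall t, `|t - s| < d -> `|y t - y s| < e.
have /(cov R (0 : R)^'+ P) : forall x, `[a, b]%classic x ->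
    \forall x' \near x & d \near (0 : R)^'+, P d x'.
  move=> x _; have e2 : 0 < e / 2 by rewrite divr_gt0.
  have /cvgrPdist_lt /(_ _ e2) := cy x.
  move=> /nbhs_ballP[r /= r0 hr].
  have hr' z : `|x - z| < r -> `|y x - y z| < e / 2 by move=> h; exact: hr.
  exists (ball x (r / 2), [set d | d < r / 2]) => /=.
    split; first by apply: nbhsx_ballx; rewrite divr_gt0.
    by near=> d => /=; near: d; apply: nbhs_right_lt; rewrite divr_gt0.
  move=> [z d] /= [xz dr] t tz.
  have xz' : `|x - z| < r / 2 by [].
  rewrite (_ : y t - y z = (y x - y z) - (y x - y t)); last by ring.
  rewrite (le_lt_trans (ler_normB _ _))// (splitr e) ltrD// hr'//.
    by rewrite (lt_le_trans xz')// ler_piMr// ?(ltW r0)// invf_le1// ler1n.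
  rewrite (_ : x - t = (x - z) - (t - z)); last by ring.
  rewrite (le_lt_trans (ler_normB _ _))// (splitr r) ltrD//.
  exact: lt_trans tz dr.
move=> H; have PF : ProperFilter (nbhs (0 : R)^'+) by exact: at_right_proper_filter.
have [d [h d0]] := filter_ex (filterI H (nbhs_right_gt (0 : R))); exists d => // s t st; apply: h.
by rewrite /= in_itv.
Unshelve. all: by end_near. Qed.

(** With a primitive, integrals over the windows [Q, 2Q] become increments, which can be compared
    when Q varies. *)
Lemma primitive_pos y : continuous y ->
  exists Phi : R -> R, forall x : R, 0 < x -> is_derive x 1 Phi (y x).
Proof.
move=> cy; exists (fun x => Rintegral leb `[0, x]%classic y) => x x0.
have I : leb.-integrable `[0, x + 1]%classic (EFin \o y).
  apply: continuous_compact_integrable; first exact: segment_compact.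
  exact: continuous_subspaceT.
have xx : x < x + 1 by rewrite ltrDl.
have [d e] := continuous_FTC1_closed xx I x0 (cy x).
by apply: DeriveDef; [exact: d|rewrite -derive1E].
Qed.

Lemma Rintegral_primitive y Phi (a b : R) : continuous y -> 0 < a -> a < b ->
  (forall x : R, 0 < x -> is_derive x 1 Phi (y x)) ->
  leb.-integrable `[a, b]%classic (EFin \o y) /\
  Rintegral leb `[a, b]%classic y = Phi b - Phi a.
Proof.
move=> cy a0 ab dPhi; split.
  apply: continuous_compact_integrable; first exact: segment_compact.
  exact: continuous_subspaceT.
have b0 := lt_trans a0 ab.
have cPhi x : 0 < x -> {for x, continuous Phi}.
  by move=> /dPhi[d _]; apply: differentiable_continuous; apply/derivable1_diffP.
rewrite /Rintegral (@continuous_FTC2 _ y Phi)//.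
- exact: continuous_subspaceT.
- split.
  + by move=> x; rewrite in_itv/= => /andP[ax _]; have [] := dPhi x (lt_trans a0 ax).
  + by apply: cvg_at_right_filter; exact: cPhi.
  + by apply: cvg_at_left_filter; exact: cPhi.
- move=> x; rewrite in_itv/= => /andP[ax _].
  by rewrite derive1E; have [_ ->] := dPhi x (lt_trans a0 ax).
Qed.

Definition riemann_node (a b : R) n k : R := a + k%:R * ((b - a) / n.+1%:R).

Definition riemann_sum (a b : R) n y : R :=
  (b - a) / n.+1%:R * \sum_(k < n.+1) y (riemann_node a b n k).

Lemma riemann_node_in (a b : R) n k : a <= b -> (k <= n)%N ->
  a <= riemann_node a b n k <= b.
Proof.
move=> ab kn; have d0 : 0 <= b - a by rewrite subr_ge0.
rewrite /riemann_node lerDl mulr_ge0 ?divr_ge0//= addrC -lerBrDr mulrCA ler_piMr//.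
by rewrite ler_pdivrMr ?mul1r ?ler_nat ?leqW.
Qed.

(** The increment of Phi telescopes over the cells; on each cell the mean value theorem and uniform
    continuity compare it with the node value. *)
Lemma riemann_cvg y Phi (a b : R) : continuous y -> 0 < a -> a <= b ->
  (forall x : R, 0 < x -> is_derive x 1 Phi (y x)) ->
  riemann_sum a b n y @[n --> \oo] --> Phi b - Phi a.
Proof.
move=> cy a0 ab dPhi; apply/cvgrPdist_le => e e0.
have ba1 : 0 < b - a + 1 by rewrite ltr_pwDr// subr_ge0.
have ea : 0 < e / (b - a + 1) by rewrite divr_gt0.
have [d d0 hd] := @segment_unif_continuous y a b _ cy ea.
have dd : 0 < d / (b - a + 1) by rewrite divr_gt0.
have := near_infty_natSinv_lt (PosNum dd); apply: filterS => n /= nd.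
set h := (b - a) / n.+1%:R.
have h0 : 0 <= h by rewrite divr_ge0 ?subr_ge0.
have hn : h * n.+1%:R = b - a by rewrite /h divfK// pnatr_eq0.
have hd' : h < d.
  rewrite /h; apply: le_lt_trans (_ : (b - a + 1) / n.+1%:R < _).
    by rewrite ler_wpM2r// lerDl.
  by rewrite mulrC -ltr_pdivlMr.
have tel : Phi b - Phi a =
    \sum_(k < n.+1) (Phi (riemann_node a b n k.+1) - Phi (riemann_node a b n k)).
  rewrite -(big_mkord xpredT (fun k => Phi (riemann_node a b n k.+1) - Phi (riemann_node a b n k))).
  rewrite telescope_sumr//; congr (Phi _ - Phi _); last by rewrite /riemann_node mul0r addr0.
  by rewrite /riemann_node mulrC hn subrKC.
rewrite tel /riemann_sum -/h mulr_sumr -sumrB.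
apply: le_trans (ler_norm_sum _ _ _) _.
apply: le_trans (_ : \sum_(k < n.+1) h * (e / (b - a + 1)) <= _); last first.
  rewrite sumr_const card_ord -mulr_natl mulrA (mulrC _ h) hn mulrCA ler_piMr ?(ltW e0)//.
  by rewrite ler_pdivrMr// mul1r lerDl.
apply: ler_sum => k _.
have /andP[ak kb] := riemann_node_in ab (ltn_ord k : (k <= n)%N).
have ek : riemann_node a b n k.+1 = riemann_node a b n k + h.
  by rewrite /riemann_node -natr1 mulrDl mul1r addrA.
rewrite ek; move: (riemann_node a b n k) ak kb => t at_ tb.
have [->|hn0] := eqVneq h 0; first by rewrite addr0 subrr !mul0r subrr normr0.
have hp : 0 < h by rewrite lt_neqAle eq_sym hn0.
have t0 := lt_le_trans a0 at_.
have th : t < t + h by rewrite ltrDl.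
have dt (x : R) : x \in `]t, t + h[ -> is_derive x 1 Phi (y x).
  by rewrite in_itv/= => /andP[tx _]; exact: dPhi (lt_trans t0 tx).
have [|c] := @MVT R Phi y t (t + h) th dt.
  apply: derivable_within_continuous => x; rewrite in_itv/= => /andP[tx _].
  by have [] := dPhi x (lt_le_trans t0 tx).
rewrite in_itv/= => /andP[tc cth] ->; rewrite addrAC subrr add0r mulrC -mulrBr normrM (ger0_norm h0).
rewrite ler_wpM2l// ltW// hd ?at_//.
by rewrite gtr0_norm ?subr_gt0// ltrBlDl (lt_trans cth)// ltrD2l.
Qed.

End Riemann.

(** * Second moments of window integrals and almost sure convergence *)

Section SecondMoment.
Context {R : realType} {dO : measure_display} {Omega : measurableType dO}.
Variable P : probability Omega R.
Local Notation leb := (@lebesgue_measure R).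

(** Applied to the Riemann sums of a pathwise integral, this yields its measurability and second
    moment without any joint measurability in time and outcome. The bound is asked only eventually
    because the mesh must be fine. *)
Lemma fatou_sqr (Z : nat -> Omega -> R) (J : Omega -> R) (B : R) :
  (forall n, measurable_fun setT (Z n)) -> (forall w, Z n w @[n --> \oo] --> J w) ->
  (exists N, forall n, (N <= n)%N -> (\int[P]_w ((Z n w) ^+ 2)%:E <= B%:E)%E) ->
  measurable_fun setT J /\ (\int[P]_w ((J w) ^+ 2)%:E <= B%:E)%E.
Proof.
move=> mZ ZJ [N bN]; split; first by apply: (measurable_fun_cvg mZ) => w _; exact: ZJ.
pose f n w := (Z (n + N)%N w ^+ 2)%:E.
have mf n : measurable_fun setT (f n) by apply/measurable_EFinP/measurable_funX.
have f0 n w : setT w -> (0 <= f n w)%E by rewrite lee_fin sqr_ge0.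
have := fatou P measurableT mf f0.
rewrite (eq_integral (fun w => ((J w) ^+ 2)%:E)); last first.
  move=> w _; have [] := @cvg_limn_einf_sup R (f^~ w) ((J w) ^+ 2)%:E; last by [].
  have h : Z (n + N)%N w @[n --> \oo] --> J w by rewrite (cvg_shiftn N (Z^~ w)); exact: ZJ.
  have hh : Z (n + N)%N w ^+ 2 @[n --> \oo] --> J w ^+ 2.
    by under eq_fun do rewrite expr2; rewrite expr2; apply: cvgM.
  by apply: cvg_EFin; [near=> n|exact: hh].
move=> /le_trans; apply; rewrite limn_einf_lim; apply: lime_le.
  by apply: ereal_nondecreasing_is_cvgn; exact: nondecreasing_einfs.
near=> n; apply: le_trans (bN (n + N)%N (leq_addl _ _)).
by apply: ereal_inf_lbound; exists n => //=.
Unshelve. all: by end_near. Qed.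

Lemma sum_inv_sqr n : \sum_(k < n) (k.+1%:R ^+ 2)^-1 <= 2 :> R.
Proof.
case: n => [|n]; first by rewrite big_ord0.
apply: le_trans (_ : 2 - (n.+1%:R)^-1 <= _); last by rewrite gerBl invr_ge0.
elim: n => [|n IH]; first by rewrite big_ord1 expr1n invr1; lra.
rewrite big_ord_recr/=; apply: le_trans (lerD IH (lexx _)) _.
have n0 : 0 < n.+1%:R :> R by [].
have -> : n.+2%:R = n.+1%:R + 1 :> R by rewrite -natr1.
move: n.+1%:R n0 => u u0; have u1 : 0 < u + 1 by lra.
rewrite -subr_ge0 (_ : _ - _ = (u * (u + 1) ^+ 2)^-1).
  by rewrite invr_ge0 mulr_ge0 ?sqr_ge0 ?(ltW u0).
by field; rewrite !gt_eqF.
Qed.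

(** The series of the X_n has finite expectation, so it converges almost surely and its terms tend
    to 0. *)
Lemma as_cvg0 (X : nat -> Omega -> R) (D : R) :
  (forall n, measurable_fun setT (X n)) -> (forall n w, 0 <= X n w) ->
  (forall n, (\int[P]_w (X n w)%:E <= (D * (n.+1%:R ^+ 2)^-1)%:E)%E) ->
  {ae P, forall w, X n w @[n --> \oo] --> (0 : R)}.
Proof.
move=> mX X0 bX.
pose f n w := (X n w)%:E.
have mf n : measurable_fun setT (f n) by exact/measurable_EFinP.
have f0 n w : setT w -> (0 <= f n w)%E by rewrite lee_fin.
have D0 : 0 <= D.
  have h : (0 <= \int[P]_w (X 0%N w)%:E)%E by apply: integral_ge0 => w _; rewrite lee_fin.
  by have := le_trans h (bX 0%N); rewrite lee_fin expr1n invr1 mulr1.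
have fin : (\int[P]_w (\sum_(n <oo) f n w) < +oo)%E.
  rewrite integral_nneseries//; apply: le_lt_trans (_ : (D * 2)%:E < _)%E; last exact: ltry.
  apply: lime_le.
    by apply: is_cvg_nneseries => n _ _; apply: integral_ge0 => w _; exact: f0.
  near=> n; rewrite big_mkord.
  apply: le_trans (_ : (\sum_(k < n) (D * (k.+1%:R ^+ 2)^-1)%:E <= _)%E).
    by apply: lee_sum => k _; exact: bX.
  by rewrite sumEFin lee_fin -mulr_sumr ler_wpM2l// sum_inv_sqr.
have I : P.-integrable setT (fun w => \sum_(n <oo) f n w)%E.
  apply/integrableP; split; first by apply: ge0_emeasurable_sum => // n w _ _; exact: f0.
  rewrite (eq_integral (fun w => (\sum_(n <oo) f n w)%E))// => w _.
  by rewrite gee0_abs// nneseries_ge0// => n _ _; exact: f0.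
have := integrable_ae measurableT I; apply: filterS => w /(_ Logic.I) Sfin.
have Soo : (\sum_(0 <= n <oo) f n w < +oo)%E by rewrite ltey_eq Sfin.
have tail := @nneseries_tail_cvg R (f^~ w) xpredT Soo (fun k _ => f0 k w Logic.I).
have : f n w @[n --> \oo] --> 0%E.
  apply: squeeze_cvge (cvg_cst 0%E) tail; near=> n; rewrite f0//=.
  have := @nneseries_lim_ge R (f^~ w) xpredT n n.+1 (fun k _ _ => f0 k w Logic.I).
  by rewrite big_nat1.
by move=> /fine_cvgP[].
Unshelve. all: by end_near. Qed.

(** A bounded primitive of (1 + |x|)^-2: sums of that function are bounded by telescoping. *)
Let sigm (x : R) := x / (1 + `|x|).

(** The cell [x, x + h] lies on one side of the origin. The factor 2 pays for evaluating at the left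
    end, which on the positive side is where the function is largest; h <= 1 makes it sufficient. *)
Let sigm_step (x h : R) : 0 < h <= 1 -> 0 <= x \/ x + h <= 0 ->
  h / (1 + `|x|) ^+ 2 <= 2 * (sigm (x + h) - sigm x).
Proof.
move=> /andP[h0 h1] [x0|x0]; rewrite /sigm.
  have xh : 0 < x + h by lra.
  rewrite (ger0_norm x0) (gtr0_norm xh).
  rewrite (_ : 2 * _ = h / ((1 + x) * ((1 + (x + h)) / 2))); last by field; rewrite !gt_eqF//; lra.
  rewrite ler_wpM2l ?(ltW h0)// lef_pV2 ?posrE; [|nra|nra].
  by nra.
have xm : x < 0 by lra.
rewrite (ler0_norm x0) (ltr0_norm xm).
rewrite (_ : 2 * _ = h / ((1 - x) * ((1 - (x + h)) / 2))); last by field; rewrite !gt_eqF//; lra.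
rewrite ler_wpM2l ?(ltW h0)// lef_pV2 ?posrE; [|nra|nra].
by nra.
Qed.

Let sigm_bound (x : R) : `|sigm x| <= 1.
Proof.
have p : 0 < 1 + `|x| by have := normr_ge0 x; lra.
rewrite /sigm normrM normfV (gtr0_norm p) ler_pdivrMr// mul1r; lra.
Qed.

(** A Riemann sum of (1 + |x|)^-2, bounded uniformly in mesh and centre. The node l = k sits exactly
    at 0, so no cell straddles the origin; 4 is 2 times the total variation 2 of [sigm]. *)
Lemma sum_correlation (h : R) n k : 0 < h <= 1 -> (k <= n)%N ->
  \sum_(l < n.+1) h / (1 + `|h * (l%:R - k%:R)|) ^+ 2 <= 4.
Proof.
move=> h01 kn.
apply: le_trans (_ : \sum_(l < n.+1) 2 * (sigm (h * (l.+1%:R - k%:R)) - sigm (h * (l%:R - k%:R))) <= _).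
  apply: ler_sum => l _.
  have -> : h * (l.+1%:R - k%:R) = h * (l%:R - k%:R) + h by rewrite -natr1; ring.
  apply: sigm_step => //; have /andP[h0 _] := h01.
  have [lk|kl] := ltnP l k; [right|left].
    have : l%:R + 1 <= k%:R :> R by rewrite natr1 ler_nat.
    by move: (l%:R : R) (k%:R : R) => u v; nra.
  by rewrite mulr_ge0 ?(ltW h0)// subr_ge0 ler_nat.
rewrite -mulr_sumr.
rewrite -(big_mkord xpredT (fun l => sigm (h * (l.+1%:R - k%:R)) - sigm (h * (l%:R - k%:R)))).
rewrite (telescope_sumr (fun l => sigm (h * (l%:R - k%:R))))//.
have := sigm_bound (h * (n.+1%:R - k%:R)); have := sigm_bound (h * (0%:R - k%:R)).
by rewrite !ler_norml => /andP[? ?] /andP[? ?]; lra.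
Qed.

Variables (Y : R -> Omega -> R).
Hypothesis mY : forall t, measurable_fun setT (Y t).
Hypothesis cY : forall w, continuous (Y^~ w).
Hypothesis IY : forall s t, itg P (fun w => Y s w * Y t w).
Variable C : R.
Hypothesis corr : forall s t, 1 <= s -> s <= t -> t <= 2 * s ->
  `|itgR P (fun w => Y s w * Y t w)| <= C / (1 + (t - s)) ^+ 2.

Let C_ge0 : 0 <= C.
Proof.
have := @corr 1 1 (lexx _) (lexx _); rewrite subrr addr0 expr1n divr1.
by move=> /(_ _)/(le_trans (normr_ge0 _)); apply; lra.
Qed.

(** Two points of one window [Q, 2Q] differ by a factor at most 2, so after ordering them the
    hypothesis on correlations applies. *)
Let corr_sym (Q s t : R) : 1 <= Q -> Q <= s <= 2 * Q -> Q <= t <= 2 * Q ->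
  `|itgR P (fun w => Y s w * Y t w)| <= C / (1 + `|s - t|) ^+ 2.
Proof.
move=> Q1 /andP[s1 s2] /andP[t1 t2].
wlog st : s t s1 s2 t1 t2 / s <= t => [H|].
  have [st|ts] := orP (le_total s t); first exact: H.
  have := H t s t1 t2 s1 s2 ts; rewrite distrC.
  by under eq_fun do rewrite mulrC.
rewrite (distrC s t) (ger0_norm (x := t - s)) ?subr_ge0//; apply: corr => //; first exact: le_trans s1.
by rewrite (le_trans t2)// ler_wpM2l.
Qed.

Let second_moment (t : R) : 1 <= t -> itgR P (fun w => Y t w ^+ 2) <= C.
Proof.
move=> t1; have := corr t1 (lexx _); rewrite subrr addr0 expr1n divr1.
under eq_fun do rewrite -expr2.
by move=> /(_ _)/ler_normlW; apply; lra.
Qed.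

Let riemann_sqr (a b : R) n (Z : R -> Omega -> R) w : riemann_sum a b n (Z^~ w) ^+ 2 =
  \sum_(k < n.+1) \sum_(l < n.+1) ((b - a) / n.+1%:R) ^+ 2 *
    (Z (riemann_node a b n k) w * Z (riemann_node a b n l) w).
Proof.
rewrite /riemann_sum exprMn expr2 [X in _ * X]expr2 mulr_suml mulr_sumr.
apply: eq_bigr => k _; rewrite !mulr_sumr; apply: eq_bigr => l _; by rewrite -expr2.
Qed.

Let riemann_itg (a b : R) n (Z : R -> Omega -> R) :
  (forall s t, itg P (fun w => Z s w * Z t w)) ->
  (\int[P]_w (riemann_sum a b n (Z^~ w) ^+ 2)%:E)%E =
  (\sum_(k < n.+1) \sum_(l < n.+1) ((b - a) / n.+1%:R) ^+ 2 *
    itgR P (fun w => Z (riemann_node a b n k) w * Z (riemann_node a b n l) w))%:E.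
Proof.
move=> IZ; under eq_integral do rewrite riemann_sqr.
have I1 k l : itg P (fun w => ((b - a) / n.+1%:R) ^+ 2 *
    (Z (riemann_node a b n k) w * Z (riemann_node a b n l) w)) by exact: itgZ.
rewrite itgR_fin; last by apply: itg_sum => k; apply: itg_sum.
congr EFin; rewrite itgR_sum; last by move=> k; apply: itg_sum.
by apply: eq_bigr => k _; rewrite itgR_sum//; apply: eq_bigr => l _; rewrite itgRZ.
Qed.

Let measurable_riemann (a b : R) n (Z : R -> Omega -> R) :
  (forall t, measurable_fun setT (Z t)) ->
  measurable_fun setT (fun w => riemann_sum a b n (Z^~ w)).
Proof.
move=> mZ; apply: measurable_funM => //; apply: measurable_sum => k; exact: mZ.
Qed.

Let Phi w := projT1 (cid (primitive_pos (@cY w))).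
Let dPhi w : forall x : R, 0 < x -> is_derive x 1 (Phi w) (Y x w).
Proof. exact: projT2 (cid (primitive_pos (@cY w))). Qed.

Let cN w : continuous (fun t => `|Y t w|).
Proof. by move=> t; apply: continuous_comp; [exact: cY|exact: norm_continuous]. Qed.

Let Psi w := projT1 (cid (primitive_pos (@cN w))).
Let dPsi w : forall x : R, 0 < x -> is_derive x 1 (Psi w) `|Y x w|.
Proof. exact: projT2 (cid (primitive_pos (@cN w))). Qed.

(** In the double sum each row is at most 4Ch by [sum_correlation]; the n + 1 rows add up to 4CQ,
    linear in Q instead of quadratic. *)
Let J_moment (Q : R) : 1 <= Q ->
  measurable_fun setT (fun w => Phi w (2 * Q) - Phi w Q) /\
  (\int[P]_w ((Phi w (2 * Q) - Phi w Q) ^+ 2)%:E <= (4 * C * Q)%:E)%E.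
Proof.
move=> Q1; have Q0 : 0 < Q by lra.
have QQ : Q <= 2 * Q by lra.
apply: (@fatou_sqr (fun n w => riemann_sum Q (2 * Q) n (Y^~ w))).
- by move=> n; exact: measurable_riemann.
- by move=> w; apply: riemann_cvg => //; exact: dPhi.
(* The mesh h = Q/(n+1) must be at most 1 for [sum_correlation]. *)
have Qi : 0 < Q^-1 by rewrite invr_gt0.
have := near_infty_natSinv_lt (PosNum Qi) => -[N _ hN]; exists N => n /hN /= nQ.
rewrite riemann_itg// lee_fin (_ : 2 * Q - Q = Q); last by ring.
set h := Q / n.+1%:R.
have h01 : 0 < h <= 1.
  rewrite /h divr_gt0//= ler_pdivrMr// mul1r.
  by rewrite ltW// -ltf_pV2 ?posrE.
have /andP[h0 h1] := h01.
apply: le_trans (_ : \sum_(k < n.+1) (C * h) * 4 <= _); last first.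
  by rewrite sumr_const card_ord -mulr_natr /h le_eqVlt; apply/orP; left; apply/eqP; field; rewrite gt_eqF//= ltr0Sn.
apply: ler_sum => k _.
apply: le_trans (_ : \sum_(l < n.+1) (C * h) * (h / (1 + `|h * (l%:R - k%:R)|) ^+ 2) <= _); last first.
  rewrite -mulr_sumr; apply: ler_wpM2l; first by rewrite mulr_ge0 ?(ltW h0).
  by apply: sum_correlation => //; rewrite -ltnS.
apply: ler_sum => l _.
rewrite expr2 -mulrA [leRHS](_ : _ = h * (h * (C / (1 + `|h * (l%:R - k%:R)|) ^+ 2))); last by ring.
do 2 (apply: ler_wpM2l; first exact: ltW).
apply: le_trans (ler_norm _) _.
have nd j : (j <= n)%N -> Q <= riemann_node Q (2 * Q) n j <= 2 * Q by exact: riemann_node_in.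
apply: le_trans (corr_sym Q1 (nd k _) (nd l _)) _; rewrite -1?ltnS//.
rewrite /riemann_node (_ : _ - (Q + _) = - (h * (l%:R - k%:R))) ?normrN//.
by rewrite /h; field; rewrite gt_eqF//= ltr0Sn.
Qed.

(** A crude bound that ignores decay of correlations, using only second moments. It controls the
    short intervals between consecutive sampling points. *)
Let K_moment (a b : R) : 1 <= a -> a <= b ->
  measurable_fun setT (fun w => Psi w b - Psi w a) /\
  (\int[P]_w ((Psi w b - Psi w a) ^+ 2)%:E <= (C * (b - a) ^+ 2)%:E)%E.
Proof.
move=> a1 ab; have a0 : 0 < a by lra.
apply: (@fatou_sqr (fun n w => riemann_sum a b n (fun t => `|Y t w|))).
- move=> n; apply: (@measurable_riemann _ _ _ (fun t w => `|Y t w|)) => t.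
  exact: measurableT_comp.
- by move=> w; apply: riemann_cvg => //; exact: dPsi.
exists 0%N => n _.
have IN s t : itg P (fun w => `|Y s w| * `|Y t w|).
  by have := itg_abs (IY s t); under [X in itg _ X -> _]eq_fun do rewrite normrM.
have := @riemann_itg a b n (fun t w => `|Y t w|) IN => /= ->.
rewrite lee_fin; set h := (b - a) / n.+1%:R.
apply: le_trans (_ : \sum_(k < n.+1) \sum_(l < n.+1) h ^+ 2 * C <= _); last first.
  rewrite !sumr_const !card_ord -!mulrnA -mulr_natr natrM /h le_eqVlt; apply/orP; left; apply/eqP; field.
  by rewrite gt_eqF//= ltr0Sn.
apply: ler_sum => k _; apply: ler_sum => l _; rewrite ler_wpM2l ?sqr_ge0//.
have nd j : (j <= n)%N -> 1 <= riemann_node a b n j.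
  by move=> jn; have /andP[h1 _] := riemann_node_in ab jn; exact: le_trans h1.
set s := riemann_node _ _ _ k; set t := riemann_node _ _ _ l.
have s1 : 1 <= s by apply: nd; rewrite -ltnS.
have t1 : 1 <= t by apply: nd; rewrite -ltnS.
have I2 u : itg P (fun w => Y u w ^+ 2) by have := IY u u; under eq_fun do rewrite -expr2.
apply: le_trans (_ : itgR P (fun w => 2^-1 * (Y s w ^+ 2 + Y t w ^+ 2)) <= _).
  apply: le_itgR => //; first by apply: itgZ; exact: itgD.
  move=> w; rewrite -(real_normK (num_real (Y s w))) -(real_normK (num_real (Y t w))).
  by have := sqr_ge0 (`|Y s w| - `|Y t w|); lra.
rewrite itgRZ; last exact: itgD.
by rewrite itgRD//; have := second_moment s1; have := second_moment t1; lra.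
Qed.

(** Along the squares the normalized integrals have second moments O(1/n^2), hence tend to 0. A
    general Q differs from a square by O(n) at the left end and O(n) at the right end of its window;
    the integrals of |Y| over these gaps have second moment O(n^2), again O(1/n^2) after division by
    q(n)^2 = (n+1)^4. *)
Theorem average_cvg0 : {ae P, forall w,
  Q^-1 * Rintegral leb `[Q, 2 * Q]%classic (Y^~ w) @[Q --> +oo] --> (0 : R)}.
Proof.
(* Squares are sparse enough for the sum of 1/q to converge and dense enough for the gaps to be
   O(sqrt q). *)
pose q n : R := n.+1%:R ^+ 2.
have q1 n : 1 <= q n by rewrite exprn_ege1// ler1n.
have q0 n : 0 < q n by exact: lt_le_trans (q1 n).
have qm n : q n <= q n.+1 by rewrite lerXn2r ?nnegrE ?ler_nat.
pose A n w := Phi w (2 * q n) - Phi w (q n).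
pose K n w := Psi w (q n.+1) - Psi w (q n).
pose L n w := Psi w (2 * q n.+1) - Psi w (2 * q n).
have sc (F : Omega -> R) (B : R) n : measurable_fun setT F /\
    (\int[P]_w ((F w) ^+ 2)%:E <= B%:E)%E ->
  measurable_fun setT (fun w => (F w / q n) ^+ 2) /\
    (\int[P]_w ((F w / q n) ^+ 2)%:E <= (B / q n ^+ 2)%:E)%E.
  move=> [mF bF]; split; first by apply: measurable_funX; exact: measurable_funM.
  under eq_integral do rewrite exprMn mulrC EFinM.
  rewrite ge0_integralZl//; last by rewrite lee_fin sqr_ge0.
    have s0 : (0 <= ((q n)^-1 ^+ 2)%:E)%E by rewrite lee_fin sqr_ge0.
    by apply: le_trans (lee_wpmul2l s0 bF) _; rewrite -EFinM exprVn mulrC.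
    by apply/measurable_EFinP/measurable_funX.
  by move=> w _; rewrite lee_fin sqr_ge0.
have dq n : q n.+1 - q n <= 3 * n.+1%:R.
  rewrite /q -[n.+2%:R]natr1; have : 1 <= n.+1%:R :> R by rewrite ler1n.
  by move: (n.+1%:R : R) => u; nra.
have lim0 (F : nat -> Omega -> R) (B : nat -> R) (D : R) :
    (forall n, measurable_fun setT (F n) /\ (\int[P]_w ((F n w) ^+ 2)%:E <= (B n)%:E)%E) ->
    (forall n, B n <= D * q n) ->
    {ae P, forall w, (F n w / q n) ^+ 2 @[n --> \oo] --> (0 : R)}.
  move=> hF hB; apply: (@as_cvg0 _ D) => [n|n w|n]; first by have [] := sc _ _ n (hF n).
    exact: sqr_ge0.
  have [_ /le_trans] := sc _ _ n (hF n); apply; rewrite lee_fin.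
  rewrite (_ : D / n.+1%:R ^+ 2 = D * q n / q n ^+ 2); last first.
    by rewrite /q; field; rewrite gt_eqF//= ltr0Sn.
  by rewrite ler_wpM2r// invr_ge0 exprn_ge0// ltW.
have hA := lim0 A (fun n => 4 * C * q n) (4 * C) (fun n => J_moment (q1 n)) (fun n => lexx _).
have dq2 n : C * (q n.+1 - q n) ^+ 2 <= 9 * C * q n.
  rewrite (_ : 9 * C * q n = C * (3 * n.+1%:R) ^+ 2); last by rewrite /q; ring.
  by rewrite ler_wpM2l// lerXn2r ?nnegrE ?dq ?subr_ge0.
have hK := lim0 K (fun n => C * (q n.+1 - q n) ^+ 2) (9 * C) (fun n => K_moment (q1 n) (qm n)) dq2.
have q21 n : 1 <= 2 * q n by have := q1 n; lra.
have q2m n : 2 * q n <= 2 * q n.+1 by rewrite ler_wpM2l.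
have hL := lim0 L (fun n => C * (2 * q n.+1 - 2 * q n) ^+ 2) (36 * C)
  (fun n => K_moment (q21 n) (q2m n)).
have {}hL : {ae P, forall w, (L n w / q n) ^+ 2 @[n --> \oo] --> (0 : R)}.
  apply: hL => n; rewrite (_ : 2 * q n.+1 - 2 * q n = 2 * (q n.+1 - q n)); last by ring.
  by have := dq2 n; rewrite exprMn mulrCA; lra.
have le_Phi w (a b : R) : 0 < a -> a <= b -> `|Phi w b - Phi w a| <= Psi w b - Psi w a.
  rewrite le_eqVlt => a0 /predU1P[->|ab]; first by rewrite !subrr normr0.
  have [I1 <-] := Rintegral_primitive (@cY w) a0 ab (@dPhi w).
  have [I2 <-] := Rintegral_primitive (@cN w) a0 ab (@dPsi w).
  exact: le_normr_Rintegral.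
suff key w : (A n w / q n) ^+ 2 @[n --> \oo] --> (0 : R) ->
    (K n w / q n) ^+ 2 @[n --> \oo] --> (0 : R) ->
    (L n w / q n) ^+ 2 @[n --> \oo] --> (0 : R) ->
    Q^-1 * Rintegral leb `[Q, 2 * Q]%classic (Y^~ w) @[Q --> +oo] --> (0 : R).
  by apply: filterS3 hA hK hL; exact: key.
move=> wA wK wL.
apply/cvgrPdist_lt => e e0; have e3 : 0 < (e / 3) ^+ 2 by rewrite exprn_gt0// divr_gt0.
have small (x : R) : `|0 - x ^+ 2| < (e / 3) ^+ 2 -> `|x| < e / 3.
  rewrite sub0r normrN normrX ltr_pXn2r// ?nnegrE ?normr_ge0// ltW// divr_gt0//.
move/cvgrPdist_lt : wA => /(_ _ e3)[N1 _ h1].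
move/cvgrPdist_lt : wK => /(_ _ e3)[N2 _ h2].
move/cvgrPdist_lt : wL => /(_ _ e3)[N3 _ h3].
pose N := maxn N1 (maxn N2 N3).
exists (q N); split; first exact: num_real.
move=> Q NQ.
have Q0 : 0 < Q by exact: lt_trans (q0 N) NQ.
(* The least n with Q <= q(n+1) brackets Q between consecutive squares, and it is at least N because
   Q > q(N). *)
have [n Nn /andP[nQ Qn]] : exists2 n, (N <= n)%N & q n <= Q <= q n.+1.
  have ex : exists n, Q <= q n.+1.
    exists (Num.bound Q); apply: le_trans (ltW (archi_boundP (ltW Q0))) _.
    rewrite /q; apply: le_trans (_ : (Num.bound Q).+2%:R <= _); first by rewrite ler_nat; do 2 apply: leqW.
    by rewrite expr2 ler_peMl// ler1n.
  case: (ex_minnP ex) => n hn mn.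
  have qmono i j : (i <= j)%N -> q i <= q j.
    by move=> ij; rewrite lerXn2r ?nnegrE ?ler_nat.
  exists n.
    by rewrite leqNgt; apply/negP => nN; have := lt_le_trans NQ hn; rewrite ltNge qmono.
  rewrite hn andbT; case: n mn {hn} => [|n] mn.
    by rewrite ltW// (le_lt_trans _ NQ)// qmono.
  by rewrite leNgt; apply/negP => /ltW/mn; rewrite ltnn.
have /small a1 := h1 n (leq_trans (leq_maxl _ _) Nn).
have /small a2 := h2 n (leq_trans (leq_maxl _ _) (leq_trans (leq_maxr _ _) Nn)).
have /small a3 := h3 n (leq_trans (leq_maxr _ _) (leq_trans (leq_maxr _ _) Nn)).
have QQ : Q < 2 * Q by lra.
have [_ ->] := Rintegral_primitive (@cY w) Q0 QQ (@dPhi w).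
have b1 := le_Phi w (q n) Q (q0 n) nQ.
have b1' := le_Phi w Q (q n.+1) Q0 Qn.
have b2 : `|Phi w (2 * Q) - Phi w (2 * q n)| <= Psi w (2 * Q) - Psi w (2 * q n).
  by apply: le_Phi; [have := q0 n; lra|lra].
have b2' : `|Phi w (2 * q n.+1) - Phi w (2 * Q)| <= Psi w (2 * q n.+1) - Psi w (2 * Q).
  by apply: le_Phi; lra.
have K0 : `|K n w| = K n w.
  by rewrite ger0_norm// (le_trans (normr_ge0 _) (le_Phi w _ _ (q0 n) (qm n))).
have L0 : `|L n w| = L n w.
  rewrite ger0_norm//; apply: le_trans (normr_ge0 _) (le_Phi w _ _ _ (q2m n)).
  by have := q0 n; lra.
rewrite sub0r normrN normrM normfV (gtr0_norm Q0) mulrC ltr_pdivrMr//.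
have qn0 := q0 n.
move: a1 a2 a3; rewrite !normrM normfV (gtr0_norm qn0) K0 L0 !ltr_pdivrMr// => a1 a2 a3.
apply: lt_le_trans (_ : e * q n <= _); last by rewrite ler_pM2l.
(* The window [Q, 2Q] is the window at q(n) extended at its right end and shortened at its left end;
   each of the three pieces contributes at most e/3. *)
have -> : Phi w (2 * Q) - Phi w Q =
  A n w + (Phi w (2 * Q) - Phi w (2 * q n)) - (Phi w Q - Phi w (q n)) by rewrite /A; ring.
have t1 := ler_normB (A n w + (Phi w (2 * Q) - Phi w (2 * q n))) (Phi w Q - Phi w (q n)).
have t2 := ler_normD (A n w) (Phi w (2 * Q) - Phi w (2 * q n)).
have p1 := normr_ge0 (Phi w (q n.+1) - Phi w Q).
have p2 := normr_ge0 (Phi w (2 * q n.+1) - Phi w (2 * Q)).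
by move: a2 a3; rewrite /K /L => a2 a3; lra.
Qed.

End SecondMoment.

(** * Distributions and Gaussian fields *)

Section DistributionBasics.
Context {R : realType} {d : nat}.
Implicit Types (T : distrib R d) (phi psi : 'cV[R]_d -> R[i]).

Lemma dpairD T phi psi : C0infty setT phi -> C0infty setT psi ->
  T (fun x => phi x + psi x) = T phi + T psi.
Proof.
move=> Cp Cs; have := dpair_linear T 1 Cp Cs; rewrite mul1r => <-.
by congr (T _); apply/funext => x; rewrite mul1r.
Qed.

Lemma dpair0 T : T (fun=> 0) = 0.
Proof.
have C0 := C0infty0 (setT : set 'cV[R]_d).
have := dpairD T C0 C0; rewrite (_ : (fun _ => 0 + 0) = fun=> 0).
  by move=> h; apply: (@addrI _ (T (fun=> 0))); rewrite addr0 -h.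
by apply/funext => x; rewrite addr0.
Qed.

Lemma dpairZ T a phi : C0infty setT phi -> T (fun x => a * phi x) = a * T phi.
Proof.
move=> Cp; have := dpair_linear T a Cp (C0infty0 _); rewrite dpair0 addr0 => <-.
by congr (T _); apply/funext => x; rewrite addr0.
Qed.

Lemma dpairB T phi psi : C0infty setT phi -> C0infty setT psi ->
  T (fun x => phi x - psi x) = T phi - T psi.
Proof.
move=> Cp Cs; have := dpair_linear T (-1) Cs Cp; rewrite mulN1r addrC => <-.
by congr (T _); apply/funext => x; rewrite mulN1r addrC.
Qed.

(** The scaling by 2/r sends the cubes of radii r/2 and r about a to those of radii 1 and 2, where
    [plateau 1] becomes 1 and 0. *)
Definition bump (a : 'cV[R]_d) (r : R) : 'cV[R]_d -> R[i] :=
  tens (fun i t => plateau 1 ((2 / r) * t + (- (2 / r) * a i 0))).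

Let bump_arg (a t r : R) : 0 < r -> `|(2 / r) * t + (- (2 / r) * a)| = 2 / r * `|t - a|.
Proof.
move=> r0; rewrite (_ : _ + _ = 2 / r * (t - a)); last by ring.
by rewrite normrM ger0_norm// divr_ge0// ltW.
Qed.

Lemma smooth_bump a r : smooth (bump a r).
Proof. by apply: smooth_tens => i; apply: smooth1_affine; exact: smooth1_plateau. Qed.

Lemma bump_eq1 a r x : 0 < r -> `|x - a| <= r / 2 -> bump a r x = 1.
Proof.
move=> r0 h; rewrite /bump /tens big1// => i _; rewrite plateau_eq1// bump_arg//.
have := coord_le_norm (x - a) i; rewrite !mxE => /le_trans/(_ h) h'.
rewrite mulrAC ler_pdivrMr// mul1r; lra.
Qed.

Lemma bump_eq0 a r x : 0 < r -> r <= `|x - a| -> bump a r x = 0.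
Proof.
move=> r0 h; have [i hi] : exists i, r <= `|x i 0 - a i 0|.
  apply: contrapT => no; have : `|x - a| < r; last by rewrite ltNge h.
  rewrite /Num.norm/= mx_normrE; apply: bigmax_lt => //= -[i j] _; rewrite ord1 !mxE/= ltNge.
  by apply/negP => ri; apply: no; exists i.
rewrite /bump /tens (bigD1 i)//= plateau_eq0 ?mul0r// bump_arg//.
by rewrite mulrAC ler_pdivlMr//; lra.
Qed.

(** Finitely many bumps cover the support of phi, each killing any test function it multiplies.
    Multiplying phi successively by 1 - bump leaves the pairing unchanged and ends with the zero
    function; this plays the role of a partition of unity. *)
Lemma dpair_local T phi : C0infty setT phi -> (forall x, dsupp T x -> ~ fsupp phi x) ->
  T phi = 0.
Proof.
move=> Cphi off; have [sphi cphi _] := Cphi.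
have loc x : exists r : R, fsupp phi x -> 0 < r /\
    forall psi, C0infty setT psi -> (forall y, r <= `|y - x| -> psi y = 0) -> T psi = 0.
  have [px|] := pselect (fsupp phi x); last by exists 0.
  have : ~ dsupp T x by move=> /off.
  move=> /existsNP[U /not_implyP[oU /not_implyP[Ux nU]]].
  have /nbhs_ballP[e /= e0 eU] := open_nbhs_nbhs (conj oU Ux).
  have e2 : 0 < e / 2 by rewrite divr_gt0.
  exists (e / 2) => _; split=> // psi Cpsi psi0; apply: contrapT => nT; apply: nU; exists psi; last exact/eqP.
  have [spsi cpsi _] := Cpsi; split=> // y hy; apply: eU.
  have hy' : [set y : 'cV[R]_d | forall i, `|y i 0 - x i 0| <= e / 2] y.
    move: y hy; apply: fsupp_sub_closed; first exact: closed_box.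
    move=> y ny; apply: psi0; rewrite leNgt; apply/negP => yx; apply: ny => i.
    by have := coord_le_norm (y - x) i; rewrite !mxE => /le_trans; apply; exact: ltW.
  rewrite -ball_normE/= distrC; apply: le_lt_trans (_ : e / 2 < e); last by rewrite ltr_pdivrMr//; lra.
  by apply: ler_cV_norm => [|i]; [exact: ltW|rewrite !mxE].
have /choice[r hr] := loc.
pose cut (s : seq 'cV[R]_d) y := \prod_(x <- s) (1 - bump x (r x) y).
have scut s : smooth (cut s).
  rewrite /cut; elim: s => [|x s IH].
    by under eq_fun do rewrite big_nil; exact: smooth_cst.
  under eq_fun do rewrite big_cons; apply: smoothM; last exact: IH.
  by apply: smoothB; [exact: smooth_cst|exact: smooth_bump].
have Tcut (s : seq 'cV[R]_d) : (forall x, x \in s -> fsupp phi x) -> T phi = T (fun y => phi y * cut s y).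
  elim: s => [|x s IH] sK.
    by congr (T _); apply/funext => y; rewrite /cut big_nil mulr1.
  rewrite IH; last by move=> y ys; apply: sK; rewrite in_cons ys orbT.
  have Kx : fsupp phi x by apply: sK; rewrite mem_head.
  have [r0 hx] := hr x Kx.
  have C1 := C0inftyMr Cphi (scut s).
  have C2 := C0inftyMr C1 (smooth_bump x (r x)).
  rewrite (_ : (fun y => phi y * cut (x :: s) y) =
     (fun y => phi y * cut s y - phi y * cut s y * bump x (r x) y)); last first.
    by apply/funext => y; rewrite /cut big_cons; ring.
  rewrite dpairB// (hx _ C2) ?subr0// => y hy.
  by rewrite bump_eq0// mulr0.
have := cphi; rewrite compact_cover => /(_ _ (fsupp phi) (fun x => ball x (r x / 2))).
case=> [x /hr[r0 _]|x Kx|D' D'K cov].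
- by apply: ball_open; rewrite divr_gt0.
- by exists x => //; apply: ballxx; have [r0 _] := hr _ Kx; rewrite divr_gt0.
rewrite (Tcut (finmap.enum_fset D')); last by move=> x xD; have /set_mem := D'K x xD.
rewrite (_ : (fun y => _) = fun=> 0) ?dpair0//; apply/funext => y.
have [->|py] := eqVneq (phi y) 0; first by rewrite mul0r.
have [x xD yx] := cov y (fsupp_nz py).
have [r0 _] := hr x (set_mem (D'K x xD)).
rewrite /cut (big_rem x)//= bump_eq1// ?subrr ?mul0r ?mulr0//.
by move: yx; rewrite -ball_normE/= distrC => /ltW.
Qed.

End DistributionBasics.

(* Derivatives in x of a(x) e^{i t x.xi} are combinations of t^k b(x) e^{i t x.xi}. *)
Section Waves.
Context {R : realType} {d : nat}.
Variable xi : 'cV[R]_d.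

Inductive wave_family : (R -> 'cV[R]_d -> R[i]) -> Prop :=
| wave_base a : C0infty setT a -> wave_family (fun t x => a x * cis (dotp x (t *: xi)))
| wave_add f g : wave_family f -> wave_family g -> wave_family (fun t x => f t x + g t x)
| wave_scale f : wave_family f -> wave_family (fun t x => t%:C * f t x).

Lemma wave_smooth f t : wave_family f -> smooth (f t).
Proof.
elim=> {f} [a Ca|f g _ sf _ sg|f _ sf].
- by apply: smoothM; [case: Ca|exact: smooth_wave].
- exact: smoothD.
- exact: smoothZ.
Qed.

Lemma wave_pderiv f i : wave_family f ->
  exists2 f', wave_family f' & forall t, pderiv i (f t) = f' t.
Proof.
elim=> {f} [a Ca|f g wf [f' wf' df] wg [g' wg' dg]|f wf [f' wf' df]].
- exists (fun t x => t%:C * ((('i * (xi i 0)%:C) * a x) * cis (dotp x (t *: xi))) +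
      pderiv i a x * cis (dotp x (t *: xi))).
    apply: wave_add; last by apply: wave_base; exact: (@C0infty_pderivs _ _ _ [:: i]).
    by apply: wave_scale; apply: wave_base; exact: C0inftyZ.
  move=> t; have sa : smooth a by case: Ca.
  rewrite (pderivM i sa (smooth_wave (t *: xi))) pderiv_wave; apply/funext => x.
  by rewrite mxE realCM; ring.
- exists (fun t x => f' t x + g' t x); first exact: wave_add.
  by move=> t; rewrite (pderivD i (wave_smooth t wf) (wave_smooth t wg)) df dg.
- exists (fun t x => t%:C * f' t x); first exact: wave_scale.
  by move=> t; rewrite (pderivZ i _ (wave_smooth t wf)) df.
Qed.

Lemma wave_pderivs f s : wave_family f ->
  exists2 f', wave_family f' & forall t, pderivs s (f t) = f' t.
Proof.
move=> wf; elim: s => [|i s [g wg dg]]; first by exists f.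
have [g' wg' dg'] := wave_pderiv i wg.
by exists g' => // t; rewrite /= dg dg'.
Qed.

Lemma wave_lipschitz f (B : R) : wave_family f -> 0 <= B -> exists L, [/\ 0 <= L,
  forall t x, `|t| <= B -> cmod (f t x) <= L &
  forall t t' x, `|t| <= B -> `|t'| <= B -> cmod (f t x - f t' x) <= L * `|t - t'|].
Proof.
move=> wf B0; elim: wf => {f} [a Ca|f g _ [L [L0 bL lL]] _ [M [M0 bM lM]]|f _ [L [L0 bL lL]]].
- have [r [M [r0 M0 aM ar]]] := C0infty_bounded Ca.
  pose X := \sum_i r * `|xi i 0|.
  have X0 : 0 <= X by apply: sumr_ge0 => i _; rewrite mulr_ge0.
  have MX : 0 <= M * (2 * X) by rewrite !mulr_ge0.
  exists (M + M * (2 * X)); split; first by rewrite addr_ge0.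
    by move=> t x _; rewrite cmodM cmod_cis mulr1 (le_trans (aM x))// lerDl.
  move=> t t' x _ _; rewrite -mulrBr cmodM mulrDl.
  have [->|ax] := eqVneq (a x) 0; first by rewrite cmod0 mul0r addr_ge0// mulr_ge0.
  apply: le_trans (_ : M * (2 * (X * `|t - t'|)) <= _); last first.
    by rewrite -!mulrA lerDr mulr_ge0.
  apply: ler_pM => //; rewrite ?cmod_ge0//.
  apply: le_trans (cis_lipschitz _ _) _; rewrite ler_wpM2l//.
  rewrite !dotpZr -mulrBl normrM mulrC ler_wpM2r//.
  apply: le_trans (ler_norm_sum _ _ _) _; apply: ler_sum => i _.
  by rewrite normrM ler_wpM2r// (le_trans (coord_le_norm x i))// ar.
- exists (L + M); split; first by rewrite addr_ge0.
    by move=> t x tB; rewrite (le_trans (cmodD _ _))// lerD// ?bL ?bM.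
  move=> t t' x tB tB'; rewrite (_ : _ - _ = (f t x - f t' x) + (g t x - g t' x)); last by ring.
  by rewrite (le_trans (cmodD _ _))// mulrDl lerD// ?lL ?lM.
- exists (B * L + L); split; first by rewrite addr_ge0 ?mulr_ge0.
    move=> t x tB; rewrite cmodM cmod_real; apply: le_trans (_ : B * L <= _); last by rewrite lerDl.
    by apply: ler_pM => //; rewrite ?cmod_ge0 ?bL.
  move=> t t' x tB tB'.
  rewrite (_ : _ - _ = t%:C * (f t x - f t' x) + (t - t')%:C * f t' x); last first.
    by rewrite rmorphB/=; ring.
  rewrite (le_trans (cmodD _ _))// !cmodM !cmod_real mulrDl lerD//.
    by rewrite -mulrA; apply: ler_pM; rewrite ?cmod_ge0 ?lL.
  by rewrite mulrC ler_wpM2r// bL.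
Qed.

(** On a fixed compact support the distribution is bounded by finitely many derivatives, and each of
    these is Lipschitz in t on bounded sets, uniformly in x. *)
Lemma dpair_wave_continuous (T : distrib R d) a : C0infty setT a ->
  continuous (fun t : R => Re (T (fun x => a x * cis (dotp x (t *: xi))))) /\
  continuous (fun t : R => Im (T (fun x => a x * cis (dotp x (t *: xi))))).
Proof.
move=> Ca; pose f t (x : 'cV[R]_d) := a x * cis (dotp x (t *: xi)).
have wf : wave_family f by exact: wave_base.
have Cf t : C0infty setT (f t) by exact: (C0inftyMr Ca (smooth_wave _)).
have ca : compact (fsupp a) by case: Ca.
have [C [N hC]] := dpair_continuous T ca.
have lip B : 0 <= B -> exists2 L, 0 <= L & forall t t', `|t| <= B -> `|t'| <= B ->
    cmod (T (f t) - T (f t')) <= L * `|t - t'|.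
  move=> B0.
  have /choice[Ls hLs] : forall s : seq 'I_d, exists L, 0 <= L /\ forall t t' x, `|t| <= B -> `|t'| <= B ->
      cmod (pderivs s (f t) x - pderivs s (f t') x) <= L * `|t - t'|.
    move=> s; have [g wg dg] := wave_pderivs s wf.
    have [L [L0 _ lL]] := wave_lipschitz wg B0.
    by exists L; split=> // t t' x tB tB'; rewrite !dg lL.
  (* The lists of directions of length at most N form a finite type, so one sum dominates all their
     Lipschitz constants. *)
  pose L := \sum_(s : {bseq N of 'I_d}) Ls s.
  have LsL (s : seq 'I_d) : (size s <= N)%N -> Ls s <= L.
    move=> sN; rewrite /L (bigD1 (Bseq sN))//= lerDl; apply: sumr_ge0 => s' _.
    by have [] := hLs s'.
  have L0 : 0 <= L by apply: sumr_ge0 => s' _; have [] := hLs s'.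
  exists (`|C| * L); first by rewrite mulr_ge0.
  move=> t t' tB tB'; rewrite -dpairB//.
  apply: le_trans (_ : C * (L * `|t - t'|) <= _); last first.
    by rewrite -mulrA ler_wpM2r ?mulr_ge0// ler_norm.
  apply: hC; first exact: C0inftyB.
    by apply: fsuppS => x ax; rewrite /f ax !mul0r subr0.
  move=> s x sN; have [st _ _] := Cf t; have [st' _ _] := Cf t'.
  rewrite (pderivsB s st st'); have [_ h] := hLs s.
  by rewrite (le_trans (h t t' x tB tB'))// ler_wpM2r// LsL.
have key (h : R[i] -> R) : (forall z w, `|h z - h w| <= cmod (z - w)) ->
    continuous (fun t => h (T (f t))).
  move=> hh t; apply/cvgrPdist_lt => e e0.
  have B0 : 0 <= `|t| + 1 by rewrite addr_ge0.
  have [L L0 lL] := lip _ B0.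
  have L1 : 0 < L + 1 by rewrite ltr_wpDl.
  have eL : 0 < Num.min 1 (e / (L + 1)) by rewrite lt_min ltr01 divr_gt0.
  apply/nbhs_ballP; exists (Num.min 1 (e / (L + 1))) => //= t'.
  rewrite /ball_/= lt_min => /andP[t1 t2].
  apply: le_lt_trans (hh _ _) _; apply: le_lt_trans (lL _ _ _ _) _.
  - by rewrite lerDl.
  - rewrite (_ : t' = t - (t - t')); last by ring.
    by rewrite (le_trans (ler_normB _ _))// lerD2l ltW.
  have : (L + 1) * `|t - t'| < e by rewrite mulrC -ltr_pdivlMr.
  by apply: le_lt_trans; rewrite ler_wpM2r// lerDl.
split; apply: key => z w; first by rewrite -ReB ler_Re_cmod.
by rewrite -ImB ler_Im_cmod.
Qed.

End Waves.

(* Test functions with two close tables of rounded derivatives on a fine grid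
   are close together with their derivatives; the tables are countably many. *)
Section Separability.
Context {R : realType} {d : nat}.
Implicit Types (phi psi : 'cV[R]_d -> R[i]).
Local Notation test_function := ('cV[R]_d -> R[i]).

Definition bounded_in (K : set 'cV[R]_d) (N : nat) (M : R) phi :=
  [/\ C0infty setT phi, fsupp phi `<=` K &
      forall s x, (size s <= N)%N -> cmod (pderivs s phi x) <= M].

Lemma pderivs0 (s : seq 'I_d) : pderivs s (fun=> 0 : R[i]) = fun=> 0.
Proof.
elim: s => //= i s ->; apply: cderive_pderiv => x.
by have := cderive_cst i (0 : R[i]) x.
Qed.

Lemma fsupp_pderivs s phi : fsupp (pderivs s phi) `<=` fsupp phi.
Proof. by elim: s => //= i s IH x /fsupp_pderiv /IH. Qed.

Lemma fsupp0 : fsupp (fun _ : 'cV[R]_d => 0 : R[i]) `<=` set0.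
Proof. by apply: fsupp_sub_closed; first exact: closed0. Qed.

Section Grid.
Variables (k Q N : nat).

(** Per axis, 2k(Q+1) + 1 nodes of spacing 1/(Q+1) cover [-k, k]; finiteness of the index type is
    what leaves only countably many integer tables. *)
Definition grid_index := {ffun 'I_d -> 'I_(2 * (k * Q.+1)).+1}.

Definition grid_point (g : grid_index) : 'cV[R]_d :=
  \col_i (((g i : nat)%:R - (k * Q.+1)%:R) / Q.+1%:R).

Lemma grid_near (x : 'cV[R]_d) : `|x| <= k%:R ->
  exists g, forall i, `|x i 0 - grid_point g i 0| <= Q.+1%:R^-1.
Proof.
move=> xk; have Q0 : 0 < Q.+1%:R :> R by [].
pose y i := (x i 0 + k%:R) * Q.+1%:R.
have xi i := le_trans (coord_le_norm x i) xk.
have y0 i : 0 <= y i.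
  by rewrite mulr_ge0// -lerBlDr sub0r; have := xi i; rewrite ler_norml => /andP[].
have yk i : (Num.truncn (y i) < (2 * (k * Q.+1)).+1)%N.
  rewrite ltnS truncn_le_nat -natr1 natrM natrM mulrA /y ltr_pwDr// ler_wpM2r//.
  by have := xi i; rewrite ler_norml => /andP[_ h]; lra.
exists [ffun i => Ordinal (yk i)] => i; rewrite mxE ffunE/=.
have /andP[h1 h2] := truncn_itv (y0 i).
rewrite (_ : x i 0 - _ = (y i - (Num.truncn (y i))%:R) / Q.+1%:R); last first.
  by rewrite /y natrM; field; rewrite gt_eqF.
rewrite ger0_norm; last by rewrite divr_ge0// subr_ge0.
by rewrite ler_pdivrMr// mulVf ?gt_eqF// lerBlDl natr1 ltW.
Qed.

Definition table phi : {ffun ({bseq N of 'I_d} * grid_index) -> int * int} :=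
  [ffun p : {bseq N of 'I_d} * grid_index => (Num.floor (Q.+1%:R * Re (pderivs p.1 phi (grid_point p.2))),
              Num.floor (Q.+1%:R * Im (pderivs p.1 phi (grid_point p.2))))].

Let floor_close (u v : R) : Num.floor (Q.+1%:R * u) = Num.floor (Q.+1%:R * v) ->
  `|u - v| <= Q.+1%:R^-1.
Proof.
move=> h; have Q0 : 0 < Q.+1%:R :> R by [].
have := floor_itv (Q.+1%:R * u); have := floor_itv (Q.+1%:R * v); rewrite h intrD.
move: ((Num.floor _)%:~R : R) => z /andP[v1 v2] /andP[u1 u2].
rewrite -[leRHS]mulr1 ler_pdivlMl// -[X in X * `|_|](gtr0_norm Q0) -normrM ler_norml; lra.
Qed.

(** Rounding contributes 2/(Q+1). Moving from x to the nearest node costs 2Md/(Q+1) for each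
    function, which requires a bound on one derivative more than is compared. *)
Lemma table_close (K : set 'cV[R]_d) M phi psi s x : (forall y, K y -> `|y| <= k%:R) ->
  bounded_in K N.+1 M phi -> bounded_in K N.+1 M psi -> table phi = table psi ->
  (size s <= N)%N ->
  cmod (pderivs s phi x - pderivs s psi x) <= (2 + 4 * M * d%:R) / Q.+1%:R.
Proof.
move=> Kk [Cphi Kphi bphi] [Cpsi Kpsi bpsi] E sN.
have M0 : 0 <= M by apply: le_trans (cmod_ge0 _) (bphi [::] 0 _).
have Q0 : 0 < Q.+1%:R :> R by [].
have [Kx|nKx] := pselect (K x); last first.
  have out f : fsupp f `<=` K -> pderivs s f x = 0.
    move=> fK; apply: contrapT => /eqP fx; apply: nKx; apply: fK.
    by apply: (@fsupp_pderivs s); exact: fsupp_nz.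
  by rewrite !out// subrr cmod0 divr_ge0// addr_ge0// !mulr_ge0.
have [g hg] := grid_near (Kk x Kx).
have lip f : C0infty setT f -> (forall t z, (size t <= N.+1)%N -> cmod (pderivs t f z) <= M) ->
    cmod (pderivs s f x - pderivs s f (grid_point g)) <= 2 * M * d%:R / Q.+1%:R.
  move=> [sf _ _] bf.
  apply: le_trans (_ : 2 * M * \sum_i `|x i 0 - grid_point g i 0| <= _).
    apply: (@cmod_lipschitz_box _ _ _ (fun i z => pderivs (i :: s) f z)) => [i z|i z _].
      by apply: smooth_cderive; exact: smooth_pderivs.
    exact: bf.
  rewrite -!mulrA; do 2 (apply: ler_wpM2l => //).
  apply: le_trans (ler_sum _ (fun i _ => hg i)) _.
  by rewrite sumr_const card_ord -(mulr_natl _^-1).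
rewrite (_ : _ - _ = (pderivs s phi x - pderivs s phi (grid_point g))
  + (pderivs s phi (grid_point g) - pderivs s psi (grid_point g))
  - (pderivs s psi x - pderivs s psi (grid_point g))); last by ring.
apply: le_trans (cmodB _ _) _; apply: le_trans (lerD (cmodD _ _) (lexx _)) _.
have mid : cmod (pderivs s phi (grid_point g) - pderivs s psi (grid_point g)) <= 2 / Q.+1%:R.
  have := congr1 (fun t : {ffun _ -> int * int} => t (Bseq sN, g)) E; rewrite !ffunE/= => -[e1 e2].
  rewrite (le_trans (cmod_le _))// ReB ImB (_ : 2 / _ = Q.+1%:R^-1 + Q.+1%:R^-1); last by ring.
  by rewrite lerD// floor_close.
have := lip phi Cphi bphi; have := lip psi Cpsi bpsi.
rewrite (_ : (2 + _) / _ = 2 * M * d%:R / Q.+1%:R + 2 / Q.+1%:R + 2 * M * d%:R / Q.+1%:R); last by ring.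
by move=> h1 h2; rewrite lerD// lerD.
Qed.

Lemma dense_sequence (K : set 'cV[R]_d) (M : R) : 0 <= M ->
  (forall y, K y -> `|y| <= k%:R) -> exists r : nat -> test_function,
  (forall i, bounded_in K N.+1 M (r i)) /\
  forall phi, bounded_in K N.+1 M phi -> exists i, forall s x, (size s <= N)%N ->
    cmod (pderivs s phi x - pderivs s (r i) x) <= (2 + 4 * M * d%:R) / Q.+1%:R.
Proof.
move=> M0 Kk.
have pick i : exists f : test_function, bounded_in K N.+1 M f /\
    ((exists2 g, bounded_in K N.+1 M g & pickle (table g) = i) -> pickle (table f) = i).
  have [[g bg gi]|no] := pselect (exists2 g, bounded_in K N.+1 M g & pickle (table g) = i).
    by exists g.
  (* For a code attained by no admissible function the zero function keeps the sequence within the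
     bounds. *)
  exists (fun=> 0); split=> //; split; first exact: C0infty0.
    by move=> x /fsupp0.
  by move=> s x _; rewrite pderivs0 cmod0.
have /choice[r hr] := pick.
exists r; split=> [i|phi bphi]; first by have [] := hr i.
exists (pickle (table phi)) => s x sN; have [br /(_ (ex_intro2 _ _ phi bphi erefl)) e] := hr (pickle (table phi)).
by apply: (table_close _ Kk) => //; apply: (pcan_inj pickleK).
Qed.

End Grid.

(** The indices are the order of the derivatives, the bound on them, the mesh and the code of a
    table. If T vanishes on the family, its continuity estimate bounds T phi by a constant times the
    mesh error, for every mesh. *)
Lemma countable_determining (K : set 'cV[R]_d) (k : nat) : compact K ->
  (forall y, K y -> `|y| <= k%:R) ->
  exists r : nat -> nat -> nat -> nat -> test_function,
  (forall N M Q i, C0infty setT (r N M Q i) /\ fsupp (r N M Q i) `<=` K) /\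
  forall T : distrib R d, (forall N M Q i, T (r N M Q i) = 0) ->
  forall phi, C0infty setT phi -> fsupp phi `<=` K -> T phi = 0.
Proof.
move=> cK Kk.
have h (p : nat * nat * nat) : exists r : nat -> test_function,
  (forall i, bounded_in K p.1.1.+1 p.1.2%:R (r i)) /\
  forall phi, bounded_in K p.1.1.+1 p.1.2%:R phi -> exists i, forall s x, (size s <= p.1.1)%N ->
    cmod (pderivs s phi x - pderivs s (r i) x) <= (2 + 4 * p.1.2%:R * d%:R) / p.2.+1%:R.
  exact: (dense_sequence _ _ (ler0n _ _) Kk).
have /choice[r hr] := h.
exists (fun N M Q => r (N, M, Q)); split=> [N M Q i|T T0 phi Cphi phiK].
  by have [/(_ i)[]] := hr (N, M, Q).
have [C [N hC]] := dpair_continuous T cK.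
have [M bM] : exists M : nat, bounded_in K N.+1 M%:R phi.
  have /choice[b hb] : forall s : seq 'I_d, exists b, 0 <= b /\ forall x, cmod (pderivs s phi x) <= b.
    move=> s; have [_ [M [_ M0 bM _]]] := C0infty_bounded (C0infty_pderivs s Cphi).
    by exists M.
  pose B := \sum_(s : {bseq N.+1 of 'I_d}) b s.
  have B0 : 0 <= B by apply: sumr_ge0 => s _; have [] := hb s.
  exists (Num.truncn B).+1; split=> // s x sN.
  apply: le_trans (ltW (truncnS_gt B)); have [_ h1] := hb s; apply: le_trans (h1 x) _.
  rewrite /B (bigD1 (Bseq sN))//= lerDl; apply: sumr_ge0 => t _.
  by have [] := hb t.
pose E := `|C| * (2 + 4 * M%:R * d%:R) : R.
have E0 : 0 <= E by rewrite mulr_ge0// addr_ge0// !mulr_ge0.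
have small (Q : nat) : cmod (T phi) <= E / Q.+1%:R.
  have [/= h1 h2] := hr (N, M, Q); have [i hi] := h2 phi bM.
  have [Ci Ki _] := h1 i.
  have -> : T phi = T (fun x => phi x - r (N, M, Q) i x) by rewrite dpairB// T0 subr0.
  apply: le_trans (_ : C * ((2 + 4 * M%:R * d%:R) / Q.+1%:R) <= _); last first.
    by rewrite /E mulrA ler_wpM2r// ler_wpM2r ?ler_norm// addr_ge0// !mulr_ge0.
  apply: hC.
  - exact: C0inftyB.
  - apply: fsupp_sub_closed; first by apply: compact_closed => //; exact: norm_hausdorff.
    move=> x nK; have out f : fsupp f `<=` K -> f x = 0.
      by move=> fK; apply: contrapT => /eqP fx; apply: nK; apply: fK; exact: fsupp_nz.
    by rewrite !out// subrr.
  - move=> s x sN; have [s1 _ _] := Cphi; have [s2 _ _] := Ci.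
    by rewrite pderivsB// hi.
apply/eqP; rewrite -cmod_eq0 eq_le cmod_ge0 andbT leNgt; apply/negP => Tp.
have eT : 0 < cmod (T phi) / (E + 1) by rewrite divr_gt0// ltr_wpDl.
have [Q _ hQ] := near_infty_natSinv_lt (PosNum eT).
have := hQ Q (leqnn Q); rewrite /= ltr_pdivlMr ?ltr_wpDl// => lt1.
have := small Q; rewrite leNgt => /negP; apply; apply: le_lt_trans lt1.
by rewrite mulrC ler_wpM2l// lerDl.
Qed.

End Separability.

(** * The Gaussian space of a field and the support of its realizations *)

Section GaussianField.
Context {R : realType} {d : nat} {dO : measure_display} {Omega : measurableType dO}.
Variables (P : probability Omega R) (f : Omega -> 'I_d -> distrib R d).
Hypothesis gf : centered_gaussian_field P f.

(** The real vector space of variables to which Wick's formula is applied. Imaginary parts belong to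
    it as well, by multiplying the test function by -i. *)
Definition gaussian_space (Y : Omega -> R) : Prop :=
  exists2 psi : 'cV[R]_d -> 'cV[R[i]]_d, C0infty_mx setT psi &
    Y = fun w => Re (dpair_vec (f w) psi).

Lemma gaussian_spaceD Y Z : gaussian_space Y -> gaussian_space Z ->
  gaussian_space (fun w => Y w + Z w).
Proof.
move=> [psi Cpsi ->] [phi Cphi ->]; exists (fun x => psi x + phi x).
  move=> i j; have := C0inftyD (Cpsi i j) (Cphi i j).
  by congr C0infty; apply/funext => x; rewrite mxE.
apply/funext => w; rewrite -ReD -big_split/=; congr Re; apply: eq_bigr => j _.
by rewrite -dpairD//; congr (f w j _); apply/funext => x; rewrite mxE.
Qed.

Lemma gaussian_spaceZ (a : R) Y : gaussian_space Y -> gaussian_space (fun w => a * Y w).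
Proof.
move=> [psi Cpsi ->]; exists (fun x => a%:C *: psi x).
  move=> i j; have := C0inftyZ a%:C (Cpsi i j).
  by congr C0infty; apply/funext => x; rewrite mxE.
apply/funext => w.
have -> : dpair_vec (f w) (fun x => a%:C *: psi x) = a%:C * dpair_vec (f w) psi.
  rewrite /dpair_vec mulr_sumr; apply: eq_bigr => j _.
  by rewrite -dpairZ//; congr (f w j _); apply/funext => x; rewrite mxE.
by rewrite ReM/= mul0r subr0.
Qed.

Lemma gaussian_space_gaussian Y : gaussian_space Y -> gaussian_rv P Y.
Proof.
move=> [psi Cpsi ->]; have [/(_ 1 0) + _] := gf Cpsi.
by congr gaussian_rv; apply/funext => w; rewrite mul1r mul0r addr0.
Qed.

Lemma gaussian_space_centered Y : gaussian_space Y -> itgR P Y = 0.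
Proof.
by move=> [psi Cpsi ->]; have [_ /(congr1 (@complex.Re R))] := gf Cpsi.
Qed.

Lemma dpair_vec_single (T : 'I_d -> distrib R d) j phi :
  dpair_vec T (fun x => \col_k (if k == j then phi x else 0)) = T j phi.
Proof.
rewrite /dpair_vec (bigD1 j)//= [X in _ + X]big1 ?addr0.
  by congr (T j _); apply/funext => x; rewrite mxE eqxx.
move=> k kj; rewrite (_ : (fun x => _) = fun=> 0) ?dpair0//.
by apply/funext => x; rewrite mxE (negbTE kj).
Qed.

Lemma gaussian_space_Re j phi : C0infty setT phi -> gaussian_space (fun w => Re (f w j phi)).
Proof.
move=> Cphi; exists (fun x => \col_k (if k == j then phi x else 0)).
  move=> i k; have := @C0infty0 _ _ (setT : set 'cV[R]_d).
  have [ij _|ij] := eqVneq i j.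
    have := Cphi; congr C0infty; apply/funext => x; by rewrite mxE ij eqxx.
  by congr C0infty; apply/funext => x; rewrite mxE (negbTE ij).
by apply/funext => w; rewrite dpair_vec_single.
Qed.

Lemma gaussian_space_Im j phi : C0infty setT phi -> gaussian_space (fun w => Im (f w j phi)).
Proof.
move=> Cphi; have := gaussian_space_Re j (C0inftyZ (- 'i) Cphi).
congr gaussian_space; apply/funext => w; rewrite dpairZ// mulNr ReN ReM/=; ring.
Qed.

Definition gaussian_itg2 A B (GA : gaussian_space A) (GB : gaussian_space B) :=
  wick_itg2 gaussian_space_gaussian GA GB.

(** The kernel at phi and its conjugate is the second moment of the pairing. It equals the integral
    of phi times an operator value that vanishes off D, since the symbol does, while phi vanishes on
    D. *)
Lemma kernel_support (D : set 'cV[R]_d) m A j phi : principal_symbol D m A (cov_kernel P f) ->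
  C0infty setT phi -> (forall x, D x -> phi x = 0) ->
  {ae P, forall w, f w j phi = 0}.
Proof.
move=> [Sigma [B [ker [_ SD] _ _ _]]] Cphi phiD.
pose Phi (x : 'cV[R]_d) : 'cV[R[i]]_d := \col_k (if k == j then conjc (phi x) else 0).
have CPhi : C0infty_mx setT Phi.
  move=> i k; have [ij|ij] := eqVneq i j.
    have := C0infty_conj Cphi; congr C0infty; apply/funext => x; by rewrite mxE ij eqxx.
  have := @C0infty0 _ _ (setT : set 'cV[R]_d).
  by congr C0infty; apply/funext => x; rewrite mxE (negbTE ij).
have := ker Phi phi CPhi Cphi j.
rewrite (bigD1 j)//= [X in _ + X]big1 ?addr0; last first.
  move=> k kj; rewrite /cov_kernel /Cexpectation.
  rewrite (_ : (fun w => _) = fun=> 0); first exact: citgC0.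
  apply/funext => w; rewrite (_ : (fun x => conjc _) = fun=> 0) ?dpair0 ?conjc0 ?mulr0//.
  by apply/funext => x; rewrite mxE (negbTE kj) conjc0.
rewrite /integralRd (_ : (fun u => _) = fun=> 0); last first.
  apply/funext => u; set x := \col_i _.
  have [->|px] := eqVneq (phi x) 0; first by rewrite mul0r.
  have nD : ~ D x by move=> /phiD px0; rewrite px0 eqxx in px.
  rewrite /psido (_ : (fun xi => _) = fun=> 0).
    rewrite !mxE /integralRd.
    by rewrite [Cintegral _ _ _](citgC0 (lebesgueRn d)) !mulr0.
  apply/funext => xi; rewrite (_ : Sigma x xi = 0) ?mul0mx ?scaler0//.
  apply/matrixP => a b; rewrite mxE; have [_ _ sup] := SD xi a b.
  by apply: contrapT => /eqP h; apply: nD; apply: sup; exact: fsupp_nz.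
rewrite [Cintegral _ _ _](citgC0 (lebesgueRn d)) => /(congr1 (@complex.Re R))/esym.
pose h w := Re (f w j phi) * Re (f w j phi) + Im (f w j phi) * Im (f w j phi).
have GR := gaussian_space_Re j Cphi; have GI := gaussian_space_Im j Cphi.
have Ih : itg P h by apply: itgD; exact: gaussian_itg2.
have h0 w : 0 <= h w by rewrite addr_ge0// -expr2 sqr_ge0.
rewrite (_ : Re _ = itgR P h); last first.
  congr itgR; apply/funext => w; rewrite ReM Re_conjc Im_conjc.
  rewrite (_ : (fun x => conjc (Phi x j 0)) = phi); first by rewrite /h; ring.
  by apply/funext => x; rewrite mxE eqxx conjcK.
rewrite Re0 => Eh.
have : (\int[P]_w `|(h w)%:E| = 0)%E.
  rewrite (eq_integral (fun w => (h w)%:E)); last by move=> w _; rewrite gee0_abs ?lee_fin.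
  by rewrite itgR_fin// Eh.
move/(ae_eq_integral_abs P measurableT (measurable_int P Ih)).
apply: filterS => w /(_ I) /= [] hw; apply/eqP; rewrite -cmod_eq0 /cmod.
by move: hw; rewrite /h -!expr2 => ->; rewrite sqrtr0.
Qed.

(** [kernel_support] leaves a null set depending on the test function. The complement of the closure
    of D is exhausted by compact sets, and on each one a countable determining family produces a
    single null set. *)
Lemma support_ae (D : set 'cV[R]_d) m A : principal_symbol D m A (cov_kernel P f) ->
  {ae P, forall w, forall j, dsupp (f w j) `<=` closure D}.
Proof.
move=> pr.
(* Points of the cube of radius n at distance at least 1/(n+1) from D. *)
pose K (n : nat) : set 'cV[R]_d := [set x : 'cV[R]_d | forall i, `|x i 0 - (0 : 'cV[R]_d) i 0| <= n%:R] `&`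
  ~` (\bigcup_(y in D) ball y (n.+1%:R^-1 : R)).
have cK n : compact (K n).
  have KB : K n `<=` [set x : 'cV[R]_d | forall i, `|x i 0 - (0 : 'cV[R]_d) i 0| <= n%:R].
    by move=> x [].
  apply: (@subclosed_compact _ _ _ _ (@compact_box R d (0 : 'cV[R]_d) n%:R) KB).
  apply: closedI; first exact: closed_box.
  by apply: open_closedC; apply: bigcup_open => y _; apply: ball_open; rewrite invr_gt0.
have Kn n y : K n y -> `|y| <= n%:R.
  by move=> [h _]; apply: ler_cV_norm => // i; have := h i; rewrite mxE subr0.
have KD n x : K n x -> ~ D x.
  move=> [_ h] Dx; apply: h; exists x => //; apply: ballxx; by rewrite invr_gt0.
have /choice[r hr] := fun n => countable_determining (cK n) (Kn n).
have ae0 : {ae P, forall w, forall n N M Q i (j : 'I_d), f w j (r n N M Q i) = 0}.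
  apply: ae_foralln => n; apply: ae_foralln => N; apply: ae_foralln => M.
  apply: ae_foralln => Q; apply: ae_foralln => i; apply: filter_forall => j.
  have [/(_ N M Q i)[C1 C2] _] := hr n; apply: (kernel_support _ pr C1) => x Dx.
  by apply: contrapT => /eqP h; apply: (KD n x) => //; apply: C2; exact: fsupp_nz.
apply: filterS ae0 => w h j x suppx; apply: contrapT => nx.
have := suppx; rewrite /dsupp/=.
have oC : open (~` closure D) by apply: closed_openC; exact: closed_closure.
have /nbhs_ballP[e /= e0 eD] := open_nbhs_nbhs (conj oC nx).
have e2 : 0 < e / 2 by rewrite divr_gt0.
have oB : open (ball x (e / 2)) by apply: ball_open.
have xB : ball x (e / 2) x by apply: ballxx.
move=> /(_ _ oB xB)[phi [sphi cphi phiU]] /eqP; apply.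
(* Large enough that K (n+1) contains the ball of radius e/2 about x: its points have norm at most
   |x| + e and distance at least e/2 from D. *)
pose n := Num.truncn (`|x| + e + (e / 2)^-1).
have nlt : `|x| + e + (e / 2)^-1 < n.+1%:R by exact: truncnS_gt.
have [_ H] := hr n.+1; apply: (H (f w j) (fun N M Q i => h _ N M Q i j)); first by split.
move=> y /phiU; rewrite -ball_normE/= => xy; split.
  move=> i; rewrite mxE subr0; apply: le_trans (coord_le_norm y i) _.
  rewrite (_ : y = x - (x - y)); last by rewrite opprB addrC subrK.
  apply: le_trans (ler_normB _ _) _; apply: le_trans (ltW nlt).
  apply: le_trans (_ : `|x| + e <= _); last by rewrite lerDl invr_ge0 ltW.
  by rewrite lerD2l (le_trans (ltW xy))// ler_pdivrMr//; lra.
move=> [z Dz]; rewrite -ball_normE/= => zy.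
have : (~` closure D) z; last by apply; exact: subset_closure.
apply: eD; rewrite -ball_normE/= (_ : x - z = (x - y) - (z - y)); last by rewrite opprB addrA subrK.
apply: le_lt_trans (ler_normB _ _) _; rewrite (splitr e) ltrD//.
apply: lt_le_trans zy _; rewrite -[leRHS]invrK lef_pV2 ?posrE ?invr_gt0//.
apply: le_trans (_ : n.+1%:R <= _); last by rewrite ler_nat.
apply: le_trans (ltW nlt); rewrite lerDr addr_ge0 ?normr_ge0//; exact: ltW.
Qed.

End GaussianField.

Section CompactPairing.
Context {R : realType} {d : nat}.

(** The choice of the cutoff in [dpair_smooth] is immaterial: two admissible cutoffs agree near the
    support of T, so [dpair_local] kills the difference. *)
Lemma dpair_smooth_eq (T : distrib R d) (g : 'cV[R]_d -> R[i]) (r0 : R) : 0 < r0 -> smooth g ->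
  (forall x, dsupp T x -> `|x| < r0) -> dpair_smooth T g = T (fun x => cutoff r0 x * g x).
Proof.
move=> r00 sg Tr; rewrite /dpair_smooth.
have oB : open [set x : 'cV[R]_d | `|x| < r0].
  rewrite (_ : [set x | _] = ball (0 : 'cV[R]_d) r0); first exact: ball_open.
  by apply/seteqP; split=> x; rewrite -ball_normE/= sub0r normrN.
have /xgetPex/= : exists v, [set v | exists chi, [/\ C0infty setT chi,
    exists U, [/\ open U, dsupp T `<=` U & forall x, U x -> chi x = 1] &
    v = T (fun x => chi x * g x)]] v.
  exists (T (fun x => cutoff r0 x * g x)); exists (cutoff r0).
  split; [exact: C0infty_cutoff| |by []].
  by exists [set x : 'cV[R]_d | `|x| < r0]; split=> // x /ltW; exact: cutoff_eq1.
move=> /(_ 0)[chi [Cchi [U [oU TU chi1]] ->]].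
apply/eqP; rewrite -subr_eq0 -dpairB; last first.
- exact: (C0inftyMr (C0infty_cutoff r0) sg).
- exact: (C0inftyMr Cchi sg).
apply/eqP; apply: dpair_local.
  by apply: C0inftyB; [exact: (C0inftyMr Cchi sg)|exact: (C0inftyMr (C0infty_cutoff r0) sg)].
move=> x Tx; rewrite /fsupp => /(_ _ (open_nbhs_nbhs (conj (openI oU oB) (conj (TU x Tx) (Tr x Tx))))).
case=> y [/= /eqP + [Uy yr]]; apply.
by rewrite chi1// cutoff_eq1 ?(ltW yr)// subrr.
Qed.

End CompactPairing.

(** * Frequency averages *)

Section WickAverage.
Context {R : realType} {dO : measure_display} {Omega : measurableType dO}.
Variable P : probability Omega R.
Local Notation leb := (@lebesgue_measure R).
Variable G : (Omega -> R) -> Prop.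
Hypothesis GD : forall Y Z, G Y -> G Z -> G (fun w => Y w + Z w).
Hypothesis GZ : forall (a : R) Y, G Y -> G (fun w => a * Y w).
Hypothesis Gg : forall Y, G Y -> gaussian_rv P Y.
Hypothesis G0 : forall Y, G Y -> itgR P Y = 0.

Let G_itg2 A B (GA : G A) (GB : G B) := wick_itg2 Gg GA GB.

Let wickE A B C D : G A -> G B -> G C -> G D ->
  itgR P (fun w => A w * B w * (C w * D w)) =
  itgR P (fun w => A w * B w) * itgR P (fun w => C w * D w) +
  itgR P (fun w => A w * C w) * itgR P (fun w => B w * D w) +
  itgR P (fun w => A w * D w) * itgR P (fun w => B w * C w).
Proof.
move=> GA GB GC GD'; rewrite -(wick GD GZ Gg G0 GA GB GC GD').
by congr itgR; apply/funext => w; rewrite mulrA.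
Qed.

Let wickI A B C D : G A -> G B -> G C -> G D ->
  itg P (fun w => A w * B w * (C w * D w)).
Proof.
move=> GA GB GC GD'; have := wick_itg Gg GA GB GC GD'.
by congr itg; apply/funext => w; rewrite mulrA.
Qed.

(** The combination of two products with a sign covers the real and imaginary parts of a product of
    two complex Gaussian observations. Wick's formula writes covariances of such products as
    products of two correlations, each O(1/(1 + t - s)), which is the square decay demanded by
    [average_cvg0]. *)
Lemma wick_average (I : Type) (N : I -> R -> Omega -> R) (r : R -> R) (C B B' sg c : R)
    (i j i' j' : I) :
  (forall k t, G (N k t)) -> (forall k w, continuous (fun t => N k t w)) ->
  (forall k l s t, 1 <= s -> s <= t -> t <= 2 * s ->
     `|itgR P (fun w => N k s w * N l t w)| <= C / (1 + (t - s))) ->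
  continuous r -> (forall t, 1 <= t -> `|r t| <= B) -> `|sg| <= 1 ->
  (forall t, 1 <= t -> `|r t * (itgR P (fun w => N i t w * N j t w) +
     sg * itgR P (fun w => N i' t w * N j' t w)) - c| <= B' / t) ->
  {ae P, forall w, Q^-1 * Rintegral leb `[Q, 2 * Q]%classic
    (fun t => r t * (N i t w * N j t w + sg * (N i' t w * N j' t w))) @[Q --> +oo] --> c}.
Proof.
move=> GN cN corr cr rB sg1 mean.
pose X t w := N i t w * N j t w + sg * (N i' t w * N j' t w).
pose Y t w := r t * X t w - c.
have IX t : itg P (X t) by apply: itgD; [exact: G_itg2|apply: itgZ; exact: G_itg2].
have mX t : measurable_fun setT (X t) := itg_meas (IX t).
have cX w : continuous (fun t => X t w).
  apply: contD; first by apply: contM; exact: cN.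
  by apply: contM; [exact: cont_cst|apply: contM; exact: cN].
have cY w : continuous (fun t => Y t w).
  by apply: contB; [apply: contM => //; exact: cX|exact: cont_cst].
have mY t : measurable_fun setT (Y t).
  by apply: measurable_funB => //; apply: measurable_funM.
have C0 : 0 <= C.
  have := @corr i i 1 1 (lexx _) (lexx _); rewrite subrr addr0 divr1.
  by move=> /(_ _)/(le_trans (normr_ge0 _)); apply; lra.
pose S s t w := X s w * X t w.
have SE s t : S s t = fun w => N i s w * N j s w * (N i t w * N j t w)
   + sg * (N i s w * N j s w * (N i' t w * N j' t w))
   + sg * (N i' s w * N j' s w * (N i t w * N j t w))
   + sg ^+ 2 * (N i' s w * N j' s w * (N i' t w * N j' t w)).
  by apply/funext => w; rewrite /S /X; ring.
have IS s t : itg P (S s t).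
  by rewrite SE; do 3 (apply: itgD; last by apply: itgZ; exact: wickI); exact: wickI.
have IYY s t : itg P (fun w => Y s w * Y t w).
  have -> : (fun w => Y s w * Y t w) =
      (fun w => (r s * r t * S s t w - c * (r s * X s w + r t * X t w)) + c ^+ 2).
    by apply/funext => w; rewrite /Y /S; ring.
  apply: itgD; last exact: finite_measure_integrable_cst.
  by apply: itgB; apply: itgZ => //; apply: itgD; exact: itgZ.
pose mn t := itgR P (X t).
have mnE t : mn t = itgR P (fun w => N i t w * N j t w) + sg * itgR P (fun w => N i' t w * N j' t w).
  by rewrite /mn itgRD; [rewrite itgRZ//; exact: G_itg2|exact: G_itg2|apply: itgZ; exact: G_itg2].
(* Covariance of the products plus the product of the two errors in the mean. *)
have EYY s t : itgR P (fun w => Y s w * Y t w) =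
    r s * r t * (itgR P (S s t) - mn s * mn t) + (r s * mn s - c) * (r t * mn t - c).
  have -> : (fun w => Y s w * Y t w) =
      (fun w => (r s * r t * S s t w - (c * r s * X s w + c * r t * X t w)) + c ^+ 2).
    by apply/funext => w; rewrite /Y /S; ring.
  have I1 : itg P (fun w => c * r s * X s w + c * r t * X t w) by apply: itgD; exact: itgZ.
  have I2 : itg P (fun w => r s * r t * S s t w) by exact: itgZ.
  have I3 : itg P (fun _ : Omega => c ^+ 2) by exact: finite_measure_integrable_cst.
  rewrite itgRD//; last exact: itgB.
  rewrite itgRB// itgRD; [|exact: itgZ..].
  rewrite [X in _ + X = _](_ : _ = c ^+ 2); last first.
    transitivity (c ^+ 2 * fine (P setT)); first exact: Rintegral_cst.
    by rewrite probability_setT mulr1.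
  by rewrite !itgRZ// -/(mn s) -/(mn t); ring.
(* The first of the three Wick pairings is the product of the means and cancels. *)
have cov k l k' l' s t : 1 <= s -> s <= t -> t <= 2 * s ->
    `|itgR P (fun w => N k s w * N l s w * (N k' t w * N l' t w)) -
      itgR P (fun w => N k s w * N l s w) * itgR P (fun w => N k' t w * N l' t w)|
    <= 2 * (C / (1 + (t - s))) ^+ 2.
  move=> s1 st ts; rewrite wickE//.
  have e4 (a b e : R) : a + b + e - a = b + e by ring.
  rewrite e4.
  apply: le_trans (ler_normD _ _) _; rewrite mulrDl mul1r !normrM.
  by apply: lerD; rewrite expr2; apply: ler_pM => //; exact: corr.
(* Four covariances of at most 2C^2 each give 8C^2; the factor 4 comes from (1 + t - s)^2 <= 4st,
   valid for 1 <= s <= t <= 2s. *)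
pose K := B ^+ 2 * (8 * C ^+ 2) + 4 * B' ^+ 2.
have corrY s t : 1 <= s -> s <= t -> t <= 2 * s ->
    `|itgR P (fun w => Y s w * Y t w)| <= K / (1 + (t - s)) ^+ 2.
  move=> s1 st ts; have t1 : 1 <= t by exact: le_trans st.
  have u0 : 0 < 1 + (t - s) by lra.
  have -> : K / (1 + (t - s)) ^+ 2 = B ^+ 2 * (8 * C ^+ 2 / (1 + (t - s)) ^+ 2) +
      4 * B' ^+ 2 / (1 + (t - s)) ^+ 2 by rewrite /K; field; rewrite gt_eqF.
  rewrite EYY; apply: le_trans (ler_normD _ _) _; apply: lerD.
    rewrite normrM; apply: ler_pM => //.
      by rewrite normrM expr2; apply: ler_pM => //; exact: rB.
    rewrite (_ : _ - mn s * mn t =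
      (itgR P (fun w => N i s w * N j s w * (N i t w * N j t w)) -
        itgR P (fun w => N i s w * N j s w) * itgR P (fun w => N i t w * N j t w))
      + sg * (itgR P (fun w => N i s w * N j s w * (N i' t w * N j' t w)) -
        itgR P (fun w => N i s w * N j s w) * itgR P (fun w => N i' t w * N j' t w))
      + sg * (itgR P (fun w => N i' s w * N j' s w * (N i t w * N j t w)) -
        itgR P (fun w => N i' s w * N j' s w) * itgR P (fun w => N i t w * N j t w))
      + sg ^+ 2 * (itgR P (fun w => N i' s w * N j' s w * (N i' t w * N j' t w)) -
        itgR P (fun w => N i' s w * N j' s w) * itgR P (fun w => N i' t w * N j' t w))); last first.
      rewrite SE.
      have i1 k l k' l' := wickI (GN k s) (GN l s) (GN k' t) (GN l' t).
      rewrite itgRD; [|do 2 (apply: itgD; last exact: itgZ); exact: i1|exact: itgZ].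
      rewrite itgRD; [|(apply: itgD; last exact: itgZ); exact: i1|exact: itgZ].
      rewrite itgRD; [|exact: i1|exact: itgZ].
      by rewrite !itgRZ// !mnE; ring.
    rewrite (_ : 8 * C ^+ 2 / _ = 2 * (C / (1 + (t - s))) ^+ 2 + 2 * (C / (1 + (t - s))) ^+ 2
      + 2 * (C / (1 + (t - s))) ^+ 2 + 2 * (C / (1 + (t - s))) ^+ 2); last first.
      by field; rewrite gt_eqF.
    have sm (a x y : R) : `|a| <= 1 -> `|x| <= y -> `|a * x| <= y.
      by move=> a1 xy; rewrite normrM (le_trans _ xy)// ler_piMl.
    apply: le_trans (ler_normD _ _) _; apply: lerD; last first.
      by apply: sm; [rewrite normrX exprn_ile1|exact: cov].
    apply: le_trans (ler_normD _ _) _; apply: lerD; last by apply: sm => //; exact: cov.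
    apply: le_trans (ler_normD _ _) _; apply: lerD; last by apply: sm => //; exact: cov.
    exact: cov.
  rewrite normrM; apply: le_trans (_ : (B' / s) * (B' / t) <= _).
    by apply: ler_pM => //; rewrite mnE; apply: mean.
  have s0 : 0 < s by lra.
  have t0 : 0 < t by lra.
  rewrite (_ : B' / s * (B' / t) = B' ^+ 2 * (s * t)^-1); last by field; rewrite !gt_eqF.
  rewrite [leRHS](_ : _ = B' ^+ 2 * ((1 + (t - s)) ^+ 2 / 4)^-1); last by field; rewrite gt_eqF.
  apply: ler_wpM2l; first exact: sqr_ge0.
  rewrite lef_pV2 ?posrE ?mulr_gt0 ?divr_gt0 ?exprn_gt0//.
  rewrite ler_pdivrMr//; nra.
have := average_cvg0 mY cY IYY corrY; apply: filterS => w wY.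
have key : Q^-1 * Rintegral leb `[Q, 2 * Q]%classic (Y^~ w) + c @[Q --> +oo] --> c.
  have wc := cvgD wY (cvg_cst c); rewrite add0r in wc; exact: wc.
apply: cvg_trans key; apply: near_eq_cvg; near=> Q.
have Q0 : 0 < Q by near: Q; exact: nbhs_pinfty_gt.
have ci (y : R -> R) : continuous y -> leb.-integrable `[Q, 2 * Q]%classic (EFin \o y).
  move=> cy; apply: continuous_compact_integrable; first exact: segment_compact.
  exact: continuous_subspaceT.
rewrite (_ : Y^~ w = fun t => r t * X t w - c)//.
rewrite RintegralB//; last by apply: ci; exact: cont_cst.
  rewrite (_ : Rintegral leb _ (fun=> c) = c * Q).
    by rewrite mulrBr [c * Q]mulrC mulKf ?gt_eqF// subrK.
  have QQ : Q < 2 * Q by lra.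
  have [||_ ->] := @FTC_segment R (fun=> c) (fun x => c * x) Q (2 * Q) QQ (@cont_cst _ _ _).
  - by apply: contM; [exact: cont_cst|move=> x; exact: cvg_id].
  - by move=> x _; apply: is_derive_eq; rewrite /GRing.scale/=; ring.
  by ring.
by apply: ci; apply: contM => //; exact: cX.
Unshelve. all: by end_near. Qed.

End WickAverage.

Section PowerBounds.
Context {R : realType}.

Lemma powR_expR (a p : R) : 0 < a -> a `^ p = expR (p * ln a).
Proof. by move=> a0; rewrite /powR gt_eqF. Qed.

(** Passing to logarithms treats both signs of p at once. *)
Lemma powR_comparable (a b c p : R) : 0 < a -> 0 < b -> 1 <= c -> a <= c * b -> b <= c * a ->
  a `^ p <= c `^ `|p| * b `^ p.
Proof.
move=> a0 b0 c1 ab ba; have c0 : 0 < c by lra.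
rewrite !powR_expR// -expRD ler_expR.
have h1 : ln a <= ln c + ln b by rewrite -lnM ?posrE// ler_ln ?posrE ?mulr_gt0.
have h2 : ln b <= ln c + ln a by rewrite -lnM ?posrE// ler_ln ?posrE ?mulr_gt0.
rewrite -lerBlDr -mulrBr (le_trans (ler_norm _))// normrM ler_wpM2l//.
by rewrite ler_norml; lra.
Qed.

Lemma cont_powR (g : R -> R) (p : R) : continuous g -> (forall t, 0 < g t) ->
  continuous (fun t => g t `^ p).
Proof.
move=> cg g0; have -> : (fun t => g t `^ p) = fun t => expR (p * ln (g t)).
  by apply/funext => t; rewrite powR_expR.
move=> t; apply: continuous_comp; last exact: continuous_expR.
apply: cvgM; first exact: cvg_cst.
by apply: continuous_comp; [exact: cg|exact: continuous_ln].
Qed.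

Lemma inv_le_inv (x y c : R) : 0 <= x -> 0 <= y -> 0 < c -> 1 + x <= c * (1 + y) ->
  (1 + y)^-1 <= c / (1 + x).
Proof.
move=> x0 y0 c0 h; rewrite ler_pdivlMr ?ltr_wpDr// mulrC ler_pdivrMr ?ltr_wpDr//.
Qed.

End PowerBounds.

Lemma norm_le_add_sub (R : realDomainType) (K x y : R) :
  `|x + y| <= K -> `|x - y| <= K -> `|x| <= K /\ `|y| <= K.
Proof. by rewrite !ler_norml => /andP[? ?] /andP[? ?]; split; apply/andP; split; lra. Qed.

(** * Correlations of the field along a ray *)

Section FieldCorrelation.
Context {R : realType} {d : nat} {dO : measure_display} {Omega : measurableType dO}.
Variables (P : probability Omega R) (f : Omega -> 'I_d -> distrib R d).
Variables (D : set 'cV[R]_d) (m : R) (Ac Ar : 'cV[R]_d -> 'M[R[i]]_d).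
Hypothesis gmig : GMIG P D m f Ac Ar.
Variable r0 : R.
Hypothesis Dr : forall x, D x -> `|x| <= r0.
Variable x : 'cV[R]_d.
Hypothesis x1 : unit_sphere x.
Local Notation leb := (@lebesgue_measure R).

Definition part (b : bool) (z : R[i]) : R := if b then Re z else Im z.

(** For a = -c_s omega this is, almost surely, the far-field pairing in direction x; positive a
    corresponds to direction -x. *)
Definition obs j (a : R) w : R[i] := f w j (probe r0 (a *: x)).

Let gf : centered_gaussian_field P f. Proof. by case: gmig. Qed.

Let enormx (a : R) : enorm (a *: x) = `|a|.
Proof. by rewrite enormZ x1 mulr1. Qed.

Lemma gaussian_obs b j a : gaussian_space f (fun w => part b (obs j a w)).
Proof.
by case: b; [apply: gaussian_space_Re|apply: gaussian_space_Im]; exact: C0infty_probe.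
Qed.

Lemma continuous_obs b j (g : R -> R) w : continuous g -> continuous (fun t => part b (obs j (g t) w)).
Proof.
move=> cg; have [c1 c2] := dpair_wave_continuous x (f w j) (C0infty_cutoff r0).
by case: b; [exact: (cont_comp cg c1)|exact: (cont_comp cg c2)].
Qed.

Lemma itg_part_obs b b' j j' a a' : itg P (fun w => part b (obs j a w) * part b' (obs j' a' w)).
Proof. by apply: (gaussian_itg2 gf); exact: gaussian_obs. Qed.

Let conj_probe (k y : 'cV[R]_d) : conjc (probe r0 k y) = probe r0 (- k) y.
Proof.
rewrite /probe rmorphM/=; congr (_ * _).
  by rewrite /cutoff /tens -realC_prod conjc_real.
by rewrite dotpNr cisN.
Qed.

Definition Ecov j l a b := Cexpectation P (fun w => obs j a w * conjc (obs l b w)).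
Definition Erel j l a b := Cexpectation P (fun w => obs j a w * obs l b w).

(** The signs are arranged to match [symbol_correlation] with k1 = -a x and k2 = -b x; conjugating a
    packet reverses its frequency. *)
Lemma Ecov_kernel j l a b :
  Ecov j l a b = cov_kernel P f j l (probe r0 (- (- a *: x))) (probe r0 (- b *: x)).
Proof.
rewrite /Ecov /cov_kernel; congr Cexpectation; apply/funext => w.
rewrite /obs scaleNr opprK; congr (_ * conjc (f w l _)).
by apply/funext => y; rewrite conj_probe scaleNr opprK.
Qed.

Lemma Erel_kernel j l a b :
  Erel j l a b = rel_kernel P f j l (probe r0 (- (- a *: x))) (probe r0 (b *: x)).
Proof. by rewrite /Erel /rel_kernel scaleNr opprK. Qed.

Let cov0 j l psi : cov_kernel P f j l psi (fun=> 0) = 0.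
Proof.
rewrite /cov_kernel /Cexpectation (_ : (fun w => _) = fun=> 0); first exact: citgC0.
apply/funext => w; rewrite (_ : (fun x => conjc _) = fun=> 0) ?dpair0 ?conjc0 ?mulr0//.
Qed.

Let rel0 j l psi : rel_kernel P f j l psi (fun=> 0) = 0.
Proof.
rewrite /rel_kernel /Cexpectation (_ : (fun w => _) = fun=> 0); first exact: citgC0.
by apply/funext => w; rewrite dpair0 mulr0.
Qed.

Lemma obs_correlation : exists2 C, 0 <= C & forall j l a b, 1 <= `|b| ->
  [/\ cmod (Ecov j l a b) <= C * `|b| `^ (- m) / (1 + `|a - b|),
      cmod (Erel j l a b) <= C * `|b| `^ (- m) / (1 + `|a + b|),
      cmod (Ecov j l a b - (`|b| `^ (- m))%:C * fourier Ac ((b - a) *: x) j l) <= C * `|b| `^ (- m - 1) &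
      cmod (Erel j l a b - (`|b| `^ (- m))%:C * fourier Ar (- (a + b) *: x) j l) <= C * `|b| `^ (- m - 1)].
Proof.
have [_ pc pr] := gmig.
have /choice[C1 h1] : forall p : 'I_d * 'I_d, exists C, 0 <= C /\ forall a b : R, 1 <= `|b| ->
    cmod (Ecov p.1 p.2 a b) <= C * `|b| `^ (- m) / (1 + `|a - b|) /\
    cmod (Ecov p.1 p.2 a b - (`|b| `^ (- m))%:C * fourier Ac ((b - a) *: x) p.1 p.2) <= C * `|b| `^ (- m - 1).
  move=> [j l]; have [C C0 h] := symbol_correlation Dr pc cov0 j l.
  exists C; split=> // a b b1; have := h (- a *: x) (- b *: x).
  rewrite -scalerBl !enormx opprK normrN Ecov_kernel (distrC a) [b - a]addrC => /(_ b1) //.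
have /choice[C2 h2] : forall p : 'I_d * 'I_d, exists C, 0 <= C /\ forall a b : R, 1 <= `|b| ->
    cmod (Erel p.1 p.2 a b) <= C * `|b| `^ (- m) / (1 + `|a + b|) /\
    cmod (Erel p.1 p.2 a b - (`|b| `^ (- m))%:C * fourier Ar (- (a + b) *: x) p.1 p.2) <= C * `|b| `^ (- m - 1).
  move=> [j l]; have [C C0 h] := symbol_correlation Dr pr rel0 j l.
  exists C; split=> // a b b1; have := h (- a *: x) (b *: x).
  by rewrite -scalerBl -opprD !enormx normrN Erel_kernel => /(_ b1).
pose C := \sum_p (C1 p + C2 p).
have C10 p : 0 <= C1 p by have [] := h1 p.
have C20 p : 0 <= C2 p by have [] := h2 p.
have le1 p : C1 p <= C.
  rewrite /C (bigD1 p)//= -addrA lerDl addr_ge0//; apply: sumr_ge0 => q _; exact: addr_ge0.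
have le2 p : C2 p <= C.
  rewrite /C (bigD1 p)//= (addrC (C1 p)) -addrA lerDl addr_ge0//.
  by apply: sumr_ge0 => q _; exact: addr_ge0.
exists C; first by apply: sumr_ge0 => p _; exact: addr_ge0.
move=> j l a b b1; have [_ /(_ a b b1)[c1 c2]] := h1 (j, l).
have [_ /(_ a b b1)[c3 c4]] := h2 (j, l).
have i0 (y : R) : 0 <= (1 + `|y|)^-1 by rewrite invr_ge0 addr_ge0.
have p0 (y : R) : 0 <= `|b| `^ y by exact: powR_ge0.
split.
- by rewrite (le_trans c1)// ler_wpM2r// ler_wpM2r.
- by rewrite (le_trans c3)// ler_wpM2r// ler_wpM2r.
- by rewrite (le_trans c2)// ler_wpM2r.
- by rewrite (le_trans c4)// ler_wpM2r.
Qed.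

Lemma Ecov_Re j l a b : Re (Ecov j l a b) =
  itgR P (fun w => Re (obs j a w) * Re (obs l b w)) + itgR P (fun w => Im (obs j a w) * Im (obs l b w)).
Proof.
rewrite -itgRD; [|exact: (itg_part_obs true true)|exact: (itg_part_obs false false)].
by congr itgR; apply/funext => w; rewrite ReM Re_conjc Im_conjc; ring.
Qed.

Lemma Ecov_Im j l a b : Im (Ecov j l a b) =
  itgR P (fun w => Im (obs j a w) * Re (obs l b w)) - itgR P (fun w => Re (obs j a w) * Im (obs l b w)).
Proof.
rewrite -itgRB; [|exact: (itg_part_obs false true)|exact: (itg_part_obs true false)].
by congr itgR; apply/funext => w; rewrite ImM Re_conjc Im_conjc; ring.
Qed.

Lemma Erel_Re j l a b : Re (Erel j l a b) =
  itgR P (fun w => Re (obs j a w) * Re (obs l b w)) - itgR P (fun w => Im (obs j a w) * Im (obs l b w)).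
Proof.
rewrite -itgRB; [|exact: (itg_part_obs true true)|exact: (itg_part_obs false false)].
by congr itgR; apply/funext => w; rewrite ReM.
Qed.

Lemma Erel_Im j l a b : Im (Erel j l a b) =
  itgR P (fun w => Im (obs j a w) * Re (obs l b w)) + itgR P (fun w => Re (obs j a w) * Im (obs l b w)).
Proof.
rewrite -itgRD; [|exact: (itg_part_obs false true)|exact: (itg_part_obs true false)].
by congr itgR; apply/funext => w; rewrite ImM; ring.
Qed.

(** Half sums and differences of covariance and relation isolate the four real correlations. Their
    decay is in |a - b| and |a + b| respectively, and both dominate the distance of |a| and |b|. *)
Lemma part_correlation : exists2 C, 0 <= C & forall p q j l a b, 1 <= `|b| ->
  `|itgR P (fun w => part p (obs j a w) * part q (obs l b w))| <=
  C * `|b| `^ (- m) / (1 + `| `|a| - `|b| |).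
Proof.
have [C C0 h] := obs_correlation; exists C => // p q j l a b b1.
have [h1 h2 _ _] := h j l a b b1.
set K := C * _ / _.
have Cb : 0 <= C * `|b| `^ (- m) by rewrite mulr_ge0// powR_ge0.
have mono (y : R) : `| `|a| - `|b| | <= `|y| -> C * `|b| `^ (- m) / (1 + `|y|) <= K.
  move=> hy; apply: ler_wpM2l => //; rewrite lef_pV2 ?posrE ?ltr_wpDr//.
  by rewrite lerD2l.
have k1 : cmod (Ecov j l a b) <= K by apply: le_trans h1 (mono _ (ler_dist_dist _ _)).
have k2 : cmod (Erel j l a b) <= K.
  by apply: le_trans h2 (mono _ _); rewrite -(normrN b) -[b in a + b]opprK; exact: ler_dist_dist.
have r1 := le_trans (ler_Re_cmod _) k1; have r2 := le_trans (ler_Re_cmod _) k2.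
have i1 := le_trans (ler_Im_cmod _) k1; have i2 := le_trans (ler_Im_cmod _) k2.
move: r1 r2 i1 i2; rewrite Ecov_Re Ecov_Im Erel_Re Erel_Im => r1 r2 i1 i2.
have [? ?] := norm_le_add_sub r1 r2; have [? ?] := norm_le_add_sub i2 i1.
by case: p; case: q.
Qed.

Variables (kap tau : R).
Hypotheses (kap0 : 0 < kap) (tau0 : 0 <= tau).

(* The frequency is truncated from below so that the symbol estimates and the
   continuity of the powers hold for all values of the parameter. *)
Definition freq_floor := Num.max 1 kap^-1.

Definition clipped (t : R) := Num.max t freq_floor.

Lemma freq_floor_ge1 : 1 <= freq_floor. Proof. by rewrite /freq_floor le_max lexx. Qed.

Lemma freq_floor_kap : 1 <= kap * freq_floor.
Proof. by rewrite -ler_pdivrMl// mulr1 /freq_floor le_max lexx orbT. Qed.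

Lemma clipped_ge t : freq_floor <= clipped t.
Proof. by rewrite /clipped le_max lexx orbT. Qed.

Lemma clipped_ge1 t : 1 <= clipped t. Proof. exact: le_trans freq_floor_ge1 (clipped_ge t). Qed.

Lemma clipped_gt0 t : 0 < clipped t. Proof. exact: lt_le_trans (clipped_ge1 t). Qed.

Lemma le_clipped t : t <= clipped t. Proof. by rewrite /clipped le_max lexx. Qed.

Lemma continuous_clipped : continuous clipped.
Proof.
have -> : clipped = fun t => 2^-1 * (t + freq_floor + `|t - freq_floor|).
  apply/funext => t; rewrite /clipped; case: (leP t freq_floor) => h.
    by rewrite ler0_norm ?subr_le0//; lra.
  by rewrite gtr0_norm ?subr_gt0//; lra.
have cid : continuous (id : R -> R) by move=> t; exact: cvg_id.
apply: contM; first exact: cont_cst.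
apply: contD; first by apply: contD; [exact: cid|exact: cont_cst].
have cB : continuous (fun t => t - freq_floor) by apply: contB; [exact: cid|exact: cont_cst].
by apply: (cont_comp cB) => t; exact: norm_continuous.
Qed.

(** Half of the normalization on each factor: the square of the weight cancels the decay (kap
    u)^(-m) of the correlations. *)
Definition weight (u : R) := (kap * u) `^ (m / 2).

(* The index (j, p, true) is the real or imaginary part of the j-th component at
   the shifted frequency, (j, p, false) that of the second factor, observed in
   direction x or -x according to the sign e. *)
Definition freq_arg (e : R) (b : bool) (u : R) := if b then - (kap * (u + tau)) else e * (kap * u).

Definition process e (k : 'I_d * bool * bool) (t : R) w : R :=
  weight (clipped t) * part k.1.2 (obs k.1.1 (freq_arg e k.2 (clipped t)) w).

Lemma gaussian_process e k t : gaussian_space f (process e k t).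
Proof. by apply: gaussian_spaceZ; exact: gaussian_obs. Qed.

Let cont_scale (c : R) (g : R -> R) : continuous g -> continuous (fun t => c * g t).
Proof. by move=> cg; apply: contM => //; exact: cont_cst. Qed.

Lemma continuous_process e k w : continuous (fun t => process e k t w).
Proof.
apply: contM.
  apply: cont_powR; first by apply: cont_scale; exact: continuous_clipped.
  by move=> t; rewrite mulr_gt0 ?clipped_gt0.
apply: (@continuous_obs _ _ (fun t => freq_arg e k.2 (clipped t))); case: k.2; rewrite /freq_arg.
  apply: contN; apply: cont_scale; apply: contD; [exact: continuous_clipped|exact: cont_cst].
by do 2 apply: cont_scale; exact: continuous_clipped.
Qed.

Lemma norm_freq_arg e b u : `|e| = 1 -> 0 < u -> `|freq_arg e b u| = kap * (u + (if b then tau else 0)).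
Proof.
move=> e1 u0; case: b; rewrite /freq_arg.
  by rewrite normrN ger0_norm// mulr_ge0 ?(ltW kap0)// addr_ge0// ltW.
by rewrite normrM e1 mul1r addr0 ger0_norm// mulr_ge0 ?ltW.
Qed.

(** Up to constants the clipped, scaled and shifted frequencies may be replaced by s and t. In the
    constant, c1 pays for the shift by tau inside the power, c2 for weights taken at two points
    within a factor 2, and c3 for comparing t - s with the difference of the actual frequencies. *)
Lemma process_correlation e : `|e| = 1 -> exists C, forall k l s t, 1 <= s -> s <= t -> t <= 2 * s ->
  `|itgR P (fun w => process e k s w * process e l t w)| <= C / (1 + (t - s)).
Proof.
move=> e1; have [C C0 hC] := part_correlation.
pose c1 := (1 + tau) `^ `| - m|; pose c2 := (2 : R) `^ `|m / 2|.
pose c3 := (1 + tau) * (1 + kap^-1) * (1 + freq_floor).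
have p1 : 0 <= c1 by exact: powR_ge0.
have p2 : 0 <= c2 by exact: powR_ge0.
have ki : 0 < kap^-1 by rewrite invr_gt0.
have f0 : 0 < freq_floor by exact: lt_le_trans freq_floor_ge1.
exists (C * (c1 * c2) * c3) => k l s t s1 st ts.
set u := clipped s; set v := clipped t.
have u0 : 0 < u by exact: clipped_gt0.
have v0 : 0 < v by exact: clipped_gt0.
have uv : u <= v.
  by rewrite /u {1}/clipped ge_max clipped_ge (le_trans st (le_clipped t)).
have v2u : v <= 2 * u.
  rewrite /v /clipped ge_max; apply/andP; split.
    by rewrite (le_trans ts)// ler_wpM2l// le_clipped.
  by have := clipped_ge s; rewrite -/u; lra.
(* Clipping can shorten a distance only below the floor, by less than [freq_floor], since s >= 1. *)
have tsuv : 1 + (t - s) <= (1 + freq_floor) * (1 + (v - u)).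
  have [sf|sf] := lerP s freq_floor.
    have uE : u = freq_floor by rewrite /u /clipped max_r.
    by have := le_clipped t; rewrite -/v; nra.
  have uE : u = s by rewrite /u /clipped max_l// ltW.
  have vE : v = t by rewrite /v /clipped max_l// ltW// (lt_le_trans sf).
  by rewrite uE vE; nra.
rewrite (_ : (fun w => _) = fun w => weight u * weight v *
    (part k.1.2 (obs k.1.1 (freq_arg e k.2 u) w) * part l.1.2 (obs l.1.1 (freq_arg e l.2 v) w))); last first.
  by apply/funext => w; rewrite /process -/u -/v; ring.
rewrite itgRZ; last by apply: (gaussian_itg2 gf); exact: gaussian_obs.
have w0 y : 0 <= weight y by exact: powR_ge0.
rewrite normrM ger0_norm ?mulr_ge0//.
have bE := norm_freq_arg l.2 e1 v0; have aE := norm_freq_arg k.2 e1 u0.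
set th2 := if l.2 then tau else 0; set th1 := if k.2 then tau else 0.
have th2b : 0 <= th2 <= tau by rewrite /th2; case: l.2; rewrite ?lexx ?tau0.
have th1b : 0 <= th1 <= tau by rewrite /th1; case: k.2; rewrite ?lexx ?tau0.
rewrite -/th1 in aE; rewrite -/th2 in bE.
have /andP[t20 t2t] := th2b; have /andP[t10 t1t] := th1b.
have v1 : 1 <= v by exact: clipped_ge1.
have kv : 0 < kap * v by rewrite mulr_gt0.
have ku : 0 < kap * u by rewrite mulr_gt0.
have b1 : 1 <= `|freq_arg e l.2 v|.
  rewrite bE (le_trans freq_floor_kap)// ler_pM2l// (le_trans (clipped_ge t))// lerDl//.
have := hC k.1.2 l.1.2 k.1.1 l.1.1 (freq_arg e k.2 u) (freq_arg e l.2 v) b1.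
rewrite aE bE => {}hC.
have q1 : (kap * (v + th2)) `^ (- m) <= c1 * (kap * v) `^ (- m).
  apply: powR_comparable => //; rewrite ?mulr_gt0//; first lra.
  - lra.
  - by rewrite mulrCA ler_pM2l//; nra.
  - rewrite mulrCA ler_pM2l//; nra.
have q2 : weight u * weight v * (kap * v) `^ (- m) <= c2.
  rewrite /weight mulrAC -mulrA.
  rewrite (_ : (kap * v) `^ (- m) * (kap * v) `^ (m / 2) = ((kap * v) `^ (m / 2))^-1); last first.
    by rewrite !powR_expR// -expRN -expRD; congr expR; field.
  rewrite ler_pdivrMr ?powR_gt0//.
  apply: powR_comparable => //; first by rewrite ler1n.
  - by rewrite mulrCA ler_pM2l//; lra.
  - by rewrite mulrCA ler_pM2l//; lra.
have q3 : (1 + `|kap * (u + th1) - kap * (v + th2)|)^-1 <= c3 / (1 + (t - s)).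
  apply: inv_le_inv; [lra|exact: normr_ge0| |].
    have a1 : 0 < 1 + tau by lra.
    have a2 : 0 < 1 + kap^-1 by lra.
    have a3 : 0 < 1 + freq_floor by lra.
    by rewrite /c3 !mulr_gt0.
  rewrite -mulrBr normrM (gtr0_norm kap0); set y := `|_ + _ - _|.
  have y0 : 0 <= y by exact: normr_ge0.
  have vuy : v - u <= y + tau.
    have := ler_norm (- (u + th1 - (v + th2))); rewrite normrN -/y => ?; lra.
  apply: le_trans tsuv _; rewrite /c3 (mulrC _ (1 + freq_floor)) -mulrA ler_pM2l; last by lra.
  have hX : 1 + y <= (1 + kap^-1) * (1 + kap * y).
    have -> : (1 + kap^-1) * (1 + kap * y) = 1 + y + (kap^-1 + kap * y) by field; rewrite gt_eqF.
    by rewrite lerDl addr_ge0 ?(ltW ki)// mulr_ge0// ltW.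
  apply: le_trans (_ : (1 + tau) * (1 + y) <= _); first by nra.
  by rewrite -!mulrA ler_wpM2l// addr_ge0.
have cp0 : 0 <= C * (kap * (v + th2)) `^ (- m) by rewrite mulr_ge0// powR_ge0.
apply: le_trans (ler_wpM2l (mulr_ge0 (w0 u) (w0 v)) hC) _.
rewrite mulrA -[leRHS]mulrA; apply: ler_pM => //.
- by rewrite !mulr_ge0// powR_ge0.
rewrite mulrCA ler_wpM2l//.
apply: le_trans (_ : weight u * weight v * (c1 * (kap * v) `^ (- m)) <= _).
  by rewrite ler_wpM2l// mulr_ge0.
by rewrite mulrCA ler_wpM2l.
Qed.

End FieldCorrelation.

(** * Averages of products of observations *)

Section FieldAverage.
Context {R : realType} {d : nat} {dO : measure_display} {Omega : measurableType dO}.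
Variables (P : probability Omega R) (f : Omega -> 'I_d -> distrib R d).
Variables (D : set 'cV[R]_d) (m : R) (Ac Ar : 'cV[R]_d -> 'M[R[i]]_d).
Hypothesis gmig : GMIG P D m f Ac Ar.
Variable r0 : R.
Hypothesis Dr : forall x, D x -> `|x| <= r0.
Variable x : 'cV[R]_d.
Hypothesis x1 : unit_sphere x.
Variables (kap tau alpha : R).
Hypotheses (kap0 : 0 < kap) (tau0 : 0 <= tau) (alpha01 : 0 <= alpha <= 1).
Local Notation leb := (@lebesgue_measure R).
Local Notation obs := (obs f r0 x).
Local Notation clip := (clipped kap).

(** With alpha = (3 - d)/2 this is what the powers of omega and omega + tau in the far-field
    amplitudes leave beside the weights; it tends to 1. *)
Definition ratio (u : R) := (u / (u + tau)) `^ alpha.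

Lemma ratio_base u : 0 < u -> 0 < u / (u + tau) <= 1.
Proof.
move=> u0; have h : 0 < u + tau by rewrite ltr_wpDr.
by rewrite divr_gt0//= ler_pdivrMr// mul1r lerDl.
Qed.

Lemma ratio_le1 u : 0 < u -> ratio u <= 1.
Proof.
move=> /ratio_base hb; have /andP[a0 _] := alpha01.
by rewrite /ratio -[leRHS](powRr0 (u / (u + tau))); apply: ger_powR.
Qed.

Lemma ratio_near1 u : 0 < u -> `|ratio u - 1| <= tau / u.
Proof.
move=> u0; have hb := ratio_base u0; have /andP[_ a1] := alpha01.
have h : 0 < u + tau by rewrite ltr_wpDr.
rewrite distrC ger0_norm ?subr_ge0 ?ratio_le1//.
have : u / (u + tau) <= ratio u by apply: ger1_powR.
move=> hr; apply: le_trans (_ : 1 - u / (u + tau) <= _); first by rewrite lerD2l lerN2.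
rewrite (_ : 1 - _ = tau / (u + tau)); last by field; rewrite gt_eqF.
by rewrite ler_wpM2l// lef_pV2 ?posrE// lerDl.
Qed.

Lemma continuous_ratio : continuous (fun t => ratio (clip t)).
Proof.
have h t : 0 < clip t + tau by rewrite ltr_wpDr// clipped_gt0.
apply: cont_powR; last by move=> t; have /andP[] := ratio_base (clipped_gt0 kap t).
have cc := @continuous_clipped R kap.
apply: contM => // t; apply: cvgV; first by rewrite gt_eqF.
by apply: cvgD; [exact: cc|exact: cvg_cst].
Qed.

Variable cov : bool.

(** [cov] selects one of the two limits. The covariance pairs with the conjugate observation in
    direction x, at argument -kap u; the relation pairs with the observation in direction -x, at
    argument kap u. *)
Definition dir_sign : R := if cov then -1 else 1.

Definition second (z : R[i]) := if cov then conjc z else z.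

Definition principal := if cov then Ac else Ar.

Let norm_sign : `|dir_sign| = 1.
Proof. by rewrite /dir_sign; case: cov; rewrite ?normrN normr1. Qed.

Definition moment j l u := Cexpectation P (fun w =>
  obs j (- (kap * (u + tau))) w * second (obs l (dir_sign * (kap * u)) w)).

(** In both cases the signs make the frequency difference kap tau exactly. The squared weight turns
    the symbol error into O(1/(kap u)), and replacing the ratio by 1 costs tau/u. *)
Lemma moment_limit : exists2 C, 0 <= C & forall j l u, freq_floor kap <= u ->
  cmod ((ratio u * weight m kap u ^+ 2)%:C * moment j l u -
    fourier principal ((kap * tau) *: x) j l) <= C / u.
Proof.
have [C C0 hC] := obs_correlation gmig Dr x1.
have A0 p := cmod_ge0 (fourier principal ((kap * tau) *: x) p.1 p.2).
pose B := \sum_(p : 'I_d * 'I_d) cmod (fourier principal ((kap * tau) *: x) p.1 p.2).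
have B0 : 0 <= B by apply: sumr_ge0 => p _; exact: A0.
have hB j l : cmod (fourier principal ((kap * tau) *: x) j l) <= B.
  rewrite /B (bigD1 (j, l))//= lerDl; apply: sumr_ge0 => p _; exact: A0.
exists (C / kap + tau * B); first by rewrite addr_ge0 ?divr_ge0 ?mulr_ge0 ?(ltW kap0).
move=> j l u fu.
have u0 : 0 < u by rewrite (lt_le_trans ltr01)// (le_trans (freq_floor_ge1 kap)).
have ku : 0 < kap * u by rewrite mulr_gt0.
have nb : `|dir_sign * (kap * u)| = kap * u by rewrite normrM norm_sign mul1r gtr0_norm.
have b1 : 1 <= `|dir_sign * (kap * u)|.
  by rewrite nb (le_trans (freq_floor_kap kap0))// ler_pM2l.
have key : cmod (moment j l u - ((kap * u) `^ (- m))%:C *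
    fourier principal ((kap * tau) *: x) j l) <= C * (kap * u) `^ (- m - 1).
  have [_ _ h1 h2] := hC j l (- (kap * (u + tau))) _ b1.
  move: h1 h2; rewrite nb /moment /second /principal /dir_sign; case: cov => [h _|_ h].
    by move: h; rewrite (_ : -1 * (kap * u) - - (kap * (u + tau)) = kap * tau)//; ring.
  by move: h; rewrite (_ : - (- (kap * (u + tau)) + 1 * (kap * u)) = kap * tau)//; ring.
set F := fourier _ _ _ _ in key *.
have w2 : weight m kap u ^+ 2 * (kap * u) `^ (- m) = 1.
  rewrite /weight -powR_mulrn ?powR_ge0// -powRrM powRN divfK ?pnatr_eq0// divff//.
  by rewrite gt_eqF// powR_gt0.
have w3 : weight m kap u ^+ 2 * (kap * u) `^ (- m - 1) = (kap * u)^-1.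
  rewrite powRD; last by apply/implyP => _; rewrite gt_eqF.
  by rewrite mulrA w2 mul1r powR_inv1// ltW.
have r1 := ratio_le1 u0; have rn := ratio_near1 u0.
have rp : 0 <= ratio u by exact: powR_ge0.
have wp : 0 <= weight m kap u ^+ 2 by exact: sqr_ge0.
have -> : (ratio u * weight m kap u ^+ 2)%:C * moment j l u - F =
   (ratio u * weight m kap u ^+ 2)%:C * (moment j l u - ((kap * u) `^ (- m))%:C * F)
   + (ratio u - 1)%:C * F.
  have e : (ratio u * weight m kap u ^+ 2)%:C * ((kap * u) `^ (- m))%:C = (ratio u)%:C :> R[i].
    by rewrite -realCM -mulrA w2 mulr1.
  by rewrite mulrBr (mulrA _%:C _%:C F) e rmorphB/= rmorph1; ring.
apply: le_trans (cmodD _ _) _; rewrite mulrDl; apply: lerD.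
  rewrite cmodM cmod_real ger0_norm; last exact: mulr_ge0 rp wp.
  apply: le_trans (ler_wpM2l (mulr_ge0 rp wp) key) _.
  rewrite [leLHS](_ : _ = ratio u * (C * (weight m kap u ^+ 2 * (kap * u) `^ (- m - 1)))); last by ring.
  rewrite w3 (_ : C / kap / u = 1 * (C * (kap * u)^-1)); last by field; rewrite !gt_eqF.
  by rewrite ler_wpM2r// mulr_ge0// invr_ge0 ltW.
rewrite cmodM cmod_real mulrAC; apply: ler_pM => //; first exact: cmod_ge0.
exact: hB.
Qed.

Let GDf := @gaussian_spaceD R d dO Omega f.
Let GZf := @gaussian_spaceZ R d dO Omega f.

Definition averaged j l t w : R[i] := (ratio (clip t) * weight m kap (clip t) ^+ 2)%:C *
  (obs j (- (kap * (clip t + tau))) w * second (obs l (dir_sign * (kap * clip t)) w)).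

Lemma continuous_averaged j l w : continuous (fun t => Re (averaged j l t w)) /\
  continuous (fun t => Im (averaged j l t w)).
Proof.
have cc := @continuous_clipped R kap.
have csc (c : R) (g : R -> R) : continuous g -> continuous (fun t => c * g t).
  by move=> cg; apply: contM => //; exact: cont_cst.
have cw : continuous (fun t => weight m kap (clip t)).
  apply: cont_powR; first by apply: csc.
  by move=> t; rewrite mulr_gt0// clipped_gt0.
have cA : continuous (fun t => ratio (clip t) * weight m kap (clip t) ^+ 2).
  apply: contM; first exact: continuous_ratio.
  by under eq_fun do rewrite expr2; exact: contM.
have c1 b : continuous (fun t => part b (obs j (- (kap * (clip t + tau))) w)).
  apply: continuous_obs; apply: contN; apply: csc; apply: contD; [exact: cc|exact: cont_cst].
have c2 b : continuous (fun t => part b (obs l (dir_sign * (kap * clip t)) w)).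
  by apply: continuous_obs; exact: (csc _ _ (csc _ _ cc)).
have c1r := c1 true; have c1i := c1 false; have c2r := c2 true; have c2i := c2 false.
rewrite /part in c1r c1i c2r c2i; rewrite /averaged /second; split.
  under eq_fun do rewrite ReM Re_real Im_real mul0r subr0.
  by apply: (contM cA); case: cov c2r c2i => c2r c2i; under eq_fun do rewrite ReM ?Re_conjc ?Im_conjc;
     apply: contB; apply: contM => //; apply: contN.
under eq_fun do rewrite ImM Re_real Im_real mul0r addr0.
by apply: (contM cA); case: cov c2r c2i => c2r c2i; under eq_fun do rewrite ImM ?Re_conjc ?Im_conjc;
   apply: contD; apply: contM => //; apply: contN.
Qed.

(** The real part of the product is Re Re + sg Im Im and the imaginary part is Im Re - sg Re Im,
    with sg = 1 when the second factor is conjugated and -1 otherwise; each is an instance of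
    [wick_average]. *)
Theorem field_average j l :
  {ae P, forall w, Q^-1 * Rintegral leb `[Q, 2 * Q]%classic (fun t => Re (averaged j l t w))
    @[Q --> +oo] --> Re (fourier principal ((kap * tau) *: x) j l)} /\
  {ae P, forall w, Q^-1 * Rintegral leb `[Q, 2 * Q]%classic (fun t => Im (averaged j l t w))
    @[Q --> +oo] --> Im (fourier principal ((kap * tau) *: x) j l)}.
Proof.
have [gf _ _] := gmig.
have [C hC] := process_correlation gmig Dr x1 kap0 tau0 norm_sign.
have [B' B'0 hB] := moment_limit.
pose N := process f m r0 x kap tau dir_sign.
have GN k t : gaussian_space f (N k t) by exact: gaussian_process.
have cN k w : continuous (fun t => N k t w) by exact: continuous_process.
have rB t : 1 <= t -> `|ratio (clip t)| <= 1.
  by move=> _; rewrite ger0_norm ?powR_ge0// ratio_le1// clipped_gt0.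
have WA := wick_average GDf GZf (gaussian_space_gaussian gf) (gaussian_space_centered gf) GN cN hC
  continuous_ratio rB.
pose sg : R := if cov then 1 else -1.
have sg1 : `|sg| <= 1 by rewrite /sg; case: cov; rewrite ?normrN normr1.
have sg2 : `|- sg| <= 1 by rewrite normrN.
have NE k t : N k t = fun w => weight m kap (clip t) * part k.1.2 (obs k.1.1 (freq_arg kap tau dir_sign k.2 (clip t)) w) by [].
have mom p q t jj ll : itgR P (fun w => N (jj, p, true) t w * N (ll, q, false) t w) =
   weight m kap (clip t) ^+ 2 * itgR P (fun w => part p (obs jj (- (kap * (clip t + tau))) w) *
     part q (obs ll (dir_sign * (kap * clip t)) w)).
  rewrite -itgRZ; last exact: (itg_part_obs gmig).
  by congr itgR; apply/funext => w; rewrite !NE /=; ring.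
have le_inv t : 1 <= t -> B' / clip t <= B' / t.
  move=> t1; rewrite ler_wpM2l// lef_pV2 ?posrE ?clipped_gt0 ?le_clipped//.
  exact: lt_le_trans t1.
have momE t jj ll : Re (moment jj ll (clip t)) =
    itgR P (fun w => Re (obs jj (- (kap * (clip t + tau))) w) * Re (obs ll (dir_sign * (kap * clip t)) w)) +
    sg * itgR P (fun w => Im (obs jj (- (kap * (clip t + tau))) w) * Im (obs ll (dir_sign * (kap * clip t)) w)).
  rewrite /moment /second /sg; case: cov.
    by have := Ecov_Re gmig r0 x jj ll (- (kap * (clip t + tau))) (dir_sign * (kap * clip t)); rewrite /Ecov mul1r.
  by have := Erel_Re gmig r0 x jj ll (- (kap * (clip t + tau))) (dir_sign * (kap * clip t)); rewrite /Erel mulN1r.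
have momI t jj ll : Im (moment jj ll (clip t)) =
    itgR P (fun w => Im (obs jj (- (kap * (clip t + tau))) w) * Re (obs ll (dir_sign * (kap * clip t)) w)) +
    - sg * itgR P (fun w => Re (obs jj (- (kap * (clip t + tau))) w) * Im (obs ll (dir_sign * (kap * clip t)) w)).
  rewrite /moment /second /sg; case: cov.
    by have := Ecov_Im gmig r0 x jj ll (- (kap * (clip t + tau))) (dir_sign * (kap * clip t)); rewrite /Ecov mulN1r.
  by have := Erel_Im gmig r0 x jj ll (- (kap * (clip t + tau))) (dir_sign * (kap * clip t)); rewrite /Erel opprK mul1r.
split.
  have mean t : 1 <= t -> `|ratio (clip t) * (itgR P (fun w => N (j, true, true) t w * N (l, true, false) t w) +
     sg * itgR P (fun w => N (j, false, true) t w * N (l, false, false) t w)) -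
     Re (fourier principal ((kap * tau) *: x) j l)| <= B' / t.
    move=> t1; apply: le_trans (le_inv t t1); apply: le_trans (hB j l _ (clipped_ge kap t)).
    apply: le_trans (ler_Re_cmod _); rewrite ReB ReM Re_real Im_real mul0r subr0 momE !mom/=.
    by rewrite le_eqVlt; apply/orP; left; apply/eqP; congr (`| _ - _|); ring.
  have E w : (fun t => Re (averaged j l t w)) = (fun t => ratio (clip t) *
      (N (j, true, true) t w * N (l, true, false) t w + sg * (N (j, false, true) t w * N (l, false, false) t w))).
    apply/funext => t; rewrite !NE /averaged /second /sg ReM Re_real Im_real mul0r subr0.
    by case: cov; rewrite ReM ?Re_conjc ?Im_conjc /=; ring.
  by have := WA _ _ _ _ _ _ _ sg1 mean; apply: filterS => w; rewrite E.
have mean t : 1 <= t -> `|ratio (clip t) * (itgR P (fun w => N (j, false, true) t w * N (l, true, false) t w) +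
   - sg * itgR P (fun w => N (j, true, true) t w * N (l, false, false) t w)) -
   Im (fourier principal ((kap * tau) *: x) j l)| <= B' / t.
  move=> t1; apply: le_trans (le_inv t t1); apply: le_trans (hB j l _ (clipped_ge kap t)).
  apply: le_trans (ler_Im_cmod _); rewrite ImB ImM Re_real Im_real mul0r addr0 momI !mom/=.
  by rewrite le_eqVlt; apply/orP; left; apply/eqP; congr (`| _ - _|); ring.
have E w : (fun t => Im (averaged j l t w)) = (fun t => ratio (clip t) *
    (N (j, false, true) t w * N (l, true, false) t w + - sg * (N (j, true, true) t w * N (l, false, false) t w))).
  apply/funext => t; rewrite !NE /averaged /second /sg ImM Re_real Im_real mul0r addr0.
  by case: cov; rewrite ImM ?Re_conjc ?Im_conjc /=; ring.
by have := WA _ _ _ _ _ _ _ sg2 mean; apply: filterS => w; rewrite E.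
Qed.

End FieldAverage.

(** * Algebra of the far-field patterns *)

Section PowerIdentities.
Context {R : realType}.

Lemma powR_scaling (c s u del : R) : 0 < c -> 0 < s -> 0 < u ->
  c ^- 2 * (c `^ ((del + 1) / 2) * (s / c * u) `^ ((del - 3) / 2)) =
  s `^ ((del - 3) / 2) * u `^ ((del - 3) / 2).
Proof.
move=> c0 s0 u0; rewrite -powR_invn; last exact: ltW.
have sc : 0 < s / c by rewrite divr_gt0.
have scu : 0 < s / c * u by rewrite mulr_gt0.
rewrite !(powR_expR _ c0) (powR_expR _ scu) (powR_expR _ s0) (powR_expR _ u0) -!expRD.
by congr expR; rewrite lnM ?posrE// ln_div ?posrE//; field.
Qed.

Lemma powR_scaling1 (s u del : R) : 0 < s ->
  s ^- 2 * (s `^ ((del + 1) / 2) * u) = s `^ ((del - 3) / 2) * u.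
Proof.
move=> s0; rewrite mulrA; congr (_ * _); rewrite -powR_invn; last exact: ltW.
by rewrite !powR_expR// -!expRD; congr expR; field.
Qed.

Lemma powR_far_scaling (s m tau u del : R) : 0 < s -> 0 < u -> 0 <= tau ->
  s `^ (m + 3 - del) * u `^ (m + 3 - del) *
  (s `^ ((del - 3) / 2) * (u + tau) `^ ((del - 3) / 2) * (s `^ ((del - 3) / 2) * u `^ ((del - 3) / 2))) =
  ratio tau ((3 - del) / 2) u * weight m s u ^+ 2.
Proof.
move=> s0 u0 t0; have ut : 0 < u + tau by rewrite ltr_wpDr.
have cu : 0 < s * u by rewrite mulr_gt0.
rewrite /ratio /weight expr2 !powR_expR ?divr_gt0// -!expRD; congr expR.
by rewrite (ln_div (x := u)) ?posrE// (lnM (x := s)) ?posrE//; field.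
Qed.

Lemma scaled_product_cov (C : R[i]) (a b : R) :
  - (C * a%:C) * conjc (- (C * b%:C)) = (cmod C ^+ 2)%:C * (a * b)%:C.
Proof.
rewrite cmod_sqr; case: C => x y; apply/eqP; rewrite eq_complex/=.
by apply/andP; split; apply/eqP; ring.
Qed.

Lemma scaled_product_rel (C : R[i]) (a b : R) :
  - (C * a%:C) * - (C * b%:C) = C ^+ 2 * (a * b)%:C.
Proof. by rewrite mulrNN realCM mulrACA expr2. Qed.

(** The four terms of the bracket are the expansion of one product, because the fourth powers of the
    speeds are squares of the weights carried by each factor. *)
Lemma outer_product4 d (U1 S1 : 'cV[R[i]]_d) (U2 S2 : 'rV[R[i]]_d) (a b : R) :
  (a ^- 4)%:C *: (U1 *m U2) + (b ^- 2 * a ^- 2)%:C *: (U1 *m S2) +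
  (b ^- 2 * a ^- 2)%:C *: (S1 *m U2) + (b ^- 4)%:C *: (S1 *m S2) =
  ((a ^- 2)%:C *: U1 + (b ^- 2)%:C *: S1) *m ((a ^- 2)%:C *: U2 + (b ^- 2)%:C *: S2).
Proof.
have e4 (c : R) : (c ^- 4)%:C = (c ^- 2)%:C * (c ^- 2)%:C :> R[i].
  by rewrite -realCM -invfM -exprD.
rewrite mulmxDl !mulmxDr -!scalemxAl -!scalemxAr !scalerA -!e4 -!realCM.
by rewrite (mulrC (a ^- 2) (b ^- 2)) !addrA.
Qed.

Lemma adjmx_comb p q (a b : R) (A B : 'M[R[i]]_(p, q)) :
  a%:C *: adjmx A + b%:C *: adjmx B = adjmx (a%:C *: A + b%:C *: B).
Proof.
have e z w : conjc (a%:C * z + b%:C * w) = a%:C * conjc z + b%:C * conjc w.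
  by case: z w => u v [u' v']; apply/eqP; rewrite eq_complex/=; apply/andP; split; apply/eqP; ring.
by apply/matrixP => i j; rewrite !mxE e.
Qed.

Lemma outer_product4_adj d (U1 S1 U2 S2 W1 W2 : 'cV[R[i]]_d) (a b : R) (al be : R[i]) :
  (a ^- 2)%:C *: U1 + (b ^- 2)%:C *: S1 = al *: W1 ->
  (a ^- 2)%:C *: U2 + (b ^- 2)%:C *: S2 = be *: W2 ->
  (a ^- 4)%:C *: (U1 *m adjmx U2) + (b ^- 2 * a ^- 2)%:C *: (U1 *m adjmx S2) +
  (b ^- 2 * a ^- 2)%:C *: (S1 *m adjmx U2) + (b ^- 4)%:C *: (S1 *m adjmx S2) =
  (al * conjc be) *: (W1 *m adjmx W2).
Proof.
move=> h1 h2; rewrite outer_product4 adjmx_comb h1 h2.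
rewrite (_ : adjmx (be *: W2) = conjc be *: adjmx W2).
  by rewrite -scalemxAl -scalemxAr scalerA.
by apply/matrixP => i j; rewrite !mxE rmorphM.
Qed.

Lemma outer_product4_tr d (U1 S1 U2 S2 W1 W2 : 'cV[R[i]]_d) (a b : R) (al be : R[i]) :
  (a ^- 2)%:C *: U1 + (b ^- 2)%:C *: S1 = al *: W1 ->
  (a ^- 2)%:C *: U2 + (b ^- 2)%:C *: S2 = be *: W2 ->
  (a ^- 4)%:C *: (U1 *m U2^T) + (b ^- 2 * a ^- 2)%:C *: (U1 *m S2^T) +
  (b ^- 2 * a ^- 2)%:C *: (S1 *m U2^T) + (b ^- 4)%:C *: (S1 *m S2^T) =
  (al * be) *: (W1 *m W2^T).
Proof.
move=> h1 h2; rewrite outer_product4.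
rewrite (_ : _ *: U2^T + _ = be *: W2^T).
  by rewrite h1 -scalemxAl -scalemxAr scalerA.
by move/matrixP: h2 => h2; apply/matrixP => i j; have := h2 j i; rewrite !mxE.
Qed.

Lemma outer_adjE d (c : R[i]) (U V : 'cV[R[i]]_d) j l :
  (c *: (U *m adjmx V)) j l = c * (U j 0 * conjc (V l 0)).
Proof. by rewrite !mxE big_ord1 !mxE. Qed.

Lemma outer_trE d (c : R[i]) (U V : 'cV[R[i]]_d) j l :
  (c *: (U *m V^T)) j l = c * (U j 0 * V l 0).
Proof. by rewrite !mxE big_ord1 !mxE. Qed.

Lemma collect_real (K Z : R[i]) (a b e : R) : a * b = e ->
  a%:C * (K * b%:C * Z) = K * (e%:C * Z).
Proof. by move=> <-; rewrite realCM; ring. Qed.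

End PowerIdentities.

Section FarFieldAlgebra.
Context {R : realType} {d : nat}.
Variables (lambda mu : R).
Hypotheses (hmu : 0 < mu) (hlambda : 0 < lambda + 2 * mu).
Hypothesis hd : d = 2%N \/ d = 3%N.
Implicit Types (g : 'I_d -> distrib R d) (x : 'cV[R]_d).
Local Notation cs := (cs mu).
Local Notation cp := (cp lambda mu).

Lemma cs_gt0 : 0 < cs. Proof. exact: powR_gt0. Qed.

Lemma cp_gt0 : 0 < cp. Proof. exact: powR_gt0. Qed.

(** The frequency scaling by c_s/c_p makes compressional and shear waves probe the field at the same
    wave number c_s u. *)
Lemma plane_pairing_scaled g x u : plane_pairing cp g x (cs / cp * u) = plane_pairing cs g x u.
Proof.
apply/matrixP => j l; rewrite !mxE; congr (dpair_smooth _ _); apply/funext => y; congr (cis (- (_ * _))).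
by field; rewrite gt_eqF// cp_gt0.
Qed.

(** The scalar factor common to both patterns once they are divided by the squares of their speeds;
    this coincidence is what allows them to be added. *)
Definition far_amplitude (u : R) : R[i] :=
  - (Cdim R d * (cs `^ ((d%:R - 3) / 2) * u `^ ((d%:R - 3) / 2))%:C).

Lemma up_scaled g x u : 0 < u -> (cp ^- 2)%:C *: up_inf lambda mu g x (cs / cp * u) =
  far_amplitude u *: (xxT x *m plane_pairing cs g x u).
Proof.
move=> u0; rewrite /up_inf plane_pairing_scaled scalerA; congr (_ *: _).
rewrite /far_amplitude mulrN; congr (- _); rewrite mulrCA -realCM; congr (_ * _%:C).
exact: powR_scaling cp_gt0 cs_gt0 u0.
Qed.

Lemma us_scaled g x u : 0 < u -> (cs ^- 2)%:C *: us_inf mu g x u =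
  far_amplitude u *: ((1%:M - xxT x) *m plane_pairing cs g x u).
Proof.
move=> u0; rewrite /us_inf scalerA; congr (_ *: _).
rewrite /far_amplitude mulrN; congr (- _); rewrite mulrCA -realCM; congr (_ * _%:C).
exact: powR_scaling1 cs_gt0.
Qed.

Lemma far_combined g x u : 0 < u ->
  (cp ^- 2)%:C *: up_inf lambda mu g x (cs / cp * u) + (cs ^- 2)%:C *: us_inf mu g x u =
  far_amplitude u *: plane_pairing cs g x u.
Proof.
move=> u0; rewrite up_scaled// us_scaled// -scalerDr -mulmxDl.
by rewrite addrC subrK mul1mx.
Qed.

Lemma cov_bracketE g x tau u : 0 < u -> 0 <= tau ->
  cov_bracket lambda mu g x tau u =
  (far_amplitude (u + tau) * conjc (far_amplitude u)) *:
    (plane_pairing cs g x (u + tau) *m adjmx (plane_pairing cs g x u)).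
Proof.
move=> u0 t0; have ut : 0 < u + tau by rewrite ltr_wpDr.
exact: (outer_product4_adj (far_combined g x ut) (far_combined g x u0)).
Qed.

Lemma rel_bracketE g x tau u : 0 < u -> 0 <= tau ->
  rel_bracket lambda mu g x tau u =
  (far_amplitude (u + tau) * far_amplitude u) *:
    (plane_pairing cs g x (u + tau) *m (plane_pairing cs g (- x) u)^T).
Proof.
move=> u0 t0; have ut : 0 < u + tau by rewrite ltr_wpDr.
exact: (outer_product4_tr (far_combined g x ut) (far_combined g (- x) u0)).
Qed.

End FarFieldAlgebra.

Section FarFieldLimit.
Context {R : realType} {d : nat} {dO : measure_display} {Omega : measurableType dO}.
Variables (P : probability Omega R) (lambda mu : R).
Hypotheses (hmu : 0 < mu) (hlambda : 0 < lambda + 2 * mu) (hd : d = 2%N \/ d = 3%N).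
Variables (f : Omega -> 'I_d -> distrib R d).
Variables (D : set 'cV[R]_d) (m : R) (Ac Ar : 'cV[R]_d -> 'M[R[i]]_d).
Hypotheses (gmig : GMIG P D m f Ac Ar) (hD : bounded_domain D).
Local Notation leb := (@lebesgue_measure R).
Local Notation cs := (cs mu).

Let alpha : R := (3 - d%:R) / 2.

Lemma Cintegral_scale (K : R[i]) (h : R -> R[i]) (a b : R) :
  continuous (fun t => Re (h t)) -> continuous (fun t => Im (h t)) ->
  Cintegral leb `[a, b]%classic (fun t => K * h t) = K * Cintegral leb `[a, b]%classic h.
Proof.
move=> c1 c2.
have ci (y : R -> R) : continuous y -> leb.-integrable `[a, b]%classic (EFin \o y).
  move=> cy; apply: continuous_compact_integrable; first exact: segment_compact.
  exact: continuous_subspaceT.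
have cz (c : R) (y : R -> R) : continuous y -> continuous (fun t => c * y t).
  by move=> cy; apply: contM => //; exact: cont_cst.
apply: complex_ext; rewrite /Cintegral /= ?ReM ?ImM/=.
  under eq_Rintegral do rewrite ReM.
  rewrite RintegralB//; [|exact/ci/cz..].
  by rewrite !RintegralZl//; exact: ci.
under eq_Rintegral do rewrite ImM.
rewrite RintegralD//; [|exact/ci/cz..].
by rewrite !RintegralZl//; exact: ci.
Qed.

(** The identity between integrands is required only beyond T0, which covers the windows [Q, 2Q] as
    soon as Q >= T0. *)
Lemma freq_average_limit (M : R -> 'M[R[i]]_d) (K : R[i]) (h : 'I_d -> 'I_d -> R -> R[i])
    (L : 'M[R[i]]_d) (T0 : R) : 0 < T0 ->
  (forall j l, continuous (fun t => Re (h j l t)) /\ continuous (fun t => Im (h j l t))) ->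
  (forall j l t, T0 <= t ->
     (cs `^ (m + 3 - d%:R) * t `^ (m + 3 - d%:R))%:C * M t j l = K * h j l t) ->
  (forall j l, Q^-1 * Rintegral leb `[Q, 2 * Q]%classic (fun t => Re (h j l t)) @[Q --> +oo] --> Re (L j l)) ->
  (forall j l, Q^-1 * Rintegral leb `[Q, 2 * Q]%classic (fun t => Im (h j l t)) @[Q --> +oo] --> Im (L j l)) ->
  mx_cvg_pinfty (freq_average mu m M) (K *: L).
Proof.
move=> T00 ch hM lR lI.
have E j l : \forall Q \near +oo, freq_average mu m M Q j l =
    K * (Q^-1 * Rintegral leb `[Q, 2 * Q]%classic (fun t => Re (h j l t)) +i*
         (Q^-1 * Rintegral leb `[Q, 2 * Q]%classic (fun t => Im (h j l t)))).
  near=> Q; rewrite mxE; have [c1 c2] := ch j l.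
  have QT : T0 <= Q by near: Q; apply: nbhs_pinfty_ge; exact: num_real.
  have -> : Cintegral leb `[Q, 2 * Q]%classic (fun omega =>
      (cs `^ (m + 3 - d%:R) * omega `^ (m + 3 - d%:R))%:C * M omega j l) =
      Cintegral leb `[Q, 2 * Q]%classic (fun t => K * h j l t).
    by congr Complex; apply: eq_Rintegral => t; rewrite inE/= in_itv/= => /andP[Qt _];
      rewrite hM// (le_trans QT).
  rewrite Cintegral_scale// mulrCA; congr (_ * _).
  by apply: complex_ext; rewrite ?ReM ?ImM/=; ring.
move=> j l; rewrite !mxE; split.
  have lim : Re K * (Q^-1 * Rintegral leb `[Q, 2 * Q]%classic (fun t => Re (h j l t))) -
      Im K * (Q^-1 * Rintegral leb `[Q, 2 * Q]%classic (fun t => Im (h j l t))) @[Q --> +oo] -->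
      Re (K * L j l).
    by rewrite ReM; apply: cvgB; apply: cvgM; [exact: cvg_cst|exact: lR|exact: cvg_cst|exact: lI].
  by apply: cvg_trans lim; apply: near_eq_cvg; have := E j l; apply: filterS => Q ->; rewrite ReM.
have lim : Re K * (Q^-1 * Rintegral leb `[Q, 2 * Q]%classic (fun t => Im (h j l t))) +
    Im K * (Q^-1 * Rintegral leb `[Q, 2 * Q]%classic (fun t => Re (h j l t))) @[Q --> +oo] -->
    Im (K * L j l).
  by rewrite ImM; apply: cvgD; apply: cvgM; [exact: cvg_cst|exact: lI|exact: cvg_cst|exact: lR].
by apply: cvg_trans lim; apply: near_eq_cvg; have := E j l; apply: filterS => Q ->; rewrite ImM.
Unshelve. all: by end_near. Qed.

Theorem far_field_limit (x : 'cV[R]_d) (tau : R) : unit_sphere x -> 0 <= tau ->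
  {ae P, forall w,
    mx_cvg_pinfty (cov_average lambda mu (f w) m x tau)
      ((cmod (Cdim R d) ^+ 2)%:C *: fourier Ac ((cs * tau) *: x)) /\
    mx_cvg_pinfty (rel_average lambda mu (f w) m x tau)
      (Cdim R d ^+ 2 *: fourier Ar ((cs * tau) *: x))}.
Proof.
move=> x1 tau0.
have [gf pc pr] := gmig.
have [rho [rho0 Drho]] : exists rho : R, 0 < rho /\ forall y, D y -> `|y| <= rho.
  have [_ _ _ [M [_ hM]]] := hD; exists (Num.max 1 (M + 1)); split; first by rewrite lt_max ltr01.
  by move=> y Dy; rewrite le_max (hM (M + 1)) ?orbT// ltrDl.
(* The margin leaves an open neighbourhood of the closure of D on which the cutoff is 1, as
   [dpair_smooth_eq] requires. *)
pose r0 := rho + 1.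
have r00 : 0 < r0 by rewrite addr_gt0.
have Dr y : D y -> `|y| <= r0 by move=> /Drho/le_trans; apply; rewrite lerDl.
have s0 : 0 < cs by exact: cs_gt0.
(* In dimensions 2 and 3 alpha is 1/2 and 0. *)
have al : 0 <= alpha <= 1 by rewrite /alpha; case: hd => ->; lra.
have avg cv j l := field_average gmig Dr x1 s0 tau0 al cv j l.
have aeRe cv : {ae P, forall w, forall j l, Q^-1 * Rintegral leb `[Q, 2 * Q]%classic
    (fun t => Re (averaged f m r0 x cs tau alpha cv j l t w)) @[Q --> +oo] -->
    Re (fourier (principal Ac Ar cv) ((cs * tau) *: x) j l)}.
  by apply: filter_forall => j; apply: filter_forall => l; have [] := avg cv j l.
have aeIm cv : {ae P, forall w, forall j l, Q^-1 * Rintegral leb `[Q, 2 * Q]%classic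
    (fun t => Im (averaged f m r0 x cs tau alpha cv j l t w)) @[Q --> +oo] -->
    Im (fourier (principal Ac Ar cv) ((cs * tau) *: x) j l)}.
  by apply: filter_forall => j; apply: filter_forall => l; have [] := avg cv j l.
have supp := support_ae gf pc.
(* On the almost sure event where the support lies in the closure of D and all entrywise averages
   converge, the rest is pathwise algebra. *)
have key w : (forall j, dsupp (f w j) `<=` closure D) ->
    (forall cv j l, Q^-1 * Rintegral leb `[Q, 2 * Q]%classic
      (fun t => Re (averaged f m r0 x cs tau alpha cv j l t w)) @[Q --> +oo] -->
      Re (fourier (principal Ac Ar cv) ((cs * tau) *: x) j l)) ->
    (forall cv j l, Q^-1 * Rintegral leb `[Q, 2 * Q]%classic
      (fun t => Im (averaged f m r0 x cs tau alpha cv j l t w)) @[Q --> +oo] -->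
      Im (fourier (principal Ac Ar cv) ((cs * tau) *: x) j l)) ->
    mx_cvg_pinfty (cov_average lambda mu (f w) m x tau)
      ((cmod (Cdim R d) ^+ 2)%:C *: fourier Ac ((cs * tau) *: x)) /\
    mx_cvg_pinfty (rel_average lambda mu (f w) m x tau)
      (Cdim R d ^+ 2 *: fourier Ar ((cs * tau) *: x)).
  move=> sw hR hI.
  have sr j y : dsupp (f w j) y -> `|y| < r0.
    move=> /sw Dy; apply: le_lt_trans (_ : rho < r0); last by rewrite ltrDl.
    have cl : closed [set z : 'cV[R]_d | forall i, `|z i 0 - (0 : 'cV[R]_d) i 0| <= rho] by exact: closed_box.
    have : closure D `<=` [set z : 'cV[R]_d | forall i, `|z i 0 - (0 : 'cV[R]_d) i 0| <= rho].
      rewrite [X in _ `<=` X](iffLR (closure_id _) cl); apply: closureS => z Dz i.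
      by rewrite mxE subr0 (le_trans (coord_le_norm z i))// Drho.
    move=> /(_ y Dy) h; apply: ler_cV_norm => [|i]; first exact: ltW.
    by have := h i; rewrite mxE subr0.
  have pp (y : 'cV[R]_d) (u : R) j : plane_pairing cs (f w) y u j 0 = f w j (probe r0 (- (cs * u) *: y)).
    rewrite mxE (_ : (fun z => cis _) = fun z => cis (dotp z (- (cs * u) *: y))).
      exact: (dpair_smooth_eq r00 (smooth_wave (- (cs * u) *: y)) (sr j)).
    by apply/funext => z; rewrite dotpZr dotpC mulNr.
  have ff0 : 0 < freq_floor cs by exact: lt_le_trans (freq_floor_ge1 cs).
  have clipE t : freq_floor cs <= t -> clipped cs t = t by move=> h; rewrite /clipped max_l.
  split.
    apply: (@freq_average_limit _ _ (fun j l t => averaged f m r0 x cs tau alpha true j l t w)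
      _ _ ff0) => [j l|j l t ft|j l|j l].
    - exact: continuous_averaged.
    - have t0 := lt_le_trans ff0 ft.
      rewrite cov_bracketE// outer_adjE /far_amplitude scaled_product_cov !pp.
      rewrite (collect_real _ _ (powR_far_scaling m d%:R s0 t0 tau0)) /averaged clipE//.
      by rewrite /second /dir_sign/= /obs mulN1r.
    - exact: (hR true).
    - exact: (hI true).
  apply: (@freq_average_limit _ _ (fun j l t => averaged f m r0 x cs tau alpha false j l t w)
    _ _ ff0) => [j l|j l t ft|j l|j l].
  - exact: continuous_averaged.
  - have t0 := lt_le_trans ff0 ft.
    rewrite rel_bracketE// outer_trE /far_amplitude scaled_product_rel !pp.
    rewrite (collect_real _ _ (powR_far_scaling m d%:R s0 t0 tau0)) /averaged clipE//.
    by rewrite /second /dir_sign/= /obs mul1r (_ : - (cs * t) *: - x = (cs * t) *: x)// scalerN scaleNr opprK.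
  - exact: (hR false).
  - exact: (hI false).
have H1 := aeRe true; have H2 := aeRe false; have H3 := aeIm true; have H4 := aeIm false.
apply: filterS3 (filterI H1 H2) (filterI H3 H4) supp => w [h1 h2] [h3 h4] h5.
by apply: (key _ h5) => -[]; [exact: h1|exact: h2|exact: h3|exact: h4].
Qed.

End FarFieldLimit.

(** * Uniqueness *)

Section CisTaylor.
Context {R : realType}.
Implicit Types (s t : R) (k n : nat).

(** The Taylor coefficient i^k / k!, in the recursive form that matches differentiation of the
    polynomial. *)
Fixpoint cis_coef k : R[i] :=
  if k is k'.+1 then (k%:R^-1)%:C * ((0 +i* 1) * cis_coef k') else 1.

Definition cis_poly n s : R[i] := \sum_(k < n) cis_coef k * (s ^+ k)%:C.

Lemma Re_cis_coefS k : Re (cis_coef k.+1) = - (k.+1%:R^-1 * Im (cis_coef k)).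
Proof.
rewrite (_ : cis_coef k.+1 = (k.+1%:R^-1)%:C * ((0 +i* 1) * cis_coef k))//.
by case: (cis_coef k) => a b; move: (_^-1) => c /=; ring.
Qed.

Lemma Im_cis_coefS k : Im (cis_coef k.+1) = k.+1%:R^-1 * Re (cis_coef k).
Proof.
rewrite (_ : cis_coef k.+1 = (k.+1%:R^-1)%:C * ((0 +i* 1) * cis_coef k))//.
by case: (cis_coef k) => a b; move: (_^-1) => c /=; ring.
Qed.

Lemma Re_cis_poly n s : Re (cis_poly n s) = \sum_(k < n) Re (cis_coef k) * s ^+ k.
Proof. by rewrite Re_sum; apply: eq_bigr => k _; rewrite !ReImE mulr0 subr0. Qed.

Lemma Im_cis_poly n s : Im (cis_poly n s) = \sum_(k < n) Im (cis_coef k) * s ^+ k.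
Proof. by rewrite Im_sum; apply: eq_bigr => k _; rewrite !ReImE mulr0 add0r. Qed.

Lemma is_derive_sum_powers (a b : nat -> R) n (s : R) : (forall k, a k.+1 = k.+1%:R^-1 * b k) ->
  is_derive s 1 (fun s : R => \sum_(k < n.+1) a k * s ^+ k) (\sum_(k < n) b k * s ^+ k).
Proof.
move=> ab; elim: n => [|n IH].
  rewrite big_ord0 (_ : (fun s : R => _) = fun=> a 0%N); first exact: is_derive_cst.
  by apply/funext => x; rewrite big_ord1 expr0 mulr1.
rewrite (_ : (fun s : R => _) =
    (fun s => (\sum_(k < n.+1) a k * s ^+ k) + a n.+1 * s ^+ n.+1)); last first.
  by apply/funext => x; rewrite big_ord_recr.
rewrite big_ord_recr/=; apply: is_deriveD.
have dX : is_derive s 1 (fun s : R => s ^+ n.+1) (n.+1%:R * s ^+ n).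
  rewrite (_ : (fun s : R => s ^+ n.+1) = (id : R -> R) ^+ n.+1); last first.
    by apply/funext => y; rewrite exprfctE.
  apply: (is_derive_eq (is_deriveX n.+1 (is_derive_id s 1))).
  by rewrite /GRing.scale/= mulr1.
apply: (is_derive_eq (is_deriveZ (a n.+1) dX)); rewrite ab /GRing.scale/=.
by rewrite mulrACA mulVf ?pnatr_eq0// mul1r.
Qed.

Lemma is_derive_Re_cis_poly n s :
  is_derive s 1 (fun s : R => Re (cis_poly n.+1 s)) (- Im (cis_poly n s)).
Proof.
rewrite (_ : (fun s : R => _) = (fun s => \sum_(k < n.+1) Re (cis_coef k) * s ^+ k)); last first.
  by apply/funext => x; exact: Re_cis_poly.
rewrite Im_cis_poly (_ : - _ = \sum_(k < n) (- Im (cis_coef k)) * s ^+ k); last first.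
  by rewrite -sumrN; apply: eq_bigr => k _; rewrite mulNr.
by apply: (@is_derive_sum_powers (fun k => Re (cis_coef k)) (fun k => - Im (cis_coef k))) => k; rewrite Re_cis_coefS mulrN.
Qed.

Lemma is_derive_Im_cis_poly n s :
  is_derive s 1 (fun s : R => Im (cis_poly n.+1 s)) (Re (cis_poly n s)).
Proof.
rewrite (_ : (fun s : R => _) = (fun s => \sum_(k < n.+1) Im (cis_coef k) * s ^+ k)); last first.
  by apply/funext => x; exact: Im_cis_poly.
rewrite Re_cis_poly.
by apply: (@is_derive_sum_powers (fun k => Im (cis_coef k)) (fun k => Re (cis_coef k))) => k; rewrite Im_cis_coefS.
Qed.

Lemma cis_poly0 n : cis_poly n.+1 0 = 1.
Proof.
rewrite /cis_poly big_ord_recl expr0 mulr1 big1 ?addr0// => i _.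
by rewrite expr0n/= mulr0.
Qed.

Lemma le_power_of_derive (g g' : R -> R) n s : (forall t : R, is_derive t 1 g (g' t)) ->
  g 0 = 0 -> (forall t, `|g' t| <= `|t| ^+ n) -> `|g s| <= `|s| ^+ n.+1.
Proof.
move=> dg g0 bg.
have dh (t : R) : is_derive t 1 (fun t => g (t * s)) (s * g' (t * s)).
  have d1 : is_derive t 1 (fun t : R => t * s) s.
    by apply: is_derive_eq; rewrite /GRing.scale/= mulr0 add0r mulr1.
  by rewrite mulrC; exact: (@is_derive1_comp _ g (fun t : R => t * s) _ _ _ (dg (t * s)) d1).
have := MVT_abs (M := `|s| ^+ n.+1) dh; rewrite mul1r mul0r g0 subr0; apply => t /andP[t0 t1].
rewrite normrM exprS ler_wpM2l// (le_trans (bg _))// lerXn2r ?nnegrE// normrM ger0_norm//.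
by rewrite ler_piMl.
Qed.

(** Induction on n: the derivative of a remainder is i times the remainder of one order less. The
    factorial is given up, so the bound is effective only where |s| < 1; continuation along the line
    makes up for it. *)
Lemma cis_taylor n s : `|Re (cis s - cis_poly n s)| <= `|s| ^+ n /\
  `|Im (cis s - cis_poly n s)| <= `|s| ^+ n.
Proof.
elim: n s => [|n IH] s.
  by rewrite /cis_poly big_ord0 subr0 expr0 !ReImE ler_norml ler_norml cos_geN1 cos_le1 sin_geN1 sin_le1.
split.
  apply: (le_power_of_derive (g := fun s => Re (cis s - cis_poly n.+1 s)) (g' := fun s => - Im (cis s - cis_poly n s))).
  - move=> t; rewrite (_ : (fun s : R => _) = (fun s => cos s - Re (cis_poly n.+1 s))); last first.
      by apply/funext => x; rewrite !ReImE.
    apply: (is_derive_eq (is_deriveB (is_derive_cos t) (is_derive_Re_cis_poly n t))).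
    by rewrite !ReImE; ring.
  - by rewrite cis_poly0 cis0 subrr.
  - by move=> t; rewrite normrN; case: (IH t).
apply: (le_power_of_derive (g := fun s => Im (cis s - cis_poly n.+1 s)) (g' := fun s => Re (cis s - cis_poly n s))).
- move=> t; rewrite (_ : (fun s : R => _) = (fun s => sin s - Im (cis_poly n.+1 s))); last first.
    by apply/funext => x; rewrite !ReImE.
  apply: (is_derive_eq (is_deriveB (is_derive_sin t) (is_derive_Im_cis_poly n t))).
  by rewrite !ReImE; ring.
- by rewrite cis_poly0 cis0 subrr.
- by move=> t; case: (IH t).
Qed.

Lemma cmod_cis_taylor n s : cmod (cis s - cis_poly n s) <= 2 * `|s| ^+ n.
Proof.
have [h1 h2] := cis_taylor n s.
by rewrite (le_trans (cmod_le _))// mulr_natl mulr2n lerD.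
Qed.

End CisTaylor.

(** * Analyticity along a line *)

Section Analyticity.
Context {R : realType} {dT : measure_display} {T : measurableType dT}.
Variables (nu : {measure set T -> \bar R}) (phi : T -> R) (B : R).
Hypotheses (mphi : measurable_fun setT phi) (B0 : 0 < B).

Section fixed.
Variable k : T -> R[i].
Hypotheses (Ik : citg nu k) (kB : forall u, k u != 0 -> `|phi u| <= B).

Let G t := citgC nu (fun u => k u * cis (t * phi u)).
Let mom j := citgC nu (fun u => k u * (cis_coef j * (phi u ^+ j)%:C)).
Let C := itgR nu (fun u => cmod (k u)).

Let citg_kM (h : T -> R[i]) (M : R) : cmeas h -> (forall u, `|phi u| <= B -> cmod (h u) <= M) ->
  citg nu (fun u => k u * h u) /\ cmod (citgC nu (fun u => k u * h u)) <= 2 * (M * C).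
Proof.
move=> mh hM.
have mkh := cmeasM (citg_meas Ik) mh.
have IM := itgZ M (citg_cmod Ik).
have b u : cmod (k u * h u) <= M * cmod (k u).
  rewrite cmodM mulrC; have [->|ku] := eqVneq (k u) 0; first by rewrite cmod0 !mulr0.
  by rewrite ler_wpM2r ?cmod_ge0// hM// kB.
split; first exact: citg_le mkh b IM.
by rewrite /C -itgRZ; [exact: cmod_citgC mkh b IM|exact: citg_cmod].
Qed.

Let meas_mom j : cmeas (fun u => cis_coef j * (phi u ^+ j)%:C).
Proof.
by apply: cmeasM; [exact: cmeas_cst|apply: cmeas_real; exact: measurable_funX].
Qed.

Let citg_mom j : citg nu (fun u => k u * (cis_coef j * (phi u ^+ j)%:C)).
Proof.
have := citg_kM (M := cmod (cis_coef j) * B ^+ j) (meas_mom j); case => // u h.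
by rewrite cmodM ler_wpM2l ?cmod_ge0// cmod_real normrX lerXn2r ?nnegrE// (le_trans _ h).
Qed.

Lemma wave_integral_taylor n t :
  cmod (G t - \sum_(j < n) (t ^+ j)%:C * mom j) <= 4 * C * (B * `|t|) ^+ n.
Proof.
have mc : cmeas (fun u => cis (t * phi u)) by apply: cmeas_cis; exact: measurable_funM.
have [Ic _] := citg_kM (M := 1) mc (fun u _ => eq_ind_r (fun z => z <= 1) (lexx 1) (cmod_cis (t * phi u))).
have Ij (j : 'I_n) := citgZ (t ^+ j)%:C (citg_mom j).
have IS := citg_sum (index_enum _) xpredT Ij.
have E : G t - \sum_(j < n) (t ^+ j)%:C * mom j =
    citgC nu (fun u => k u * (cis (t * phi u) - cis_poly n (t * phi u))).
  rewrite (_ : \sum_(j < n) _ = citgC nu (fun u => \sum_(j < n) (t ^+ j)%:C * (k u * (cis_coef j * (phi u ^+ j)%:C)))); last first.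
    by rewrite (citgC_sum _ _ Ij); apply: eq_bigr => j _; rewrite citgCZ//; exact: citg_mom.
  rewrite -(citgCB Ic IS); congr citgC; apply/funext => u; rewrite mulrBr; congr (_ - _).
  rewrite /cis_poly big_distrr/=; apply: eq_bigr => j _.
  by rewrite exprMn realCM; ring.
rewrite E; have := @citg_kM (fun u => cis (t * phi u) - cis_poly n (t * phi u)) (2 * (B * `|t|) ^+ n).
have -> : 2 * (2 * (B * `|t|) ^+ n * C) = 4 * C * (B * `|t|) ^+ n by ring.
case => //.
  apply: cmeasB => //; split.
    under eq_fun do rewrite Re_cis_poly.
    apply: measurable_sum => j; apply: measurable_funM => //; apply: measurable_funX.
    exact: measurable_funM.
  under eq_fun do rewrite Im_cis_poly.
  apply: measurable_sum => j; apply: measurable_funM => //; apply: measurable_funX.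
  exact: measurable_funM.
move=> u h; rewrite (le_trans (cmod_cis_taylor _ _))// ler_wpM2l// lerXn2r ?nnegrE ?mulr_ge0 ?(ltW B0)//.
by rewrite normrM mulrC ler_wpM2r.
Qed.

Let C0 : 0 <= C. Proof. by apply: itgR_ge0 => u; exact: cmod_ge0. Qed.

(** A first nonzero coefficient would dominate the Taylor remainder near 0. *)
Lemma wave_moment_eq0 delta : 0 < delta -> (forall t, `|t| < delta -> G t = 0) ->
  forall n, mom n = 0.
Proof.
move=> d0 G0; elim/ltn_ind => n IH.
apply/eqP; rewrite -cmod_eq0; apply/negPn/negP => a0.
have ap : 0 < cmod (mom n) by rewrite lt_def a0 cmod_ge0.
pose L := 4 * C * B ^+ n.+1.
have L0 : 0 <= L by rewrite !mulr_ge0// exprn_ge0// ltW.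
(* Taylor's bound at order n + 1 gives |mom n| <= L t, while this t satisfies 2(L + 1) t <= |mom
   n|. *)
pose t := Num.min (delta / 2) (cmod (mom n) / (2 * (L + 1))).
have L1 : 0 < L + 1 by rewrite ltr_wpDl.
have t0 : 0 < t by rewrite lt_min !divr_gt0// mulr_gt0.
have td : `|t| < delta.
  rewrite gtr0_norm// (@le_lt_trans _ _ (delta / 2))// ?ge_min ?lexx// ltr_pdivrMr//; lra.
have := wave_integral_taylor n.+1 t; rewrite G0// big_ord_recr/= big1 => [|j _]; last first.
  by rewrite IH// mulr0.
rewrite [0 + (_ * _)]add0r [0 - (_ * _)]sub0r cmodN cmodM cmod_real normrX gtr0_norm// => h.
have : cmod (mom n) <= L * t.
  rewrite -(ler_pM2l (exprn_gt0 n t0)) (le_trans h)// exprMn [t ^+ n.+1]exprS /L.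
  move: (B ^+ n.+1) (t ^+ n) => b c.
  by rewrite le_eqVlt; apply/orP; left; apply/eqP; ring.
have : t <= cmod (mom n) / (2 * (L + 1)) by rewrite ge_min lexx orbT.
rewrite ler_pdivlMr ?mulr_gt0// => h1 h2.
have : t * (2 * (L + 1)) <= t * L by rewrite (le_trans h1)// mulrC.
rewrite ler_pM2l// => h3; lra.
Qed.

(** With all coefficients zero, the Taylor bound reads 4C 2^-n for every n. *)
Lemma wave_integral_eq0_disk delta : 0 < delta -> (forall t, `|t| < delta -> G t = 0) ->
  forall t, B * `|t| <= 2^-1 -> G t = 0.
Proof.
move=> d0 G0 t Bt; have m0 := wave_moment_eq0 d0 G0.
apply/eqP; rewrite -cmod_eq0 -normr_le0 ger0_norm ?cmod_ge0//.
apply/ler_addgt0Pl => e e0; rewrite addr0.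
have C1 : 0 < 4 * C + 1 by rewrite ltr_wpDl// mulr_ge0.
have : \forall n \near \oo, (2^-1 : R) ^+ n < e / (4 * C + 1).
  have := @cvg_expr R 2^-1; rewrite ger0_norm// => /(_ _)/cvgrPdist_lt H.
  have e1 : 0 < e / (4 * C + 1) by rewrite divr_gt0.
  have h21 : (2^-1 : R) < 1 by rewrite invf_lt1// ltr1n.
  apply: filterS (H h21 _ e1) => n.
  by rewrite sub0r normrN ger0_norm// exprn_ge0.
case=> N _ /(_ N (leqnn N))/= hN.
have := wave_integral_taylor N t; rewrite big1 => [|j _]; last by rewrite m0 mulr0.
rewrite subr0 => /le_trans; apply.
have : (B * `|t|) ^+ N <= (2^-1) ^+ N by rewrite lerXn2r ?nnegrE ?mulr_ge0 ?(ltW B0).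
move=> /le_lt_trans/(_ hN); rewrite ltr_pdivlMr// => h.
rewrite (le_trans _ (ltW h))// mulrC ler_wpM2l ?exprn_ge0 ?mulr_ge0 ?(ltW B0)//; lra.
Qed.

End fixed.

(** Recentering at c multiplies k by the unimodular factor e^(ic phi) and changes none of the
    hypotheses, so the radius 1/(2B) is the same at every centre and finitely many steps reach any
    t. *)
Lemma wave_integral_eq0 (k : T -> R[i]) delta : citg nu k ->
  (forall u, k u != 0 -> `|phi u| <= B) -> 0 < delta ->
  (forall t, `|t| < delta -> citgC nu (fun u => k u * cis (t * phi u)) = 0) ->
  forall t, citgC nu (fun u => k u * cis (t * phi u)) = 0.
Proof.
move=> Ik kB d0 h0.
(* One application reaches distance 2r; the induction moves the centre by r and keeps the other r as
   the new neighbourhood. *)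
pose r := (4 * B)^-1; have r0 : 0 < r by rewrite invr_gt0 mulr_gt0.
pose Z c := exists2 e, 0 < e & forall t, `|t - c| < e -> citgC nu (fun u => k u * cis (t * phi u)) = 0.
have step c : Z c -> forall t, `|t - c| <= 2 * r -> citgC nu (fun u => k u * cis (t * phi u)) = 0.
  move=> [e e0 he] t tc.
  have E s : (fun u => k u * cis (c * phi u) * cis (s * phi u)) = (fun u => k u * cis ((c + s) * phi u)).
    by apply/funext => u; rewrite -mulrA -cisD mulrDl.
  have mc : cmeas (fun u => k u * cis (c * phi u)).
    by apply: cmeasM (citg_meas Ik) _; apply: cmeas_cis; exact: measurable_funM.
  have Ikc : citg nu (fun u => k u * cis (c * phi u)).
    by apply: citg_le mc _ (citg_cmod Ik) => u; rewrite cmodM cmod_cis mulr1.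
  have kBc u : k u * cis (c * phi u) != 0 -> `|phi u| <= B.
    by move=> h; apply: kB; apply: contra h => /eqP ->; rewrite mul0r.
  have := @wave_integral_eq0_disk _ Ikc kBc e e0 _ (t - c); rewrite E [c + _]addrC subrK; apply.
    by move=> s s0; rewrite E; apply: he; rewrite addrAC subrr add0r.
  rewrite -ler_pdivlMl// (le_trans tc)// /r invfM mulrA mulrC.
  by rewrite (_ : 2 / 4 = 2^-1 :> R)//; field.
have Zn n : forall c, `|c| <= n%:R * r -> Z c.
  elim: n => [|n IH] c.
    rewrite mul0r normr_le0 => /eqP ->; exists delta => // t; rewrite subr0; exact: h0.
  move=> cn; exists r => // t tc.
  (* The point of the segment from 0 to c that the induction hypothesis covers, at distance at most
     r from c. *)
  pose c' := c * (n%:R / n.+1%:R).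
  have n1 : 0 < n.+1%:R :> R by [].
  have /step : Z c'.
    apply: IH; rewrite normrM [`|_ / _|]ger0_norm ?divr_ge0// [leLHS]mulrA ler_pdivrMr//.
    by rewrite (_ : n%:R * r * _ = n.+1%:R * r * n%:R); [rewrite ler_wpM2r|ring].
  apply; rewrite (_ : t - c' = (t - c) + (c - c')); last by ring.
  rewrite (le_trans (ler_normD _ _))// mulr_natl mulr2n lerD ?(ltW tc)//.
  rewrite /c' (_ : c - _ = c / n.+1%:R); last first.
    by move: (n1) => /lt0r_neq0; rewrite -[n.+1%:R]natr1; move: (n%:R : R) => a a0; field.
  by rewrite normrM normfV [`|_.+1%:R|]ger0_norm// ler_pdivrMr// mulrC.
move=> t; have /step : Z t; last by apply; rewrite subrr normr0 mulr_ge0// ltW.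
apply: (Zn (Num.truncn (`|t| / r)).+1).
by rewrite -ler_pdivrMr// ltW// truncnS_gt.
Qed.

End Analyticity.

(** * Injectivity of the Fourier transform on test functions *)

Section FourierInjective.
Context {R : realType} {d : nat}.
Local Notation leb := (@lebesgue_measure R).

Section tensor.
Variables (c : 'I_d -> R -> R) (r : R).
Hypotheses (sc : forall i, smooth1 (c i)) (supc : forall i, supp1 r (c i)).

Let citg_wave_ft1 (y : R) i : citg leb (fun t => cis (y * t) * ft1 (c i) t).
Proof.
have If := citg_ft1_fun (sc i) (supc i).
apply: (citg_le _ _ (citg_cmod If)) => [|t]; last by rewrite cmodM cmod_cis mul1r.
apply: cmeasM (citg_meas If); apply: cmeas_cis; apply: continuous_measurable_fun.
exact: continuous_scale.
Qed.

Lemma fourier_inversion_tens (y : 'cV[R]_d) :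
  citgC (lebesgueRn d) (fun u => cis (dotp y (vec u)) * \prod_i ft1 (c i) (tnth u i)) =
  ((2 * pi) ^+ d)%:C * tens c y.
Proof.
have [_ E] := citg_prodT (fun i => citg_wave_ft1 (y i 0) i).
have -> : (fun u : d.-tuple R => cis (dotp y (vec u)) * \prod_i ft1 (c i) (tnth u i)) =
    (fun u => \prod_i (cis (y i 0 * tnth u i) * ft1 (c i) (tnth u i))).
  apply/funext => u; rewrite big_split/= -cis_sum /dotp; congr (cis _ * _).
  by apply: eq_bigr => i _; rewrite mxE.
rewrite E; under eq_bigr => i _ do rewrite (fourier_inversion1 _ (sc i) (supc i)) realCM.
by rewrite big_split/= -realC_prod prodr_const card_ord.
Qed.

(* Fourier inversion of the tensor product and an exchange of integrals. *)
Lemma tens_pairing_eq0 (g : 'cV[R]_d -> R[i]) : C0infty setT g ->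
  (forall xi, citgC (lebesgueRn d) (fun u => g (vec u) * cis (dotp (vec u) xi)) = 0) ->
  citgC (lebesgueRn d) (fun u => g (vec u) * tens c (vec u)) = 0.
Proof.
move=> Cg g0.
have Ig := C0infty_citg Cg.
have [If _] := citg_prodT (fun i => citg_ft1_fun (sc i) (supc i)).
pose f (z : d.-tuple R * d.-tuple R) :=
  g (vec z.1) * (cis (dotp (vec z.1) (vec z.2)) * \prod_i ft1 (c i) (tnth z.2 i)).
have mf : cmeas f.
  have c1 (h : d.-tuple R -> R[i]) : cmeas h -> cmeas (fun z : d.-tuple R * d.-tuple R => h z.1).
    by move=> [h1 h2]; split; [exact: measurableT_comp h1 measurable_fst|exact: measurableT_comp h2 measurable_fst].
  have c2 (h : d.-tuple R -> R[i]) : cmeas h -> cmeas (fun z : d.-tuple R * d.-tuple R => h z.2).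
    by move=> [h1 h2]; split; [exact: measurableT_comp h1 measurable_snd|exact: measurableT_comp h2 measurable_snd].
  apply: cmeasM; first exact: c1 (citg_meas Ig).
  apply: cmeasM; last exact: c2 (citg_meas If).
  apply: cmeas_cis; apply: measurable_sum => i; apply: measurable_funM.
    under eq_fun do rewrite mxE.
    exact: measurableT_comp (measurable_tnthR i) measurable_fst.
  under eq_fun do rewrite mxE.
  exact: measurableT_comp (measurable_tnthR i) measurable_snd.
have fb x y : cmod (f (x, y)) <= cmod (g (vec x)) * cmod (\prod_i ft1 (c i) (tnth y i)).
  by rewrite /f !cmodM cmod_cis mul1r.
have S := citgC_swap mf fb (citg_cmod Ig) (citg_cmod If).
have It : citg (lebesgueRn d) (fun u => g (vec u) * tens c (vec u)).
  by apply: (C0infty_citg (g := fun x => g x * tens c x)); apply: C0inftyMr Cg _; exact: smooth_tens.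
have : ((2 * pi) ^+ d)%:C * citgC (lebesgueRn d) (fun u => g (vec u) * tens c (vec u)) = 0.
  rewrite -(citgCZ _ It) -[RHS](citgC0 (lebesgueRn d)); apply: etrans (etrans _ S) _.
    congr citgC; apply/funext => u.
    have Iv : citg (lebesgueRn d) (fun v => cis (dotp (vec u) (vec v)) * \prod_i ft1 (c i) (tnth v i)).
      apply: (citg_le _ _ (citg_cmod If)) => [|v]; last by rewrite cmodM cmod_cis mul1r.
      apply: cmeasM _ (citg_meas If); apply: (ccont_cmeas (g := fun x => cis (dotp (vec u) x))).
      under eq_fun do rewrite dotpC.
      exact: smooth_ccont (smooth_wave _).
    by rewrite /f/= (citgCZ _ Iv) fourier_inversion_tens mulrCA.
  congr citgC; apply/funext => v.
  have Iw : citg (lebesgueRn d) (fun u => g (vec u) * cis (dotp (vec u) (vec v))).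
    apply: (citg_le _ _ (citg_cmod Ig)) => [|u]; last by rewrite cmodM cmod_cis mulr1.
    apply: cmeasM (citg_meas Ig) _; apply: (ccont_cmeas (g := fun x => cis (dotp x (vec v)))).
    exact: smooth_ccont (smooth_wave _).
  have := citgCZ (\prod_i ft1 (c i) (tnth v i)) Iw; rewrite g0 mulr0 => <-.
  by congr citgC; apply/funext => u; rewrite /f /=; ring.
move/eqP; rewrite mulf_eq0 => /orP[|/eqP//].
have p0 : (2 * pi) ^+ d != 0 :> R.
  by apply: expf_neq0; apply: lt0r_neq0; apply: mulr_gt0; [exact: ltr0n|exact: pi_gt0].
by rewrite -cmod_eq0 cmod_real normr_eq0 (negbTE p0).
Qed.

End tensor.

Let plateau_ge0 (s x : R) : 0 <= plateau s x.
Proof. by rewrite mulr_ge0// mulr_ge0// ?fexp0_ge0// invr_ge0 ltW// step_den_gt0. Qed.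

(** The one-dimensional factor of [bump], singled out because its integral is positive. *)
Let hat (a r t : R) : R := plateau 1 ((2 / r) * t + (- (2 / r) * a)).

Let hatE (a r t : R) : 0 < r -> `|(2 / r) * t + (- (2 / r) * a)| = 2 * `|t - a| / r.
Proof.
move=> r0; rewrite (_ : _ + _ = 2 / r * (t - a)); last by ring.
by rewrite normrM [`|2 / r|]ger0_norm; [rewrite mulrAC|rewrite divr_ge0// ltW].
Qed.

Let smooth1_hat a r : smooth1 (hat a r).
Proof. by apply: smooth1_affine; exact: smooth1_plateau. Qed.

Let supp1_hat a r M : 0 < r -> `|a| <= M -> supp1 (M + r) (hat a r).
Proof.
move=> r0 aM t h; rewrite /hat plateau_eq0// hatE// ler_pdivlMr//.
have := ler_normD (t - a) a; rewrite subrK; lra.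
Qed.

Let itgR_hat_gt0 (a r : R) : 0 < r -> itg leb (hat a r) /\ 0 < itgR leb (hat a r).
Proof.
move=> r0.
have Ic : itg leb (hat a r).
  exact: supp1_itg (smooth1_continuous (smooth1_hat a r)) (supp1_hat r0 (lexx _)).
split => //.
pose I := `[a - r / 2, a + r / 2]%classic.
have : itgR leb (\1_I : R -> R) <= itgR leb (hat a r).
  apply: le_itgR => //; first exact: integrable_indic_itv.
  move=> t; rewrite indicE; case: (boolP (t \in I)) => [|_]; last exact: plateau_ge0.
  rewrite inE /I/= in_itv/= => /andP[h1 h2].
  rewrite /hat plateau_eq1// hatE// ler_pdivrMr//.
  have : `|t - a| <= r / 2 by rewrite ler_norml; apply/andP; split; lra.
  lra.
apply: lt_le_trans; rewrite /itgR /Rintegral.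
rewrite (_ : (\int[leb]_(x in setT) ((\1_I : R -> R) x)%:E)%E = r%:E)//.
rewrite (integral_indic _ measurableT)/= ?setIT; last exact: measurable_itv.
rewrite lebesgue_measure_itv/= lte_fin -EFinB.
by case: ifPn => [_|/negP[]]; [congr (_%:E); field|rewrite ltrD2l; lra].
Qed.

(** After multiplication by the conjugate of g(x0) the real part is positive near x0, and the
    integral against a nonnegative tensor bump there is positive, contrary to [tens_pairing_eq0]. *)
Lemma fourier_injective (g : 'cV[R]_d -> R[i]) : C0infty setT g ->
  (forall xi, citgC (lebesgueRn d) (fun u => g (vec u) * cis (dotp (vec u) xi)) = 0) ->
  forall x, g x = 0.
Proof.
move=> Cg g0 x0; apply/eqP/negPn/negP => gx.
pose h x := conjc (g x0) * g x.
have Ch : C0infty setT h by exact: C0inftyZ.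
have h0 xi : citgC (lebesgueRn d) (fun u => h (vec u) * cis (dotp (vec u) xi)) = 0.
  have Iw : citg (lebesgueRn d) (fun u => g (vec u) * cis (dotp (vec u) xi)).
    apply: (C0infty_citg (g := fun x => g x * cis (dotp x xi))); apply: C0inftyMr Cg _.
    exact: smooth_wave.
  have := citgCZ (conjc (g x0)) Iw; rewrite g0 mulr0 => <-.
  by congr citgC; apply/funext => u; rewrite mulrA.
have hx : 0 < Re (h x0).
  rewrite /h ReM Re_conjc Im_conjc mulNr opprK -!expr2 -cmod_sqr exprn_gt0//.
  by rewrite lt_def cmod_ge0 cmod_eq0 gx.
pose e := Re (h x0) / 2; have e0 : 0 < e by rewrite divr_gt0.
have [r r0 hr] : exists2 r, 0 < r & forall x, `|x - x0| < r -> e <= Re (h x).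
  have [ch _] := smooth_ccont (let: And3 a _ _ := Ch in a).
  have /cvgrPdist_lt/(_ _ e0) := ch x0.
  move=> /nbhs_ballP[r /= r0 H]; exists r => // x xr.
  have := H x; rewrite /= -ball_normE/= distrC => /(_ xr).
  by rewrite ltr_distl => /andP[]; rewrite /e; lra.
pose c (i : 'I_d) := hat (x0 i 0) r.
have sc i : smooth1 (c i) by exact: smooth1_hat.
have supc i : supp1 (`|x0| + r) (c i) by apply: supp1_hat => //; exact: coord_le_norm.
have It : citg (lebesgueRn d) (fun u => h (vec u) * tens c (vec u)).
  by apply: (C0infty_citg (g := fun x => h x * tens c x)); apply: C0inftyMr Ch _; exact: smooth_tens.
have /(congr1 (@complex.Re R)) := tens_pairing_eq0 sc supc Ch h0.
rewrite citgC_Re Re0 => E.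
have [Ib Eb] := itg_prodT (fun i => (itgR_hat_gt0 (x0 i 0) r0).1).
have : e * \prod_i itgR leb (c i) <= 0.
  rewrite -E -Eb -(itgRZ _ Ib); apply: le_itgR; [exact: itgZ|by case: It|] => u.
  have tE : tens c (vec u) = (\prod_i c i (tnth u i))%:C.
    by rewrite /tens -realC_prod; congr (_%:C); apply: eq_bigr => i _; rewrite mxE.
  have t0 : 0 <= \prod_i c i (tnth u i) by apply: prodr_ge0 => i _; exact: plateau_ge0.
  rewrite tE ReM Re_real Im_real mulr0 subr0.
  have [xr|xr] := ltP `|vec u - x0| r; first by rewrite ler_wpM2r// hr.
  have := bump_eq0 r0 xr; rewrite /bump -/c tE => /(congr1 (@complex.Re R)); rewrite Re_real Re0 => ->.
  by rewrite !mulr0.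
rewrite leNgt mulr_gt0//; apply: prodr_gt0 => i _; exact: (itgR_hat_gt0 (x0 i 0) r0).2.
Qed.

End FourierInjective.

(** * Uniqueness from observations on an open set *)

Section OpenObservation.
Context {R : realType} {d : nat}.

Lemma enorm_dist (x y : 'cV[R]_d) : `|enorm x - enorm y| <= enorm (x - y).
Proof.
have h (a b : 'cV[R]_d) : enorm a - enorm b <= enorm (a - b).
  by rewrite lerBlDr (le_trans _ (enormD _ _))// subrK.
rewrite ler_norml h andbT lerNl (_ : - (enorm x - enorm y) = enorm y - enorm x); last by ring.
by rewrite (le_trans (h y x))// -enormN (_ : - (y - x) = x - y)// opprD opprK addrC.
Qed.

(** Polar coordinates: a point y near c tau0 x0 is c (|y|/c) (y/|y|), and the pair (|y|/c, y/|y|)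
    stays close to (tau0, x0). *)
Lemma open_observation_line (Theta : set (R * 'cV[R]_d)) (c : R) : 0 < c ->
  open_observation Theta -> exists xi0 : 'cV[R]_d, forall v, exists2 e, 0 < e &
    forall t, `|t| < e -> exists p, Theta p /\ xi0 + t *: v = (c * p.1) *: p.2.
Proof.
move=> c0 [[[tau0 x0]] Th [U oU EU]].
move: (Th); rewrite EU => -[Up [/= tau00 /= x01]].
exists ((c * tau0) *: x0) => v.
have /nbhs_ballP[e /= e0 eU] : nbhs (tau0, x0) U by exact: open_nbhs_nbhs.
pose n0 := c * tau0; have n00 : 0 < n0 by rewrite mulr_gt0.
pose V := enorm v + 1; have V0 : 0 < V by rewrite ltr_wpDl ?enorm_ge0.
have vV : enorm v <= V by rewrite lerDl.
(* The three bounds keep |y| above n0/2, the direction within e of x0, and |y|/c within e of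
   tau0. *)
pose q := Num.min (n0 / 2) (Num.min (e * n0 / 4) (e * c)).
have q0 : 0 < q by rewrite !lt_min !divr_gt0// ?mulr_gt0.
exists (q / V); first by rewrite divr_gt0.
move=> t; rewrite ltr_pdivlMr// => tV.
have tv : `|t| * enorm v < q by rewrite (le_lt_trans _ tV)// ler_wpM2l.
have := tv; rewrite !lt_min => /and3P[q1 q2 q3].
pose y := n0 *: x0 + t *: v; pose n := enorm y.
have nn0 : `|n - n0| <= `|t| * enorm v.
  have := enorm_dist y (n0 *: x0); rewrite /y [X in enorm (X - _)]addrC addrK.
  by rewrite [in X in X -> _]enormZ x01 mulr1 (gtr0_norm n00) enormZ.
have n2 : n0 / 2 <= n by move: nn0; rewrite ler_norml => /andP[]; lra.
have np : 0 < n by rewrite (lt_le_trans _ n2)// divr_gt0.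
exists (n / c, n^-1 *: y); split; last first.
  by rewrite /= scalerA (mulrCA c) divff ?gt_eqF// mulr1 divff ?gt_eqF// scale1r.
split; last first.
  split; first by rewrite /= divr_gt0.
  by rewrite /unit_sphere/= enormZ -/n gtr0_norm ?invr_gt0// mulVf// gt_eqF.
apply: eU; split; rewrite /ball/=.
  rewrite (_ : tau0 - n / c = (n0 - n) / c); last by rewrite /n0; field; rewrite gt_eqF.
  rewrite normrM distrC [`|c^-1|]gtr0_norm ?invr_gt0// ltr_pdivrMr//.
  exact: le_lt_trans q3.
split=> // i j; rewrite ord1 /ball/=.
suff h : enorm (x0 - n^-1 *: y) < e.
  by have := le_lt_trans (coord_le_enorm _ i) h; rewrite !mxE.
have -> : x0 - n^-1 *: y = n^-1 *: ((n - n0) *: x0 - t *: v).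
  apply/matrixP => a b; rewrite /y !mxE; move: (lt0r_neq0 np).
  by generalize n => z z0; field.
rewrite enormZ gtr0_norm ?invr_gt0// ltr_pdivrMl//.
have : enorm ((n - n0) *: x0 - t *: v) <= 2 * (`|t| * enorm v).
  rewrite (le_trans (enormD _ _))// enormN !enormZ x01 mulr1 mulr_natl mulr2n lerD//.
have h : e * (n0 / 2) <= e * n by rewrite ler_pM2l.
lra.
Qed.

(** The transform vanishes near xi0, hence along every line through xi0. The line towards -xi is
    used because [fourier_injective] has the opposite sign in the exponential. *)
Lemma wave_transform_determined (Theta : set (R * 'cV[R]_d)) (c : R) (g : 'cV[R]_d -> R[i]) :
  0 < c -> open_observation Theta -> C0infty setT g ->
  (forall p, Theta p ->
    citgC (lebesgueRn d) (fun u => cis (- dotp (vec u) ((c * p.1) *: p.2)) * g (vec u)) = 0) ->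
  forall x, g x = 0.
Proof.
move=> c0 oT Cg h0; apply: (fourier_injective Cg) => xi.
have [xi0 /(_ (- xi - xi0))[e e0 he]] := open_observation_line c0 oT.
set v := - xi - xi0 in he.
have [r [M [r0 _ _ gr]]] := C0infty_bounded Cg.
pose k (u : d.-tuple R) := cis (- dotp (vec u) xi0) * g (vec u).
pose phi (u : d.-tuple R) := - dotp (vec u) v.
pose B := r * (\sum_i `|v i 0|) + 1.
have B0 : 0 < B by rewrite ltr_wpDl// mulr_ge0// sumr_ge0.
have mphi : measurable_fun setT phi.
  by apply: (measurable_continuous_vec (g := fun x => - dotp x v)); apply: contN; exact: continuous_dotp.
have Ik : citg (lebesgueRn d) k.
  have Ig := C0infty_citg Cg.
  apply: (citg_le _ _ (citg_cmod Ig)) => [|u]; last by rewrite cmodM cmod_cis mul1r.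
  apply: cmeasM (citg_meas Ig); apply: cmeas_cis.
  by apply: (measurable_continuous_vec (g := fun x => - dotp x xi0)); apply: contN; exact: continuous_dotp.
have kB u : k u != 0 -> `|phi u| <= B.
  move=> ku; have ur : `|vec u| <= r.
    by apply: gr; apply: contra ku => /eqP; rewrite /k => ->; rewrite mulr0.
  rewrite normrN (le_trans (ler_norm_sum _ _ _))// /B big_distrr/= (@le_trans _ _ (\sum_i r * `|v i 0|))// ?lerDl//.
  apply: ler_sum => i _; rewrite normrM ler_wpM2r//.
  exact: le_trans (coord_le_norm _ i) ur.
have E t : (fun u => k u * cis (t * phi u)) =
    (fun u : d.-tuple R => cis (- dotp (vec u) (xi0 + t *: v)) * g (vec u)).
  apply/funext => u; rewrite /k mulrAC -cisD /phi dotpDr dotpZr; congr (cis _ * _); ring.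
have := wave_integral_eq0 mphi B0 Ik kB e0 _ 1; rewrite E scale1r addrC /v subrK => H.
rewrite -[RHS]H => [|t te].
  congr citgC; apply/funext => u; rewrite mulrC dotpNr opprK//.
by rewrite E; have [p [Tp ->]] := he _ te; exact: h0.
Qed.

Lemma fourier_determined (D : set 'cV[R]_d) (Theta : set (R * 'cV[R]_d)) (c : R)
    (z : R[i]) p q (A A' : 'cV[R]_d -> 'M[R[i]]_(p, q)) :
  0 < c -> z != 0 -> open_observation Theta -> C0infty_mx D A -> C0infty_mx D A' ->
  (forall tau x, Theta (tau, x) ->
    z *: fourier A ((c * tau) *: x) = z *: fourier A' ((c * tau) *: x)) -> A = A'.
Proof.
move=> c0 z0 oT CA CA' AA; apply/funext => x; apply/matrixP => i j; apply/eqP.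
rewrite -subr_eq0; apply/eqP.
have C1 : C0infty setT (fun x => A x i j) by exact: C0inftyS (CA i j).
have C2 : C0infty setT (fun x => A' x i j) by exact: C0inftyS (CA' i j).
apply: (wave_transform_determined (g := fun x => A x i j - A' x i j) c0 oT).
  exact: C0inftyB.
move=> [tau y] /AA; set xi := _ *: y => /(scalerI z0)/matrixP/(_ i j).
rewrite !mxE /= -/xi => E.
have I (F : 'cV[R]_d -> R[i]) : C0infty setT F ->
    citg (lebesgueRn d) (fun u => cis (- dotp (vec u) xi) * F (vec u)).
  move=> CF; have IF := C0infty_citg CF.
  apply: (citg_le _ _ (citg_cmod IF)) => [|u]; last by rewrite cmodM cmod_cis mul1r.
  apply: cmeasM (citg_meas IF); apply: cmeas_cis.
  by apply: (measurable_continuous_vec (g := fun x => - dotp x xi)); apply: contN; exact: continuous_dotp.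
have -> : (fun u : d.-tuple R => cis (- dotp (vec u) xi) * (A (vec u) i j - A' (vec u) i j)) =
    (fun u => cis (- dotp (vec u) xi) * A (vec u) i j - cis (- dotp (vec u) xi) * A' (vec u) i j).
  by apply/funext => u; rewrite mulrBr.
rewrite (citgCB (I _ C1) (I _ C2)); apply/eqP; rewrite subr_eq0; apply/eqP.
move: E; rewrite /integralRd.
under [in LHS]eq_fun do rewrite mxE.
by under [in RHS]eq_fun do rewrite mxE.
Qed.

End OpenObservation.

Lemma mx_cvg_pinfty_unique {R : realType} p q (F : R -> 'M[R[i]]_(p, q)) L L' :
  mx_cvg_pinfty F L -> mx_cvg_pinfty F L' -> L = L'.
Proof.
move=> h h'; apply/matrixP => i j; have [h1 h2] := h i j; have [h1' h2'] := h' i j.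
by apply: complex_ext; [exact: cvg_unique h1 h1'|exact: cvg_unique h2 h2'].
Qed.

(** Two almost sure events of a probability space share an outcome, at which the limits must
    agree. *)
Lemma ae_limit_unique {R : realType} {dO : measure_display} {Omega : measurableType dO}
    (P : probability Omega R) p q (F : Omega -> R -> 'M[R[i]]_(p, q)) L L' :
  {ae P, forall w, mx_cvg_pinfty (F w) L} -> {ae P, forall w, mx_cvg_pinfty (F w) L'} -> L = L'.
Proof.
move=> h h'.
have pf : ProperFilter (almost_everywhere P).
  by apply: ae_properfilter_algebraOfSetsType; rewrite [X in (_ < X)%E](_ : _ = 1%E) ?lte01//; exact: probability_setT.
have [w [hw hw']] := @filter_ex _ _ pf _ (filterI h h').
exact: mx_cvg_pinfty_unique hw hw'.
Qed.

Lemma Cdim_neq0 (R : realType) d : Cdim R d != 0.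
Proof.
have p0 : 0 < pi :> R := pi_gt0 R.
rewrite -cmod_eq0 /Cdim; case: ifP => _.
  rewrite cmodM cmod_cis mul1r cmod_eq0 invr_eq0 -cmod_eq0 cmod_real normr_eq0.
  by apply: lt0r_neq0; rewrite sqrtr_gt0 mulr_gt0.
by rewrite cmod_real normr_eq0 invr_eq0; apply: lt0r_neq0; rewrite mulr_gt0.
Qed.

Theorem theorem6p2 (R : realType) (dO : measure_display)
    (Omega : measurableType dO) (P : probability Omega R)
    (completeP : measure_is_complete P)
    (d : nat) (hd : d = 2%N \/ d = 3%N)
    (lambda mu : R) (hmu : 0 < mu) (hlambda : 0 < lambda + 2 * mu)
    (D : set 'cV[R]_d) (hD : bounded_domain D)
    (m : R) (hm : d%:R - 4 < m <= d%:R)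
    (f : Omega -> 'I_d -> distrib R d) (Ac Ar : 'cV[R]_d -> 'M[R[i]]_d)
    (hf : GMIG P D m f Ac Ar) :
  (forall (x : 'cV[R]_d) (tau : R), unit_sphere x -> 0 <= tau ->
    {ae P, forall w,
      mx_cvg_pinfty (cov_average lambda mu (f w) m x tau)
        ((cmod (Cdim R d) ^+ 2)%:C *: fourier Ac ((cs mu * tau) *: x)) /\
      mx_cvg_pinfty (rel_average lambda mu (f w) m x tau)
        (Cdim R d ^+ 2 *: fourier Ar ((cs mu * tau) *: x))}) /\
  (forall Theta : set (R * 'cV[R]_d), open_observation Theta ->
    forall (dO' : measure_display) (Omega' : measurableType dO')
      (P' : probability Omega' R) (completeP' : measure_is_complete P')
      (f' : Omega' -> 'I_d -> distrib R d) (Ac' Ar' : 'cV[R]_d -> 'M[R[i]]_d)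
      (hf' : GMIG P' D m f' Ac' Ar'),
    (forall L : R -> 'cV[R]_d -> 'M[R[i]]_d,
      (forall tau x, Theta (tau, x) ->
        {ae P, forall w,
          mx_cvg_pinfty (cov_average lambda mu (f w) m x tau) (L tau x)} /\
        {ae P', forall w,
          mx_cvg_pinfty (cov_average lambda mu (f' w) m x tau) (L tau x)}) ->
      Ac = Ac') /\
    (forall L : R -> 'cV[R]_d -> 'M[R[i]]_d,
      (forall tau x, Theta (tau, x) ->
        {ae P, forall w,
          mx_cvg_pinfty (rel_average lambda mu (f w) m x tau) (L tau x)} /\
        {ae P', forall w,
          mx_cvg_pinfty (rel_average lambda mu (f' w) m x tau) (L tau x)}) ->
      Ar = Ar')).
Proof.
split => [x tau x1 tau0|]; first exact: (far_field_limit hmu hlambda hd hf hD x1 tau0).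
move=> Theta oT dO' Omega' P' _ f' Ac' Ar' hf'.
have H x tau := @far_field_limit _ _ _ _ _ _ _ hmu hlambda hd _ _ _ _ _ hf hD x tau.
have H' x tau := @far_field_limit _ _ _ _ _ _ _ hmu hlambda hd _ _ _ _ _ hf' hD x tau.
have c0 : 0 < cs mu by exact: cs_gt0.
have Tsub tau x : Theta (tau, x) -> 0 <= tau /\ unit_sphere x.
  by case: oT => _ [U _ ->] [_ [/= /ltW]].
have [_ [Sc [Bc [_ _ CAc _ _]]] [Sr [Br [_ _ CAr _ _]]]] := hf.
have [_ [Sc' [Bc' [_ _ CAc' _ _]]] [Sr' [Br' [_ _ CAr' _ _]]]] := hf'.
(* The common limits L are identified, for either field, with a nonzero multiple of the Fourier
   transform of its principal symbol, which reduces both claims to [fourier_determined]. *)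
split=> L hL.
- apply: (fourier_determined (z := (cmod (Cdim R d) ^+ 2)%:C) c0 _ oT CAc CAc') => [|tau x Th].
    by rewrite -cmod_eq0 cmod_real normr_eq0 expf_neq0// cmod_eq0 Cdim_neq0.
  have [tau0 x1] := Tsub _ _ Th; have [h1 h2] := hL _ _ Th.
  apply: (@etrans _ _ (L tau x)).
    apply: (ae_limit_unique _ h1); apply: filterS (H x tau x1 tau0) => w; exact: proj1.
  apply: (ae_limit_unique h2); apply: filterS (H' x tau x1 tau0) => w; exact: proj1.
- apply: (fourier_determined (z := Cdim R d ^+ 2) c0 _ oT CAr CAr') => [|tau x Th].
    by rewrite expf_neq0// Cdim_neq0.
  have [tau0 x1] := Tsub _ _ Th; have [h1 h2] := hL _ _ Th.
  apply: (@etrans _ _ (L tau x)).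
    apply: (ae_limit_unique _ h1); apply: filterS (H x tau x1 tau0) => w; exact: proj2.
  apply: (ae_limit_unique h2); apply: filterS (H' x tau x1 tau0) => w; exact: proj2.
Qed.
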